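(* Let $d\ge2$ and $\alpha>0$. Let $1\le p<2$, $\theta>0$, and $q,r\in[1,\infty]$. The set of singular solutions $$u\in\bigcap_{1\le\tilde p<2}L^{\tilde p}(\mathbb{T}^d)\ \cap\bigcap_{\tilde\theta>0,\ \tilde q,\tilde r\in[1,\infty]}B^{-\tilde\theta}_{\tilde q,\tilde r}(\mathbb{T}^d)$$ to the stationary fractional Navier-Stokes equations $$\mathrm{div}(u\otimes u)+(-\Delta)^\alpha u+\nabla p=0,\qquad \mathrm{div}\,u=0,\qquad \hat u(0)=0\quad\text{on }\mathbb{T}^d$$ is dense in $\mathbb{P}L^p(\mathbb{T}^d)$, and dense in $\mathbb{P}B^{-\theta}_{q,r}(\mathbb{T}^d)$ (weak*-dense if $r=\infty$).
   Context: $\mathbb{T}^d=\mathbb{R}^d/\mathbb{Z}^d$; $\hat f(m)=\langle f,e^{-2\pi i m\cdot x}\rangle$ for $f\in\mathscr{D}'(\mathbb{T}^d)$; $(-\Delta)^\alpha f=\sum_{m}(2\pi|m|)^{2\alpha}\hat f(m)e^{2\pi i m\cdot x}$. For vectors, $(a\otimes b)_{ij}=a_ib_j$; for matrix fields, $(\mathrm{div} A)_i=\partial_jA_{ij}$. Dyadic integers are integer powers of $2$ that are $\ge 1$. Fix a radial bump function $\chi\in C_c^\infty(\mathbb{R}^d)$ supported in $B(0,1)$ and equal to $1$ on $B(0,9/10)$. For dyadic $N$, $P_{\le N}f=\sum_{m}\chi(m/N)\hat f(m)e^{2\pi i m\cdot x}$, $P_1=P_{\le 1}$, $P_N=P_{\le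 N}-P_{\le N/2}$ for $N\ge2$. For $s\in\mathbb{R}$, $q,r\in[1,\infty]$, $B^s_{q,r}(\mathbb{T}^d)$ is the space of distributions with $\|f\|_{B^s_{q,r}}=(\sum_N N^{sr}\|P_Nf\|_{L^q}^r)^{1/r}<\infty$ (supremum if $r=\infty$). For $X=B^s_{q,r}$ or $X=L^p$, $\mathbb{P}X=\{f\in X(\mathbb{T}^d;\mathbb{R}^d):\mathrm{div} f=0,\ \hat f(0)=0\}$. The weak*-topology on $B^{-\theta}_{q,\infty}$ is the one induced by $B^{\theta}_{q',1}$, $\frac1q+\frac1{q'}=1$. $\dot H^{s}$ is the space of distributions modulo constants with $\|f\|_{\dot H^s}=(\sum_{m\neq0}|m|^{2s}|\hat f(m)|^2)^{1/2}<\infty$. For $u\in\mathscr{D}'(\mathbb{T}^d)$ vector-valued and $s>0$, $u\otimes u$ is well-defined as a paraproduct in $\dot H^{-s}$ if $\sum_{N,M}\|P_Nu\otimes P_Mu\|_{\dot H^{-s}}<\infty$ ($N,M$ over all dyadic integers); then $u\otimes u:=\sum_{N,M}P_Nu\otimes P_Mu$ in $\dot H^{-s}$ (defined modulo constants, identified with its mean-zero representative). Singular solution (stationary): $u\in\mathscr{D}'(\mathbb{T}^d)$ with $\hat u(0)=0$, weakly divergence free, such that there exists $s>0$ for which $u\otimes u$ is well-defined as a paraproduct in $\dot H^{-s}$, and $-\langle u\otimes u,\nabla\varphi\rangle+\langle u,(-\Delta)^\alpha\varphi\rangle=0$ for every divergence-free $\varphi\in C^\infty(\mathbb{T}^d)$.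 *)

(* Defs.v *)
From HB Require Import structures.
From mathcomp Require Import all_boot all_order all_algebra.
From mathcomp Require Import all_classical all_reals all_analysis.
From mathcomp.real_closed Require Import complex.

Set Implicit Arguments.
Unset Strict Implicit.
Unset Printing Implicit Defensive.

Import Order.TTheory GRing.Theory Num.Theory.
Import numFieldNormedType.Exports.

Local Open Scope classical_set_scope.
Local Open Scope ring_scope.
Local Open Scope complex_scope.

(* Functions on the torus R^d / Z^d are Z^d-periodic functions of 'rV[R]_d when
   they have to be differentiated, and functions of d.-tuple R, which carries
   the product sigma-algebra, when they have to be integrated.  The measure is
   Lebesgue measure on [0, 1]^d, an iterated product of uniform laws. *)

Section torus_measure.
Variable R : realType.
Local Notation M := (measurableTypeR R).

Definition tcons (n : nat) (z : M * n.-tuple M) : n.+1.-tuple M :=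
  [the n.+1.-tuple M of z.1 :: z.2].

Lemma measurable_tcons n : measurable_fun [set: M * n.-tuple M] (@tcons n).
Proof. exact: measurable_cons. Qed.

HB.instance Definition _ n := isMeasurableFun.Build _ _ _ _ (@tcons n)
  (@measurable_tcons n).

Fixpoint torus_measure (n : nat) : probability (n.-tuple M) R :=
  match n with
  | 0 => \d_[tuple]
  | n'.+1 => distribution
      (uniform_prob (@ltr01 R) \x torus_measure n')%E (@tcons n')
  end.

End torus_measure.

Section torus.
Variables (R : realType) (d : nat).

Local Notation M := (measurableTypeR R).
Local Notation mu := (torus_measure R d).

Definition row_of (t : d.-tuple M) : 'rV[R]_d := \row_i tnth t i.

Definition enorm (v : 'I_d -> R) : R := Num.sqrt (\sum_i v i ^+ 2).

Definition freq_norm (m : 'rV[int]_d) : R := enorm (fun i => (m 0 i)%:~R).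

Definition partial (i : 'I_d) (f : 'rV[R]_d -> R) : 'rV[R]_d -> R :=
  fun x => 'D_(delta_mx 0 i) f x.

Definition partials (s : seq 'I_d) (f : 'rV[R]_d -> R) : 'rV[R]_d -> R :=
  foldr partial f s.

Definition smooth (f : 'rV[R]_d -> R) : Prop :=
  forall s : seq 'I_d, continuous (partials s f) /\
    forall i x, derivable (partials s f) x (delta_mx 0 i).

Definition Zd_periodic (f : 'rV[R]_d -> R) : Prop :=
  forall (m : 'rV[int]_d) x, f (x + map_mx intr m) = f x.

Definition test_fun (f : 'rV[R]_d -> R) : Prop := smooth f /\ Zd_periodic f.

(* Distributions.  A real distribution is a linear functional on real test
   functions, continuous for the C^k norms.  It is encoded as a function on all
   of 'rV[R]_d -> R whose values outside test_fun are irrelevant: below it is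
   only ever evaluated at smooth periodic functions. *)

Definition functional : Type := ('rV[R]_d -> R) -> R.

Definition Ck_norm (k : nat) (f : 'rV[R]_d -> R) : \bar R :=
  ereal_sup [set y | exists s x,
    (size s <= k)%N /\ y = (`|partials s f x|)%:E].

Definition is_distribution (f : functional) : Prop :=
  (forall (a : R) (phi psi : 'rV[R]_d -> R), test_fun phi -> test_fun psi ->
     f (fun x => a * phi x + psi x) = a * f phi + f psi) /\
  exists (C : R) (k : nat), forall phi, test_fun phi ->
    ((`|f phi|)%:E <= C%:E * Ck_norm k phi)%E.

Definition distribution_of (g : 'rV[R]_d -> R) : functional :=
  fun phi => \int[mu]_t (g (row_of t) * phi (row_of t)).

Definition represents (g : d.-tuple M -> R) (f : functional) : Prop :=
  mu.-integrable setT (EFin \o g) /\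
  forall phi, test_fun phi ->
    f phi = \int[mu]_t (g t * phi (row_of t)).

Definition phase (m : 'rV[int]_d) (x : 'rV[R]_d) : R :=
  2 * pi * \sum_i (m 0 i)%:~R * x 0 i.

Definition expi (m : 'rV[int]_d) (x : 'rV[R]_d) : R[i] :=
  cos (phase m x) +i* sin (phase m x).

(* <f, e^(-2 i pi m.x)>, with f extended complex-linearly *)
Definition fourier (f : functional) (m : 'rV[int]_d) : R[i] :=
  f (fun x => cos (phase m x)) -i* f (fun x => sin (phase m x)).

(* The term c(m) f^(m) e^(2 i pi m.x) of a Fourier multiplier.  All multipliers
   c below are real and even and f is real, so that the terms of m and -m are
   conjugate and the real parts have the same sum as the complex terms. *)
Definition fourier_term (c : 'rV[int]_d -> R) (f : functional)
    (m : 'rV[int]_d) (x : 'rV[R]_d) : R :=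
  complex.Re ((c m)%:C * fourier f m * expi m x).

Definition bump_function (chi : 'rV[R]_d -> R) : Prop :=
  [/\ smooth chi,
      (forall x y : 'rV[R]_d, enorm (x 0) = enorm (y 0) -> chi x = chi y),
      closure [set x | chi x != 0] `<=` [set x : 'rV[R]_d | enorm (x 0) < 1] &
      (forall x : 'rV[R]_d, enorm (x 0) < 9 / 10 -> chi x = 1)].

Section littlewood_paley.
Variable chi : 'rV[R]_d -> R.

(* P_{<= N} for N = 2 ^ n *)
Definition P_le (n : nat) (f : functional) (x : 'rV[R]_d) : R :=
  \sum_(m \in [set: 'rV[int]_d])
    fourier_term (fun m => chi (\row_i ((m 0 i)%:~R / 2 ^+ n))) f m x.

(* P_N for N = 2 ^ n *)
Definition P_dyadic (n : nat) (f : functional) (x : 'rV[R]_d) : R :=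
  if n is n'.+1 then P_le n'.+1 f x - P_le n' f x else P_le 0 f x.

Definition vfunctional : Type := 'I_d -> functional.

Definition is_vdistribution (u : vfunctional) : Prop :=
  forall i, is_distribution (u i).

(* +oo if u is not an integrable function *)
Definition Lp_norm (p : \bar R) (u : vfunctional) : \bar R :=
  ereal_inf [set Lnorm mu p (fun t => (enorm (fun i => g i t))%:E)
            | g in [set g : 'I_d -> d.-tuple M -> R |
                     forall i, represents (g i) (u i)]].

Definition LP_norm (q : \bar R) (n : nat) (u : vfunctional) : \bar R :=
  Lnorm mu q (fun t => (enorm (fun i => P_dyadic n (u i) (row_of t)))%:E).

Definition besov_norm (s : R) (q r : \bar R) (u : vfunctional) : \bar R :=
  if r is r0%:E then
    ((\sum_(0 <= n <oo)
       ((2 ^+ n) `^ (s * r0))%:E * (LP_norm q n u) `^ r0) `^ r0^-1)%E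
  else
    ereal_sup (range (fun n : nat => (((2 ^+ n) `^ s)%:E * LP_norm q n u)%E)).

Definition Lp_space (p : \bar R) : set vfunctional :=
  [set u | is_vdistribution u /\ (Lp_norm p u < +oo)%E].

Definition besov_space (s : R) (q r : \bar R) : set vfunctional :=
  [set u | is_vdistribution u /\ (besov_norm s q r u < +oo)%E].

Definition weakly_div_free (u : vfunctional) : Prop :=
  forall phi, test_fun phi -> \sum_i u i (partial i phi) = 0.

Definition mean_zero (u : vfunctional) : Prop := forall i, fourier (u i) 0 = 0.

(* divergence-free, mean-zero elements of X *)
Definition solenoidal (X : set vfunctional) : set vfunctional :=
  X `&` [set u | weakly_div_free u /\ mean_zero u].

Definition norm_dense (N : vfunctional -> \bar R) (X S : set vfunctional) :
    Prop :=
  S `<=` X /\ forall v (eps : R), X v -> 0 < eps ->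
    exists2 u, S u & (N (u - v)%R < eps%:E)%E.

(* The duality between B^{-s}_{q,oo} and B^s_{q',1}, s > 0: the extension of
   f |-> (phi |-> <f, phi>) from test functions to B^s_{q',1}, in which
   P_{<= N} g converges to g. *)
Definition besov_pairing (f g : vfunctional) : R :=
  limn (fun n : nat => \sum_i f i (P_le n (g i)) : R).

(* density for the topology on X induced by the functionals besov_pairing _ g,
   for g in Y *)
Definition weak_star_dense (Y X S : set vfunctional) : Prop :=
  S `<=` X /\ forall v (k : nat) (g : 'I_k -> vfunctional) (eps : R),
    X v -> (forall j, Y (g j)) -> 0 < eps ->
    exists2 u, S u & forall j, `|besov_pairing (u - v) (g j)| < eps.

Definition mfunctional : Type := 'I_d -> 'I_d -> functional.

Definition Hdot_norm (s : R) (A : mfunctional) : \bar R :=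
  sqrte (\esum_(m in [set m : 'rV[int]_d | m != 0%R])
    ((freq_norm m) `^ (2 * s) *
      \sum_i \sum_j ComplexField.Normc.normc (fourier (A i j) m) ^+ 2)%:E).

Definition Hdot_space (s : R) : set mfunctional :=
  [set A | (forall i j, is_distribution (A i j)) /\ (Hdot_norm s A < +oo)%E].

(* P_N u \otimes P_M u for N = 2 ^ k.1 and M = 2 ^ k.2 *)
Definition LP_tensor (u : vfunctional) (k : nat * nat) : mfunctional :=
  fun i j => distribution_of
    (fun x => P_dyadic k.1 (u i) x * P_dyadic k.2 (u j) x).

Definition paraproduct_well_defined (s : R) (u : vfunctional) : Prop :=
  (\esum_(k in [set: nat * nat]) Hdot_norm (- s) (LP_tensor u k) < +oo)%E.

(* T is the mean-zero representative of the sum of the LP_tensor u k in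
   \dot H^{-s}.  Under paraproduct_well_defined the series converges absolutely,
   so the order of summation does not matter. *)
Definition is_paraproduct (s : R) (u : vfunctional) (T : mfunctional) : Prop :=
  [/\ Hdot_space (- s) T,
      (forall i j, fourier (T i j) 0 = 0) &
      (fun K : nat => Hdot_norm (- s) (T -
         \sum_(n < K) \sum_(l < K) LP_tensor u (n : nat, l : nat))%R) @ \oo
        --> 0%E].

Definition frac_laplacian (alpha : R) (phi : 'rV[R]_d -> R) : 'rV[R]_d -> R :=
  fun x => limn (fun K : nat =>
    \sum_(m \in [set m : 'rV[int]_d | forall i, `|m 0 i| <= K%:Z])
      fourier_term (fun m => (2 * pi * freq_norm m) `^ (2 * alpha))
        (distribution_of phi) m x : R).

Definition singular_solution (alpha : R) (u : vfunctional) : Prop :=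
  [/\ is_vdistribution u, mean_zero u, weakly_div_free u &
   exists s : R, [/\ 0 < s, paraproduct_well_defined s u &
    exists2 T, is_paraproduct s u T &
      forall phi : 'I_d -> 'rV[R]_d -> R,
        (forall i, test_fun (phi i)) ->
        (forall x, \sum_i partial i (phi i) x = 0) ->
        - (\sum_i \sum_j T i j (partial j (phi i))) +
          \sum_i u i (frac_laplacian alpha (phi i)) = 0]].

Definition singular_solutions (alpha : R) : set vfunctional :=
  [set u | [/\ singular_solution alpha u,
    (forall p : R, 1 <= p < 2 -> Lp_space p%:E u) &
    (forall (theta : R) (q r : \bar R), 0 < theta ->
       (1 <= q)%E -> (1 <= r)%E -> besov_space (- theta) q r u)]].

End littlewood_paley.

End torus.

(* Main.v *)
Require Import Defs.
From HB Require Import structures.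
From mathcomp Require Import all_boot all_order all_algebra.
From mathcomp Require Import all_classical all_reals all_analysis.
From mathcomp.real_closed Require Import complex.
From mathcomp Require Import measurable_realfun ess_sup_inf.
From mathcomp Require Import zify ring lra.

Set Implicit Arguments.
Unset Strict Implicit.
Unset Printing Implicit Defensive.

Import Order.TTheory GRing.Theory Num.Theory.
Import numFieldNormedType.Exports.

Local Open Scope classical_set_scope.
Local Open Scope ring_scope.

(** Let L u be the symmetric matrix with the symbol, homogeneous of degree
    2 alpha - 1 and linear in u, for which div (L u) is the fractional Laplacian of
    u up to a gradient. A divergence free field u solves the equation if its
    paraproduct u (x) u is - L u up to constants. The proof produces such fields
    close to any given one.

    Start from a divergence free trigonometric polynomial without zero mode and
    write u (x) u + L u as a sum of terms rho eta (x) eta over finitely many integer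
    vectors eta. One of these terms is cancelled by adding a divergence free field
    w = sqrt 2 b cos(2 pi N xi.x) eta + O(1/N), where xi is orthogonal to eta and N
    is huge: the square of the cosine has the mean 1/2, so that w (x) w is
    b^2 eta (x) eta up to high frequencies, and b^2 = c^2 - rho does the job, since
    the constant c^2 is invisible modulo constants. High frequencies are small in
    spaces of negative order, and so are L w and the products of w with what was
    there before. Iterating along a sequence of rapidly increasing frequencies
    drives the error to zero; each w occupies a single Littlewood-Paley block, and
    the series of the products of blocks converges absolutely.

    The L^2 norm of b is not small, but its L^p norm for p < 2 can be: multiplying
    b by sqrt (2/3) (1 + cos(2 pi M xi.x)) changes b^2 by high frequencies only and
    decreases the L^1 norm by a fixed factor (concentration). The Besov norms of w of
    negative order are small because b is fixed before N. So the sum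
    of all corrections is as small as desired in the spaces of the theorem.
    This is blocks_exist (the construction) and singular_solution_of_blocks (the
    sum of the blocks is a singular solution). All of it is carried out with
    trigonometric polynomials, and errors are measured by weighted sums of
    amplitudes.

    It remains to approximate a field v by trigonometric polynomials, for which
    Fejer means are used: they preserve the divergence and, their kernel being
    positive, contract every L^q norm (fejer_contraction). In L^p they converge to v
    since trigonometric polynomials are dense (trig_polynomials_dense). In a
    Besov space they converge on each block and are bounded by v on all of them
    (block_approximation); if r is finite the late blocks of v are negligible
    (besov_dense), and in the weak-star sense the late blocks of the test fields are
    (besov_weak_star_dense). *)

(** * Real trigonometric polynomials *)

Section trig_polynomials.
Variables (R : realType) (d : nat).
Local Notation freq := 'rV[int]_d.

(** The triple (a, m, b) stands for the wave a cos(2 pi m.x + b); recording the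
    phase shift b keeps sines, derivatives and products of waves within real
    numbers. *)
Definition mode : Type := R * freq * R.
Definition amp (l : mode) : R := l.1.1.
Definition mfreq (l : mode) : freq := l.1.2.
Definition shft (l : mode) : R := l.2.

Implicit Types (f g h : seq mode) (l : mode) (m : freq) (x : 'rV[R]_d).

Definition wave m (b : R) x : R := cos (phase m x + b).

Definition ev f x : R := \sum_(l <- f) amp l * wave (mfreq l) (shft l) x.

Lemma ev_nil x : ev [::] x = 0. Proof. by rewrite /ev big_nil. Qed.

Lemma ev_cons l f x : ev (l :: f) x = amp l * wave (mfreq l) (shft l) x + ev f x.
Proof. by rewrite /ev big_cons. Qed.

Lemma ev_cat f g x : ev (f ++ g) x = ev f x + ev g x.
Proof. by rewrite /ev big_cat. Qed.

Lemma ev_flatten (ff : seq (seq mode)) x :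
  ev (flatten ff) x = \sum_(f <- ff) ev f x.
Proof.
elim: ff => [|f ff IH] /=; first by rewrite ev_nil big_nil.
by rewrite ev_cat big_cons IH.
Qed.

Lemma phaseD m m' x : phase (m + m') x = phase m x + phase m' x.
Proof.
rewrite /phase -mulrDr -big_split /=; congr (_ * _).
by apply: eq_bigr => i _; rewrite mxE intrD mulrDl.
Qed.

Lemma phaseN m x : phase (- m) x = - phase m x.
Proof.
rewrite /phase -mulrN -sumrN; congr (_ * _).
by apply: eq_bigr => i _; rewrite mxE intrN mulNr.
Qed.

Lemma phaseB m m' x : phase (m - m') x = phase m x - phase m' x.
Proof. by rewrite phaseD phaseN. Qed.

Lemma phase0 x : phase (0 : freq) x = 0.
Proof. by have := phaseB 0 0 x; rewrite !subrr. Qed.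

Lemma wave_norm m b x : `|wave m b x| <= 1.
Proof. exact: cos_max. Qed.

Lemma wave_sin m x : wave m (- (pi / 2)) x = sin (phase m x).
Proof. by rewrite /wave cosBpihalf. Qed.

Lemma wave_cos m x : wave m 0 x = cos (phase m x).
Proof. by rewrite /wave addr0. Qed.

Lemma wave_mul m b m' b' x : wave m b x * wave m' b' x =
  2^-1 * wave (m + m') (b + b') x + 2^-1 * wave (m - m') (b - b') x.
Proof.
rewrite /wave phaseD phaseB.
rewrite (_ : _ + _ + _ = (phase m x + b) + (phase m' x + b')); last by ring.
rewrite (_ : _ - _ + _ = (phase m x + b) - (phase m' x + b')); last by ring.
by rewrite (cosD (phase m x + b)) cosB; field.
Qed.

Definition tscale (c : R) f : seq mode :=
  [seq (c * amp l, mfreq l, shft l) | l <- f].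

Lemma ev_scale c f x : ev (tscale c f) x = c * ev f x.
Proof.
rewrite /ev /tscale big_map mulr_sumr.
by apply: eq_bigr => l _ /=; rewrite mulrA.
Qed.

Definition mode_mul (l l' : mode) : seq mode :=
  [:: (amp l * amp l' / 2, mfreq l + mfreq l', shft l + shft l');
      (amp l * amp l' / 2, mfreq l - mfreq l', shft l - shft l')].

Definition tmul f g : seq mode :=
  flatten [seq mode_mul l l' | l <- f, l' <- g].

Lemma ev_mul f g x : ev (tmul f g) x = ev f x * ev g x.
Proof.
rewrite /tmul ev_flatten big_allpairs_dep /= /ev mulr_suml.
apply: eq_bigr => l _; rewrite mulr_sumr; apply: eq_bigr => l' _.
rewrite /mode_mul !big_cons big_nil addr0 /amp /mfreq /shft /=.
by rewrite mulrACA wave_mul; ring.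
Qed.

(** An even real symbol acts in the same way on both exponentials of a wave, so
    that the wave keeps its phase. *)
Definition mult (c : freq -> R) f : seq mode :=
  [seq (c (mfreq l) * amp l, mfreq l, shft l) | l <- f].

(** The symbol i c(m), with c real and odd: multiplication by i is the phase shift
    pi / 2. *)
Definition imult (c : freq -> R) f : seq mode :=
  [seq (c (mfreq l) * amp l, mfreq l, shft l + pi / 2) | l <- f].

Definition spec (P : freq -> Prop) f : Prop := forall l, l \in f -> P (mfreq l).

Lemma spec_nil P : spec P [::]. Proof. by move=> l. Qed.

Lemma spec_cons P l f : P (mfreq l) -> spec P f -> spec P (l :: f).
Proof. by move=> Pl Pf l'; rewrite inE => /predU1P[->//|]; exact: Pf. Qed.

Lemma spec_cat P f g : spec P f -> spec P g -> spec P (f ++ g).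
Proof. by move=> Pf Pg l; rewrite mem_cat => /orP[/Pf|/Pg]. Qed.

Lemma specW (P Q : freq -> Prop) f :
  (forall m, P m -> Q m) -> spec P f -> spec Q f.
Proof. by move=> PQ Pf l /Pf /PQ. Qed.

Lemma spec_map P (F : mode -> mode) f :
  (forall l, mfreq (F l) = mfreq l) -> spec P f -> spec P (map F f).
Proof. by move=> HF Pf l /mapP[l' /Pf Pl ->]; rewrite HF. Qed.

Lemma spec_scale P c f : spec P f -> spec P (tscale c f).
Proof. exact: spec_map. Qed.

Lemma spec_mult P c f : spec P f -> spec P (mult c f).
Proof. exact: spec_map. Qed.

Lemma spec_imult P c f : spec P f -> spec P (imult c f).
Proof. exact: spec_map. Qed.

(** A product of two waves has the sum and the difference of their frequencies. *)
Lemma spec_mul (P Q S : freq -> Prop) f g :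
  (forall m m', P m -> Q m' -> S (m + m') /\ S (m - m')) ->
  spec P f -> spec Q g -> spec S (tmul f g).
Proof.
move=> PQS Pf Qg l /flattenP[s /allpairsP[[l1 l2] /= [/Pf P1 /Qg Q2 ->]]].
have [H1 H2] := PQS _ _ P1 Q2.
by rewrite !inE => /orP[] /eqP ->.
Qed.

Lemma ev_multS c1 c2 f x :
  ev (mult (fun m => c1 m + c2 m) f) x = ev (mult c1 f) x + ev (mult c2 f) x.
Proof.
rewrite /ev /mult !big_map -big_split /=; apply: eq_bigr => l _.
by rewrite /amp /= /mfreq /=; ring.
Qed.

Lemma ev_mult1 c f x : spec (fun m => c m = 1) f -> ev (mult c f) x = ev f x.
Proof.
move=> cf; rewrite /ev /mult big_map !big_seq; apply: eq_bigr => l lf.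
by rewrite {1}/amp /= cf// mul1r.
Qed.

Lemma ev_mult0 c f x : spec (fun m => c m = 0) f -> ev (mult c f) x = 0.
Proof.
move=> cf; rewrite /ev /mult big_map big_seq big1// => l lf.
by rewrite {1}/amp /= cf// mul0r mul0r.
Qed.

Lemma mult_cat c f g : mult c (f ++ g) = mult c f ++ mult c g.
Proof. exact: map_cat. Qed.

Lemma imult_cat c f g : imult c (f ++ g) = imult c f ++ imult c g.
Proof. exact: map_cat. Qed.

(** The Wiener norm with weight w; lists that evaluate to the same function may
    have different norms, so it only serves as an upper bound. *)
Definition wnorm (w : freq -> R) f : R := \sum_(l <- f) w (mfreq l) * `|amp l|.

Definition anorm f : R := wnorm (fun=> 1) f.

Section wnorm.
Variable w : freq -> R.
Hypothesis w_ge0 : forall m, 0 <= w m.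

Lemma wnorm_ge0 f : 0 <= wnorm w f.
Proof. by apply: sumr_ge0 => l _; rewrite mulr_ge0. Qed.

Lemma wnorm_nil : wnorm w [::] = 0. Proof. by rewrite /wnorm big_nil. Qed.

Lemma wnorm_cons l f : wnorm w (l :: f) = w (mfreq l) * `|amp l| + wnorm w f.
Proof. by rewrite /wnorm big_cons. Qed.

Lemma wnorm_cat f g : wnorm w (f ++ g) = wnorm w f + wnorm w g.
Proof. by rewrite /wnorm big_cat. Qed.

Lemma wnorm_scale c f : wnorm w (tscale c f) = `|c| * wnorm w f.
Proof.
rewrite /wnorm big_map mulr_sumr; apply: eq_bigr => l _.
by rewrite /amp /mfreq /= normrM mulrCA.
Qed.

Lemma wnorm_flatten (ff : seq (seq mode)) :
  wnorm w (flatten ff) = \sum_(f <- ff) wnorm w f.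
Proof.
elim: ff => [|f ff IH] /=; first by rewrite wnorm_nil big_nil.
by rewrite wnorm_cat big_cons IH.
Qed.

Lemma wnorm_le_spec f (c : R) :
  spec (fun m => w m <= c) f -> wnorm w f <= c * anorm f.
Proof.
move=> H; rewrite /anorm /wnorm mulr_sumr !big_seq ler_sum// => l lf.
by rewrite mul1r ler_wpM2r// H.
Qed.

Lemma wnorm_imult_le c f (C : R) (v : freq -> R) :
  spec (fun m => w m * `|c m| <= C * v m) f ->
  wnorm w (imult c f) <= C * wnorm v f.
Proof.
move=> H; rewrite /wnorm big_map mulr_sumr !big_seq ler_sum// => l lf.
by rewrite /amp /mfreq /= normrM !mulrA ler_wpM2r// H.
Qed.

End wnorm.

Lemma anorm_ge0 f : 0 <= anorm f. Proof. by apply: wnorm_ge0. Qed.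

Lemma anorm_mul f g : anorm (tmul f g) = anorm f * anorm g.
Proof.
rewrite /anorm /tmul wnorm_flatten big_allpairs_dep /= /wnorm mulr_suml.
apply: eq_bigr => l _; rewrite mulr_sumr; apply: eq_bigr => l' _.
rewrite /mode_mul !big_cons big_nil addr0 /amp /= !mul1r.
by rewrite normrM normfV (ger0_norm (ler0n R 2)) normrM; field.
Qed.

Lemma ev_le_anorm f x : `|ev f x| <= anorm f.
Proof.
apply: (le_trans (ler_norm_sum _ _ _)); rewrite /anorm /wnorm.
apply: ler_sum => l _; rewrite normrM mul1r -[leRHS]mulr1.
by rewrite ler_wpM2l// wave_norm.
Qed.

Definition fnorm (m : freq) : R := freq_norm R m.

Lemma fnormE m : fnorm m = Num.sqrt (\sum_i ((m 0 i)%:~R : R) ^+ 2).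
Proof. by []. Qed.

Lemma enorm_ge0 (v : 'I_d -> R) : 0 <= enorm v.
Proof. exact: sqrtr_ge0. Qed.

Lemma enorm_sqr (v : 'I_d -> R) : enorm v ^+ 2 = \sum_i v i ^+ 2.
Proof. by rewrite sqr_sqrtr// sumr_ge0// => i _; exact: sqr_ge0. Qed.

Lemma coord_le_enorm (v : 'I_d -> R) i : `|v i| <= enorm v.
Proof.
rewrite -sqrtr_sqr ler_wsqrtr// (bigD1 i)//= lerDl sumr_ge0// => j _.
exact: sqr_ge0.
Qed.

Lemma enorm_le_sum (v : 'I_d -> R) : enorm v <= \sum_i `|v i|.
Proof.
have s0 : 0 <= \sum_i `|v i| by rewrite sumr_ge0.
rewrite -(ler_pXn2r (n := 2))// ?nnegrE ?enorm_ge0// enorm_sqr.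
suff: forall (r : seq 'I_d), \sum_(i <- r) v i ^+ 2 <= (\sum_(i <- r) `|v i|) ^+ 2.
  by apply.
elim=> [|i r IH]; first by rewrite !big_nil expr0n.
rewrite !big_cons sqrrD real_normK ?num_real// -addrA lerD2l.
apply: (le_trans IH); rewrite lerDr mulrn_wge0// mulr_ge0// sumr_ge0//.
Qed.

(** From Lagrange's identity. *)
Lemma cauchy_sums (v w : 'I_d -> R) :
  \sum_i v i * w i <= enorm v * enorm w.
Proof.
have [s0|s0] := ltP (\sum_i v i * w i) 0.
  by apply: (le_trans (ltW s0)); rewrite mulr_ge0// enorm_ge0.
rewrite -(ler_pXn2r (n := 2))// ?nnegrE ?mulr_ge0 ?enorm_ge0//.
  rewrite exprMn !enorm_sqr -subr_ge0.
  have -> : (\sum_i v i ^+ 2) * (\sum_i w i ^+ 2) - (\sum_i v i * w i) ^+ 2 =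
      2^-1 * \sum_i \sum_j (v i * w j - v j * w i) ^+ 2.
    have -> : \sum_i \sum_j (v i * w j - v j * w i) ^+ 2 =
        \sum_i \sum_j v i ^+ 2 * w j ^+ 2 + \sum_i \sum_j v j ^+ 2 * w i ^+ 2
        - 2 * \sum_i \sum_j (v i * w i) * (v j * w j).
      rewrite mulr_sumr -sumrN -!big_split /=; apply: eq_bigr => i _.
      rewrite mulr_sumr -sumrN -!big_split /=; apply: eq_bigr => j _; ring.
    rewrite (exchange_big_dep xpredT)//= expr2.
    have sp (f g : 'I_d -> R) :
        \sum_i \sum_j f i * g j = (\sum_i f i) * (\sum_j g j).
      by rewrite mulr_suml; apply: eq_bigr => i _; rewrite mulr_sumr.
    rewrite !sp (exchange_big_dep xpredT)//= sp; by field.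
  rewrite mulr_ge0 ?invr_ge0// sumr_ge0// => i _; rewrite sumr_ge0// => j _.
  exact: sqr_ge0.
Qed.

Lemma enormD (v w : 'I_d -> R) : enorm (fun i => v i + w i) <= enorm v + enorm w.
Proof.
rewrite -(ler_pXn2r (n := 2))// ?nnegrE ?addr_ge0 ?enorm_ge0// sqrrD !enorm_sqr.
rewrite (eq_bigr (fun i => v i ^+ 2 + 2 * (v i * w i) + w i ^+ 2)); last first.
  by move=> i _; ring.
rewrite !big_split /= -mulr_sumr -(mulr_natl (_ * _)).
by rewrite lerD2r lerD2l ler_pM2l// cauchy_sums.
Qed.

Lemma fnorm_ge0 m : 0 <= fnorm m. Proof. exact: enorm_ge0. Qed.

Lemma fnorm_sqr m : fnorm m ^+ 2 = \sum_i ((m 0 i)%:~R : R) ^+ 2.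
Proof. exact: enorm_sqr. Qed.

Lemma fnormD m m' : fnorm (m + m') <= fnorm m + fnorm m'.
Proof.
rewrite /fnorm /freq_norm; apply: le_trans (enormD _ _).
by rewrite le_eqVlt; apply/orP; left; apply/eqP; congr enorm; apply/funext => i;
  rewrite mxE intrD.
Qed.

Lemma fnormN m : fnorm (- m) = fnorm m.
Proof.
rewrite !fnormE; congr Num.sqrt; apply: eq_bigr => i _.
by rewrite mxE intrN sqrrN.
Qed.

Lemma fnormMn m n : fnorm (m *+ n) = n%:R * fnorm m.
Proof.
apply/eqP; rewrite -(eqrXn2 (n := 2)) ?mulr_ge0 ?fnorm_ge0//; apply/eqP.
rewrite exprMn !fnorm_sqr mulr_sumr; apply: eq_bigr => i _.
by rewrite mulmxnE -exprMn mulr_natl rmorphMn.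
Qed.

Lemma fnormB m m' : fnorm (m - m') <= fnorm m + fnorm m'.
Proof. by rewrite -(fnormN m') fnormD. Qed.

Lemma fnorm_lb m m' : fnorm m - fnorm m' <= fnorm (m + m').
Proof. by rewrite lerBlDr; have := fnormB (m + m') m'; rewrite addrK. Qed.

Lemma fnorm_lbB m m' : fnorm m - fnorm m' <= fnorm (m - m').
Proof. by have := fnorm_lb m (- m'); rewrite fnormN. Qed.

Lemma coord_le_fnorm m i : `|(m 0 i)%:~R| <= fnorm m.
Proof. exact: (coord_le_enorm (fun i => (m 0 i)%:~R)). Qed.

Lemma neq0_coord m : m != 0 -> exists i, m 0 i != 0.
Proof.
move=> m0; apply/existsP; apply: contra_neqT m0 => /existsPn H.
by apply/rowP => i; rewrite mxE; apply/eqP; have := H i; rewrite negbK.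
Qed.

Lemma fnorm_ge1 m : m != 0 -> 1 <= fnorm m.
Proof.
move=> /neq0_coord[i mi]; apply: le_trans (coord_le_fnorm m i).
by rewrite -intr_norm (ler_int _ 1) -gtz0_ge1 normr_gt0.
Qed.

Lemma fnorm_gt0 m : m != 0 -> 0 < fnorm m.
Proof. by move=> /fnorm_ge1; exact: lt_le_trans. Qed.

Lemma fnorm0 : fnorm 0 = 0.
Proof. by have := fnormMn 0 0; rewrite mulr0n mul0r. Qed.

Lemma fnorm_le_sum m : fnorm m <= \sum_i `|(m 0 i)%:~R|.
Proof. exact: enorm_le_sum. Qed.

(** The weight of a space of order -k of functions modulo constants, hence the
    value 0 at the zero frequency. *)
Definition hweight (k : nat) m : R := if m == 0 then 0 else fnorm m ^- k.

Lemma hweight_ge0 k m : 0 <= hweight k m.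
Proof. by rewrite /hweight; case: ifP => // _; rewrite invr_ge0 exprn_ge0// fnorm_ge0. Qed.

Lemma hweight_le1 k m : hweight k m <= 1.
Proof.
rewrite /hweight; case: ifPn => // m0.
by rewrite invf_le1 ?exprn_gt0 ?fnorm_gt0// exprn_ege1// fnorm_ge1.
Qed.

Lemma hweight_le k m (L : R) : (0 < k)%N -> 0 < L -> L <= fnorm m ->
  hweight k m <= L^-1.
Proof.
case: k => // k _ L0 Lm; rewrite /hweight; case: ifPn => [_|m0].
  by rewrite invr_ge0 ltW.
rewrite lef_pV2 ?posrE ?exprn_gt0 ?fnorm_gt0// exprS.
apply: (le_trans Lm); rewrite -[leLHS]mulr1 ler_wpM2l ?fnorm_ge0//.
by rewrite exprn_ege1// fnorm_ge1.
Qed.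

Lemma hweight_le_anorm k f : wnorm (hweight k) f <= anorm f.
Proof.
by rewrite -[leRHS]mul1r; apply: wnorm_le_spec => l _; exact: hweight_le1.
Qed.

(** A convenient upper bound for the frequencies of f. *)
Definition deg f : R := \sum_(l <- f) fnorm (mfreq l).

Lemma deg_ge0 f : 0 <= deg f.
Proof. by apply: sumr_ge0 => l _; exact: fnorm_ge0. Qed.

Lemma spec_deg f : spec (fun m => fnorm m <= deg f) f.
Proof.
move=> l lf; rewrite /deg (perm_big _ (perm_to_rem lf)) big_cons lerDl.
by apply: sumr_ge0 => l' _; exact: fnorm_ge0.
Qed.

End trig_polynomials.

(** * Integration on the torus *)

Section bounded_measurable.
Context {disp : measure_display} {T : measurableType disp} {R : realType}.
Variable P : probability T R.
Implicit Types f g : T -> R.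

Definition bdm f : Prop :=
  measurable_fun [set: T] f /\ exists C, forall t, `|f t| <= C.

Lemma bdm_integrable f : bdm f -> P.-integrable setT (EFin \o f).
Proof.
move=> [mf [C fC]]; apply: measurable_bounded_integrable => //.
  by rewrite -ge0_fin_numE// fin_num_measure.
exists C; split; first exact: num_real.
by move=> y Cy x _; exact: le_trans (fC x) (ltW Cy).
Qed.

Lemma bdm_cst c : bdm (fun=> c).
Proof. by split; [exact: measurable_cst | exists `|c|]. Qed.

Lemma bdmD f g : bdm f -> bdm g -> bdm (fun t => f t + g t).
Proof.
move=> [mf [C fC]] [mg [D gD]]; split; first exact: measurable_funD.
by exists (C + D) => t; rewrite (le_trans (ler_normD _ _))// lerD.
Qed.

Lemma bdmM f g : bdm f -> bdm g -> bdm (fun t => f t * g t).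
Proof.
move=> [mf [C fC]] [mg [D gD]]; split; first exact: measurable_funM.
by exists (C * D) => t; rewrite normrM ler_pM.
Qed.

Lemma bdmZ c f : bdm f -> bdm (fun t => c * f t).
Proof. by move=> bf; apply: bdmM => //; exact: bdm_cst. Qed.

Lemma bdmB f g : bdm f -> bdm g -> bdm (fun t => f t - g t).
Proof.
move=> bf /(bdmZ (-1)) bg; have := bdmD bf bg.
by congr bdm; apply/funext => t; rewrite mulN1r.
Qed.

Lemma bdm_sum (I : Type) (r : seq I) (F : I -> T -> R) :
  (forall i, bdm (F i)) -> bdm (fun t => \sum_(i <- r) F i t).
Proof.
move=> bF; elim: r => [|i r IH].
  by under eq_fun do rewrite big_nil; exact: bdm_cst.
by under eq_fun do rewrite big_cons; exact: bdmD.
Qed.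

Lemma bdm_norm f : bdm f -> bdm (fun t => `|f t|).
Proof.
move=> [mf [C fC]]; split; first exact: measurableT_comp.
by exists C => t; rewrite normr_id.
Qed.

Lemma Rint_cst c : \int[P]_t (c : R) = c.
Proof. by rewrite Rintegral_cst// [X in fine X]probability_setT mulr1. Qed.

Lemma Rint_sum (I : Type) (r : seq I) (F : I -> T -> R) :
  (forall i, P.-integrable setT (EFin \o F i)) ->
  \int[P]_t (\sum_(i <- r) F i t) = \sum_(i <- r) \int[P]_t F i t.
Proof.
move=> bF; elim: r => [|i r IH].
  by under eq_Rintegral do rewrite big_nil; rewrite Rint_cst big_nil.
under eq_Rintegral do rewrite big_cons.
rewrite big_cons RintegralD//; first by rewrite IH.
have -> : EFin \o (fun t => \sum_(i <- r) F i t) =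
    (fun t => (\sum_(i <- r) (EFin \o F i) t)%E).
  by apply/funext => t /=; rewrite sumEFin.
exact: integrable_sum.
Qed.

Lemma le_Rint_bdm f g : bdm f -> bdm g -> (forall t, f t <= g t) ->
  \int[P]_t f t <= \int[P]_t g t.
Proof. by move=> bf bg fg; apply: le_Rintegral => //; exact: bdm_integrable. Qed.

Lemma Rint_le_bound f C : bdm f -> (forall t, `|f t| <= C) ->
  `|\int[P]_t f t| <= C.
Proof.
move=> bf fC; apply: (le_trans (le_normr_Rintegral _ _)) => //.
  exact: bdm_integrable.
rewrite -[leRHS]Rint_cst; apply: le_Rint_bdm => //; first exact: bdm_norm.
exact: bdm_cst.
Qed.

Lemma integrable_mul_bdm f g : P.-integrable setT (EFin \o f) -> bdm g ->
  P.-integrable setT (EFin \o (fun t => f t * g t)).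
Proof.
move=> intf [mg [C gC]].
have -> : EFin \o (fun t => f t * g t) = ((EFin \o f) \* (EFin \o g))%E.
  by apply/funext => t /=; rewrite EFinM.
apply: integrableMl => //; exists C; split; first exact: num_real.
by move=> y Cy x _; exact: le_trans (gC x) (ltW Cy).
Qed.

End bounded_measurable.

Section unit_interval.
Variable R : realType.
Local Notation M := (measurableTypeR R).
Local Notation U := (uniform_prob (@ltr01 R)).

Lemma integral_unif (f : M -> R) : bdm f ->
  (\int[U]_x (f x)%:E = \int[lebesgue_measure]_(x in `[0%R, 1%R]) (f x)%:E)%E.
Proof.
move=> bf; rewrite integralE [RHS]integralE.
have mf : measurable_fun setT (fun x => (f x)%:E) by apply/measurable_EFinP; case: bf.
rewrite !integral_uniform ?subr0 ?invr1 ?mul1e//.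
  exact: measurable_funeneg.
exact: measurable_funepos.
Qed.

Lemma unif_FTC (F f : R -> R) :
  (forall x, derivable F x 1) -> (forall x, derive1 F x = f x) -> continuous f ->
  \int[U]_x f x = F 1 - F 0.
Proof.
move=> dF F'f cf.
have mf : measurable_fun setT (f : M -> R) by exact: continuous_measurable_fun.
pose g (x : R) := if 0 <= x <= 1 then f x else 0.
have bg : bdm (g : M -> R).
  split.
    apply: measurable_fun_if => //=; first by apply: measurable_and => //; exact: measurable_fun_ler.
    exact: measurable_funTS.
  have [C fC] : exists C, {in `[0, 1], forall x, `|f x| <= C}.
    have ct : {within `[0, 1], continuous (fun x => `|f x|)}.
      by apply: continuous_subspaceT => x; apply: continuous_comp;
        [exact: cf|exact: norm_continuous].
    have [c _ Hc] := EVT_max (@ler01 R) ct.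
    by exists (`|f c|) => x; exact: Hc.
  exists (Num.max C 0) => x; rewrite /g; case: ifPn => x01.
    by rewrite le_max fC.
  by rewrite normr0 le_max lexx orbT.
have -> : \int[U]_x f x = \int[U]_x g x.
  rewrite /Rintegral; congr fine; rewrite /= .
  have sub (h : M -> \bar R) : measurable_fun setT h ->
      (forall x, 0 <= h x)%E -> (\int[U]_x h x =
      \int[U]_x (h x * (if 0 <= x <= 1 then 1 else 0)%:E))%E.
    move=> mh h0; rewrite !integral_uniform//.
    - congr (_ * _)%E; apply: eq_integral => x; rewrite inE /= in_itv /= => ->.
      by rewrite mule1.
    - apply: emeasurable_funM => //; apply/measurable_EFinP.
      apply: measurable_fun_if => //=.
      by apply: measurable_and => //; exact: measurable_fun_ler.
    - by move=> x; rewrite mule_ge0//; case: ifP.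
  rewrite integralE [RHS]integralE; congr (_ - _)%E.
    rewrite sub//; last by apply: measurable_funepos; exact/measurable_EFinP.
    apply: eq_integral => x _; rewrite /g !funeposE; case: ifP => _.
      by rewrite mule1.
    by rewrite mule0 maxxx.
  rewrite sub//; last by apply: measurable_funeneg; exact/measurable_EFinP.
  apply: eq_integral => x _; rewrite /g !funenegE; case: ifP => _.
    by rewrite mule1.
  by rewrite mule0 oppe0 maxxx.
rewrite /Rintegral integral_unif//.
transitivity (fine (\int[lebesgue_measure]_(x in `[0%R, 1%R]) (f x)%:E)%E).
  congr fine; apply: eq_integral => x.
  by rewrite inE /= in_itv /= /g => ->.
rewrite (@continuous_FTC2 _ f F)//.
- exact: continuous_subspaceT.
- have cF : continuous F.
    by move=> x; apply/differentiable_continuous/derivable1_diffP.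
  split=> [x _||]; first exact: dF.
    by apply: cvg_at_right_filter; exact: cF.
  by apply: cvg_at_left_filter; exact: cF.
Qed.

End unit_interval.

Section torus_integration.
Variable R : realType.
Local Notation M := (measurableTypeR R).
Local Notation U := (uniform_prob (@ltr01 R)).

Lemma bdm_tcons n (f : n.+1.-tuple M -> R) : bdm f -> bdm (f \o @tcons R n).
Proof.
move=> [mf [C fC]]; split; last by exists C => z; exact: fC.
by apply: measurableT_comp => //; exact: measurable_tcons.
Qed.

Lemma integral_torusS n (f : n.+1.-tuple M -> R) : bdm f ->
  (\int[torus_measure R n.+1]_t (f t)%:E =
   \int[U \x torus_measure R n]_z (f (tcons z))%:E)%E.
Proof.
move=> bf; have [mf _] := bf.
rewrite [LHS]/= (integral_pushforward (@measurable_tcons R n) (f := EFin \o f))//.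
- exact/measurable_EFinP.
- exact/bdm_integrable/bdm_tcons.
Qed.

Lemma bdm_section1 n (f : n.+1.-tuple M -> R) y : bdm f ->
  bdm (fun t => f (tcons (y, t))).
Proof.
move=> /bdm_tcons[mf [C fC]]; split; last by exists C => t; exact: (fC (y, t)).
exact: measurableT_comp mf (pair1_measurable y).
Qed.

Lemma bdm_section2 n (f : n.+1.-tuple M -> R) t : bdm f ->
  bdm (fun y => f (tcons (y, t))).
Proof.
move=> /bdm_tcons[mf [C fC]]; split; last by exists C => y; exact: (fC (y, t)).
exact: measurableT_comp mf (pair2_measurable t).
Qed.

Lemma Rint_torus0 n (f : n.+1.-tuple M -> R) : bdm f ->
  (forall y, \int[torus_measure R n]_t f (tcons (y, t)) = 0) \/
  (forall t, \int[U]_y f (tcons (y, t)) = 0) ->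
  \int[torus_measure R n.+1]_t f t = 0.
Proof.
move=> bf H; rewrite /Rintegral integral_torusS//.
have int := bdm_integrable (U \x torus_measure R n)%E (bdm_tcons bf).
have ext d (T : measurableType d) (P : probability T R) (g : T -> R) :
    bdm g -> \int[P]_t g t = 0 -> (\int[P]_t (g t)%:E)%E = 0%E.
  move=> bg Hg; rewrite -[LHS]fineK; first by rewrite [fine _]Hg.
  by apply: integrable_fin_num => //; exact: bdm_integrable.
case: H => H.
  rewrite -(integral12_prod_meas1 int) /fubini_F /=.
  rewrite (eq_integral (fun=> 0%E)) ?integral0// => y _.
  by apply: ext; [exact: bdm_section1|exact: H].
rewrite -(integral21_prod_meas1 int) /fubini_G /=.
rewrite (eq_integral (fun=> 0%E)) ?integral0// => t _.
by apply: ext; [exact: bdm_section2|exact: H].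
Qed.

Definition upd n (t : n.-tuple M) (j : 'I_n) (y : R) : n.-tuple M :=
  [tuple if i == j then y else tnth t i | i < n].

(** By Fubini's theorem: the torus measure is an iterated product, and the
    coordinate j is reached after j sections. *)
Lemma Rint_torus_coord0 n (j : 'I_n) (f : n.-tuple M -> R) : bdm f ->
  (forall t, \int[U]_y f (upd t j y) = 0) ->
  \int[torus_measure R n]_t f t = 0.
Proof.
elim: n j f => [[]//|n IH] j f bf H; apply: Rint_torus0 => //.
case: (unliftP ord0 j) H => [j' ->|->] H.
  left=> y; apply: (IH j' (fun t => f (tcons (y, t)))); first exact: bdm_section1.
  move=> t; rewrite -[RHS](H (tcons (y, t))); apply: eq_Rintegral => z _.
  congr f; apply: eq_from_tnth => i; rewrite !tnth_mktuple.
  case: (unliftP ord0 i) => [i' ->|->].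
    by rewrite (inj_eq (@lift_inj _ _)) /tcons /= !tnthS tnth_mktuple.
  by rewrite !(tnth_nth 0) /=.
right=> t; rewrite -[RHS](H (tcons (0, t))); apply: eq_Rintegral => z _.
congr f; apply: eq_from_tnth => i; rewrite !tnth_mktuple.
case: (unliftP ord0 i) => [i' ->|->]; last by rewrite eqxx (tnth_nth 0).
by rewrite eq_sym -[_ == _]negbK neq_lift /= /tcons /= !tnthS.
Qed.

End torus_integration.

(** * Test functions and their Fourier coefficients *)

Section test_functions.
Variables (R : realType) (d : nat).
Local Notation M := (measurableTypeR R).
Local Notation mu := (torus_measure R d).
Local Notation freq := 'rV[int]_d.
Local Notation e_ j := (delta_mx 0 j : 'rV[R]_d).
Implicit Types (f g : seq (mode R d)) (m : freq) (x : 'rV[R]_d) (t : d.-tuple M).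

Local Notation row_of := (@row_of R d).

(** The topology of 'rV[R]_d and the product sigma-algebra of tuples are unrelated
    by construction. A continuous function is the limit of its values at the
    points of finer and finer grids, and those are measurable step functions. *)
Lemma continuous_measurable_row (f : 'rV[R]_d -> R) : continuous f ->
  measurable_fun [set: d.-tuple M] (f \o row_of).
Proof.
move=> cf; pose pt n (k : freq) : 'rV[R]_d := \row_i ((k 0 i)%:~R / 2 ^+ n).
pose rnd n t : freq := \row_i Num.floor (2 ^+ n * tnth t i).
apply: (@measurable_fun_cvg _ _ _ _ (fun n t => f (pt n (rnd n t)))).
  move=> n _ Y mY; rewrite setTI.
  pose Q (k : freq) (i : 'I_d) : set (d.-tuple M) :=
    [set t | (k 0 i)%:~R <= 2 ^+ n * tnth t i < (k 0 i + 1)%:~R].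
  have -> : (fun t => f (pt n (rnd n t))) @^-1` Y =
      \bigcup_(k : freq) (if `[< Y (f (pt n k)) >] then
        \big[setI/setT]_(i < d) Q k i else set0).
    apply/seteqP; split => t /=.
      move=> Yt; exists (rnd n t) => //; rewrite asboolT//.
      elim/big_ind : _ => //= i _.
      by rewrite /Q /= mxE floor_itv.
    move=> [k _]; case: asboolP => // Yk H.
    have {}H i : Q k i t by move: H; rewrite (bigD1 i)//= => -[].
    have -> : rnd n t = k; last by [].
    apply/rowP => i; rewrite mxE; apply/eqP; rewrite floor_eq.
    exact: H.
  apply: countable_bigcupT_measurable; first exact: countableP.
  move=> k; case: ifP => // _; apply: bigsetI_measurable => i _.
  have mi : measurable_fun setT (fun t : d.-tuple M => 2 ^+ n * tnth t i).
    by apply: measurable_funM => //; exact: measurable_tnth.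
  have := mi measurableT `[(k 0 i)%:~R, (k 0 i + 1)%:~R[%classic (measurable_itv _).
  rewrite setTI; congr measurable.
move=> t _; apply: continuous_cvg; first exact: cf.
apply/cvg_ballP => e e0; near=> n.
split=> // i j; rewrite /ball /= !mxE.
have /andP[h1 h2] := floor_itv (2 ^+ n * tnth t j).
have n0 : (0 : R) < 2 ^+ n by rewrite exprn_gt0.
rewrite ger0_norm; last by rewrite subr_ge0 ler_pdivrMr// (mulrC (tnth t j)).
have N : 1 / (2 : R) ^+ n < e by near: n; exact: (near_infty_natSinv_expn_lt (PosNum e0)).
apply: le_lt_trans N; rewrite lerBlDr -mulrDl ler_pdivlMr//.
by rewrite mulrC addrC -(intrD _ _ 1) ltW.
Unshelve. all: by end_near. Qed.

Lemma periodic_bounded (f : 'rV[R]_d -> R) : continuous f -> Zd_periodic f ->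
  exists C, forall x, `|f x| <= C.
Proof.
move=> cf pf.
pose A := [set v : 'rV[R]_d | forall i, `[0, 1]%classic (v ord0 i)].
have cA : compact A by apply: (@rV_compact R d (fun=> `[0, 1]%classic)) => i; exact: segment_compact.
have : compact (f @` A) by apply: continuous_compact => //; exact: continuous_subspaceT.
move=> /compact_bounded[C [_ HC]]; exists (C + 1) => x.
pose m : freq := \row_i Num.floor (x 0 i).
have -> : f x = f (x - map_mx intr m).
  by rewrite -(pf m (x - _)) subrK.
apply: HC; first by rewrite ltrDl.
exists (x - map_mx intr m) => // i.
have /andP[h1 h2] := floor_itv (x 0 i).
rewrite /= in_itv /= !mxE subr_ge0 h1 /= lerBlDl.
by rewrite intrD in h2; exact: ltW.
Qed.

Lemma bdm_row (f : 'rV[R]_d -> R) : continuous f -> Zd_periodic f ->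
  bdm (fun t : d.-tuple M => f (row_of t)).
Proof.
move=> cf pf; split; first exact: continuous_measurable_row.
by have [C HC] := periodic_bounded cf pf; exists C => t; exact: HC.
Qed.

Lemma contD (f g : 'rV[R]_d -> R) :
  continuous f -> continuous g -> continuous (fun x => f x + g x).
Proof. by move=> cf cg x; exact: cvgD (cf x) (cg x). Qed.

Lemma contM (f g : 'rV[R]_d -> R) :
  continuous f -> continuous g -> continuous (fun x => f x * g x).
Proof. by move=> cf cg x; exact: cvgM (cf x) (cg x). Qed.

Lemma contC (c : R) : continuous (fun _ : 'rV[R]_d => c).
Proof. exact: cst_continuous. Qed.

Lemma row_upd t j y : row_of (upd t j y) = y *: e_ j + row_of (upd t j 0).
Proof.
apply/rowP => i; rewrite !mxE !tnth_mktuple eqxx /= eq_sym.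
by case: eqVneq => _; rewrite ?mulr1 ?mulr0 ?addr0 ?add0r.
Qed.

Lemma line_quotient (g : 'rV[R]_d -> R) (v x : 'rV[R]_d) (y : R) :
  (fun h => h^-1 *: (((fun z => g (z *: v + x)) \o shift y) (h *: 1) -
     g (y *: v + x))) =
  (fun h : R => h^-1 *: ((g \o shift (y *: v + x)) (h *: v) - g (y *: v + x))).
Proof.
apply/funext => h /=; congr (_ *: (g _ - _)).
by rewrite [h%:A]mulr1 scalerDl addrA.
Qed.

Lemma derivable_line (g : 'rV[R]_d -> R) v x y :
  derivable g (y *: v + x) v -> derivable (fun z : R => g (z *: v + x)) y 1.
Proof. by rewrite /derivable line_quotient. Qed.

Lemma derive_line (g : 'rV[R]_d -> R) v x (y : R) :
  derive1 (fun z : R => g (z *: v + x)) y = 'D_v g (y *: v + x).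
Proof. by rewrite derive1E /derive line_quotient. Qed.

Lemma line_continuous (v x : 'rV[R]_d) : continuous (fun z : R => z *: v + x).
Proof.
move=> z; apply: cvgD; last exact: cvg_cst.
by apply: cvgZl; exact: cvg_id.
Qed.

(** Integrating a partial derivative of a periodic function gives 0: integrate
    first along the coordinate of the derivative. *)
Lemma Rint_partial (g : 'rV[R]_d -> R) j :
  (forall x, derivable g x (e_ j)) -> continuous (partial j g) ->
  Zd_periodic g -> Zd_periodic (partial j g) ->
  \int[mu]_t partial j g (row_of t) = 0.
Proof.
move=> dg cg pg pg'; apply: (@Rint_torus_coord0 R d j (fun t => partial j g (row_of t))).
  exact: bdm_row.
move=> t; set x := row_of (upd t j 0).
have -> : \int[uniform_prob (@ltr01 R)]_y partial j g (row_of (upd t j y)) =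
    \int[uniform_prob (@ltr01 R)]_y partial j g (y *: e_ j + x).
  by apply: eq_Rintegral => y _; rewrite row_upd.
rewrite (@unif_FTC _ (fun y => g (y *: e_ j + x))).
- apply/eqP; rewrite subr_eq0 scale0r add0r scale1r addrC; apply/eqP.
  have := pg (delta_mx 0 j) x; congr (g (_ + _) = _).
  by apply/rowP => i; rewrite !mxE; case: eqP; case: eqP.
- by move=> y; apply: derivable_line; exact: dg.
- by move=> y; rewrite derive_line.
- by move=> y; apply: continuous_comp; [exact: line_continuous|exact: cg].
Qed.

Lemma phase_line m j (h : R) x :
  phase m (h *: e_ j + x) = phase m x + h * (2 * pi * (m 0 j)%:~R).
Proof.
rewrite /phase (bigD1 j)//= [in RHS](bigD1 j)//= !mxE !eqxx /= mulr1.
rewrite (eq_bigr (fun i => (m 0 i)%:~R * x 0 i)); first by ring.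
by move=> i ij; rewrite !mxE (negbTE ij) andbF mulr0 add0r.
Qed.

Lemma is_derive_wave m b x j : is_derive x (e_ j) (wave m b)
  (2 * pi * (m 0 j)%:~R * wave m (b + pi / 2) x).
Proof.
pose c : R := 2 * pi * (m 0 j)%:~R.
have E : (fun h : R => wave m b (h *: e_ j + x)) =
         (fun h => cos (c * h + (phase m x + b))).
  by apply/funext => h; rewrite /wave phase_line -/c; congr cos; ring.
have H : is_derive (0 : R) 1 (fun h => cos (c * h + (phase m x + b)))
    (c * wave m (b + pi / 2) x).
  apply: is_derive_eq.
  by rewrite /wave (addrA (phase m x)) cosDpihalf mulr0 add0r addr0 /GRing.scale /=; ring.
have D0 : derivable (wave m b) x (e_ j).
  by apply/derivable1P; rewrite E; exact: ex_derive.
apply: DeriveDef => //.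
have := derive_line (wave m b) (e_ j) x 0.
by rewrite scale0r add0r E derive1E derive_val => <-.
Qed.

Definition pderiv (j : 'I_d) f : seq (mode R d) :=
  imult (fun m => 2 * pi * (m 0 j)%:~R) f.

Lemma is_derive_ev f x j : is_derive x (e_ j) (ev f) (ev (pderiv j f) x).
Proof.
elim: f => [|l f IH].
  rewrite /pderiv /= ev_nil.
  have -> : ev [::] = cst 0 :> ('rV[R]_d -> R) by apply/funext => y; rewrite ev_nil.
  exact: is_derive_cst.
have -> : ev (l :: f) = (amp l *: wave (mfreq l) (shft l)) + ev f.
  by apply/funext => y; rewrite ev_cons.
have := is_derive_wave (mfreq l) (shft l) x j => W.
apply: is_derive_eq.
by rewrite [pderiv _ _]/= ev_cons /amp /mfreq /shft /= /GRing.scale /=; ring.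
Qed.

Lemma partial_ev j f : partial j (ev f) = ev (pderiv j f).
Proof. by apply/funext => x; exact: (@derive_val _ _ _ _ _ _ _ (is_derive_ev f x j)). Qed.

Lemma continuous_phase m : continuous (phase m : 'rV[R]_d -> R).
Proof.
apply: contM; first exact: contC.
elim: (index_enum _) => [|i r IH].
  by under eq_fun do rewrite big_nil; exact: contC.
under eq_fun do rewrite big_cons; apply: contD IH.
by apply: contM; [exact: contC|exact: coord_continuous].
Qed.

Lemma continuous_wave m b : continuous (wave m b : 'rV[R]_d -> R).
Proof.
move=> x; apply: continuous_comp; last exact: continuous_cos.
by apply: contD; [exact: continuous_phase|exact: contC].
Qed.

Lemma continuous_ev f : continuous (ev f : 'rV[R]_d -> R).
Proof.
elim: f => [|l f IH].
  have -> : ev [::] = (fun=> 0) :> ('rV[R]_d -> R) by apply/funext => x; rewrite ev_nil.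
  exact: contC.
have -> : ev (l :: f) = (fun x => amp l * wave (mfreq l) (shft l) x + ev f x).
  by apply/funext => x; rewrite ev_cons.
apply: contD IH.
by apply: contM; [exact: contC|exact: continuous_wave].
Qed.

Lemma wave_periodic m b : Zd_periodic (wave m b : 'rV[R]_d -> R).
Proof.
move=> k x.
have [n Hn] : exists n : int, phase m (x + map_mx intr k) = phase m x + (n%:~R * (pi *+ 2)).
  exists (\sum_i m 0 i * k 0 i).
  have E : \sum_i (m 0 i)%:~R * (x + map_mx intr k) 0 i =
      \sum_i (m 0 i)%:~R * x 0 i + (\sum_i m 0 i * k 0 i)%:~R.
    rewrite rmorph_sum -big_split /=; apply: eq_bigr => i _.
    by rewrite !mxE intrM mulrDr.
  by rewrite /phase E mulrDr -mulr_natr; ring.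
rewrite /wave Hn addrAC; move: (phase m x + b) => y.
have per (i : nat) z : cos (z + i%:R * (pi *+ 2)) = cos z :> R.
  elim: i => [|i IH]; first by rewrite mul0r addr0.
  by rewrite -natr1 mulrDl mul1r addrA cosD2pi IH.
case: n Hn => n _; first exact: per.
have := per n.+1 (y + (Negz n)%:~R * (pi *+ 2)).
by rewrite -addrA -mulrDl NegzE mulrNz -pmulrn addNr mul0r addr0 => <-.
Qed.

Lemma ev_periodic f : Zd_periodic (ev f : 'rV[R]_d -> R).
Proof. by move=> k x; apply: eq_bigr => l _; rewrite wave_periodic. Qed.

Lemma ev_smooth f : smooth (ev f : 'rV[R]_d -> R).
Proof.
move=> s.
have [g ->] : exists g, partials s (ev f) = ev g.
  elim: s => [|i s [g Hg]]; first by exists f.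
  by exists (pderiv i g); rewrite /= Hg partial_ev.
split; first exact: continuous_ev.
by move=> i x; case: (is_derive_ev g x i).
Qed.

Lemma ev_test f : test_fun (ev f : 'rV[R]_d -> R).
Proof. by split; [exact: ev_smooth|exact: ev_periodic]. Qed.

Lemma wave_ev m b : wave m b = ev [:: (1, m, b)] :> ('rV[R]_d -> R).
Proof. by apply/funext => x; rewrite ev_cons ev_nil /amp /= mul1r addr0. Qed.

Lemma wave_test m b : test_fun (wave m b : 'rV[R]_d -> R).
Proof. rewrite wave_ev; exact: ev_test. Qed.

Lemma bdm_ev f : bdm (fun t => ev f (row_of t)).
Proof. by apply: bdm_row; [exact: continuous_ev|exact: ev_periodic]. Qed.

Lemma bdm_wave m b : bdm (fun t => wave m b (row_of t)).
Proof. by rewrite wave_ev; exact: bdm_ev. Qed.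

Lemma test_continuous (phi : 'rV[R]_d -> R) : test_fun phi -> continuous phi.
Proof. by move=> [/(_ [::])[]]. Qed.

Lemma bdm_test (phi : 'rV[R]_d -> R) : test_fun phi ->
  bdm (fun t => phi (row_of t)).
Proof. by move=> tf; apply: bdm_row; [exact: test_continuous|case: tf]. Qed.

Lemma test_partial j (phi : 'rV[R]_d -> R) : test_fun phi -> test_fun (partial j phi).
Proof.
move=> [sf pf]; split.
  move=> s; have := sf (rcons s j).
  by rewrite /partials foldr_rcons.
move=> k x; rewrite /partial /derive.
set F := fun _ => _; set G := fun _ => _; suff -> : F = G by [].
by apply/funext => h; rewrite /F /G /= pf addrA pf.
Qed.

Lemma test_partials s (phi : 'rV[R]_d -> R) : test_fun phi ->
  test_fun (partials s phi).
Proof. by move=> tf; elim: s => //= i s IH; exact: test_partial. Qed.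

Lemma test_derivable (phi : 'rV[R]_d -> R) x j : test_fun phi ->
  derivable phi x (e_ j).
Proof. by move=> [/(_ [::])[_]]. Qed.

Definition Iw (phi : 'rV[R]_d -> R) m b : R :=
  \int[mu]_t (phi (row_of t) * wave m b (row_of t)).

(** Integration by parts; differentiating a wave shifts its phase by pi / 2. *)
Lemma Iw_partial j (phi : 'rV[R]_d -> R) m b : test_fun phi ->
  Iw (partial j phi) m b = - (2 * pi * (m 0 j)%:~R) * Iw phi m (b + pi / 2).
Proof.
move=> tf; have tw := wave_test m b; have tw' := wave_test m (b + pi / 2).
pose g : 'rV[R]_d -> R := (phi * wave m b)%R.
pose c : R := 2 * pi * (m 0 j)%:~R.
have gE : partial j g = fun x => partial j phi x * wave m b x +
    c * (phi x * wave m (b + pi / 2) x).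
  apply/funext => x; rewrite /partial deriveM; [|exact: test_derivable..].
  rewrite (@derive_val _ _ _ _ _ _ _ (is_derive_wave m b x j)).
  by rewrite /GRing.scale /= -/c; ring.
have tp := test_partial j tf.
have : \int[mu]_t partial j g (row_of t) = 0.
  apply: Rint_partial.
  - by move=> x; apply: derivableM; exact: test_derivable.
  - rewrite gE; apply: contD; first by apply: contM; exact: test_continuous.
    by apply: contM; [exact: contC|apply: contM; exact: test_continuous].
  - by move=> k x; rewrite /g !mulrfctE tf.2 tw.2.
  - by move=> k x; rewrite gE tp.2 tw.2 tf.2 tw'.2.
rewrite gE RintegralD//; [
  |by apply/bdm_integrable/bdmM; exact: bdm_test
  |by apply/bdm_integrable/bdmZ/bdmM; exact: bdm_test].
rewrite RintegralZl//; last by apply: bdm_integrable; apply: bdmM; exact: bdm_test.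
by rewrite -/(Iw _ _ _) -/(Iw _ _ _) -/c => /eqP; rewrite addr_eq0 mulNr => /eqP.
Qed.

Lemma Iw_cst_wave m b : m != 0 -> \int[mu]_t wave m b (row_of t) = 0.
Proof.
move=> /neq0_coord[j mj].
have t1 : test_fun (fun _ : 'rV[R]_d => 1 : R).
  have -> : (fun _ => 1) = ev [:: (1, 0, 0)] :> ('rV[R]_d -> R).
    by apply/funext => x; rewrite ev_cons ev_nil /wave phase0 !addr0 cos0 mulr1.
  exact: ev_test.
have := Iw_partial j m (b - pi / 2) t1; rewrite subrK.
have -> : partial j (fun=> 1) = (fun=> 0) :> ('rV[R]_d -> R).
  by apply/funext => x; exact: derive_cst.
rewrite /Iw; under eq_Rintegral do rewrite mul0r.
rewrite Rint_cst => /esym/eqP; rewrite mulf_eq0 oppr_eq0 mulf_eq0 intr_eq0 (negbTE mj).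
rewrite orbF mulf_eq0 pnatr_eq0 (gt_eqF (pi_gt0 R)) /= => /eqP H.
by rewrite -[RHS]H; apply: eq_Rintegral => t _; rewrite mul1r.
Qed.

Lemma Rint_wave m b : \int[mu]_t wave m b (row_of t) = if m == 0 then cos b else 0.
Proof.
case: ifPn => [/eqP ->|]; last exact: Iw_cst_wave.
under eq_Rintegral do rewrite /wave phase0 add0r.
by rewrite Rint_cst.
Qed.

Lemma Rint_ev f : \int[mu]_t ev f (row_of t) =
  \sum_(l <- f) amp l * (if mfreq l == 0 then cos (shft l) else 0).
Proof.
rewrite Rint_sum.
  apply: eq_bigr => l _; rewrite RintegralZl ?Rint_wave//.
  exact/bdm_integrable/bdm_wave.
by move=> l; apply/bdm_integrable/bdmZ/bdm_wave.
Qed.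

Lemma Rint_ev0 f : spec (fun m => m != 0) f -> \int[mu]_t ev f (row_of t) = 0.
Proof.
move=> sf; rewrite Rint_ev big_seq big1// => l /sf /negbTE ->.
by rewrite mulr0.
Qed.

Lemma Iw_wave m b m' b' : Iw (wave m b) m' b' =
  2^-1 * (if m + m' == 0 then cos (b + b') else 0) +
  2^-1 * (if m - m' == 0 then cos (b - b') else 0).
Proof.
rewrite /Iw; under eq_Rintegral do rewrite wave_mul.
rewrite RintegralD//; try by apply/bdm_integrable/bdmZ/bdm_wave.
by rewrite !RintegralZl// ?Rint_wave//; apply/bdm_integrable/bdm_wave.
Qed.

Lemma Iw_partials k j (phi : 'rV[R]_d -> R) m b : test_fun phi ->
  Iw (partials (nseq k j) phi) m b =
  (- (2 * pi * (m 0 j)%:~R)) ^+ k * Iw phi m (b + k%:R * (pi / 2)).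
Proof.
move=> tf; elim: k b => [|k IH] b; first by rewrite mul1r mul0r addr0.
rewrite [partials _ _]/= Iw_partial; last exact: test_partials.
rewrite IH exprS mulrA; congr (_ * Iw _ _ _); rewrite -natr1; ring.
Qed.

Lemma Iw_le (phi : 'rV[R]_d -> R) m b C : test_fun phi ->
  (forall x, `|phi x| <= C) -> `|Iw phi m b| <= C.
Proof.
move=> tf HC; apply: Rint_le_bound.
  by apply: bdmM; [exact: bdm_test|exact: bdm_wave].
move=> t; rewrite normrM -[leRHS]mulr1 ler_pM//; exact: wave_norm.
Qed.

Lemma pi_ge1 : 1 <= pi :> R.
Proof. exact: le_trans (ler1n _ 2) (pi_ge2 R). Qed.

(** By k integrations by parts in the direction j. *)
Lemma Iw_decay k j (phi : 'rV[R]_d -> R) m b C : test_fun phi ->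
  (forall s x, (size s <= k)%N -> `|partials s phi x| <= C) ->
  `|(m 0 j)%:~R| ^+ k * `|Iw phi m b| <= C.
Proof.
move=> tf HC.
have := Iw_partials k j m (b - k%:R * (pi / 2)) tf; rewrite subrK => E.
have : `|Iw (partials (nseq k j) phi) m (b - k%:R * (pi / 2))| <= C.
  by apply: Iw_le; [exact: test_partials|move=> x; apply: HC; rewrite size_nseq].
rewrite E normrM; apply: le_trans; rewrite ler_wpM2r// normrX normrN.
rewrite lerXn2r ?nnegrE// normrM ler_peMl// normrM.
rewrite !ger0_norm ?pi_ge0// mulr_ege1 ?ler1n// pi_ge1//.
Qed.

End test_functions.

(** * Fourier series of functionals *)

Section fourier_series.
Variables (R : realType) (d : nat).
Local Notation M := (measurableTypeR R).
Local Notation mu := (torus_measure R d).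
Local Notation freq := 'rV[int]_d.
Implicit Types (f g : seq (mode R d)) (m : freq) (x : 'rV[R]_d) (t : d.-tuple M)
  (F : functional R d).
Local Notation row_of := (@row_of R d).

Definition cosm m : 'rV[R]_d -> R := fun x => cos (phase m x).
Definition sinm m : 'rV[R]_d -> R := fun x => sin (phase m x).

Lemma cosmE m : cosm m = wave m 0.
Proof. by apply/funext => x; rewrite wave_cos. Qed.

Lemma sinmE m : sinm m = wave m (- (pi / 2)).
Proof. by apply/funext => x; rewrite wave_sin. Qed.

Lemma cosm_test m : test_fun (cosm m). Proof. rewrite cosmE; exact: wave_test. Qed.
Lemma sinm_test m : test_fun (sinm m). Proof. rewrite sinmE; exact: wave_test. Qed.

Definition nfour F m : R := Num.sqrt (F (cosm m) ^+ 2 + F (sinm m) ^+ 2).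

Lemma normc_fourier F m : ComplexField.Normc.normc (fourier F m) = nfour F m.
Proof. by rewrite /fourier /= sqrrN. Qed.

Lemma nfour_ge0 F m : 0 <= nfour F m. Proof. exact: sqrtr_ge0. Qed.

Lemma fourier_termE (c : freq -> R) F m x : fourier_term c F m x =
  c m * (F (cosm m) * cosm m x + F (sinm m) * sinm m x).
Proof.
rewrite /fourier_term /fourier /expi /= -/(cosm m) -/(sinm m) /cosm /sinm /=.
by rewrite !mul0r !subr0 addr0 /=; ring.
Qed.

Definition cube (K : nat) : seq freq :=
  [seq \row_i ((fun_of_fin p i : nat)%:Z - K%:Z) |
    p : {ffun 'I_d -> 'I_(K.*2.+1)} <- enum {: {ffun 'I_d -> 'I_(K.*2.+1)}}].

Lemma cube_uniq K : uniq (cube K).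
Proof.
rewrite map_inj_uniq ?enum_uniq// => p q /rowP H; apply/ffunP => i.
by have := H i; rewrite !mxE => /addIr [] /val_inj.
Qed.

Lemma mem_cube K m : (m \in cube K) = [forall i, `|m 0 i| <= K%:Z].
Proof.
apply/mapP/forallP => [[p _ ->] i|H].
  rewrite mxE ler_norml lerBrDr addNr lez_nat /= lerBlDr.
  by rewrite -PoszD lez_nat addnn -ltnS ltn_ord.
have Hi i : (absz (m 0 i + K%:Z)%R < K.*2.+1)%N.
  have := H i; rewrite ler_norml => /andP[h1 h2].
  rewrite ltnS -lez_nat gez0_abs; last by rewrite -lerBlDr sub0r.
  by rewrite -addnn PoszD lerD2r.
exists [ffun i => Ordinal (Hi i)]; first by rewrite mem_enum.
apply/rowP => i; rewrite mxE ffunE /= gez0_abs ?addrK//.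
by have := H i; rewrite ler_norml => /andP[h1 _]; rewrite -lerBlDr sub0r.
Qed.

Lemma cube_fnorm K m : fnorm R m <= K%:R -> m \in cube K.
Proof.
move=> H; rewrite mem_cube; apply/forallP => i.
rewrite -(ler_int R) intr_norm; exact: le_trans (coord_le_fnorm R m i) H.
Qed.

Lemma fsum_cube K (G : freq -> R) : (forall m, m \notin cube K -> G m = 0) ->
  \sum_(m \in [set: freq]) G m = \sum_(m <- cube K) G m.
Proof.
move=> H; rewrite (fsbigE (cube K)) ?cube_uniq//; last by move=> m _; exact: H.
by apply: eq_bigl => m; rewrite in_setT.
Qed.

Lemma fsum_cube_in K (G : freq -> R) :
  \sum_(m \in [set m : freq | forall i, `|m 0 i| <= K%:Z]) G m =
  \sum_(m <- cube K) G m.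
Proof.
rewrite (fsbig_seq _ G (cube_uniq K)).
suff -> : [set m : freq | forall i, `|m 0 i| <= K%:Z] = [set` cube K] by [].
apply/seteqP; split=> m /=; first by move=> H; rewrite mem_cube; apply/forallP.
by rewrite mem_cube => /forallP.
Qed.

Lemma dist_ev f (phi : 'rV[R]_d -> R) : test_fun phi ->
  distribution_of (ev f) phi =
  \sum_(l <- f) amp l * Iw phi (mfreq l) (shft l).
Proof.
move=> tf.
rewrite /distribution_of.
under eq_Rintegral do rewrite mulr_suml.
rewrite Rint_sum.
  apply: eq_bigr => l _; rewrite /Iw -RintegralZl//.
    by apply: eq_Rintegral => t _; ring.
  by apply/bdm_integrable/bdmM; [exact: bdm_test|exact: bdm_wave].
move=> l; apply/bdm_integrable/bdmM; last exact: bdm_test.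
exact/bdmZ/bdm_wave.
Qed.

Lemma dist_cat f g (phi : 'rV[R]_d -> R) : test_fun phi ->
  distribution_of (ev (f ++ g)) phi =
  distribution_of (ev f) phi + distribution_of (ev g) phi.
Proof. by move=> tf; rewrite !dist_ev// big_cat. Qed.

Lemma eq_dist (G H : 'rV[R]_d -> R) : G =1 H -> distribution_of G = distribution_of H.
Proof. by move=> /funext ->. Qed.

(** Coefficients of a wave: only the frequencies m and -m contribute. *)
Lemma wave_cosm m b m' : Iw (cosm m') m b =
  2^-1 * ((m' == - m)%:R * cos b) + 2^-1 * ((m' == m)%:R * cos b).
Proof.
rewrite cosmE Iw_wave add0r sub0r cosN.
rewrite addr_eq0 subr_eq0.
by case: (m' == - m); case: (m' == m); rewrite ?mul1r ?mul0r.
Qed.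

Lemma wave_sinm m b m' : Iw (sinm m') m b =
  2^-1 * ((m' == - m)%:R * sin b) - 2^-1 * ((m' == m)%:R * sin b).
Proof.
rewrite sinmE Iw_wave addr_eq0 subr_eq0.
rewrite addrC (addrC (- _) b) cosBpihalf addrC -opprD cosN (addrC (pi / 2)) cosDpihalf.
by case: (m' == - m); case: (m' == m); rewrite ?mul1r ?mul0r ?mulr0 ?oppr0 ?addr0 ?mulrN.
Qed.

(** The Fourier coefficients of a wave of frequency m0 sit at m0 and at - m0, each
    with weight one half; as c is even the two halves carry the same factor. *)
Lemma mult_series (c : freq -> R) f K x :
  (forall m, c (- m) = c m) -> (forall m, m \notin cube K -> c m = 0) ->
  \sum_(m <- cube K) c m * (distribution_of (ev f) (cosm m) * cosm m x +
     distribution_of (ev f) (sinm m) * sinm m x) = ev (mult c f) x.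
Proof.
move=> ce c0.
pose G l m := c m * (amp l * Iw (cosm m) (mfreq l) (shft l) * cosm m x +
  amp l * Iw (sinm m) (mfreq l) (shft l) * sinm m x).
transitivity (\sum_(m <- cube K) \sum_(l <- f) G l m).
  apply: eq_bigr => m _; rewrite !dist_ev; [|exact: sinm_test|exact: cosm_test].
  by rewrite !mulr_suml -big_split /= mulr_sumr.
rewrite exchange_big /= /ev /mult big_map; apply: eq_bigr => l _.
set m0 := mfreq l; set b := shft l; rewrite {1}/amp /= /mfreq /shft /= -/m0 -/b.
have GE m : G l m = 2^-1 * amp l * wave m0 b x *
    ((m == m0)%:R * c m0 + (m == - m0)%:R * c m0).
  rewrite /G wave_cosm wave_sinm -/m0 -/b /cosm /sinm /wave.
  case: (eqVneq m (- m0)) => [->|_]; case: (eqVneq _ m0) => [e|_];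
    rewrite ?mul0r ?mul1r ?mulr0 ?add0r ?addr0 ?subr0 ?mul0r ?mulr0 //.
  - have p0 : phase m0 x = 0.
      have := phaseN m0 x; rewrite e => p; have : phase m0 x *+ 2 = 0.
        by rewrite mulr2n {1}p addNr.
      by move=> /eqP; rewrite mulrn_eq0 /= => /eqP.
    by rewrite ce phaseN p0 oppr0 add0r cos0 sin0; field.
  - by rewrite ce phaseN cosN sinN cosD; field.
  - by rewrite e cosD; field.
  - by rewrite oppr0 !(mul0r, mulr0) addr0 mulr0.
under eq_bigr do rewrite GE.
have S m1 : c m1 = c m0 -> \sum_(m <- cube K) (m == m1)%:R * c m0 = c m0.
  move=> cm1; case: (boolP (m1 \in cube K)) => m1K.
    rewrite (bigD1_seq m1) ?cube_uniq//= eqxx mul1r big1 ?addr0// => m /negbTE ->.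
    by rewrite mul0r.
  rewrite -cm1 c0// big1_seq// => m /andP[_ mK]; case: eqVneq => [e|_].
    by rewrite -e mK in m1K.
  by rewrite mul0r.
by rewrite -mulr_sumr big_split /= !S ?ce//; field.
Qed.

Lemma sqrt_sum_le (a b c e : R) : Num.sqrt ((a + c) ^+ 2 + (b + e) ^+ 2) <=
  Num.sqrt (a ^+ 2 + b ^+ 2) + Num.sqrt (c ^+ 2 + e ^+ 2).
Proof.
pose v (p q : R) (i : 'I_2) := if i == ord0 then p else q.
have vE p q : Num.sqrt (p ^+ 2 + q ^+ 2) = enorm (v p q).
  by rewrite /enorm !big_ord_recl big_ord0 addr0.
rewrite !vE; apply: le_trans (enormD (v a b) (v c e)); rewrite le_eqVlt.
by apply/orP; left; apply/eqP; congr enorm; apply/funext => i; rewrite /v; case: ifP.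
Qed.

Lemma sqrt_scale (a p q : R) : Num.sqrt ((a * p) ^+ 2 + (a * q) ^+ 2) =
  `|a| * Num.sqrt (p ^+ 2 + q ^+ 2).
Proof. by rewrite !exprMn -mulrDr sqrtrM ?sqr_ge0// sqrtr_sqr. Qed.

Lemma nfourD F G H m : F (cosm m) = G (cosm m) + H (cosm m) ->
  F (sinm m) = G (sinm m) + H (sinm m) -> nfour F m <= nfour G m + nfour H m.
Proof. by move=> h1 h2; rewrite /nfour h1 h2 sqrt_sum_le. Qed.

Lemma nfour_ev f m : nfour (distribution_of (ev f)) m <=
  \sum_(l <- f) `|amp l| * (2^-1 * (m == - mfreq l)%:R + 2^-1 * (m == mfreq l)%:R).
Proof.
elim: f => [|l f IH].
  rewrite big_nil /nfour !dist_ev; [|exact: sinm_test|exact: cosm_test].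
  by rewrite !big_nil expr0n /= addr0 sqrtr0.
rewrite big_cons; apply: le_trans (lerD _ IH).
  apply: (@nfourD _ (distribution_of (ev [:: l])));
    rewrite -(cat1s l f) dist_cat//; [exact: cosm_test|exact: sinm_test].
rewrite /nfour !dist_ev; [|exact: sinm_test|exact: cosm_test].
rewrite !big_seq1 sqrt_scale ler_wpM2l// wave_cosm wave_sinm.
apply: (le_trans (sqrt_sum_le _ _ _ _)).
have E (a : R) (b : bool) : Num.sqrt ((a * (b%:R * cos (shft l))) ^+ 2 +
    (a * (b%:R * sin (shft l))) ^+ 2) = `|a| * b%:R.
  by rewrite !mulrA sqrt_scale cos2Dsin2 sqrtr1 mulr1 normrM (ger0_norm (ler0n _ _)).
rewrite -[X in _ + Num.sqrt (_ + X ^+ 2)]mulNr -[X in _ + Num.sqrt (_ + X)]sqrrN.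
by rewrite mulNr opprK !E !ger0_norm// invr_ge0.
Qed.

(** wsumle k F c: the norm of F with weight |m|^-k in the Wiener algebra is at
    most c. *)
Definition wsumle (k : nat) F (c : R) : Prop := forall r : seq freq, uniq r ->
  \sum_(m <- r) hweight R k m * nfour F m <= c.

Lemma hweightN k m : hweight R k (- m) = hweight R k m.
Proof. by rewrite /hweight oppr_eq0 fnormN. Qed.

Lemma wsumle_ev k f : wsumle k (distribution_of (ev f)) (wnorm (hweight R k) f).
Proof.
move=> r ur.
pose G l m := `|amp l| * (2^-1 * ((m == - mfreq l)%:R * hweight R k m) +
  2^-1 * ((m == mfreq l)%:R * hweight R k m)).
apply: (@le_trans _ _ (\sum_(m <- r) \sum_(l <- f) G l m)).
  apply: ler_sum => m _; apply: le_trans (ler_wpM2l _ (nfour_ev f m)) _.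
    exact: hweight_ge0.
  rewrite mulr_sumr; apply: ler_sum => l _; rewrite /G le_eqVlt; apply/orP; left.
  by apply/eqP; ring.
rewrite exchange_big /=; apply: ler_sum => l _.
rewrite -mulr_sumr mulrC ler_wpM2r// big_split /= -!mulr_sumr.
have S m1 : hweight R k m1 = hweight R k (mfreq l) ->
    \sum_(m <- r) (m == m1)%:R * hweight R k m <= hweight R k (mfreq l).
  move=> E; case: (boolP (m1 \in r)) => m1r.
    rewrite (bigD1_seq m1)//= eqxx mul1r big1 ?addr0 ?E// => m /negbTE ->.
    by rewrite mul0r.
  rewrite big1_seq ?hweight_ge0// => m /andP[_ mr]; case: eqVneq => [e|_].
    by rewrite -e mr in m1r.
  by rewrite mul0r.
have S1 := S _ (hweightN k (mfreq l)); have S2 := S _ erefl.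
by lra.
Qed.

Lemma wsumleD k F G H (c c' : R) :
  (forall m, F (cosm m) = G (cosm m) + H (cosm m)) ->
  (forall m, F (sinm m) = G (sinm m) + H (sinm m)) ->
  wsumle k G c -> wsumle k H c' -> wsumle k F (c + c').
Proof.
move=> h1 h2 hG hH r ur; apply: le_trans (lerD (hG _ ur) (hH _ ur)).
rewrite -big_split /=; apply: ler_sum => m _; rewrite -mulrDr.
by rewrite ler_wpM2l ?hweight_ge0// nfourD.
Qed.

Lemma wsumleW k F (c c' : R) : c <= c' -> wsumle k F c -> wsumle k F c'.
Proof. by move=> cc H r ur; exact: le_trans (H r ur) cc. Qed.

Lemma wsumle_lim k F (Fn : nat -> functional R d) (c : R) :
  (forall m, (fun n => Fn n (cosm m)) @ \oo --> F (cosm m)) ->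
  (forall m, (fun n => Fn n (sinm m)) @ \oo --> F (sinm m)) ->
  (\forall n \near \oo, wsumle k (Fn n) c) -> wsumle k F c.
Proof.
move=> h1 h2 H r ur.
have cv m : (fun n => hweight R k m * nfour (Fn n) m) @ \oo --> hweight R k m * nfour F m.
  apply: cvgM; first exact: cvg_cst.
  apply: continuous_cvg; first exact: sqrt_continuous.
  by rewrite !expr2; apply: cvgD; apply: cvgM.
have : (fun n => \sum_(m <- r) hweight R k m * nfour (Fn n) m) @ \oo -->
    \sum_(m <- r) hweight R k m * nfour F m.
  elim: r {ur} => [|m r IH].
    by under eq_fun do rewrite big_nil; rewrite big_nil; exact: cvg_cst.
  by under eq_fun do rewrite big_cons; rewrite big_cons; exact: cvgD.
move=> cvs; rewrite -(cvg_lim _ cvs)//; apply: limr_le.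
  by apply/cvg_ex; eexists; exact: cvs.
by apply: filterS H => n Hn; exact: Hn.
Qed.

Lemma wsumle_Hdot k (A : mfunctional R d) (c : R) : 0 <= c ->
  (forall i j, wsumle k (A i j) c) ->
  (Hdot_norm (- k%:R) A <= (d%:R * c)%:E)%E.
Proof.
move=> c0 H.
have dc0 : 0 <= d%:R * c by rewrite mulr_ge0.
have -> : (d%:R * c)%:E = sqrte ((d%:R * c) ^+ 2)%:E.
  by rewrite /= sqrtr_sqr ger0_norm.
rewrite /Hdot_norm lee_sqrt ?lee_fin ?sqr_ge0//; apply: ub_ereal_sup => _ [X [fX sX] <-].
rewrite fsbig_finite// sumEFin lee_fin.
pose r : seq freq := finmap.enum_fset (fset_set X).
have E m : m \in r -> freq_norm R m `^ (2 * - k%:R) = hweight R k m ^+ 2.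
  rewrite /r in_fset_set// inE => /sX /= m0; rewrite /hweight (negbTE m0).
  rewrite mulrN powRN -natrM powR_mulrn ?fnorm_ge0// mulnC exprM exprVn.
  by rewrite -/(fnorm R m).
apply: (@le_trans _ _ (\sum_(m <- r) \sum_i \sum_j
    (hweight R k m * nfour (A i j) m) ^+ 2)).
  rewrite !big_seq; apply: ler_sum => m mr; rewrite E// mulr_sumr.
  apply: ler_sum => i _; rewrite mulr_sumr; apply: ler_sum => j _.
  by rewrite normc_fourier exprMn.
rewrite exchange_big /=.
have -> : (d%:R * c) ^+ 2 = \sum_(i < d) \sum_(j < d) c ^+ 2.
  by rewrite !sumr_const !card_ord -[RHS]mulr_natr -(mulr_natr (c ^+ 2)); ring.
apply: ler_sum => i _; rewrite exchange_big /=; apply: ler_sum => j _.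
have := H i j r (finmap.fset_uniq _).
set S := \sum_(_ <- _) _ => SC.
have S0 : 0 <= S.
  by apply: sumr_ge0 => m _; rewrite mulr_ge0 ?hweight_ge0 ?nfour_ge0.
apply: (@le_trans _ _ (S ^+ 2)); last by rewrite lerXn2r ?nnegrE.
rewrite /S; elim: (r) => [|m s IH].
  by rewrite !big_nil expr0n.
rewrite !big_cons sqrrD; apply: le_trans (lerD (lexx _) IH) _.
rewrite lerD2r lerDl mulrn_wge0// mulr_ge0//.
  by rewrite mulr_ge0 ?hweight_ge0 ?nfour_ge0.
by apply: sumr_ge0 => m' _; rewrite mulr_ge0 ?hweight_ge0 ?nfour_ge0.
Qed.

Lemma hweight_fnorm m j : m != 0 ->
  (forall i, `|m 0 i| <= `|m 0 j|) -> (0 < d)%N ->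
  fnorm R m <= d%:R * `|(m 0 j)%:~R|.
Proof.
move=> m0 H d0; apply: (le_trans (fnorm_le_sum R m)).
apply: (@le_trans _ _ (\sum_(i < d) `|(m 0 j)%:~R : R|)).
  by apply: ler_sum => i _; rewrite -!intr_norm ler_int.
by rewrite sumr_const card_ord mulr_natl.
Qed.

(** Integrating by parts k times along the largest coordinate of a frequency m
    gains |m|^-k up to the factor d^k. *)
Lemma dist_ev_le k f (phi : 'rV[R]_d -> R) (C : R) : test_fun phi ->
  spec (fun m => m != 0) f ->
  (forall s x, (size s <= k)%N -> `|partials s phi x| <= C) ->
  `|distribution_of (ev f) phi| <= wnorm (hweight R k) f * (d%:R ^+ k * C).
Proof.
move=> tf sf HC; rewrite dist_ev//.
apply: (le_trans (ler_norm_sum _ _ _)); rewrite /wnorm mulr_suml.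
rewrite !big_seq; apply: ler_sum => l lf; rewrite normrM.
rewrite -mulrA mulrCA ler_wpM2l// /hweight (negbTE (sf _ lf)).
have m0 := sf _ lf; set m := mfreq l in m0 *.
have [j0 mj0] := neq0_coord m0.
have d0 : (0 < d)%N by case: d j0 {tf sf HC lf mj0 m m0 l} => [[]|].
pose j := [arg max_(i > j0) `|m 0%R i|%N].
have Hj i : `|m 0 i| <= `|m 0 j|.
  rewrite /j; case: arg_maxnP => // i' _ /(_ i isT).
  by rewrite -!abszE lez_nat.
have := hweight_fnorm m0 Hj d0 => Hm.
have := Iw_decay j m (shft l) tf HC => D.
rewrite ler_pdivlMl ?exprn_gt0 ?fnorm_gt0//.
apply: (@le_trans _ _ ((d%:R * `|(m 0 j)%:~R|) ^+ k * `|Iw phi m (shft l)|)).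
  by rewrite ler_wpM2r// lerXn2r ?nnegrE ?fnorm_ge0// mulr_ge0.
by rewrite exprMn -mulrA ler_wpM2l// exprn_ge0.
Qed.

End fourier_series.

(** * The fractional Laplacian of a test function *)

Section dominated.
Context {disp : measure_display} {T : measurableType disp} {R : realType}.
Variable P : probability T R.

Lemma dominated_Rint (fn : nat -> T -> R) (f h : T -> R) :
  (forall n, measurable_fun setT (fn n)) -> measurable_fun setT f ->
  P.-integrable setT (EFin \o h) ->
  (forall n t, `|fn n t| <= h t) ->
  {ae P, forall t, (fn n t) @[n --> \oo] --> f t} ->
  P.-integrable setT (EFin \o f) /\
  \int[P]_t fn n t @[n --> \oo] --> \int[P]_t f t.
Proof.
move=> mfn mf ih dom cv.
have [i1 _ i3] := @dominated_convergence _ _ _ P setT measurableT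
  (fun n => EFin \o fn n) (EFin \o f) (EFin \o h)
  (fun n => proj2 (measurable_EFinP _ _) (mfn n))
  (proj2 (measurable_EFinP _ _) mf)
  ltac:(by apply: filterS cv => t Ht _; apply/cvg_EFin; [exact: nearW|exact: Ht])
  ih ltac:(by apply: nearW => t n _; rewrite /= lee_fin; exact: dom).
split=> //; apply: fine_cvg; rewrite fineK; first exact: i3.
exact: integrable_fin_num.
Qed.

Lemma bounded_Rint (fn : nat -> T -> R) (f : T -> R) (B : R) :
  (forall n, measurable_fun setT (fn n)) -> (forall n t, `|fn n t| <= B) ->
  (forall t, (fn n t) @[n --> \oo] --> f t) ->
  bdm f /\ \int[P]_t fn n t @[n --> \oo] --> \int[P]_t f t.
Proof.
move=> mfn dom cv.
have mf : measurable_fun setT f.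
  by apply: (measurable_fun_cvg mfn) => t _; exact: cv.
split.
  split=> //; exists B => t.
  have cvn : `|fn n t| @[n --> \oo] --> `|f t| by apply: cvg_norm; exact: cv.
  rewrite -(cvg_lim _ cvn)//; apply: limr_le.
    by apply/cvg_ex; eexists; exact: cvn.
  by apply: nearW => n; exact: dom.
have [] := @dominated_Rint fn f (fun=> B) mfn mf _ dom _ => //.
  exact/bdm_integrable/bdm_cst.
by apply: nearW.
Qed.

End dominated.

Section fractional_laplacian.
Variables (R : realType) (d : nat).
Local Notation M := (measurableTypeR R).
Local Notation mu := (torus_measure R d).
Local Notation freq := 'rV[int]_d.
Implicit Types (f g : seq (mode R d)) (m : freq) (x : 'rV[R]_d) (t : d.-tuple M).
Local Notation row_of := (@row_of R d).

Lemma partials_bounded (phi : 'rV[R]_d -> R) k : test_fun phi ->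
  exists2 C, 0 <= C & forall s x, (size s <= k)%N -> `|partials s phi x| <= C.
Proof.
elim: k phi => [|k IH] phi tf.
  have [C HC] := periodic_bounded (test_continuous tf) tf.2.
  exists C; first exact: le_trans (normr_ge0 _) (HC 0).
  by move=> s x; rewrite leqn0 => /nilP ->; exact: HC.
have [C0 C00 HC0] := IH _ tf.
have /choice[C HC] : forall i : 'I_d, exists C, 0 <= C /\
    forall s x, (size s <= k)%N -> `|partials s (partial i phi) x| <= C.
  by move=> i; have [C c0 HC] := IH _ (test_partial i tf); exists C.
have S0 : 0 <= \sum_i C i by apply: sumr_ge0 => i _; case: (HC i).
exists (C0 + \sum_i C i); first exact: addr_ge0.
move=> s x; case/lastP: s => [|s i] ss; first by rewrite ler_wpDr ?HC0.
rewrite /partials foldr_rcons -/(partials _ _) ler_wpDl//.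
have [_ Hi] := HC i; rewrite size_rcons ltnS in ss.
apply: (le_trans (Hi s x ss)); rewrite (bigD1 i)//= lerDl.
by apply: sumr_ge0 => j _; case: (HC j).
Qed.

Definition decay1 (j : int) : R := (1 + j%:~R ^+ 2)^-1.

Lemma decay1_gt0 j : 0 < decay1 j.
Proof. by rewrite invr_gt0 ltr_pwDl// sqr_ge0. Qed.

Lemma decay1N j : decay1 (- j) = decay1 j.
Proof. by rewrite /decay1 intrN sqrrN. Qed.

Lemma sum_decay1 (K : nat) :
  \sum_(p < K.*2.+1) decay1 ((p : nat)%:Z - K%:Z) <= 5.
Proof.
suff : \sum_(p < K.*2.+1) decay1 ((p : nat)%:Z - K%:Z) <= 5 - 4 * K.+1%:R^-1.
  by move/le_trans; apply; rewrite lerBlDr lerDl mulr_ge0.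
elim: K => [|K IH].
  by rewrite big_ord_recl big_ord0 /decay1 subrr expr0n /= !addr0 invr1; lra.
rewrite doubleS big_ord_recl big_ord_recr /=.
rewrite (eq_bigr (fun p : 'I__ => decay1 ((p : nat)%:Z - K%:Z))); last first.
  by move=> p _; congr decay1; rewrite /bump /= add1n; lia.
have -> : decay1 (0 - K.+1%:Z) = decay1 K.+1 by rewrite sub0r decay1N.
have -> : decay1 ((bump 0 K.*2.+1)%:Z - K.+1%:Z) = decay1 K.+1.
  by congr decay1; rewrite /bump /= add1n; lia.
have q : decay1 K.+1 <= 2 * (K.+1%:R^-1 - K.+2%:R^-1).
  have k0 : (0 : R) <= K%:R by [].
  rewrite /decay1 -[K.+1%:Z%:~R]/(K.+1%:R : R) -(natr1 K) -(natr1 K.+1) -(natr1 K).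
  rewrite -subr_ge0.
  have -> : 2 * ((K%:R + 1)^-1 - (K%:R + 1 + 1)^-1) - (1 + (K%:R + 1) ^+ 2)^-1 =
     (K%:R ^+ 2 + K%:R + 2) / ((K%:R + 1) * (K%:R + 1 + 1) * (1 + (K%:R + 1) ^+ 2)) :> R.
    by field; apply/and3P; split; apply: lt0r_neq0; nra.
  by apply: divr_ge0; nra.
move: IH q; set S := \sum_(_ < _) _; set D := decay1 _.
by set u := K.+1%:R^-1; set v := K.+2%:R^-1 => IH q; lra.
Qed.

Lemma sum_cube_decay K : \sum_(m <- cube d K) \prod_i decay1 (m 0 i) <= 5 ^+ d.
Proof.
rewrite /cube big_map big_enum /=.
rewrite (eq_bigr (fun p : {ffun 'I_d -> 'I_(K.*2.+1)} =>
    \prod_i decay1 ((p i : nat)%:Z - K%:Z))); last first.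
  by move=> p _; apply: eq_bigr => i _; rewrite mxE.
rewrite -(bigA_distr_bigA (fun (i : 'I_d) (j : 'I_(K.*2.+1)) =>
   decay1 ((j : nat)%:Z - K%:Z))) /= prodr_const card_ord.
rewrite lerXn2r ?nnegrE//; last exact: sum_decay1.
by apply: sumr_ge0 => p _; exact/ltW/decay1_gt0.
Qed.

Variable alpha : R.
Hypothesis alpha_gt0 : 0 < alpha.

Definition lapsym m : R := (2 * pi * fnorm R m) `^ (2 * alpha).

Lemma lapsym_ge0 m : 0 <= lapsym m. Proof. exact: powR_ge0. Qed.

Lemma lapsymN m : lapsym (- m) = lapsym m.
Proof. by rewrite /lapsym fnormN. Qed.

Lemma lapsym0 : lapsym 0 = 0.
Proof. by rewrite /lapsym fnorm0 mulr0 powR0// mulf_neq0// gt_eqF. Qed.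

Lemma twopi_ge1 : 1 <= 2 * pi :> R.
Proof. by have := pi_ge1 R; lra. Qed.

Lemma twopi_gt0 : 0 < 2 * pi :> R.
Proof. exact: lt_le_trans ltr01 twopi_ge1. Qed.

Lemma lapsym_le n m : m != 0 -> 2 * alpha <= n%:R ->
  lapsym m <= (2 * pi) ^+ n * fnorm R m ^+ n.
Proof.
move=> m0 an; rewrite -exprMn -powR_mulrn; last first.
  by rewrite mulr_ge0 ?fnorm_ge0// ltW ?twopi_gt0.
by apply: ler_powR => //; rewrite mulr_ege1 ?twopi_ge1 ?fnorm_ge1.
Qed.

Definition lapcoef (phi : 'rV[R]_d -> R) m : R :=
  lapsym m * (`|Iw phi m 0| + `|Iw phi m (- (pi / 2))|).

Lemma lapcoef_ge0 phi m : 0 <= lapcoef phi m.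
Proof. by rewrite mulr_ge0 ?lapsym_ge0 ?addr_ge0. Qed.

Lemma lapcoef_decay phi : test_fun phi ->
  exists2 C, 0 <= C & forall m, lapcoef phi m <= C * \prod_i decay1 (m 0 i).
Proof.
move=> tf; have [n an] : exists n : nat, 2 * alpha <= n%:R.
  by exists (Num.bound (2 * alpha)); rewrite ltW// archi_boundP// mulr_ge0// ltW.
have [C C0 HC] := partials_bounded (n + d.*2) tf.
pose A := (2 * pi) ^+ n * d%:R ^+ n * 2 ^+ d * (C + C) : R.
have A0 : 0 <= A.
  rewrite !mulr_ge0 ?exprn_ge0 ?addr_ge0//; exact/ltW/twopi_gt0.
exists A => // m.
have [->|m0] := eqVneq m 0.
  rewrite /lapcoef lapsym0 mul0r mulr_ge0// prodr_ge0// => i _.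
  exact/ltW/decay1_gt0.
have [j0 _] := neq0_coord m0.
have d0 : (0 < d)%N by case: (d) j0 => [[]|].
pose j := [arg max_(i > j0) `|m 0%R i|%N].
have Hj i : `|m 0 i| <= `|m 0 j|.
  rewrite /j; case: arg_maxnP => // i' _ /(_ i isT).
  by rewrite -!abszE lez_nat.
set z : R := `|(m 0 j)%:~R|.
have z1 : 1 <= z.
  have [i mi] := neq0_coord m0.
  rewrite /z -intr_norm (ler_int _ 1) -gtz0_ge1; apply: lt_le_trans (Hj i).
  by rewrite normr_gt0.
have z0 : 0 <= z by exact: le_trans ler01 z1.
have fz : fnorm R m <= d%:R * z by exact: hweight_fnorm.
have Pz : (\prod_i decay1 (m 0 i))^-1 <= 2 ^+ d * z ^+ d.*2.
  rewrite -prodfV -mul2n exprM -exprMn.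
  rewrite -[X in _ <= _ ^+ X]card_ord -prodr_const; apply: ler_prod => i _.
  rewrite invr_ge0 (ltW (decay1_gt0 _)) /= /decay1 invrK mulr_natl mulr2n lerD//.
    by rewrite exprn_ege1.
  have zi : `|(m 0 i)%:~R| <= z by rewrite /z -!intr_norm ler_int.
  by rewrite -(real_normK (num_real _)) lerXn2r ?nnegrE// (le_trans ler01).
have P0 : 0 < \prod_i decay1 (m 0 i) by apply: prodr_gt0 => i _; exact: decay1_gt0.
rewrite -ler_pdivrMr//.
have L : lapsym m <= (2 * pi) ^+ n * (d%:R ^+ n * z ^+ n).
  apply: (le_trans (lapsym_le m0 an)); rewrite ler_wpM2l ?exprn_ge0//.
    exact/ltW/twopi_gt0.
  by rewrite -exprMn lerXn2r ?nnegrE ?fnorm_ge0// mulr_ge0.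
have D b : z ^+ (n + d.*2) * `|Iw phi m b| <= C by exact: Iw_decay.
apply: (@le_trans _ _ ((2 * pi) ^+ n * (d%:R ^+ n * z ^+ n) *
    (`|Iw phi m 0| + `|Iw phi m (- (pi / 2))|) * (2 ^+ d * z ^+ d.*2))).
  apply: ler_pM => //; first exact: lapcoef_ge0.
    by rewrite invr_ge0 ltW.
  by rewrite /lapcoef ler_wpM2r// addr_ge0.
have -> : (2 * pi) ^+ n * (d%:R ^+ n * z ^+ n) *
    (`|Iw phi m 0| + `|Iw phi m (- (pi / 2))|) * (2 ^+ d * z ^+ d.*2) =
  (2 * pi) ^+ n * d%:R ^+ n * 2 ^+ d *
   (z ^+ (n + d.*2) * `|Iw phi m 0| + z ^+ (n + d.*2) * `|Iw phi m (- (pi / 2))|).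
  by rewrite exprD; ring.
rewrite /A ler_wpM2l ?lerD//.
by rewrite !mulr_ge0 ?exprn_ge0//; exact/ltW/twopi_gt0.
Qed.

Definition lap_partial (phi : 'rV[R]_d -> R) K x : R :=
  \sum_(m <- cube d K) lapsym m *
    (Iw phi m 0 * cosm m x + Iw phi m (- (pi / 2)) * sinm m x).

Lemma dist_cosm (phi : 'rV[R]_d -> R) m : distribution_of phi (cosm m) = Iw phi m 0.
Proof. by rewrite cosmE. Qed.

Lemma dist_sinm (phi : 'rV[R]_d -> R) m :
  distribution_of phi (sinm m) = Iw phi m (- (pi / 2)).
Proof. by rewrite sinmE. Qed.

Lemma frac_laplacianE phi x :
  frac_laplacian alpha phi x = limn (fun K => lap_partial phi K x).
Proof.
rewrite /frac_laplacian; apply: (f_equal (fun u : nat -> R => limn u)).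
apply/funext => K.
rewrite fsum_cube_in; apply: eq_bigr => m _.
by rewrite fourier_termE dist_cosm dist_sinm.
Qed.

Lemma cube_mono K L (G : freq -> R) : (K <= L)%N -> (forall m, 0 <= G m) ->
  \sum_(m <- cube d K) G m <= \sum_(m <- cube d L) G m.
Proof.
move=> KL G0.
rewrite [leRHS](bigID (fun m => m \in cube d K)) /=.
rewrite [X in _ <= X + _](_ : _ = \sum_(m <- cube d K) G m).
  by rewrite lerDl sumr_ge0.
rewrite -big_filter; apply: perm_big; apply: uniq_perm; rewrite ?cube_uniq//.
  by rewrite filter_uniq// cube_uniq.
move=> m; rewrite mem_filter !mem_cube andb_idr// => /forallP H.
by apply/forallP => i; apply: le_trans (H i) _; rewrite lez_nat.
Qed.

Lemma lap_partial_cvg phi : test_fun phi -> exists B, forall x,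
  (forall K, `|lap_partial phi K x| <= B) /\
  cvgn (fun K => lap_partial phi K x).
Proof.
move=> tf; have [C C0 HC] := lapcoef_decay tf.
have TB K : \sum_(m <- cube d K) lapcoef phi m <= C * 5 ^+ d.
  apply: le_trans (ler_wpM2l C0 (sum_cube_decay K)); rewrite mulr_sumr.
  by apply: ler_sum => m _; exact: HC.
exists (C * 5 ^+ d) => x.
pose tm m := lapsym m * (Iw phi m 0 * cosm m x + Iw phi m (- (pi / 2)) * sinm m x).
have tB m : `|tm m| <= lapcoef phi m.
  rewrite /tm /lapcoef normrM (ger0_norm (lapsym_ge0 _)) ler_wpM2l ?lapsym_ge0//.
  apply: (le_trans (ler_normD _ _)); rewrite !normrM.
  by rewrite lerD// -[leRHS]mulr1 ler_wpM2l// ?cos_max ?sin_max.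
have SB K : `|lap_partial phi K x| <= C * 5 ^+ d.
  apply: le_trans (TB K); apply: (le_trans (ler_norm_sum _ _ _)).
  by apply: ler_sum => m _; exact: tB.
split=> //.
have c1 : cvgn (fun K => \sum_(m <- cube d K) lapcoef phi m).
  apply: nondecreasing_is_cvgn.
    by move=> K L KL; apply: cube_mono => // m; exact: lapcoef_ge0.
  by exists (C * 5 ^+ d) => _ [K _ <-]; exact: TB.
have c2 : cvgn (fun K => \sum_(m <- cube d K) (lapcoef phi m + tm m)).
  apply: nondecreasing_is_cvgn.
    move=> K L KL; apply: cube_mono => // m; rewrite -lerBlDl sub0r.
    by have := tB m; rewrite ler_norml => /andP[].
  exists (C * 5 ^+ d + C * 5 ^+ d) => _ [K _ <-].
  rewrite big_split /= lerD//; exact: le_trans (ler_norm _) (SB K).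
rewrite (_ : (fun K => lap_partial phi K x) =
    (fun K => \sum_(m <- cube d K) (lapcoef phi m + tm m)) -
    (fun K => \sum_(m <- cube d K) lapcoef phi m)); first exact: is_cvgB.
apply/funext => K; rewrite !fctE -sumrB; apply: eq_bigr => m _.
by rewrite -/(tm m) addrAC subrr add0r.
Qed.

Lemma bdm_lap_partial phi K : bdm (fun t => lap_partial phi K (row_of t)).
Proof.
apply: bdm_sum => m; apply: bdmZ; apply: bdmD; apply: bdmZ.
  by rewrite cosmE; exact: bdm_wave.
by rewrite sinmE; exact: bdm_wave.
Qed.

Lemma Iw_lap_partial phi K m b : test_fun phi -> m \in cube d K ->
  Iw (lap_partial phi K) m b = lapsym m * Iw phi m b.
Proof.
move=> tf mK.
pose c k := if k \in cube d K then lapsym k else 0.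
have ce k : c (- k) = c k.
  rewrite /c lapsymN; congr (if _ then _ else _); rewrite !mem_cube.
  by apply: eq_forallb => i; rewrite mxE normrN.
have c0 k : k \notin cube d K -> c k = 0 by rewrite /c => /negbTE ->.
have intw (f : 'rV[R]_d -> R) k e : bdm (fun t => f (row_of t)) ->
    mu.-integrable setT (EFin \o (fun t => f (row_of t) * wave k e (row_of t))).
  by move=> bf; apply/bdm_integrable/bdmM => //; exact: bdm_wave.
transitivity (\sum_(k <- cube d K) c k *
    (Iw (cosm k) m b * Iw phi k 0 + Iw (sinm k) m b * Iw phi k (- (pi / 2)))).
  rewrite /Iw /lap_partial; under eq_Rintegral do rewrite mulr_suml.
  rewrite Rint_sum; last first.
    move=> k; apply/bdm_integrable/bdmM; last exact: bdm_wave.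
    apply: bdmZ; apply: bdmD; apply: bdmZ.
      by rewrite cosmE; exact: bdm_wave.
    by rewrite sinmE; exact: bdm_wave.
  rewrite !big_seq; apply: eq_bigr => k kK; rewrite /c kK.
  rewrite -/(Iw phi k 0) -/(Iw phi k _) -/(Iw (cosm k) m b) -/(Iw (sinm k) m b).
  have bc : bdm (fun t => cosm k (row_of t)) by rewrite cosmE; exact: bdm_wave.
  have bs : bdm (fun t => sinm k (row_of t)) by rewrite sinmE; exact: bdm_wave.
  transitivity (\int[mu]_t (lapsym k * Iw phi k 0 * (cosm k (row_of t) * wave m b (row_of t))
     + lapsym k * Iw phi k (- (pi / 2)) * (sinm k (row_of t) * wave m b (row_of t)))).
    by apply: eq_Rintegral => t _; ring.
  rewrite RintegralD//; try by apply/bdm_integrable/bdmZ/bdmM => //; exact: bdm_wave.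
  rewrite !RintegralZl//; try exact: intw.
  by rewrite -/(Iw (cosm k) m b) -/(Iw (sinm k) m b); ring.
have E x := mult_series [:: (1, m, b)] x ce c0.
have F (k : freq) : distribution_of (ev [:: (1, m, b)]) (cosm k) = Iw (cosm k) m b.
  rewrite dist_ev ?big_seq1 ?mul1r//; exact: cosm_test.
have G (k : freq) : distribution_of (ev [:: (1, m, b)]) (sinm k) = Iw (sinm k) m b.
  rewrite dist_ev ?big_seq1 ?mul1r//; exact: sinm_test.
have : \int[mu]_t (\sum_(k <- cube d K) c k * (Iw (cosm k) m b * cosm k (row_of t) +
     Iw (sinm k) m b * sinm k (row_of t)) * phi (row_of t)) = lapsym m * Iw phi m b.
  transitivity (\int[mu]_t (lapsym m * (phi (row_of t) * wave m b (row_of t)))).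
    apply: eq_Rintegral => t _; rewrite -mulr_suml.
    have := E (row_of t); under eq_bigr do rewrite F G; move=> ->.
    by rewrite /mult /= ev_cons ev_nil /amp /mfreq /shft /= /c mK; ring.
  rewrite RintegralZl//; exact/intw/bdm_test.
move=> <-; rewrite Rint_sum.
  apply: eq_bigr => k _.
  transitivity (\int[mu]_t (c k * Iw (cosm k) m b * (phi (row_of t) * wave k 0 (row_of t))
     + c k * Iw (sinm k) m b * (phi (row_of t) * wave k (- (pi / 2)) (row_of t)))).
    rewrite RintegralD//; try by apply/bdm_integrable/bdmZ/bdmM; [exact: bdm_test|exact: bdm_wave].
    rewrite !RintegralZl//; try by apply/intw/bdm_test.
    by rewrite -/(Iw phi k 0) -/(Iw phi k _); ring.
  by apply: eq_Rintegral => t _; rewrite -cosmE -sinmE; ring.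
move=> k; apply/bdm_integrable/bdmM; last exact: bdm_test.
apply: bdmZ; apply: bdmD; apply: bdmZ.
  by rewrite cosmE; exact: bdm_wave.
by rewrite sinmE; exact: bdm_wave.
Qed.

(** The coefficients of a test function decay rapidly, so that the defining series
    converges boundedly and can be integrated term by term. *)
Lemma frac_laplacian_spec phi : test_fun phi ->
  bdm (fun t => frac_laplacian alpha phi (row_of t)) /\
  forall m b, Iw (frac_laplacian alpha phi) m b = lapsym m * Iw phi m b.
Proof.
move=> tf; have [B HB] := lap_partial_cvg tf.
have cv x : lap_partial phi n x @[n --> \oo] --> frac_laplacian alpha phi x.
  by rewrite frac_laplacianE; have [_] := HB x.
split.
  have [] := @bounded_Rint _ _ _ mu (fun n t => lap_partial phi n (row_of t))
     (fun t => frac_laplacian alpha phi (row_of t)) B => //.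
  - by move=> n; have [] := bdm_lap_partial phi n.
  - by move=> n t; have [] := HB (row_of t).
move=> m b.
have [_ cvI] := @bounded_Rint _ _ _ mu
   (fun n t => lap_partial phi n (row_of t) * wave m b (row_of t))
   (fun t => frac_laplacian alpha phi (row_of t) * wave m b (row_of t)) B
   ltac:(by move=> n; have [] := bdmM (bdm_lap_partial phi n) (bdm_wave m b))
   ltac:(by move=> n t; rewrite normrM -[leRHS]mulr1 ler_pM ?wave_norm//; have [] := HB (row_of t))
   ltac:(by move=> t; apply: cvgMl; exact: cv).
have : Iw (lap_partial phi n) m b @[n --> \oo] --> lapsym m * Iw phi m b.
  apply: cvg_near_cst; near=> n; apply: Iw_lap_partial => //.
  apply: (@cube_fnorm R); near: n; exact: nbhs_infty_ger.
by move=> cv2; exact: (cvg_unique _ cvI cv2).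
Unshelve. all: by end_near. Qed.

End fractional_laplacian.

(** * Littlewood-Paley blocks *)

Section littlewood_paley_blocks.
Variables (R : realType) (d : nat) (chi : 'rV[R]_d -> R).
Hypothesis hchi : bump_function chi.
Local Notation M := (measurableTypeR R).
Local Notation freq := 'rV[int]_d.
Implicit Types (f g : seq (mode R d)) (m : freq) (x : 'rV[R]_d)
  (F : functional R d).
Local Notation fnorm := (fnorm R).

Lemma chi_out x : 1 <= enorm (x 0) -> chi x = 0.
Proof.
have [_ _ H _] := hchi; move=> x1; apply/eqP; apply: contraT => cx.
have : enorm (x 0) < 1 by apply: H; exact: subset_closure.
by rewrite ltNge x1.
Qed.

Lemma chi_in x : enorm (x 0) < 9 / 10 -> chi x = 1.
Proof. by have [_ _ _ H] := hchi; exact: H. Qed.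

Definition sym n m : R := chi (\row_i ((m 0 i)%:~R / 2 ^+ n)).

Lemma enorm_dilate n m :
  enorm ((\row_i ((m 0 i)%:~R / 2 ^+ n) : 'rV[R]_d) 0) = fnorm m / 2 ^+ n.
Proof.
rewrite /fnorm /freq_norm /enorm.
under eq_bigr do rewrite mxE exprMn.
rewrite -mulr_suml sqrtrM; last by apply: sumr_ge0 => i _; exact: sqr_ge0.
by rewrite sqrtr_sqr ger0_norm// invr_ge0 exprn_ge0.
Qed.

Lemma pow2_gt0 n : (0 : R) < 2 ^+ n. Proof. by rewrite exprn_gt0. Qed.

Lemma sym_out n m : 2 ^+ n <= fnorm m -> sym n m = 0.
Proof.
move=> H; apply: chi_out; rewrite enorm_dilate ler_pdivlMr ?pow2_gt0//.
by rewrite mul1r.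
Qed.

Lemma sym_in n m : fnorm m < 9 / 10 * 2 ^+ n -> sym n m = 1.
Proof. by move=> H; apply: chi_in; rewrite enorm_dilate ltr_pdivrMr ?pow2_gt0. Qed.

Lemma symN n m : sym n (- m) = sym n m.
Proof.
have [_ H _ _] := hchi; apply: H; rewrite !enorm_dilate.
by rewrite fnormN.
Qed.

Definition dsym n m : R := if n is n'.+1 then sym n'.+1 m - sym n' m else sym 0 m.

Lemma dsymN n m : dsym n (- m) = dsym n m.
Proof. by case: n => [|n] /=; rewrite !symN. Qed.

Lemma dsym_out n m : 2 ^+ n <= fnorm m -> dsym n m = 0.
Proof.
case: n => [|n] H /=; first exact: sym_out.
rewrite !sym_out ?subrr//; apply: le_trans H.
by rewrite exprS ler_peMl ?ler1n// ltW ?pow2_gt0.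
Qed.

Lemma dsym_low n m : fnorm m < 9 / 10 * 2 ^+ n -> dsym n.+1 m = 0.
Proof.
move=> H; rewrite /= !sym_in ?subrr//; apply: lt_le_trans H _.
by rewrite ler_wpM2l// exprS ler_peMl ?ler1n// ltW ?pow2_gt0.
Qed.

Lemma dsym_block n m : 2 ^+ n <= fnorm m -> fnorm m < 9 / 10 * 2 ^+ n.+1 ->
  dsym n.+1 m = 1.
Proof. by move=> h1 h2; rewrite /= sym_in// sym_out// subr0. Qed.

Lemma sum_dsym n m : \sum_(k < n.+1) dsym k m = sym n m.
Proof.
elim: n => [|n IH]; first by rewrite big_ord_recl big_ord0 addr0.
by rewrite big_ord_recr IH /= addrC subrK.
Qed.

(** Blocks two or more indices apart do not meet: where the block n lives, it adds
    up to 1 with its two neighbours. *)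
Lemma dsym_adjacent n m : dsym n m != 0 ->
  sym n.+1 m - (if n is n'.+2 then sym n' m else 0) = 1.
Proof.
move=> H.
have h1 : fnorm m < 2 ^+ n.
  by rewrite ltNge; apply: contraNN H => H; rewrite dsym_out.
rewrite sym_in; last by apply: lt_le_trans h1 _; rewrite exprS; have := pow2_gt0 n; lra.
case: n H h1 => [|[|n]] H h1; rewrite ?subr0//.
rewrite sym_out ?subr0//; rewrite leNgt; apply: contraNN H => H.
rewrite dsym_low//; apply: lt_le_trans H _; rewrite exprS.
by have := pow2_gt0 n; lra.
Qed.

Lemma sym_cube n K m : 2 ^+ n <= K%:R :> R -> m \notin cube d K -> sym n m = 0.
Proof.
move=> nK mK; apply: sym_out; apply: le_trans nK _; rewrite leNgt.
by apply: contraNN mK => /ltW /cube_fnorm.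
Qed.

Lemma dsym_cube n K m : 2 ^+ n <= K%:R :> R -> m \notin cube d K -> dsym n m = 0.
Proof.
case: n => [|n] H mK /=; first exact: (sym_cube H).
rewrite (sym_cube H)// (@sym_cube n K)// ?subrr//; apply: le_trans H.
by rewrite exprS ler_peMl ?ler1n// ltW ?pow2_gt0.
Qed.

Lemma P_leE n K F x : 2 ^+ n <= K%:R :> R -> P_le chi n F x =
  \sum_(m <- cube d K) sym n m * (F (cosm m) * cosm m x + F (sinm m) * sinm m x).
Proof.
move=> nK; rewrite /P_le (@fsum_cube R d K); last first.
  by move=> m mK; rewrite fourier_termE -/(sym n m) (sym_cube nK)// mul0r.
by apply: eq_bigr => m _; rewrite fourier_termE.
Qed.

Lemma P_dyadicE n K F x : 2 ^+ n <= K%:R :> R -> P_dyadic chi n F x =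
  \sum_(m <- cube d K) dsym n m * (F (cosm m) * cosm m x + F (sinm m) * sinm m x).
Proof.
case: n => [|n] H; first by rewrite /= (P_leE _ _ H).
rewrite /= (P_leE _ _ H) (@P_leE n K); last first.
  by apply: le_trans H; rewrite exprS ler_peMl ?ler1n// ltW ?pow2_gt0.
by rewrite -sumrB; apply: eq_bigr => m _; rewrite mulrBl.
Qed.

Lemma pow2_nat n : (2 ^ n)%:R = 2 ^+ n :> R. Proof. exact: natrX. Qed.

Lemma P_dyadic_ev n f x :
  P_dyadic chi n (distribution_of (ev f)) x = ev (mult (dsym n) f) x.
Proof.
rewrite (@P_dyadicE n (2 ^ n)%N) ?pow2_nat// mult_series//; first exact: dsymN.
by move=> m; apply: dsym_cube; rewrite pow2_nat.
Qed.

(** For c supported in the cube this is the image of F under the multiplier c: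
    blocks and Fejer means of arbitrary functionals are trigonometric polynomials. *)
Definition trunc (c : freq -> R) F K : seq (mode R d) :=
  flatten [seq [:: (c m * F (cosm m), m, 0); (c m * F (sinm m), m, - (pi / 2))]
          | m <- cube d K].

Lemma ev_trunc c F K x : ev (trunc c F K) x =
  \sum_(m <- cube d K) c m * (F (cosm m) * cosm m x + F (sinm m) * sinm m x).
Proof.
rewrite /trunc ev_flatten big_map; apply: eq_bigr => m _.
rewrite !ev_cons ev_nil /amp /mfreq /shft /= wave_cos wave_sin /cosm /sinm.
by ring.
Qed.

Lemma P_dyadic_trunc n F x :
  P_dyadic chi n F x = ev (trunc (dsym n) F (2 ^ n)) x.
Proof. by rewrite (@P_dyadicE n (2 ^ n)%N) ?pow2_nat// ev_trunc. Qed.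

Lemma P_le_trunc n F x : P_le chi n F x = ev (trunc (sym n) F (2 ^ n)) x.
Proof. by rewrite (@P_leE n (2 ^ n)%N) ?pow2_nat// ev_trunc. Qed.

Lemma ev_trunc_lim c F (Fn : nat -> functional R d) K x :
  (forall m, (fun n => Fn n (cosm m)) @ \oo --> F (cosm m)) ->
  (forall m, (fun n => Fn n (sinm m)) @ \oo --> F (sinm m)) ->
  ev (trunc c (Fn n) K) x @[n --> \oo] --> ev (trunc c F K) x.
Proof.
move=> h1 h2; under eq_fun do rewrite ev_trunc; rewrite ev_trunc.
suff : (fun n => \sum_(m <- cube d K) c m * (Fn n (cosm m) * cosm m x +
      Fn n (sinm m) * sinm m x)) @ \oo -->
    \sum_(m <- cube d K) c m * (F (cosm m) * cosm m x + F (sinm m) * sinm m x) by [].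
elim: (cube d K) => [|m r IH].
  by under eq_fun do rewrite big_nil; rewrite big_nil; exact: cvg_cst.
under eq_fun do rewrite big_cons; rewrite big_cons; apply: cvgD => //.
by apply: cvgMr; apply: cvgD; apply: cvgMl.
Qed.

Lemma P_dyadic_lim n F (Fn : nat -> functional R d) x :
  (forall m, (fun n => Fn n (cosm m)) @ \oo --> F (cosm m)) ->
  (forall m, (fun n => Fn n (sinm m)) @ \oo --> F (sinm m)) ->
  P_dyadic chi n (Fn k) x @[k --> \oo] --> P_dyadic chi n F x.
Proof.
move=> h1 h2; under eq_fun do rewrite P_dyadic_trunc; rewrite P_dyadic_trunc.
exact: ev_trunc_lim.
Qed.

End littlewood_paley_blocks.

(** * Lebesgue norms *)

Lemma poweR_mono (R : realType) (r : R) (x y : \bar R) : 0 <= r -> (0 <= x)%E ->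
  (x <= y)%E -> (x `^ r <= y `^ r)%E.
Proof.
move=> r0 x0 xy; apply: gt0_ler_poweR => //; rewrite in_itv /= leey andbT//.
exact: le_trans xy.
Qed.

Section Lnorm_facts.
Context {disp : measure_display} {T : measurableType disp} {R : realType}.
Variable P : probability T R.
Implicit Types (f g : T -> R) (q : \bar R).

Local Notation N q f := (Lnorm P q (EFin \o f)).

Let P_gt0 : (0 < P [set: T])%E.
Proof. by rewrite [X in (_ < X)%E]probability_setT lte01. Qed.

Lemma measurable_norm_powR (f : T -> R) (p : R) : measurable_fun setT f ->
  measurable_fun setT (fun t => (`|f t| `^ p)%:E).
Proof.
move=> mf; apply/measurable_EFinP.
apply: (@measurableT_comp _ _ _ _ _ _ (@powR R ^~ p)) => //.
exact: measurableT_comp.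
Qed.

Lemma le_Lnorm q f g : (1 <= q)%E -> measurable_fun setT f ->
  measurable_fun setT g -> (forall t, `|f t| <= `|g t|) -> (N q f <= N q g)%E.
Proof.
move=> q1 mf mg fg; rewrite unlock; case: q q1 => [q||]// q1.
  rewrite lee_fin in q1; have q0 : 0 <= q by exact: le_trans ler01 q1.
  apply: poweR_mono; rewrite ?invr_ge0//.
    by apply: integral_ge0 => t _; exact: poweR_ge0.
  apply: ge0_le_integral => //.
  - by move=> t _; exact: poweR_ge0.
  - exact: measurable_norm_powR.
  - exact: measurable_norm_powR.
  - by move=> t _; rewrite lee_fin ge0_ler_powR ?nnegrE.
rewrite P_gt0; apply: le_ess_sup; apply: nearW => t /=.
by rewrite lee_fin.
Qed.

Lemma Lnorm_cst q (c : R) : (1 <= q)%E -> N q (fun=> c) = `|c|%:E.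
Proof.
move=> q1; rewrite unlock; case: q q1 => [q||]// q1.
  rewrite lee_fin in q1; have q0 : 0 < q by exact: lt_le_trans ltr01 q1.
  under eq_integral do rewrite /= .
  rewrite integral_cst// [X in (_ * X)%E]probability_setT mule1.
  by rewrite poweR_EFin -powRrM mulfV ?gt_eqF// powRr1.
by rewrite P_gt0; exact: ess_sup_cst.
Qed.

Lemma Lnorm_ub q f (C : R) : (1 <= q)%E -> measurable_fun setT f ->
  (forall t, `|f t| <= C) -> (N q f <= C%:E)%E.
Proof.
move=> q1 mf fC.
have [t0|T0] := pselect (exists t : T, True); last first.
  exfalso; have : P setT = 0%E.
    have -> : [set: T] = set0 by apply/seteqP; split => t // _; apply: T0; exists t.
    exact: measure0.
  by rewrite probability_setT => /eqP; rewrite onee_eq0.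
have C0 : 0 <= C by case: t0 => t _; exact: le_trans (normr_ge0 _) (fC t).
rewrite -[C]ger0_norm// -(Lnorm_cst C q1); apply: le_Lnorm => // t.
by rewrite (ger0_norm C0).
Qed.

Lemma LnormZ_eq q (c : R) f : (1 <= q)%E -> measurable_fun setT f ->
  N q (fun t => c * f t) = (`|c|%:E * N q f)%E.
Proof.
move=> q1 mf; rewrite unlock; case: q q1 => [q||]// q1.
  rewrite lee_fin in q1; have q0 : 0 < q by exact: lt_le_trans ltr01 q1.
  have mp := measurable_norm_powR q mf.
  rewrite (eq_integral (fun t => (`|c| `^ q)%:E * (`|f t| `^ q)%:E)%E); last first.
    by move=> t _; rewrite /= normrM powRM.
  rewrite ge0_integralZl//.
    rewrite poweRM.
    - by rewrite poweR_EFin -powRrM mulfV ?gt_eqF// powRr1.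
    - by rewrite lee_fin powR_ge0.
    - by apply: integral_ge0 => t _; rewrite lee_fin powR_ge0.
rewrite P_gt0 -ess_supZl//; congr ess_sup; apply/funext => t /=.
by rewrite normrM EFinM.
Qed.

Lemma LnormD q f g : (1 <= q)%E -> measurable_fun setT f ->
  measurable_fun setT g -> (N q (fun t => f t + g t)%R <= N q f + N q g)%E.
Proof. by move=> q1 mf mg; exact: eminkowski. Qed.

Lemma Lnorm_sum q (I : Type) (r : seq I) (F : I -> T -> R) : (1 <= q)%E ->
  (forall i, measurable_fun setT (F i)) ->
  (N q (fun t => \sum_(i <- r) F i t)%R <= \sum_(i <- r) N q (F i))%E.
Proof.
move=> q1 mF; elim: r => [|i r IH].
  rewrite big_nil (_ : (fun t => _) = (fun=> 0)).
    by rewrite Lnorm_cst// normr0.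
  by apply/funext => t; rewrite big_nil.
rewrite big_cons (_ : (fun t => _) = (fun t => F i t + \sum_(j <- r) F j t)).
  apply: le_trans (LnormD q1 (mF i) _) _; first exact: measurable_sum.
  by rewrite leeD2l.
by apply/funext => t; rewrite big_cons.
Qed.

Lemma LnormN_eq q f : N q (fun t => - f t) = N q f.
Proof.
rewrite -(oppe_Lnorm P (EFin \o f)).
by congr Lnorm; apply/funext => t /=; rewrite EFinN.
Qed.

Lemma Lnorm1_Rint f : bdm f -> N 1%E f = (\int[P]_t `|f t|)%:E.
Proof.
move=> bf; rewrite Lnorm1 /Rintegral fineK//.
by apply: integrable_fin_num => //; exact/bdm_integrable/bdm_norm.
Qed.

Lemma cvg_powR_seq (x : nat -> R) (l p : R) : 1 <= p -> (forall n, 0 <= x n) ->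
  x @ \oo --> l -> (fun n => x n `^ p) @ \oo --> l `^ p.
Proof.
move=> p1 x0 xl.
have p0 : 0 < p by exact: lt_le_trans ltr01 p1.
have l0 : 0 <= l.
  rewrite -(cvg_lim _ xl)//; apply: limr_ge; last exact: nearW.
  by apply/cvg_ex; exists l.
move: l0; rewrite le_eqVlt => /orP[/eqP l0|l0].
  rewrite -l0 powR0 ?gt_eqF//.
  apply: (@squeeze_cvgr _ _ _ _ (fun=> 0) x).
  - have xl1 : \forall n \near \oo, x n < 1.
      by apply: (cvgr_lt l xl); rewrite -l0 ltr01.
    apply: filterS xl1 => n xn1.
    rewrite powR_ge0 /=; have := x0 n; rewrite le_eqVlt => /orP[/eqP <-|xn0].
      by rewrite powR0 ?gt_eqF.
    by apply: ge1r_powR => //; rewrite xn0 ltW.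
  - exact: cvg_cst.
  - by rewrite l0.
suff cl : {for l, continuous (fun y => y `^ p)} by exact: (@cvg_comp _ _ _ x (fun y => y `^ p) \oo (nbhs l) (nbhs (l `^ p)) xl cl).
apply/differentiable_continuous/derivable1_diffP.
by apply: derivable_powR; rewrite in_itv /= l0.
Qed.

(** The sum of the |h n| is integrable, hence finite almost everywhere, and
    dominates the partial sums. *)
Lemma series_Lp (h : nat -> T -> R) (C : R) : (forall n, bdm (h n)) ->
  (forall N, \sum_(n < N) \int[P]_t `|h n t| <= C) ->
  exists g : T -> R, [/\ P.-integrable setT (EFin \o g),
    (forall phi, bdm phi ->
      \int[P]_t ((\sum_(n < k) h n t) * phi t) @[k --> \oo] -->
      \int[P]_t (g t * phi t)) &
    (forall p B, 1 <= p -> 0 <= B ->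
      (forall k, (N p%:E (fun t => \sum_(n < k) h n t)%R <= B%:E)%E) ->
      (N p%:E g <= B%:E)%E)].
Proof.
move=> bh HC.
pose H t := (\sum_(n <oo) `|h n t|%:E)%E.
have mh n : measurable_fun setT (h n) by case: (bh n).
have mH : measurable_fun setT H.
  apply: ge0_emeasurable_sum => // n _; apply/measurable_EFinP.
  exact: measurableT_comp.
have H0 t : (0 <= H t)%E by apply: nneseries_ge0.
have iH : (\int[P]_t H t <= C%:E)%E.
  rewrite integral_nneseries//; last first.
    by move=> n; apply/measurable_EFinP; exact: measurableT_comp.
  apply: lime_le.
    apply: is_cvg_nneseries => n _ _; exact: integral_ge0.
  apply: nearW => n.
  have E i : (\int[P]_t (`|h i t|)%:E)%E = (\int[P]_t `|h i t|)%:E.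
    rewrite /Rintegral fineK//; apply: integrable_fin_num => //.
    exact/bdm_integrable/bdm_norm.
  have := HC n; rewrite -lee_fin -sumEFin; apply: le_trans; rewrite big_mkord.
  by apply: lee_sum => i _; rewrite E.
have intH : P.-integrable setT H.
  apply/integrableP; split => //.
  under eq_integral do rewrite gee0_abs//.
  exact: le_lt_trans iH (ltry _).
pose G := [set t | H t \is a fin_num].
have mG : measurable G.
  by have := emeasurable_fin_num measurableT mH; rewrite setTI.
have aeG : {ae P, forall t, G t}.
  by apply: filterS (integrable_ae measurableT intH) => t; apply.
pose h' n t := h n t * \1_G t.
have bI : bdm (\1_G : T -> R).
  by split; [exact: measurable_indic|exists 1 => t; rewrite indicE; case: (_ \in _); rewrite ?normr1 ?normr0].
have bh' n : bdm (h' n) by exact: bdmM.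
pose fH t := fine (H t).
have mfH : measurable_fun setT fH by exact: measurableT_comp.
have partial_le t k : G t -> \sum_(n < k) `|h n t| <= fH t.
  move=> Gt; rewrite -lee_fin /fH fineK// -sumEFin.
  rewrite -(big_mkord xpredT (fun n => `|h n t|%:E)).
  by apply: nneseries_lim_ge.
have dom k t : `|\sum_(n < k) h' n t| <= fH t.
  rewrite /h' -mulr_suml normrM indicE; case: (boolP (t \in G)) => tG /=.
    rewrite normr1 mulr1; apply: le_trans (ler_norm_sum _ _ _) _.
    by apply: partial_le; rewrite inE in tG.
  by rewrite normr0 mulr0 fine_ge0.
have cv t : cvgn (fun k => \sum_(n < k) h' n t).
  have : cvgn (series (fun n => `|h' n t|)).
    apply: nondecreasing_is_cvgn.
      apply/nondecreasing_seqP => k.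
      by rewrite seriesSr lerDl.
    exists (fH t) => _ [k _ <-]; rewrite /series /= big_mkord.
    rewrite /h'; under eq_bigr do rewrite normrM.
    rewrite -mulr_suml indicE; case: (boolP (t \in G)) => tG /=.
      by rewrite normr1 mulr1; apply: partial_le; rewrite inE in tG.
    by rewrite normr0 mulr0 fine_ge0.
  move=> cn; have : cvgn (series (fun n => h' n t)) by exact: normed_cvg.
  rewrite (_ : series _ = (fun k => \sum_(n < k) h' n t))//.
  by apply/funext => k; rewrite /series /= big_mkord.
pose g t := limn (fun k => \sum_(n < k) h' n t).
have msum k : measurable_fun setT (fun t => \sum_(n < k) h' n t).
  by apply: measurable_sum => n; case: (bh' n).
have mg : measurable_fun setT g by apply: (measurable_fun_cvg msum) => t _; exact: cv.
have ifH : P.-integrable setT (EFin \o fH).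
  have := intH; apply: le_integrable => //; first exact/measurable_EFinP.
  by move=> t _; rewrite /= /fH; case: (H t) (H0 t) => //= r; rewrite normr0 leey.
have [ig _] := @dominated_Rint _ _ _ P (fun k t => \sum_(n < k) h' n t) g fH
  msum mg ifH dom (nearW _ cv).
have aeh k : {ae P, forall t, \sum_(n < k) h n t = \sum_(n < k) h' n t}.
  apply: filterS aeG => t Gt; apply: eq_bigr => n _.
  by rewrite /h' indicE mem_set// mulr1.
exists g; split=> //.
  move=> phi bphi; have [mphi [B HB]] := bphi.
  have msp k : bdm (fun t => (\sum_(n < k) h' n t) * phi t).
    by apply: bdmM => //; exact: bdm_sum.
  have B0 : 0 <= Num.max B 0 by rewrite le_max lexx orbT.
  have [_] := @dominated_Rint _ _ _ P (fun k t => (\sum_(n < k) h' n t) * phi t)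
     (fun t => g t * phi t) (fun t => Num.max B 0 * fH t)
     (fun k => (msp k).1) ltac:(exact: measurable_funM)
     ltac:(by have := integrableZl measurableT (Num.max B 0) ifH)
     ltac:(by move=> k t; rewrite normrM mulrC ler_pM// le_max HB)
     ltac:(by apply: nearW => t; apply: cvgMl; exact: cv).
  suff -> : (fun k => \int[P]_t ((\sum_(n < k) h n t) * phi t)) =
      (fun k => \int[P]_t ((\sum_(n < k) h' n t) * phi t)) by [].
  apply/funext => k.
  rewrite /Rintegral; congr fine; apply: ae_eq_integral => //.
  - by apply/measurable_EFinP; have [] := bdmM (bdm_sum (index_enum 'I_k) (fun n : 'I_k => bh n)) bphi.
  - by apply/measurable_EFinP; case: (msp k).
  - by apply: filterS (aeh k) => t E _ /=; rewrite E.
move=> p B p1 B0 HB; have p0 : 0 < p by exact: lt_le_trans ltr01 p1.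
have bound k : (\int[P]_t (`|\sum_(n < k) h' n t| `^ p)%:E <= (B `^ p)%:E)%E.
  have := HB k; rewrite unlock.
  rewrite (@ae_eq_integral _ _ _ P setT (fun t => (`|\sum_(n < k) h' n t| `^ p)%:E)
    (fun t => (`|\sum_(n < k) h n t| `^ p)%:E)) //; first last.
  - by apply: filterS (aeh k) => t E _ /=; rewrite E.
  - exact: measurable_norm_powR.
  - by apply: measurable_norm_powR; apply: measurable_sum => n; case: (bh n).
  move=> Hk.
  have I0 : (0 <= \int[P]_t (`|\sum_(n < k) h' n t| `^ p)%:E)%E.
    by apply: integral_ge0 => t _; rewrite lee_fin powR_ge0.
  rewrite -[leLHS]poweRe1// -(mulVf (lt0r_neq0 p0)) poweRrM -poweR_EFin.
  apply: poweR_mono; [exact: ltW|exact: poweR_ge0|exact: Hk].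
have gp t : (`|g t| `^ p)%:E = limn_einf (fun k => (`|\sum_(n < k) h' n t| `^ p)%:E).
  have cvt : (fun k => (`|\sum_(n < k) h' n t| `^ p)%:E) @ \oo --> (`|g t| `^ p)%:E.
    apply/cvg_EFin; first exact: nearW.
    apply: cvg_powR_seq => //; apply: cvg_norm; exact: cv.
  rewrite is_cvg_limn_einfE; last by apply/cvg_ex; eexists; exact: cvt.
  by rewrite (cvg_lim _ cvt).
have F : (\int[P]_t (`|g t| `^ p)%:E <= (B `^ p)%:E)%E.
  under eq_integral do rewrite gp.
  apply: (le_trans (fatou _ measurableT (fun k => measurable_norm_powR p (msum k)) _)).
    by move=> k t _; rewrite lee_fin powR_ge0.
  rewrite limn_einf_lim; apply: lime_le.
    exact: is_cvg_einfs.
  apply: nearW => k; apply: le_trans (bound k); apply: ereal_inf_lbound.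
  by exists k => /=.
rewrite unlock.
have -> : B%:E = ((B `^ p)%:E `^ p^-1)%E.
  by rewrite poweR_EFin -powRrM mulfV ?gt_eqF// powRr1.
apply: poweR_mono => //; first by rewrite invr_ge0 ltW.
by apply: integral_ge0 => t _; rewrite lee_fin powR_ge0.
Qed.

End Lnorm_facts.

(** * Besov norms of sums of blocks *)

Section sums.
Variable R : realType.

Lemma powR_superadd (I : Type) (s : seq I) (z : I -> R) (r : R) : 1 <= r ->
  (forall i, 0 <= z i) -> \sum_(i <- s) z i `^ r <= (\sum_(i <- s) z i) `^ r.
Proof.
move=> r1 z0; have r0 : 0 < r by exact: lt_le_trans ltr01 r1.
elim: s => [|i s IH]; first by rewrite !big_nil powR0// gt_eqF.
rewrite !big_cons; set S := \sum_(j <- s) z j in IH *.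
have S0 : 0 <= S by apply: sumr_ge0.
apply: le_trans (lerD (lexx _) IH) _.
rewrite -[z i `^ r]mulr_powRB1// -[S `^ r]mulr_powRB1//.
rewrite -[(z i + S) `^ r]mulr_powRB1 ?addr_ge0// mulrDl.
apply: lerD; rewrite ler_wpM2l// ge0_ler_powR ?nnegrE ?subr_ge0 ?addr_ge0//.
  by rewrite lerDl.
by rewrite lerDr.
Qed.

(** Finitely many terms do not matter. *)
Lemma summable_near (x delta : nat -> R) (D : R) : (forall n, 0 <= delta n) ->
  (forall n, 0 <= x n) -> (forall N, \sum_(n < N) delta n <= D) ->
  (\forall n \near \oo, x n <= delta n) ->
  exists2 C, 0 <= C & forall N, \sum_(n < N) x n <= C.
Proof.
move=> d0 x0 HD [n0 _ Hn].
exists (\sum_(n < n0) x n + D).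
  rewrite addr_ge0 ?sumr_ge0//; have := HD 0%N; by rewrite big_ord0.
move=> N; have [Nn|nN] := leqP N n0.
  rewrite ler_wpDr//; first by have := HD 0%N; rewrite big_ord0.
  rewrite (big_ord_widen n0 x Nn) [leRHS](bigID (fun i : 'I_n0 => (i < N)%N)) /=.
  by rewrite lerDl sumr_ge0.
rewrite -!(big_mkord xpredT) (big_cat_nat (leq0n n0) (ltnW nN))/= lerD//.
apply: le_trans (HD N).
rewrite -(big_mkord xpredT) (big_cat_nat (leq0n n0) (ltnW nN))/=.
rewrite ler_wpDl ?sumr_ge0//.
rewrite big_nat [leRHS]big_nat; apply: ler_sum => i /andP[n0i _].
exact: Hn.
Qed.

Lemma summable_cvg (x : nat -> R) (C : R) : (forall n, 0 <= x n) ->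
  (forall N, \sum_(n < N) x n <= C) -> cvgn (fun N => \sum_(n < N) x n).
Proof.
move=> x0 HC; apply: nondecreasing_is_cvgn; last by exists C => _ [N _ <-].
by apply/nondecreasing_seqP => N; rewrite big_ord_recr /= lerDl.
Qed.

End sums.

Section besov_bounds.
Variables (R : realType) (d : nat) (chi : 'rV[R]_d -> R).
Local Notation mu := (torus_measure R d).

(** The norm of l^1 dominates the one of l^r for every r. *)
Lemma besov_le (q r : \bar R) (theta : R) (u : vfunctional R d) (y : nat -> R)
    (Y : R) : (1 <= r)%E -> (forall n, 0 <= y n) -> 0 <= Y ->
  (forall n, (LP_norm chi q n u <= (y n)%:E)%E) ->
  (forall N, \sum_(n < N) (2 ^+ n) `^ (- theta) * y n <= Y) ->
  (besov_norm chi (- theta) q r u <= Y%:E)%E.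
Proof.
move=> r1 y0 Y0 Hy HY; rewrite /besov_norm.
have L0 n : (0 <= LP_norm chi q n u)%E by exact: Lnorm_ge0.
pose z n := (2 ^+ n) `^ (- theta) * y n : R.
have z0 n : 0 <= z n by rewrite mulr_ge0 ?powR_ge0.
case: r r1 => [r||]// r1.
  rewrite lee_fin in r1; have r0 : 0 < r by exact: lt_le_trans ltr01 r1.
  have -> : Y%:E = ((Y `^ r)%:E `^ r^-1)%E.
    by rewrite poweR_EFin -powRrM mulfV ?gt_eqF// powRr1.
  have t0 n : (0 <= ((2 ^+ n) `^ (- theta * r))%:E * LP_norm chi q n u `^ r)%E.
    by rewrite mule_ge0// ?lee_fin ?powR_ge0// poweR_ge0.
  apply: poweR_mono; first by rewrite invr_ge0 ltW.
    exact: nneseries_ge0.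
  apply: lime_le; first exact: is_cvg_nneseries.
  apply: nearW => N; rewrite big_mkord.
  apply: (@le_trans _ _ (\sum_(n < N) (z n `^ r)%:E)%E).
    apply: lee_sum => n _.
    rewrite /z powRM ?powR_ge0// -powRrM EFinM lee_wpmul2l ?lee_fin ?powR_ge0//.
    by rewrite -poweR_EFin; apply: poweR_mono => //; exact: ltW.
  rewrite sumEFin lee_fin; apply: (le_trans (powR_superadd (z := fun i : 'I_N => z i) _ r1 (fun i => z0 i))).
  apply: ge0_ler_powR; rewrite ?nnegrE ?sumr_ge0//; first exact: ltW.
  by move: (HY N).
apply: ge_ereal_sup => _ [n _ <-].
apply: (@le_trans _ _ (z n)%:E).
  by rewrite /z EFinM lee_wpmul2l// lee_fin powR_ge0.
rewrite lee_fin; apply: le_trans (HY n.+1); rewrite big_ord_recr /=.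
by rewrite lerDr; apply: sumr_ge0 => i _; exact: z0.
Qed.

Lemma bdm_enorm (F : 'I_d -> d.-tuple (measurableTypeR R) -> R) :
  (forall i, measurable_fun setT (F i)) ->
  measurable_fun setT (fun t => enorm (fun i => F i t)).
Proof.
move=> mF; apply: measurableT_comp; first exact: (continuous_measurable_fun (@sqrt_continuous R)).
by apply: measurable_sum => i; exact: measurable_funX.
Qed.

Lemma Lnorm_enorm_le q (F : 'I_d -> d.-tuple (measurableTypeR R) -> R) :
  (1 <= q)%E -> (forall i, measurable_fun setT (F i)) ->
  (Lnorm mu q (fun t => (enorm (fun i => F i t))%:E) <=
   \sum_i Lnorm mu q (EFin \o F i))%E.
Proof.
move=> q1 mF.
have mn i : measurable_fun setT (fun t => `|F i t|) by exact: measurableT_comp.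
apply: (@le_trans _ _ (Lnorm mu q (EFin \o (fun t => \sum_i `|F i t|)))).
  apply: (le_Lnorm _ q1) => //.
  - exact: bdm_enorm.
  - exact: measurable_sum.
  - move=> t; rewrite !ger0_norm ?enorm_ge0 ?sumr_ge0//; exact: enorm_le_sum.
apply: (le_trans (Lnorm_sum _ _ q1 mn)); apply: lee_sum => i _.
by apply: le_Lnorm => // t; rewrite normr_id.
Qed.

Lemma Lnorm_le_enorm q (F : 'I_d -> d.-tuple (measurableTypeR R) -> R) i :
  (1 <= q)%E -> (forall i, measurable_fun setT (F i)) ->
  (Lnorm mu q (EFin \o F i) <=
   Lnorm mu q (fun t => (enorm (fun i => F i t))%:E))%E.
Proof.
move=> q1 mF; apply: (le_Lnorm _ q1) => //; first exact: bdm_enorm.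
move=> t; rewrite (ger0_norm (enorm_ge0 _)).
exact: (coord_le_enorm (fun i => F i t)).
Qed.

Lemma measurable_ev (f : seq (mode R d)) :
  measurable_fun setT (fun t : d.-tuple (measurableTypeR R) => ev f (row_of t)).
Proof. by case: (bdm_ev f). Qed.

Lemma Lnorm_ev_le q (f : seq (mode R d)) : (1 <= q)%E ->
  (Lnorm mu q (fun t => (ev f (row_of t))%:E) <= (anorm f)%:E)%E.
Proof.
move=> q1; apply: Lnorm_ub => //; first exact: measurable_ev.
by move=> t; exact: ev_le_anorm.
Qed.

Lemma LP_norm_ev_le q n (u : vfunctional R d) (f : 'I_d -> seq (mode R d)) :
  (1 <= q)%E -> (forall i x, P_dyadic chi n (u i) x = ev (f i) x) ->
  (LP_norm chi q n u <= (\sum_i anorm (f i))%:E)%E.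
Proof.
move=> q1 H; rewrite /LP_norm.
have -> : (fun t => (enorm (fun i => P_dyadic chi n (u i) (row_of t)))%:E) =
    (fun t : d.-tuple (measurableTypeR R) => (enorm (fun i => ev (f i) (row_of t)))%:E).
  by apply/funext => t; congr (enorm _)%:E; apply/funext => i; rewrite H.
apply: (le_trans (Lnorm_enorm_le q1 (fun i => measurable_ev (f i)))).
by rewrite -sumEFin; apply: lee_sum => i _; exact: Lnorm_ev_le.
Qed.

End besov_bounds.

(** * A stress whose divergence is the fractional Laplacian *)

Section stress.
Variables (R : realType) (d : nat) (alpha : R).
Hypothesis alpha_gt0 : 0 < alpha.
Local Notation mu := (torus_measure R d).
Local Notation freq := 'rV[int]_d.
Local Notation fnorm := (fnorm R).
Implicit Types (f g : seq (mode R d)) (m : freq) (x : 'rV[R]_d).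

(** Chosen so that the sum over j of (2 pi i m_j) (i lsym_j(m)) is (2 pi |m|)^(2
    alpha). *)
Definition lsym (j : 'I_d) m : R :=
  - (lapsym alpha m * (m 0 j)%:~R / (2 * pi * fnorm m ^+ 2)).

Definition Lm (i j : 'I_d) (u : 'I_d -> seq (mode R d)) : seq (mode R d) :=
  imult (lsym j) (u i) ++ imult (lsym i) (u j).

Lemma ev_imult (c : freq -> R) f x : ev (imult c f) x =
  \sum_(l <- f) c (mfreq l) * amp l * wave (mfreq l) (shft l + pi / 2) x.
Proof. by rewrite /ev /imult big_map. Qed.

Lemma Lm_sym i j u x : ev (Lm i j u) x = ev (Lm j i u) x.
Proof. by rewrite !ev_cat addrC. Qed.

Lemma Iw_Dpi (phi : 'rV[R]_d -> R) m b : test_fun phi ->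
  Iw phi m (b + pi / 2 + pi / 2) = - Iw phi m b.
Proof.
move=> tf; rewrite -mulN1r /Iw -RintegralZl//; last first.
  by apply/bdm_integrable/bdmM; [exact: bdm_test|exact: bdm_wave].
apply: eq_Rintegral => t _; rewrite mulrCA mulN1r; congr (_ * _).
by rewrite /wave !addrA -(addrA _ (pi / 2)) -splitr cosDpi.
Qed.

(** The divergence of the first term of Lm u is the fractional Laplacian of u.
    That of the second one is a gradient, as lsym(m) is parallel to m, and
    divergence free fields do not see it. *)
Lemma stress_pairing (u : 'I_d -> seq (mode R d)) (phi : 'I_d -> 'rV[R]_d -> R) :
  (forall i, test_fun (phi i)) ->
  (forall x, \sum_i partial i (phi i) x = 0) ->
  \sum_i \sum_j distribution_of (ev (Lm i j u)) (partial j (phi i)) =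
  - \sum_i distribution_of (ev (u i)) (frac_laplacian alpha (phi i)).
Proof.
move=> tphi divphi.
have tp i j : test_fun (partial j (phi i)) by exact: test_partial.
have divI m b : \sum_i (m 0 i)%:~R * Iw (phi i) m b = 0.
  have : \int[mu]_t ((\sum_i partial i (phi i) (row_of t)) *
      wave m (b - pi / 2) (row_of t)) = 0.
    by under eq_Rintegral do rewrite divphi mul0r; rewrite Rint_cst.
  under eq_Rintegral do rewrite mulr_suml.
  rewrite Rint_sum; last first.
    by move=> i; apply/bdm_integrable/bdmM; [exact: bdm_test|exact: bdm_wave].
  rewrite (eq_bigr (fun i => - (2 * pi) * ((m 0 i)%:~R * Iw (phi i) m b))).
    rewrite -mulr_sumr => /eqP; rewrite mulf_eq0 oppr_eq0 gt_eqF ?twopi_gt0//=.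
    by move=> /eqP.
  by move=> i _; rewrite -/(Iw _ _ _) Iw_partial// subrK; ring.
transitivity (\sum_i \sum_j (distribution_of (ev (imult (lsym j) (u i))) (partial j (phi i)) +
    distribution_of (ev (imult (lsym i) (u j))) (partial j (phi i)))).
  by apply: eq_bigr => i _; apply: eq_bigr => j _; rewrite dist_cat.
have D1 i j : distribution_of (ev (imult (lsym j) (u i))) (partial j (phi i)) =
    \sum_(l <- u i) amp l * (lsym j (mfreq l) * (2 * pi * (mfreq l 0 j)%:~R)) *
      Iw (phi i) (mfreq l) (shft l).
  rewrite dist_ev// /imult big_map; apply: eq_bigr => l _.
  by rewrite {1}/amp {1}/mfreq {1}/shft /= Iw_partial// Iw_Dpi//; ring.
have D2 i j : distribution_of (ev (imult (lsym i) (u j))) (partial j (phi i)) =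
    \sum_(l <- u j) amp l * (lsym i (mfreq l) * (2 * pi * (mfreq l 0 j)%:~R)) *
      Iw (phi i) (mfreq l) (shft l).
  rewrite dist_ev// /imult big_map; apply: eq_bigr => l _.
  by rewrite {1}/amp {1}/mfreq {1}/shft /= Iw_partial// Iw_Dpi//; ring.
under eq_bigr do rewrite big_split /=.
rewrite big_split /=.
rewrite [X in _ + X](_ : _ = 0) ?addr0; last first.
  rewrite exchange_big /= big1// => j _.
  under eq_bigr do rewrite D2.
  rewrite exchange_big /= big1// => l _.
  rewrite (eq_bigr (fun i => - (amp l * lapsym alpha (mfreq l) /
    (2 * pi * fnorm (mfreq l) ^+ 2) * (2 * pi * (mfreq l 0 j)%:~R)) *
    ((mfreq l 0 i)%:~R * Iw (phi i) (mfreq l) (shft l)))).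
    by rewrite -mulr_sumr divI mulr0.
  by move=> i _; rewrite /lsym; ring.
rewrite -sumrN; apply: eq_bigr => i _; under eq_bigr do rewrite D1.
rewrite exchange_big /=.
have [blap Hlap] := frac_laplacian_spec alpha_gt0 (tphi i).
rewrite /distribution_of; under eq_Rintegral do rewrite mulr_suml.
rewrite Rint_sum; last first.
  by move=> l; apply/bdm_integrable/bdmM => //; apply: bdmZ; exact: bdm_wave.
rewrite -sumrN; apply: eq_bigr => l _; set m := mfreq l; set b := shft l.
transitivity (- (amp l * Iw (frac_laplacian alpha (phi i)) m b)); last first.
  congr (- _); rewrite /Iw -RintegralZl//.
    by apply: eq_Rintegral => t _; ring.
  by apply/bdm_integrable/bdmM => //; exact: bdm_wave.
rewrite Hlap -mulr_suml -mulr_sumr.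
suff -> : \sum_j lsym j m * (2 * pi * (m 0 j)%:~R) = - lapsym alpha m by ring.
have [->|m0] := eqVneq m 0.
  rewrite lapsym0// oppr0 big1// => j _.
  by rewrite /lsym lapsym0// !mul0r oppr0 mul0r.
rewrite (eq_bigr (fun j => - (lapsym alpha m / fnorm m ^+ 2) * (m 0 j)%:~R ^+ 2)).
  rewrite -mulr_sumr -fnorm_sqr mulNr divfK// expf_neq0// gt_eqF//.
  exact: fnorm_gt0.
move=> j _; rewrite /lsym; have P0 := twopi_gt0 R.
move: (2 * pi : R) P0 => P P0; field.
by rewrite (gt_eqF (fnorm_gt0 R m0)) (gt_eqF P0).
Qed.

Variable k : nat.
Hypothesis hk : 2 * alpha <= k%:R.

Definition inv_fnorm m : R := (fnorm m)^-1.

Definition CL : R := (2 * pi) ^+ k.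

Lemma lsym_le j m : hweight R k.+1 m * `|lsym j m| <= CL * inv_fnorm m.
Proof.
have C0 : 0 <= CL by rewrite exprn_ge0// ltW// twopi_gt0.
rewrite /hweight; case: eqVneq => [->|m0].
  by rewrite mul0r mulr_ge0// invr_ge0 fnorm_ge0.
have f0 := fnorm_gt0 R m0; have f1 := fnorm_ge1 R m0.
have P0 := twopi_gt0 R; have P1 := twopi_ge1 R.
have L := lapsym_le m0 hk.
rewrite /lsym normrN !normrM normfV (ger0_norm (lapsym_ge0 _ _)).
rewrite (ger0_norm (_ : 0 <= 2 * pi * fnorm m ^+ 2)); last first.
  by rewrite mulr_ge0 ?exprn_ge0// ltW.
apply: (@le_trans _ _ (fnorm m ^- k.+1 * ((2 * pi) ^+ k * fnorm m ^+ k * fnorm m /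
    fnorm m ^+ 2))).
  rewrite ler_wpM2l ?invr_ge0 ?exprn_ge0 ?(ltW f0)//.
  apply: ler_pM.
  - by rewrite mulr_ge0 ?lapsym_ge0.
  - by rewrite invr_ge0 mulr_ge0 ?exprn_ge0// ltW.
  - apply: ler_pM => //; first exact: lapsym_ge0.
    exact: coord_le_fnorm.
  - rewrite lef_pV2 ?posrE ?mulr_gt0 ?exprn_gt0//.
    + by rewrite ler_peMl// exprn_ge0// ltW.
    + exact: pi_gt0.
rewrite /CL /inv_fnorm exprS.
have -> : (fnorm m * fnorm m ^+ k)^-1 *
    ((2 * pi) ^+ k * fnorm m ^+ k * fnorm m / fnorm m ^+ 2) =
    (2 * pi) ^+ k * (fnorm m ^- 2).
  by field; rewrite ?expf_neq0 ?gt_eqF.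
rewrite ler_wpM2l// lef_pV2 ?posrE ?exprn_gt0// expr2.
by rewrite ler_peMr// ltW.
Qed.

Lemma wnorm_Lm_le i j u (L : R) : 0 < L ->
  (forall i, spec (fun m => L <= fnorm m) (u i)) ->
  wnorm (hweight R k.+1) (Lm i j u) <= CL * L^-1 * (anorm (u i) + anorm (u j)).
Proof.
move=> L0 su; rewrite /Lm wnorm_cat mulrDr.
have C0 : 0 <= CL by rewrite exprn_ge0// ltW// twopi_gt0.
have H i' j' : wnorm (hweight R k.+1) (imult (lsym j') (u i')) <=
    CL * L^-1 * anorm (u i').
  rewrite -mulrA; apply: le_trans (ler_wpM2l C0 (wnorm_le_spec (w := inv_fnorm) _)).
    by apply: wnorm_imult_le => l _; exact: lsym_le.
  move=> l /su Ll; rewrite /inv_fnorm lef_pV2 ?posrE//; exact: lt_le_trans Ll.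
by rewrite lerD.
Qed.

Lemma spec_Lm P i j u : (forall i, spec P (u i)) -> spec P (Lm i j u).
Proof. by move=> H; apply: spec_cat; apply: spec_imult. Qed.

Lemma Lm_cat i j u v :
  ev (Lm i j (fun i => u i ++ v i)) =1 ev (Lm i j u ++ Lm i j v).
Proof. by move=> x; rewrite /Lm !imult_cat !ev_cat; ring. Qed.

End stress.

(** * The sum of a sequence of blocks *)

Lemma cvg_bigsum (R : realType) (I : Type) (r : seq I) (x : I -> nat -> R) (l : I -> R) :
  (forall i, x i n @[n --> \oo] --> l i) ->
  \sum_(i <- r) x i n @[n --> \oo] --> \sum_(i <- r) l i.
Proof.
move=> H; elim: r => [|i r IH].
  by rewrite big_nil; under eq_fun do rewrite big_nil; exact: cvg_cst.
by rewrite big_cons; under eq_fun do rewrite big_cons; exact: cvgD.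
Qed.

Section assembly.
Variables (R : realType) (d : nat) (chi : 'rV[R]_d -> R) (alpha : R).
Hypothesis hchi : bump_function chi.
Hypothesis alpha_gt0 : 0 < alpha.
Local Notation mu := (torus_measure R d).
Local Notation freq := 'rV[int]_d.
Local Notation fnorm := (fnorm R).
Implicit Types (f g : seq (mode R d)) (m : freq) (x : 'rV[R]_d).
Local Notation row_of := (@row_of R d).
Local Notation mtuple := (d.-tuple (measurableTypeR R)).

Lemma dist_partial f (phi : 'rV[R]_d -> R) j : test_fun phi ->
  distribution_of (ev f) (partial j phi) = - distribution_of (ev (pderiv j f)) phi.
Proof.
move=> tphi; rewrite !dist_ev//; last exact: test_partial.
rewrite /pderiv /imult big_map -sumrN; apply: eq_bigr => l _.
by rewrite Iw_partial//= /amp /mfreq /shft /=; ring.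
Qed.

Lemma integrable_distribution (g : mtuple -> R) :
  mu.-integrable setT (EFin \o g) ->
  is_distribution (fun phi : 'rV[R]_d -> R => \int[mu]_t (g t * phi (row_of t))).
Proof.
move=> ig; split.
  move=> c phi psi tphi tpsi.
  have i1 := integrable_mul_bdm ig (bdm_test tphi).
  have i2 := integrable_mul_bdm ig (bdm_test tpsi).
  rewrite -RintegralZl// -RintegralD//; last first.
    apply: eq_integrable (integrableZl measurableT c i1) => // t _ /=.
  by apply: eq_Rintegral => t _; ring.
exists (\int[mu]_t `|g t|), 0%N => phi tphi.
have [C C0 HC] := partials_bounded 0 tphi.
have N0 : (`|\int[mu]_t (g t * phi (row_of t))|%:E <=
    (\int[mu]_t `|g t|)%:E * Ck_norm 0 phi)%E; last exact: N0.
have ub x : ((`|phi x|)%:E <= Ck_norm 0 phi)%E.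
  by apply: ereal_sup_ubound; exists [::], x.
have Cfin : (Ck_norm 0 phi <= C%:E)%E.
  apply: ge_ereal_sup => _ [s [x [s0 ->]]]; rewrite lee_fin; exact: HC.
have Cpos : (0 <= Ck_norm 0 phi)%E.
  by apply: le_trans (ub 0); rewrite lee_fin.
have fin : Ck_norm 0 phi \is a fin_num.
  by rewrite ge0_fin_numE//; apply: le_lt_trans Cfin _; rewrite ltry.
rewrite -(fineK fin) -EFinM lee_fin.
have ub' x : `|phi x| <= fine (Ck_norm 0 phi).
  by rewrite -lee_fin fineK.
have ign : mu.-integrable setT (EFin \o (fun t => `|g t|)).
  exact: integrable_norm.
have igp := integrable_mul_bdm ig (bdm_test tphi).
apply: le_trans (le_normr_Rintegral measurableT igp) _.
rewrite -RintegralZr//; apply: le_Rintegral => //.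
- exact: integrable_norm igp.
- apply: eq_integrable (integrableZr measurableT (fine (Ck_norm 0 phi)) ign) => // t _ /=.
- by move=> t _; rewrite normrM ler_wpM2l.
Qed.

(** All members of the sequence are bounded by the same seminorm of order k. *)
Lemma limit_distribution (F : functional R d) (f : nat -> seq (mode R d)) k C :
  0 <= C -> (forall n, spec (fun m => m != 0) (f n)) ->
  (forall n, wnorm (hweight R k) (f n) <= C) ->
  (forall phi, F phi = limn (fun n => distribution_of (ev (f n)) phi)) ->
  (forall phi, test_fun phi -> cvgn (fun n => distribution_of (ev (f n)) phi)) ->
  is_distribution F.
Proof.
move=> C0 sf fC FE cF.
have lin n := (integrable_distribution (bdm_integrable mu (bdm_ev (f n)))).1.
split.
  move=> c phi psi tphi tpsi; rewrite !FE.
  transitivity (limn (fun n => c * distribution_of (ev (f n)) phi +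
    distribution_of (ev (f n)) psi)).
    by congr (limn _); apply/funext => n; exact: lin.
  apply/cvg_lim => //; apply: cvgD; last exact: cF.
  by apply: cvgM; [exact: cvg_cst|exact: cF].
exists (C * d%:R ^+ k), k => phi tphi.
have [B B0 HB] := partials_bounded k tphi.
have ub s x : (size s <= k)%N -> ((`|partials s phi x|)%:E <= Ck_norm k phi)%E.
  by move=> sk; apply: ereal_sup_ubound; exists s, x.
have Cfin : (Ck_norm k phi <= B%:E)%E.
  by apply: ge_ereal_sup => _ [s [x [s0 ->]]]; rewrite lee_fin; exact: HB.
have Cpos : (0 <= Ck_norm k phi)%E.
  by apply: le_trans (ub [::] 0 _); rewrite ?lee_fin.
have fin : Ck_norm k phi \is a fin_num.
  by rewrite ge0_fin_numE//; apply: le_lt_trans Cfin _; rewrite ltry.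
rewrite -(fineK fin) -EFinM lee_fin FE.
have c0 : 0 <= fine (Ck_norm k phi) by exact: fine_ge0.
have cn := cF _ tphi.
have -> : `|limn (fun n => distribution_of (ev (f n)) phi)| =
    limn (fun n => `|distribution_of (ev (f n)) phi|).
  by apply/esym/cvg_lim => //; exact: (cvg_norm cn).
apply: limr_le; first exact: (is_cvg_norm cn).
apply: nearW => n; apply: le_trans (dist_ev_le (k := k) (C := fine (Ck_norm k phi)) tphi (sf n) _) _.
  by move=> s x sk; rewrite -lee_fin fineK// ub.
by rewrite -mulrA ler_wpM2r// mulr_ge0// exprn_ge0.
Qed.

Variables (nv : nat) (a : nat -> 'I_d -> seq (mode R d)).

Fixpoint U N (i : 'I_d) : seq (mode R d) :=
  if N is N'.+1 then U N' i ++ a N i else a 0 i.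

Lemma ev_U N i x : ev (U N i) x = \sum_(n < N.+1) ev (a n i) x.
Proof.
elim: N => [|N IH]; first by rewrite big_ord_recr big_ord0 /= add0r.
by rewrite /= ev_cat IH [RHS]big_ord_recr.
Qed.

Lemma spec_U P N i : (forall n, spec P (a n i)) -> spec P (U N i).
Proof. by move=> H; elim: N => [|N IH] //=; exact: spec_cat. Qed.

(** The Littlewood-Paley blocks of the sum of all a n: the frequencies of a n.+1
    lie where the symbol of the block nv + n.+1 is 1 and all others vanish. *)
Definition block n (i : 'I_d) : seq (mode R d) :=
  if (n <= nv)%N then mult (dsym chi n) (a 0 i) else a (n - nv) i.

Hypothesis spec_a0 :
  forall i, spec (fun m => (m != 0) && (fnorm m < 9 / 10 * 2 ^+ nv)) (a 0 i).
Hypothesis spec_aS : forall n i, spec (fun m => (2 ^+ (nv + n) <= fnorm m) &&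
  (fnorm m < 9 / 10 * 2 ^+ (nv + n).+1)) (a n.+1 i).

Lemma spec_a_neq0 n i : spec (fun m => m != 0) (a n i).
Proof.
case: n => [|n]; first by move=> l /spec_a0/andP[].
move=> l /spec_aS/andP[H _]; apply/eqP => m0; move: H.
by rewrite m0 (fnorm0 R d) leNgt exprn_gt0.
Qed.

Lemma dsym_a n k i x : ev (mult (dsym chi n) (a k i)) x =
  if (n <= nv)%N then (if k is 0 then ev (mult (dsym chi n) (a 0 i)) x else 0)
  else if (n - nv == k)%N then ev (a k i) x else 0.
Proof.
have p9 : 0 <= 9 / 10 :> R by lra.
have mono p q : (p <= q)%N -> 2 ^+ p <= 2 ^+ q :> R.
  by move=> pq; rewrite ler_weXn2l// ler1n.
case: leqP => nn.
  case: k => // k; apply: ev_mult0 => l /spec_aS/andP[H _].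
  apply: (dsym_out hchi); apply: le_trans H; apply: mono; lia.
case: eqVneq => [<-|nk].
  apply: ev_mult1.
  have -> : (n - nv = (n - nv).-1.+1)%N by lia.
  move=> l /spec_aS/andP[H1 H2].
  have e : (nv + (n - nv).-1).+1 = n by lia.
  rewrite -e; apply: (dsym_block hchi) => //.
apply: ev_mult0; case: n nn nk => // n nn.
have [kn nk|kn nk] := ltnP k (n.+1 - nv)%N.
  move=> l lk; apply: (dsym_low hchi).
  case: k lk {nk} kn => [/spec_a0/andP[_ H] _|k /spec_aS/andP[_ H] kn];
    apply: lt_le_trans H _; rewrite ler_wpM2l//; apply: mono; lia.
case: k kn nk => [|k kn nk]; first by move=> *; exfalso; lia.
move=> l /spec_aS/andP[H _]; apply: (dsym_out hchi); apply: le_trans H.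
apply: mono; lia.
Qed.

Lemma dsym_U n N i x : (n <= nv + N)%N ->
  ev (mult (dsym chi n) (U N i)) x = ev (block n i) x.
Proof.
move=> nN.
have -> : ev (mult (dsym chi n) (U N i)) x =
    \sum_(k < N.+1) ev (mult (dsym chi n) (a k i)) x.
  elim: N {nN} => [|N IH]; first by rewrite big_ord_recr big_ord0 /= add0r.
  by rewrite /= mult_cat ev_cat IH [RHS]big_ord_recr.
rewrite /block; case: leqP => nn.
  rewrite big_ord_recl /= dsym_a nn big1 ?addr0// => k _.
  by rewrite dsym_a nn.
have kN : (n - nv < N.+1)%N by lia.
rewrite (bigD1 (Ordinal kN))//= dsym_a leqNgt nn /= eqxx big1 ?addr0// => k.
by rewrite -val_eqE /= dsym_a leqNgt nn /= eq_sym => /negbTE ->.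
Qed.

Lemma sum_block N i x :
  \sum_(n < (nv + N).+1) ev (block n i) x = ev (U N i) x.
Proof.
elim: N => [|N IH].
  rewrite addn0 /=.
  rewrite (eq_bigr (fun n : 'I__ => ev (mult (dsym chi n) (a 0 i)) x)); last first.
    by move=> n _; rewrite /block -ltnS ltn_ord.
  rewrite /ev; under eq_bigr do rewrite big_map.
  rewrite exchange_big /=; rewrite !big_seq; apply: eq_bigr => l la.
  rewrite /amp /mfreq /shft /=.
  under eq_bigr do rewrite -mulrA.
  rewrite -mulr_suml (sum_dsym chi nv) (sym_in hchi) ?mul1r//.
  by have /andP[] := spec_a0 la.
rewrite addnS big_ord_recr /= IH ev_cat; congr (_ + ev _ _).
by rewrite /block ifF; [congr (a _ i); lia|apply/negbTE; lia].
Qed.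

Variable k' : nat.
Hypothesis hk : 2 * alpha <= k'%:R.
Local Notation k := k'.+1.
Variables (delta : nat -> R) (D : R).
Hypothesis delta_ge0 : forall n, 0 <= delta n.
Hypothesis delta_sum : forall N, \sum_(n < N) delta n <= D.
Hypothesis div_a : forall n x, \sum_i ev (pderiv i (a n i)) x = 0.
Hypothesis Lp_a : forall p : R, 1 <= p < 2 -> \forall n \near \oo, forall i,
  (Lnorm mu p%:E (fun t => (ev (a n i) (row_of t))%:E) <= (delta n)%:E)%E.
Hypothesis anorm_a : forall theta : R, 0 < theta -> \forall n \near \oo,
  forall i, (2 ^+ (nv + n)) `^ (- theta) * anorm (a n i) <= delta n.
Variable gamma : nat -> nat -> R.
Hypothesis gamma_ge0 : forall n l, 0 <= gamma n l.
Variable Gamma : R.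
Hypothesis gamma_sum :
  forall N, \sum_(n < N) \sum_(l < n.+1) gamma n l <= Gamma.
Hypothesis gammaP : forall n l i j, (l <= n)%N -> exists2 G,
  (forall x, ev (block n i) x * ev (block l j) x = ev G x) &
  wnorm (hweight R k) G <= gamma n l.
Variable E : nat -> 'I_d -> 'I_d -> seq (mode R d).
Hypothesis EP : forall N i j x,
  ev (U N i) x * ev (U N j) x + ev (Lm alpha i j (U N)) x = ev (E N i j) x.
Hypothesis E_cvg0 : forall i j, wnorm (hweight R k) (E N i j) @[N --> \oo] --> 0.

(** *** The limit *)

Lemma Lp_sum (p : R) : 1 <= p < 2 -> exists2 C, 0 <= C & forall i N,
  \sum_(n < N) fine (Lnorm mu p%:E (fun t => (ev (a n i) (row_of t))%:E)) <= C.
Proof.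
move=> /[dup] p12 /andP[p1 _].
pose z i n : R := fine (Lnorm mu p%:E (fun t => (ev (a n i) (row_of t))%:E)).
have fin n i : Lnorm mu p%:E (fun t => (ev (a n i) (row_of t))%:E) \is a fin_num.
  rewrite ge0_fin_numE ?Lnorm_ge0//.
  by apply: le_lt_trans (Lnorm_ev_le _ _) _; rewrite ?lee_fin// ltry.
have /choice[C HC] : forall i, exists C, 0 <= C /\ forall N, \sum_(n < N) z i n <= C.
  move=> i; have z0 n : 0 <= z i n by rewrite fine_ge0 ?Lnorm_ge0.
  have zd : \forall n \near \oo, z i n <= delta n.
    near=> n; rewrite -lee_fin /z fineK//; move: i {z0}; near: n; exact: Lp_a.
  by have [C C0 HC] := summable_near delta_ge0 z0 delta_sum zd; exists C.
exists (\sum_i C i); first by apply: sumr_ge0 => i _; case: (HC i).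
move=> i N; apply: le_trans ((HC i).2 N) _.
by rewrite (bigD1 i)//= lerDl sumr_ge0// => j _; case: (HC j).
Unshelve. all: by end_near. Qed.

Lemma limit_exists i : exists g : mtuple -> R,
  [/\ mu.-integrable setT (EFin \o g),
    (forall phi : 'rV[R]_d -> R, bdm (fun t : mtuple => phi (row_of t)) ->
      distribution_of (ev (U N i)) phi @[N --> \oo] -->
      \int[mu]_t ((ev (a 0 i) (row_of t) + g t) * phi (row_of t))) &
    (forall p B, 1 <= p -> 0 <= B ->
      (forall N, \sum_(n < N) fine (Lnorm mu p%:E (fun t => (ev (a n.+1 i) (row_of t))%:E))
        <= B) ->
      (Lnorm mu p%:E (EFin \o g) <= B%:E)%E)].
Proof.
have fin (p : R) n : 1 <= p ->
    Lnorm mu p%:E (fun t => (ev (a n i) (row_of t))%:E) \is a fin_num.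
  move=> p1; rewrite ge0_fin_numE ?Lnorm_ge0//.
  by apply: le_lt_trans (Lnorm_ev_le _ _) _; rewrite ?lee_fin// ltry.
have p1 : 1 <= (1 : R) < 2 by apply/andP; split; lra.
have [C C0 HC] := Lp_sum p1.
pose h n (t : mtuple) := ev (a n.+1 i) (row_of t).
have hC N : \sum_(n < N) \int[mu]_t `|h n t| <= C.
  apply: le_trans (HC i N.+1); rewrite big_ord_recl /= ler_wpDl//.
    by rewrite fine_ge0// Lnorm_ge0.
  apply: ler_sum => n _; rewrite le_eqVlt; apply/orP; left; apply/eqP.
  exact: (esym (congr1 fine (Lnorm1_Rint mu (bdm_ev (a n.+1 i))))).
have [g [ig limg Lg]] := series_Lp (fun n => bdm_ev (a n.+1 i)) hC.
exists g; split => //.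
  move=> phi bphi.
  have -> : (fun N => distribution_of (ev (U N i)) phi) = (fun N =>
      \int[mu]_t (ev (a 0 i) (row_of t) * phi (row_of t)) +
      \int[mu]_t ((\sum_(n < N) h n t) * phi (row_of t))).
    apply/funext => N; rewrite -RintegralD//; first last.
    - by apply/bdm_integrable/bdmM => //; apply: bdm_sum => n; exact: bdm_ev.
    - by apply/bdm_integrable/bdmM => //; exact: bdm_ev.
    apply: eq_Rintegral => t _; rewrite ev_U big_ord_recl /= mulrDl; congr (_ + _ * _).
  have -> : \int[mu]_t ((ev (a 0 i) (row_of t) + g t) * phi (row_of t)) =
      \int[mu]_t (ev (a 0 i) (row_of t) * phi (row_of t)) +
      \int[mu]_t (g t * phi (row_of t)); last first.
    by apply: cvgD; [exact: cvg_cst|exact: limg].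
  rewrite -RintegralD//; first last.
  - exact: integrable_mul_bdm.
  - by apply/bdm_integrable/bdmM => //; exact: bdm_ev.
  by apply: eq_Rintegral => t _; rewrite mulrDl.
move=> p B p1' B0 HB; apply: Lg => // N.
apply: le_trans (Lnorm_sum _ _ _ _) _ => //.
  by move=> n; exact: measurable_ev.
apply: le_trans (_ : ((\sum_(n < N) fine (Lnorm mu p%:E
    (fun t => (ev (a n.+1 i) (row_of t))%:E)))%:E <= _)%E); last first.
  by rewrite lee_fin.
rewrite -sumEFin; apply: lee_sum => n _; rewrite fineK ?fin//.
Qed.

(** *** The stress *)

(** The tensor - Lm u for the sum u of all blocks. *)
Definition stress i j : functional R d := fun phi =>
  limn (fun N => distribution_of (ev (tscale (-1) (Lm alpha i j (U N)))) phi).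

Definition tau i j n : R := wnorm (hweight R k) (Lm alpha i j (a n)).

Lemma tau_ge0 i j n : 0 <= tau i j n.
Proof. by apply: wnorm_ge0 => m; exact: hweight_ge0. Qed.

Lemma tau_sum : exists2 C, 0 <= C & forall i j N, \sum_(n < N) tau i j n <= C.
Proof.
have CL0 : 0 <= CL R k' by rewrite exprn_ge0// ltW// twopi_gt0.
have H i j : exists C, 0 <= C /\ forall N, \sum_(n < N) tau i j n <= C.
  pose c := CL R k' * 4; have c0 : 0 <= c by rewrite mulr_ge0.
  have dc0 n : 0 <= c * delta n by rewrite mulr_ge0.
  have dsum N : \sum_(n < N) c * delta n <= c * D by rewrite -mulr_sumr ler_wpM2l.
  have near_tau : \forall n \near \oo, tau i j n <= c * delta n.
    near=> n; have n0 : (0 < n)%N by near: n; exact: nbhs_infty_gt.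
    have en : n = n.-1.+1 by lia.
    have L0 : (0 : R) < 2 ^+ (nv + n.-1) by rewrite exprn_gt0.
    have W := @wnorm_Lm_le R d alpha _ hk i j (a n) _ L0.
    apply: (le_trans (W _)); first by rewrite en => i' l /spec_aS/andP[].
    have A i' : (2 ^+ (nv + n)) ^-1 * anorm (a n i') <= delta n.
      rewrite -powR_inv1 ?exprn_ge0//; move: i'; near: n; exact: anorm_a.
    have e : (2 ^+ (nv + n.-1))^-1 = 2 * (2 ^+ (nv + n))^-1 :> R.
      by rewrite {2}en addnS exprS; field; rewrite gt_eqF.
    rewrite e /c -!mulrA ler_wpM2l//.
    have := A i; have := A j; set X := _^-1; move=> ? ?; rewrite mulrDr mulrDr.
    by lra.
  have [C C0 HC] := summable_near dc0 (tau_ge0 i j) dsum near_tau.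
  by exists C.
have /choice[C HC] : forall i, exists C : 'I_d -> R, forall j, 0 <= C j /\
    forall N, \sum_(n < N) tau i j n <= C j.
  by move=> i; have [f Hf] := choice (H i); exists f.
exists (\sum_i \sum_j C i j).
  by apply: sumr_ge0 => i _; apply: sumr_ge0 => j _; case: (HC i j).
move=> i j N; apply: le_trans ((HC i j).2 N) _.
rewrite (bigD1 i)//= (bigD1 j)//= -addrA lerDl addr_ge0//.
  by apply: sumr_ge0 => j' _; case: (HC i j').
by apply: sumr_ge0 => i' _; apply: sumr_ge0 => j' _; case: (HC i' j').
Unshelve. all: by end_near. Qed.

Lemma dist_Lm i j u v (phi : 'rV[R]_d -> R) : test_fun phi ->
  distribution_of (ev (Lm alpha i j (fun i => u i ++ v i))) phi =
  distribution_of (ev (Lm alpha i j u)) phi +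
  distribution_of (ev (Lm alpha i j v)) phi.
Proof. by move=> tphi; rewrite (eq_dist (Lm_cat _ _ _ _ _)) dist_cat. Qed.

Lemma dist_Lm_U i j N (phi : 'rV[R]_d -> R) : test_fun phi ->
  distribution_of (ev (Lm alpha i j (U N))) phi =
  \sum_(n < N.+1) distribution_of (ev (Lm alpha i j (a n))) phi.
Proof.
move=> tphi; elim: N => [|N IH]; first by rewrite big_ord_recr big_ord0 /= add0r.
rewrite [RHS]big_ord_recr /= -IH -dist_Lm//.
Qed.

Lemma spec_Lm_a i j n : spec (fun m => m != 0) (Lm alpha i j (a n)).
Proof. by apply: spec_Lm => i'; exact: spec_a_neq0. Qed.

Lemma wnorm_Lm_U i j N :
  wnorm (hweight R k) (Lm alpha i j (U N)) <= \sum_(n < N.+1) tau i j n.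
Proof.
elim: N => [|N IH]; first by rewrite big_ord_recr big_ord0 /= add0r.
rewrite big_ord_recr /=; apply: le_trans (lerD IH (lexx _)).
by rewrite /tau /Lm !wnorm_cat !imult_cat !wnorm_cat; lra.
Qed.

Lemma dist_opp f (phi : 'rV[R]_d -> R) : test_fun phi ->
  distribution_of (ev (tscale (-1) f)) phi = - distribution_of (ev f) phi.
Proof.
move=> tphi; rewrite !dist_ev// /tscale big_map -sumrN; apply: eq_bigr => l _.
by rewrite {1}/amp /= mulN1r mulNr.
Qed.

Lemma stress_cvg i j phi : test_fun phi ->
  distribution_of (ev (tscale (-1) (Lm alpha i j (U N)))) phi @[N --> \oo] -->
  stress i j phi.
Proof.
move=> tphi; rewrite /stress.
suff : cvgn (fun N => distribution_of (ev (Lm alpha i j (U N))) phi).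
  by under [in X in _ -> X]eq_fun do rewrite dist_opp//; move/is_cvgN.
have [B B0 HB] := partials_bounded k tphi.
have [C C0 HC] := tau_sum.
pose y n := distribution_of (ev (Lm alpha i j (a n))) phi.
have yle n : `|y n| <= tau i j n * (d%:R ^+ k * B).
  by apply: dist_ev_le => //; exact: spec_Lm_a.
have cy : cvgn (fun N => \sum_(n < N) `|y n|).
  apply: (@summable_cvg _ (fun n => `|y n|) (C * (d%:R ^+ k * B))) => // N.
  apply: le_trans (_ : \sum_(n < N) tau i j n * (d%:R ^+ k * B) <= _).
    by apply: ler_sum.
  by rewrite -mulr_suml ler_wpM2r// mulr_ge0 ?exprn_ge0.
have {cy} : cvgn (series y).
  apply: normed_cvg.
  have -> : [normed series y] = (fun N => \sum_(n < N) `|y n|).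
    by apply/funext => N; rewrite /= /series /= big_mkord.
  exact: cy.
rewrite /series /=; under eq_fun do rewrite big_mkord.
move=> cy; under eq_fun do rewrite dist_Lm_U//.
by move/cvg_ex: cy => [l yl]; apply/cvg_ex; exists l; rewrite -cvg_shiftS in yl.
Qed.

Lemma stress_distribution i j : is_distribution (stress i j).
Proof.
have [C C0 HC] := tau_sum.
apply: (@limit_distribution _ (fun N => tscale (-1) (Lm alpha i j (U N))) k C C0) => //.
- by move=> n; apply: spec_scale; apply: spec_Lm => i'; apply: spec_U => m;
    exact: spec_a_neq0.
- move=> n; rewrite wnorm_scale normrN1 mul1r.
  exact: le_trans (wnorm_Lm_U _ _ _) (HC _ _ _).
- by move=> phi tphi; apply/cvg_ex; exists (stress i j phi); exact: stress_cvg.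
Qed.

Lemma spec_neq0_cosm0 f : spec (fun m => m != 0) f ->
  distribution_of (ev f) (cosm 0) = 0 /\ distribution_of (ev f) (sinm 0) = 0.
Proof.
move=> sf; rewrite !dist_ev; [|exact: sinm_test|exact: cosm_test].
split; rewrite big_seq big1// => l /sf m0.
  by rewrite wave_cosm !(eq_sym 0) oppr_eq0 (negbTE m0); rewrite !mul0r !mulr0 addr0 mulr0.
by rewrite wave_sinm !(eq_sym 0) oppr_eq0 (negbTE m0); rewrite !mul0r !mulr0 subr0 mulr0.
Qed.

Lemma spec_Lm_U i j N : spec (fun m => m != 0) (Lm alpha i j (U N)).
Proof. by apply: spec_Lm => i'; apply: spec_U => n; exact: spec_a_neq0. Qed.

Lemma fourier_lim0 (F : functional R d) (f : nat -> seq (mode R d)) :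
  (forall n, spec (fun m => m != 0) (f n)) ->
  (forall phi, test_fun phi -> distribution_of (ev (f n)) phi @[n --> \oo] --> F phi) ->
  fourier F 0 = 0.
Proof.
move=> sf HF.
have H0 phi : test_fun phi -> (forall n, distribution_of (ev (f n)) phi = 0) -> F phi = 0.
  move=> tphi f0; have := HF _ tphi; under eq_fun do rewrite f0.
  by move=> H; apply: (cvg_unique _ H) => //; exact: cvg_cst.
rewrite /fourier (H0 _ (cosm_test _ 0)); last by move=> n; case: (spec_neq0_cosm0 (sf n)).
rewrite (H0 _ (sinm_test _ 0)); last by move=> n; case: (spec_neq0_cosm0 (sf n)).
by rewrite oppr0.
Qed.

(** *** The paraproduct *)

Variable u : vfunctional R d.
Hypothesis u_lim : forall i phi, test_fun phi ->
  distribution_of (ev (U N i)) phi @[N --> \oo] --> u i phi.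

Lemma P_dyadic_u n i x : P_dyadic chi n (u i) x = ev (block n i) x.
Proof.
have H := P_dyadic_lim (chi := chi) hchi (n := n) (F := u i)
  (Fn := fun N => distribution_of (ev (U N i))) (x := x) (fun m => u_lim (i := i) (cosm_test _ m))
  (fun m => u_lim (i := i) (sinm_test _ m)).
apply: (cvg_unique _ H) => //.
apply: cvg_near_cst; near=> N; rewrite P_dyadic_ev//; apply: dsym_U.
near: N; exists n => // N /= nN; lia.
Unshelve. all: by end_near. Qed.

Lemma LP_tensor_u n l i j : LP_tensor chi u (n, l) i j =
  distribution_of (fun x => ev (block n i) x * ev (block l j) x).
Proof. by apply: eq_dist => x /=; rewrite !P_dyadic_u. Qed.

Definition gamma_sym (p : nat * nat) : R :=
  if (p.2 <= p.1)%N then gamma p.1 p.2 else gamma p.2 p.1.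

Lemma Hdot_tensor p : (Hdot_norm (- k%:R) (LP_tensor chi u p) <=
  (d%:R * gamma_sym p)%:E)%E.
Proof.
case: p => n l; apply: wsumle_Hdot.
  by rewrite /gamma_sym; case: ifP.
move=> i j; rewrite LP_tensor_u /gamma_sym /=; case: leqP => [ln|nl].
  have [G GE GG] := gammaP i j ln.
  by rewrite (eq_dist GE); apply: wsumleW GG _; exact: wsumle_ev.
have [G GE GG] := gammaP j i (ltnW nl).
rewrite (eq_dist (H := ev G)); first by apply: wsumleW GG _; exact: wsumle_ev.
by move=> x; rewrite mulrC GE.
Qed.

Lemma gamma_sym_sum N : \sum_(p <- [seq (n, l) | n <- iota 0 N, l <- iota 0 N])
  gamma_sym p <= 2 * Gamma.
Proof.
rewrite big_allpairs_dep /=.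
have -> : \sum_(n <- iota 0 N) \sum_(l <- iota 0 N) gamma_sym (n, l) =
    \sum_(n < N) \sum_(l < N) gamma_sym (n : nat, l : nat).
  rewrite -(big_mkord xpredT (fun n => \sum_(l < N) gamma_sym (n, l : nat))).
  rewrite /index_iota subn0; apply: eq_bigr => n _.
  by rewrite -(big_mkord xpredT (fun l => gamma_sym (n, l))) /index_iota subn0.
have H (n : 'I_N) : \sum_(l < N) (if (l <= n)%N then gamma n l else 0) =
    \sum_(l < n.+1) gamma n l.
  by rewrite (big_ord_widen N (fun l => gamma n l)) ?ltn_ord// [RHS]big_mkcond.
apply: (@le_trans _ _ (\sum_(n < N) \sum_(l < N)
   ((if (l <= n)%N then gamma n l else 0) + (if (n <= l)%N then gamma l n else 0)))).
  apply: ler_sum => n _; apply: ler_sum => l _; rewrite /gamma_sym /=.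
  case: leqP => ln; first by rewrite lerDl; case: ifP.
  by rewrite (ltnW ln) add0r.
under eq_bigr do rewrite big_split /=.
rewrite big_split /= [X in _ + X]exchange_big /=.
under eq_bigr do rewrite H.
by have := gamma_sum N; lra.
Qed.

Lemma paraproduct_u : paraproduct_well_defined chi k%:R u.
Proof.
rewrite /paraproduct_well_defined.
apply: (@le_lt_trans _ _ (d%:R * (2 * Gamma))%:E); last exact: ltry.
apply: ge_ereal_sup => _ [X [finX _] <-].
rewrite fsbig_finite//.
pose r : seq (nat * nat) := finmap.enum_fset (fset_set X).
apply: (@le_trans _ _ (\sum_(p <- r) (d%:R * gamma_sym p)%:E)%E).
  by apply: lee_sum => p _; exact: Hdot_tensor.
rewrite sumEFin lee_fin -mulr_sumr ler_wpM2l//.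
pose N := (\max_(p <- r) (maxn p.1 p.2)).+1.
apply: le_trans (gamma_sym_sum N).
set s := [seq (n, l) | n <- iota 0 N, l <- iota 0 N].
have us : uniq s by apply: allpairs_uniq; rewrite ?iota_uniq// => -[? ?] [? ?].
have rs : {subset r <= s}.
  move=> [n l] pr; have /= := leq_bigmax_seq (F := fun p : nat * nat => maxn p.1 p.2) (P := xpredT) (n, l) pr erefl.
  rewrite -ltnS -/N => nlN; apply/allpairsP; exists (n, l).
  by rewrite !mem_iota/=; split => //; lia.
have -> : \sum_(p <- r) gamma_sym p = \sum_(p <- [seq p <- s | p \in r]) gamma_sym p.
  apply: perm_big; apply: uniq_perm; rewrite ?filter_uniq//; first exact: finmap.fset_uniq.
  by move=> p; rewrite mem_filter; case: (boolP (p \in r)) => // /rs ->.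
rewrite big_filter [leRHS](bigID (mem r)) /= lerDl sumr_ge0// => p _.
by rewrite /gamma_sym; case: ifP.
Qed.

(** The blocks of u up to nv + N add up to U N, and U N satisfies the equation up
    to E N. *)
Lemma sum_tensor N i j (phi : 'rV[R]_d -> R) : test_fun phi ->
  (\sum_(n < (nv + N).+1) \sum_(l < (nv + N).+1)
     LP_tensor chi u (n : nat, l : nat))%R i j phi =
  distribution_of (ev (E N i j)) phi - distribution_of (ev (Lm alpha i j (U N))) phi.
Proof.
move=> tphi; set K := (nv + N).+1.
rewrite !fct_sumE.
under eq_bigr do rewrite !fct_sumE.
transitivity (\sum_(n < K) \sum_(l < K) \int[mu]_t
   (ev (block n i) (row_of t) * ev (block l j) (row_of t) * phi (row_of t))).
  by apply: eq_bigr => n _; apply: eq_bigr => l _; rewrite LP_tensor_u.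
have bp n l : mu.-integrable setT (EFin \o (fun t : mtuple =>
    ev (block n i) (row_of t) * ev (block l j) (row_of t) * phi (row_of t))).
  by apply/bdm_integrable/bdmM; [apply: bdmM; exact: bdm_ev|exact: bdm_test].
have be f : mu.-integrable setT (EFin \o (fun t : mtuple => ev f (row_of t) * phi (row_of t))).
  by apply/bdm_integrable/bdmM; [exact: bdm_ev|exact: bdm_test].
rewrite /distribution_of -RintegralB//.
transitivity (\int[mu]_t (\sum_(n < K) \sum_(l < K)
   (ev (block n i) (row_of t) * ev (block l j) (row_of t) * phi (row_of t)))).
  rewrite Rint_sum; last first.
    move=> n; apply: bdm_integrable; apply: bdm_sum => l.
    by apply: bdmM; [apply: bdmM; exact: bdm_ev|exact: bdm_test].
  by apply: eq_bigr => n _; rewrite Rint_sum.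
apply: eq_Rintegral => t _; rewrite -EP mulrDl addrK -!sum_block.
by rewrite mulr_suml mulr_suml; apply: eq_bigr => n _; rewrite mulr_sumr mulr_suml.
Qed.

Lemma wsumle_stress i j C : (forall N, \sum_(n < N) tau i j n <= C) ->
  wsumle k (stress i j) C.
Proof.
move=> HC; apply: (wsumle_lim (Fn := fun N =>
    distribution_of (ev (tscale (-1) (Lm alpha i j (U N)))))).
- by move=> m; apply: stress_cvg; exact: cosm_test.
- by move=> m; apply: stress_cvg; exact: sinm_test.
apply: nearW => N; apply: wsumleW (wsumle_ev _ _).
rewrite wnorm_scale normrN1 mul1r; exact: le_trans (wnorm_Lm_U _ _ _) (HC _).
Qed.

Lemma wnorm_Lm_tail i j N N' : exists2 f,
  wnorm (hweight R k) f <= \sum_(n < N') tau i j (N.+1 + n)%N &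
  forall phi, test_fun phi -> distribution_of (ev (Lm alpha i j (U (N + N')))) phi =
    distribution_of (ev (Lm alpha i j (U N))) phi + distribution_of (ev f) phi.
Proof.
elim: N' => [|N' [f ff fE]].
  exists [::]; first by rewrite wnorm_nil big_ord0.
  by move=> phi tphi; rewrite addn0 [X in _ + X]dist_ev// big_nil addr0.
exists (f ++ Lm alpha i j (a (N.+1 + N')%N)).
  by rewrite wnorm_cat big_ord_recr /= lerD.
move=> phi tphi; rewrite addnS /= dist_Lm// fE// dist_cat// addrA.
by rewrite -addSn.
Qed.

(** The stress differs from a partial sum of the paraproduct by the error E N and
    by the part of Lm u that comes from the later blocks. *)
Lemma wsumle_tail i j N C :
  (forall N', \sum_(n < N') tau i j (N.+1 + n)%N <= C) ->
  wsumle k (fun phi => stress i j phi -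
    (distribution_of (ev (E N i j)) phi - distribution_of (ev (Lm alpha i j (U N))) phi))
    (C + wnorm (hweight R k) (E N i j)).
Proof.
move=> HC.
apply: (wsumleD (G := fun phi => stress i j phi +
    distribution_of (ev (Lm alpha i j (U N))) phi)
    (H := distribution_of (ev (tscale (-1) (E N i j))))).
- by move=> m; rewrite dist_opp; [ring|exact: cosm_test].
- by move=> m; rewrite dist_opp; [ring|exact: sinm_test].
- pose Fn N' : functional R d := fun phi =>
    distribution_of (ev (tscale (-1) (Lm alpha i j (U (N + N'))))) phi +
    distribution_of (ev (Lm alpha i j (U N))) phi.
  have Fcvg phi : test_fun phi -> Fn N' phi @[N' --> \oo] -->
      stress i j phi + distribution_of (ev (Lm alpha i j (U N))) phi.
    move=> tphi; apply: cvgD; last exact: cvg_cst.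
    rewrite (_ : (fun N' => _) = [sequence (distribution_of
      (ev (tscale (-1) (Lm alpha i j (U (N' + N))))) phi)]_N').
      rewrite (cvg_shiftn N (fun N' => distribution_of
        (ev (tscale (-1) (Lm alpha i j (U N')))) phi)).
      exact: stress_cvg.
    by apply/funext => N' /=; rewrite addnC.
  apply: (wsumle_lim (Fn := Fn)).
  + by move=> m; apply: Fcvg; exact: cosm_test.
  + by move=> m; apply: Fcvg; exact: sinm_test.
  apply: nearW => N'; have [f ff fE] := wnorm_Lm_tail i j N N'.
  apply: wsumleW (HC N') _; apply: wsumleW ff _.
  have -> : wnorm (hweight R k) f = wnorm (hweight R k) (tscale (-1) f).
    by rewrite wnorm_scale normrN1 mul1r.
  have W := wsumle_ev k (tscale (-1) f).
  move=> r ur; apply: le_trans (W r ur); apply: ler_sum => m _.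
  rewrite /nfour /Fn !dist_opp ?fE ?dist_opp//; try exact: cosm_test; try exact: sinm_test.
  set X := distribution_of (ev (Lm _ _ _ _)) _; set Y := distribution_of (ev (Lm _ _ _ _)) _.
  rewrite (_ : - (X + _) + X = - distribution_of (ev f) (cosm m)); last by ring.
  by rewrite (_ : - (Y + _) + Y = - distribution_of (ev f) (sinm m)); last by ring.
- rewrite -[X in wsumle _ _ X](_ : wnorm (hweight R k) (tscale (-1) (E N i j)) = _).
    exact: wsumle_ev.
  by rewrite wnorm_scale normrN1 mul1r.
Qed.

Lemma is_paraproduct_u : is_paraproduct chi k%:R u stress.
Proof.
have [C C0 HC] := tau_sum.
split.
- split; first exact: stress_distribution.
  apply: le_lt_trans (_ : (_ <= (d%:R * C)%:E)%E) _; last exact: ltry.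
  by apply: wsumle_Hdot => // i j; exact: wsumle_stress.
- move=> i j; apply: (@fourier_lim0 _ (fun N => tscale (-1) (Lm alpha i j (U N)))).
    by move=> N; apply: spec_scale; exact: spec_Lm_U.
  by move=> phi; exact: stress_cvg.
pose tau' n := \sum_i \sum_j tau i j n.
pose E' N := \sum_i \sum_j wnorm (hweight R k) (E N i j).
have tau'0 n : 0 <= tau' n by apply: sumr_ge0 => i _; apply: sumr_ge0 => j _; exact: tau_ge0.
have W0 f : 0 <= wnorm (hweight R k) f by apply: wnorm_ge0 => m; exact: hweight_ge0.
have E'0 n : 0 <= E' n by apply: sumr_ge0 => i _; apply: sumr_ge0 => j _.
have tauS N : \sum_(n < N) tau' n <= \sum_(i < d) \sum_(j < d) C.
  rewrite exchange_big /=; apply: ler_sum => i _; rewrite exchange_big /=.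
  by apply: ler_sum => j _; exact: HC.
have ctau := summable_cvg tau'0 tauS.
pose L := limn (fun N => \sum_(n < N) tau' n).
have leL N : \sum_(n < N) tau' n <= L.
  apply: nondecreasing_cvgn_le => //; apply/nondecreasing_seqP => n.
  by rewrite big_ord_recr /= lerDl.
pose z N := d%:R * ((L - \sum_(n < N.+1) tau' n) + E' N).
have z_cvg : z N @[N --> \oo] --> 0.
  rewrite -(mulr0 d%:R); apply: cvgM; first exact: cvg_cst.
  rewrite -[X in _ --> X]addr0; apply: cvgD.
    have cL : L - \sum_(n < N.+1) tau' n @[N --> \oo] --> L - L.
      apply: cvgB; first exact: cvg_cst.
      by rewrite (cvg_shiftS (fun N => \sum_(n < N) tau' n)).
    by rewrite subrr in cL.
  have cE : E' N @[N --> \oo] --> \sum_(i < d) \sum_(j < d) (0 : R).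
    by apply: cvg_bigsum => i; apply: cvg_bigsum => j; exact: E_cvg0.
  by rewrite big1 in cE => // i _; rewrite big1.
have bound N : (Hdot_norm (- k%:R) (stress - \sum_(n < (nv + N).+1)
    \sum_(l < (nv + N).+1) LP_tensor chi u (n : nat, l : nat))%R <= (z N)%:E)%E.
  apply: wsumle_Hdot; first by rewrite addr_ge0// subr_ge0.
  move=> i j.
  have tail N' : \sum_(n < N') tau i j (N.+1 + n)%N <= L - \sum_(n < N.+1) tau' n.
    rewrite lerBrDl; apply: le_trans (leL (N.+1 + N')%N).
    rewrite big_split_ord /= lerD// ?lerD//.
    apply: ler_sum => n _; rewrite /tau' (bigD1 i)//= (bigD1 j)//= -addrA lerDl.
    by apply: addr_ge0; apply: sumr_ge0 => i' _; rewrite ?tau_ge0// sumr_ge0// => j' _; exact: tau_ge0.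
  have le1 : wnorm (hweight R k) (E N i j) <= E' N.
    rewrite /E' (bigD1 i)//= (bigD1 j)//= -addrA lerDl.
    by rewrite addr_ge0// sumr_ge0// => i' _; rewrite ?sumr_ge0.
  have W := wsumle_tail tail.
  apply: (wsumleW (c := (L - \sum_(n < N.+1) tau' n) + wnorm (hweight R k) (E N i j))).
    by rewrite lerD2l.
  move=> r ur; apply: le_trans (W r ur); apply: ler_sum => m _.
  rewrite /nfour /= -(sum_tensor N i j (cosm_test _ m)) -(sum_tensor N i j (sinm_test _ m)).
  exact: lexx.
rewrite -(cvg_shiftn nv.+1).
have zE : (z N)%:E @[N --> \oo] --> 0%:E by apply: cvg_EFin; [exact: nearW|exact: z_cvg].
have c0 : (fun=> 0%E : \bar R) @ \oo --> 0%:E by exact: cvg_cst.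
refine (squeeze_cvge _ c0 zE).
near=> N; apply/andP; split; first exact: sqrte_ge0.
by rewrite /= (_ : (N + nv.+1 = (nv + N).+1)%N) ?bound//; lia.
Unshelve. all: by end_near. Qed.

(** The identity of stress_pairing for the partial sums passes to the limit. *)
Lemma u_equation (phi : 'I_d -> 'rV[R]_d -> R) :
  (forall i, distribution_of (ev (U N i)) (frac_laplacian alpha (phi i)) @[N --> \oo]
    --> u i (frac_laplacian alpha (phi i))) ->
  (forall i, test_fun (phi i)) -> (forall x, \sum_i partial i (phi i) x = 0) ->
  - (\sum_i \sum_j stress i j (partial j (phi i))) +
    \sum_i u i (frac_laplacian alpha (phi i)) = 0.
Proof.
move=> lapl tphi divphi; apply/eqP; rewrite addrC subr_eq0 eq_sym; apply/eqP.
have tp i j : test_fun (partial j (phi i)) by exact: test_partial.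
have lim1 : \sum_i \sum_j distribution_of (ev (tscale (-1) (Lm alpha i j (U N))))
    (partial j (phi i)) @[N --> \oo] --> \sum_i \sum_j stress i j (partial j (phi i)).
  by apply: cvg_bigsum => i; apply: cvg_bigsum => j; exact: stress_cvg.
apply: (cvg_unique _ lim1) => //.
rewrite (_ : (fun N => _) = (fun N => \sum_i distribution_of (ev (U N i))
    (frac_laplacian alpha (phi i)))); first by apply: cvg_bigsum => i; exact: lapl.
apply/funext => N; rewrite -[RHS]opprK -(stress_pairing alpha_gt0 _ tphi divphi) -sumrN.
by apply: eq_bigr => i _; rewrite -sumrN; apply: eq_bigr => j _; rewrite dist_opp.
Qed.

End assembly.

(** What makes the sum of the fields a n a singular solution. The blocks are
    summable in L^p for p < 2 and in Besov spaces of negative order; their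
    products are summable in a space of order -(k'+1), which makes the paraproduct
    converge; and the partial sums satisfy the equation up to errors that vanish
    in the same space. *)
Record good_blocks (R : realType) (d : nat) (chi : 'rV[R]_d -> R) (alpha : R)
    (nv k' : nat) (a : nat -> 'I_d -> seq (mode R d)) : Prop := GoodBlocks {
  gb_spec0 : forall i, spec (fun m => (m != 0) &&
    (fnorm R m < 9 / 10 * 2 ^+ nv)) (a 0 i);
  gb_specS : forall n i, spec (fun m => (2 ^+ (nv + n) <= fnorm R m) &&
    (fnorm R m < 9 / 10 * 2 ^+ (nv + n).+1)) (a n.+1 i);
  gb_div : forall n x, \sum_i ev (pderiv i (a n i)) x = 0;
  gb_sum : exists (delta : nat -> R) (D : R), [/\ (forall n, 0 <= delta n),
    (forall N, \sum_(n < N) delta n <= D),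
    (forall p : R, 1 <= p < 2 -> \forall n \near \oo, forall i,
      (Lnorm (torus_measure R d) p%:E (fun t => (ev (a n i) (row_of t))%:E) <=
       (delta n)%:E)%E) &
    (forall theta : R, 0 < theta -> \forall n \near \oo,
      forall i, (2 ^+ (nv + n)) `^ (- theta) * anorm (a n i) <= delta n)];
  gb_tensor : exists (gamma : nat -> nat -> R) (Gamma : R), [/\
    (forall n l, 0 <= gamma n l),
    (forall N, \sum_(n < N) \sum_(l < n.+1) gamma n l <= Gamma) &
    (forall n l i j, (l <= n)%N -> exists2 G,
      (forall x, ev (block chi nv a n i) x * ev (block chi nv a l j) x = ev G x) &
      wnorm (hweight R k'.+1) G <= gamma n l)];
  gb_equation : exists E : nat -> 'I_d -> 'I_d -> seq (mode R d),
    (forall N i j x, ev (U a N i) x * ev (U a N j) x + ev (Lm alpha i j (U a N)) x =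
      ev (E N i j) x) /\
    (forall i j, wnorm (hweight R k'.+1) (E N i j) @[N --> \oo] --> 0) }.

(** The tensor - Lm u is the paraproduct of the sum u with itself, and its
    divergence cancels the fractional Laplacian. *)
Theorem singular_solution_of_blocks (R : realType) (d : nat) (chi : 'rV[R]_d -> R)
    (alpha : R) (nv k' : nat) (a : nat -> 'I_d -> seq (mode R d)) :
  bump_function chi -> 0 < alpha -> 2 * alpha <= k'%:R ->
  good_blocks chi alpha nv k' a ->
  exists g : 'I_d -> d.-tuple (measurableTypeR R) -> R,
  let u : vfunctional R d := fun i phi =>
    \int[torus_measure R d]_t ((ev (a 0 i) (row_of t) + g i t) * phi (row_of t)) in
  [/\ singular_solutions chi alpha u,
    (forall i, (torus_measure R d).-integrable setT (EFin \o g i)),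
    (forall i p B, 1 <= p -> 0 <= B ->
      (forall N, \sum_(n < N) fine (Lnorm (torus_measure R d) p%:E
        (fun t => (ev (a n.+1 i) (row_of t))%:E)) <= B) ->
      (Lnorm (torus_measure R d) p%:E (EFin \o g i) <= B%:E)%E) &
    (forall n i x, P_dyadic chi n (u i) x = ev (block chi nv a n i) x)].
Proof.
move=> hchi alpha0 hk [s0 sS div_a [delta [D [delta0 Dsum Lp_a anorm_a]]]
  [gamma [Gamma [gamma0 Gsum gammaP]]] [E [EP E0]]].
set mu := torus_measure R d.
have spec0 n i : spec (fun m => m != 0) (a n i) by eapply spec_a_neq0; eassumption.
have /choice[g Hg] := limit_exists delta0 Dsum Lp_a.
exists g => u.
have u_lim i phi : bdm (fun t : d.-tuple (measurableTypeR R) => phi (row_of t)) ->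
    distribution_of (ev (U a N i)) phi @[N --> \oo] --> u i phi.
  by have [_ + _] := Hg i; exact.
have u_limt i phi : test_fun phi ->
    distribution_of (ev (U a N i)) phi @[N --> \oo] --> u i phi.
  by move=> tphi; apply: u_lim; exact: bdm_test.
have iu i : mu.-integrable setT (EFin \o (fun t => ev (a 0 i) (row_of t) + g i t)).
  have [ig _ _] := Hg i.
  have ia := bdm_integrable mu (bdm_ev (a 0 i)).
  by apply: eq_integrable (integrableD measurableT ia ig).
have Pu n i x : P_dyadic chi n (u i) x = ev (block chi nv a n i) x.
  by eapply P_dyadic_u; eassumption.
have ud : is_vdistribution u by move=> i; exact: integrable_distribution.
have pi1 : 1 <= (1 : R) < 2 by apply/andP; split; lra.
split => //; last 1 first.
- by move=> i; case: (Hg i).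
split.
- split => //.
  + move=> i; apply: (fourier_lim0 (f := fun N => U a N i)); last exact: u_limt.
    by move=> N; apply: spec_U => n; exact: spec0.
  + move=> phi tphi.
    have tp i : test_fun (partial i phi) by exact: test_partial.
    have lim1 : \sum_i distribution_of (ev (U a N i)) (partial i phi) @[N --> \oo]
        --> \sum_i u i (partial i phi).
      by apply: cvg_bigsum => i; exact: u_limt.
    apply: (cvg_unique _ lim1) => //.
    suff -> : (fun N => \sum_i distribution_of (ev (U a N i)) (partial i phi)) =
      (fun=> 0) by exact: cvg_cst.
    apply/funext => N; under eq_bigr do rewrite dist_partial//.
    rewrite sumrN /distribution_of -Rint_sum; last first.
      by move=> i; apply/bdm_integrable/bdmM; [exact: bdm_ev|exact: bdm_test].
    under eq_Rintegral do rewrite -mulr_suml.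
    transitivity (- \int[mu]_t (0 : R)); last by rewrite Rint_cst oppr0.
    congr (- _); apply: eq_Rintegral => t _.
    rewrite (_ : \sum_i _ = 0) ?mul0r//.
    elim: N => [|N IH]; first exact: div_a.
    rewrite /= /pderiv; under eq_bigr do rewrite imult_cat ev_cat.
    by rewrite big_split /= IH div_a addr0.
  + exists k'.+1%:R; split => //; first by eapply paraproduct_u; eassumption.
    exists (stress alpha a).
      by eapply is_paraproduct_u; eassumption.
    move=> phi tphi divphi.
    eapply u_equation; try eassumption; move=> i.
    by apply: u_lim; have [] := frac_laplacian_spec alpha0 (tphi i).
- move=> p /[dup] p12 /andP[p1 _]; split => //.
  have [C C0 HC] : exists2 C, 0 <= C & forall i N, \sum_(n < N) fine
      (Lnorm mu p%:E (fun t => (ev (a n i) (row_of t))%:E)) <= C.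
    by eapply Lp_sum; eassumption.
  have q1 : (1 <= p%:E)%E by rewrite lee_fin.
  have mG i : measurable_fun setT (g i).
    by have [/integrableP[/measurable_EFinP]] := Hg i.
  have mS i : measurable_fun setT (fun t => ev (a 0 i) (row_of t) + g i t).
    by apply: measurable_funD => //; exact: measurable_ev.
  apply: (@le_lt_trans _ _ (\sum_i ((anorm (a 0 i))%:E + C%:E))%E); last first.
    by rewrite sumEFin ltry.
  apply: (@le_trans _ _ (Lnorm mu p%:E (fun t =>
      (enorm (fun i => ev (a 0 i) (row_of t) + g i t))%:E))).
    apply: ereal_inf_lbound; exists (fun i t => ev (a 0 i) (row_of t) + g i t) => //.
  apply: le_trans (Lnorm_enorm_le q1 mS) _; apply: lee_sum => i _.
  apply: le_trans (LnormD _ q1 (measurable_ev (a 0 i)) (mG i)) _.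
  apply: leeD; first exact: Lnorm_ev_le.
  have [_ _ L] := Hg i; apply: L => // N; apply: le_trans (HC i N.+1).
  by rewrite big_ord_recl lerDr fine_ge0// Lnorm_ge0.
move=> theta q r theta0 q1 r1; split => //.
pose y n := \sum_i anorm (block chi nv a n i).
have y0 n : 0 <= y n by apply: sumr_ge0 => i _; exact: anorm_ge0.
pose x n := (2 ^+ n) `^ (- theta) * y n : R.
have x0 n : 0 <= x n by rewrite mulr_ge0// powR_ge0.
pose delta' n := d%:R * delta (n - nv)%N.
have D0 : 0 <= D by have := Dsum 0%N; rewrite big_ord0.
have delta'0 n : 0 <= delta' n by rewrite mulr_ge0.
have delta'S N : \sum_(n < N) delta' n <= d%:R * (nv.+1%:R * delta 0 + D).
  rewrite -mulr_sumr ler_wpM2l//.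
  apply: (@le_trans _ _ (\sum_(n < nv.+1 + N) delta (n - nv)%N)).
    rewrite (big_ord_widen (nv.+1 + N)%N (fun n => delta (n - nv)%N)) ?leq_addl//.
    by rewrite [leRHS](bigID (fun n : 'I__ => (n < N)%N))/= lerDl sumr_ge0.
  rewrite big_split_ord /= lerD//.
    apply: (@le_trans _ _ (\sum_(n < nv.+1) delta 0)).
      apply: ler_sum => n _; rewrite (_ : (n - nv = 0)%N)//.
      by apply/eqP; rewrite subn_eq0 -ltnS ltn_ord.
    by rewrite sumr_const card_ord mulr_natl.
  apply: le_trans (Dsum N.+1); rewrite big_ord_recl /= ler_wpDl//.
  by apply: ler_sum => n _; rewrite (_ : (nv.+1 + n - nv = n.+1)%N)//; lia.
have near_x : \forall n \near \oo, x n <= delta' n.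
  have [n0 _ Hn0] := anorm_a _ theta0.
  near=> n.
  have nn : (nv + n0 < n)%N by near: n; exact: nbhs_infty_gt.
  rewrite /x /y mulr_sumr /delta' mulr_natl -[d in leRHS]card_ord -sumr_const.
  apply: ler_sum => i _; rewrite /block leqNgt (leq_ltn_trans (leq_addr _ _) nn) /=.
  rewrite -[in (2 ^+ n)](_ : (nv + (n - nv) = n)%N); last by lia.
  by apply: Hn0 => /=; lia.
have [Y Y0 HY] := summable_near delta'0 x0 delta'S near_x.
apply: le_lt_trans (besov_le r1 y0 Y0 _ HY) _; last exact: ltry.
by move=> n; apply: LP_norm_ev_le => // i z; exact: Pu.
by move=> i; case: (Hg i).
Unshelve. all: by end_near. Qed.

(** * One oscillating block *)

Section interpolation.
Context {disp : measure_display} {T : measurableType disp} {R : realType}.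
Variable P : probability T R.

(** Where |f| <= L the power |f|^p is at most L |f|, elsewhere it is at most
    L^(p-2) f^2. *)
Lemma Lnorm_interp (f : T -> R) (L delta c p : R) : bdm f -> 1 <= L ->
  0 < delta -> 0 <= c <= 1 ->
  L * \int[P]_t `|f t| + L `^ (- delta) * \int[P]_t (f t ^+ 2) <= c ^+ 2 ->
  1 <= p <= 2 - delta -> (Lnorm P p%:E (EFin \o f) <= c%:E)%E.
Proof.
move=> bf L1 d0 /andP[c0 c1] Hc /andP[p1 p2].
have p0 : 0 < p by exact: lt_le_trans ltr01 p1.
have L0 : 0 < L by exact: lt_le_trans ltr01 L1.
have [mf [C HC]] := bf.
have b1 : bdm (fun t => `|f t|) by exact: bdm_norm.
have b2 : bdm (fun t => f t ^+ 2).
  by rewrite (_ : (fun t => _) = (fun t => f t * f t)); [exact: bdmM|apply/funext => t; rewrite expr2].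
have b3 : bdm (fun t => L * `|f t| + L `^ (- delta) * f t ^+ 2).
  by apply: bdmD; exact: bdmZ.
have pt t : `|f t| `^ p <= L * `|f t| + L `^ (- delta) * f t ^+ 2.
  have q0 : 0 <= L `^ (- delta) * f t ^+ 2 by rewrite mulr_ge0 ?powR_ge0 ?sqr_ge0.
  have [fL|Lf] := leP `|f t| L.
    rewrite ler_wpDr// -mulr_powRB1// mulrC ler_wpM2r//.
    have [f1|f1] := leP `|f t| 1.
      apply: le_trans L1; have e : 1 `^ (p - 1) = 1 :> R by rewrite powR1.
      rewrite -[X in _ <= X]e.
      by rewrite ge0_ler_powR ?nnegrE ?subr_ge0.
    apply: le_trans fL; rewrite -[leRHS]powRr1//.
    by apply: ler_powR; [exact: ltW|lra].
  have f0 : 0 < `|f t| by exact: lt_trans L0 Lf.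
  rewrite ler_wpDl ?mulr_ge0 ?(ltW L0)// -real_normK ?num_real//.
  have -> : p = (p - 2) + 2 by ring.
  rewrite powRD; last by rewrite (gt_eqF f0) implybT.
  rewrite -[2 in X in _ * X]/(2%:R) powR_mulrn// ler_wpM2r ?sqr_ge0//.
  apply: (@le_trans _ _ (L `^ (p - 2))).
    have -> : p - 2 = - (2 - p) by ring.
    rewrite !powRN lef_pV2 ?posrE ?powR_gt0//.
    by rewrite ge0_ler_powR ?nnegrE ?(ltW L0) ?(ltW Lf)//; lra.
  by apply: ler_powR => //; lra.
have I : (\int[P]_t (`|f t| `^ p)%:E <= (c ^+ 2)%:E)%E.
  apply: (@le_trans _ _ (\int[P]_t (L * `|f t| + L `^ (- delta) * f t ^+ 2)%:E)%E).
    apply: ge0_le_integral => //.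
    - exact: measurable_norm_powR.
    - by apply/measurable_EFinP; case: b3.
    - by move=> t _; rewrite lee_fin pt.
  rewrite -[X in (X <= _)%E]fineK; last first.
    by apply: integrable_fin_num => //; exact: bdm_integrable.
  rewrite lee_fin; apply: le_trans Hc; rewrite -[X in X <= _]/(\int[P]_t _).
  rewrite RintegralD//; try exact/bdm_integrable/bdmZ.
  by rewrite !RintegralZl//; exact: bdm_integrable.
rewrite unlock.
have -> : c%:E = ((c `^ p)%:E `^ p^-1)%E.
  by rewrite poweR_EFin -powRrM mulfV ?gt_eqF// powRr1.
apply: poweR_mono; first by rewrite invr_ge0 ltW.
  by apply: integral_ge0 => t _; rewrite lee_fin powR_ge0.
apply: (le_trans I); rewrite lee_fin -powR_mulrn//.
have [->|cn] := eqVneq c 0.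
  by rewrite !powR0 ?gt_eqF// pnatr_eq0.
by rewrite ger_powR// ?lt0r ?cn ?c0//; lra.
Qed.

End interpolation.

Section high_frequencies.
Variables (R : realType) (d : nat).
Local Notation mu := (torus_measure R d).
Local Notation freq := 'rV[int]_d.
Local Notation fnorm := (fnorm R).
Implicit Types (f g : seq (mode R d)) (m : freq) (x : 'rV[R]_d).
Local Notation row_of := (@row_of R d).

Lemma wnorm_high k f (L : R) : 0 < L -> spec (fun m => L <= fnorm m) f ->
  wnorm (hweight R k.+1) f <= L^-1 * anorm f.
Proof.
move=> L0 sf; apply: wnorm_le_spec => l /sf Ll; exact: hweight_le.
Qed.

Lemma spec_mul_high f g (L D : R) :
  spec (fun m => L + D <= fnorm m) f -> spec (fun m => fnorm m <= D) g ->
  spec (fun m => L <= fnorm m) (tmul f g).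
Proof.
apply: spec_mul => m m' H1 H2.
by have := fnorm_lb R m m'; have := fnorm_lbB R m m'; split; lra.
Qed.

Lemma spec_mul_low f g (C D : R) :
  spec (fun m => fnorm m <= C) f -> spec (fun m => fnorm m <= D) g ->
  spec (fun m => fnorm m <= C + D) (tmul f g).
Proof.
apply: spec_mul => m m' H1 H2.
by have := fnormD R m m'; have := fnormB R m m'; split; lra.
Qed.

Lemma spec_low_mul f g (L D : R) :
  spec (fun m => fnorm m <= D) f -> spec (fun m => L + D <= fnorm m) g ->
  spec (fun m => L <= fnorm m) (tmul f g).
Proof.
apply: spec_mul => m m' H1 H2; rewrite [m + m']addrC.
have := fnorm_lb R m' m; have := fnorm_lbB R m' m.
by rewrite -(fnormN R (m' - m)) opprB; split; lra.
Qed.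

Lemma high_neq0 f (L : R) : 0 < L -> spec (fun m => L <= fnorm m) f ->
  spec (fun m => m != 0) f.
Proof.
move=> L0; apply: specW => m; apply: contraTneq => ->.
by rewrite (fnorm0 R d) leNgt L0.
Qed.

(** The product has high frequencies only, and there the weight is small. *)
Lemma wnorm_osc k f m b (L c : R) : 0 < L -> L + deg f <= fnorm m ->
  wnorm (hweight R k.+1) (tmul f [:: (c, m, b)]) <= L^-1 * (anorm f * `|c|) /\
  spec (fun m => m != 0) (tmul f [:: (c, m, b)]).
Proof.
move=> L0 Lm.
have S : spec (fun m => L <= fnorm m) (tmul f [:: (c, m, b)]).
  apply: (@spec_low_mul f _ L (deg f)); first exact: spec_deg.
  by apply: spec_cons; [exact: Lm|exact: spec_nil].
split; last exact: high_neq0 S.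
apply: le_trans (wnorm_high _ L0 S) _; rewrite anorm_mul.
by rewrite /anorm wnorm_cons wnorm_nil mul1r addr0.
Qed.

Definition one_cos m : seq (mode R d) := [:: (1, 0, 0); (1, m, 0)].

Lemma ev_one_cos m x : ev (one_cos m) x = 1 + wave m 0 x.
Proof.
rewrite /one_cos !ev_cons ev_nil /amp /mfreq /shft /= !mul1r addr0.
by rewrite wave_cos phase0 cos0.
Qed.

Lemma ev_wave m b x (c : R) : ev [:: (c, m, b)] x = c * wave m b x.
Proof. by rewrite ev_cons ev_nil addr0. Qed.

Lemma wave_double m x : wave (m + m) 0 x = 2 * wave m 0 x ^+ 2 - 1.
Proof.
rewrite !wave_cos phaseD cosD.
have := cos2Dsin2 (phase m x); rewrite -!expr2; lra.
Qed.

Let s : R := Num.sqrt (2 / 3).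

Let s_sqr : s ^+ 2 = 2 / 3. Proof. by rewrite sqr_sqrtr. Qed.

Let s_ge0 : 0 <= s. Proof. exact: sqrtr_ge0. Qed.

Let s_lt1 : s < 1.
Proof.
rewrite -(@ltr_pXn2r _ 2) ?nnegrE// s_sqr expr1n; lra.
Qed.

(** Each multiplication by s (1 + cos), with a huge frequency, changes the square
    of the function by high frequencies only, but multiplies the mean of a
    nonnegative majorant by s < 1. *)
Lemma concentration_step k (xi : freq) (a : seq (mode R d)) J : xi != 0 ->
  forall eps, 0 < eps -> exists b E F, [/\
    forall x, ev b x ^+ 2 = ev a x ^+ 2 + ev E x,
    spec (fun m => m != 0) E, wnorm (hweight R k.+1) E <= eps,
    forall x, `|ev b x| <= ev F x &
    \int[mu]_t ev F (row_of t) = s ^+ J * anorm a].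
Proof.
move=> xi0; elim: J => [|J IH] eps eps0.
  exists a, [::], [:: (anorm a, 0, 0)]; split.
  - by move=> x; rewrite ev_nil addr0.
  - exact: spec_nil.
  - by rewrite wnorm_nil ltW.
  - by move=> x; rewrite ev_wave wave_cos phase0 cos0 mulr1; exact: ev_le_anorm.
  - by rewrite Rint_ev big_cons big_nil /= eqxx cos0 addr0 mulr1 mul1r.
have [|b [E [F [bE sE wE bF iF]]]] := IH (eps / 2); first by rewrite divr_gt0.
pose g := tmul b b.
pose L := 1 + 4 * anorm g / eps.
have A0 := anorm_ge0 g.
have L0 : 0 < L by rewrite ltr_pwDl// divr_ge0 ?mulr_ge0// ltW.
have D0 : 0 <= deg g by exact: deg_ge0. have DF0 : 0 <= deg F by exact: deg_ge0.
have B0 : 0 <= L + (deg g + deg F) by rewrite addr_ge0 ?(ltW L0) ?addr_ge0.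
pose M := Num.bound (L + (deg g + deg F)).
have HM : L + (deg g + deg F) <= fnorm (xi *+ M).
  rewrite fnormMn; apply: (@le_trans _ _ M%:R).
    by apply/ltW; exact: archi_boundP.
  by rewrite ler_peMr// fnorm_ge1.
set m := xi *+ M in HM.
have Hg : L + deg g <= fnorm m by lra.
have HF : L + deg F <= fnorm m by lra.
have Hg2 : L + deg g <= fnorm (m + m).
  by rewrite -mulr2n fnormMn; have := fnorm_ge0 R m; lra.
have [w1 n1] := wnorm_osc k 0 (4 / 3) L0 Hg.
have [w2 n2] := wnorm_osc k 0 (1 / 3) L0 Hg2.
have [_ nF] := wnorm_osc k 0 1 L0 HF.
(* s^2 (1 + cos y)^2 = 1 + (4/3) cos y + (1/3) cos 2y *)
exists (tscale s (tmul b (one_cos m))),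
  (E ++ tmul g [:: (4 / 3, m, 0)] ++ tmul g [:: (1 / 3, m + m, 0)]),
  (tscale s (tmul F (one_cos m))); split.
- move=> x; rewrite ev_scale ev_mul ev_one_cos !ev_cat !ev_mul !ev_wave wave_double.
  rewrite addrA -bE !exprMn s_sqr; by field.
- by apply: spec_cat => //; exact: spec_cat.
- rewrite !wnorm_cat.
  have e1 : `|4 / 3 : R| = 4 / 3 by rewrite ger0_norm.
  have e2 : `|1 / 3 : R| = 1 / 3 by rewrite ger0_norm.
  rewrite e1 in w1; rewrite e2 in w2.
  have LA : L^-1 * anorm g <= eps / 4.
    rewrite mulrC ler_pdivrMr// /L.
    have -> : eps / 4 * (1 + 4 * anorm g / eps) = eps / 4 + anorm g.
      by field; rewrite gt_eqF.
    lra.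
  rewrite mulrA in w1; rewrite mulrA in w2.
  lra.
- move=> x; rewrite !ev_scale !ev_mul !ev_one_cos normrM (ger0_norm s_ge0).
  have w0 : 0 <= 1 + wave m 0 x.
    have := wave_norm m 0 x; rewrite ler_norml => /andP[]; lra.
  by rewrite ler_wpM2l// normrM (ger0_norm w0) ler_wpM2r.
- rewrite exprS -mulrA -iF -RintegralZl//; last exact/bdm_integrable/bdm_ev.
  transitivity (\int[mu]_t (s * ev F (row_of t) + s * ev (tmul F [:: (1, m, 0)]) (row_of t))).
    apply: eq_Rintegral => t _; rewrite ev_scale !ev_mul ev_one_cos ev_wave; ring.
  rewrite RintegralD//; try exact/bdm_integrable/bdmZ/bdm_ev.
  rewrite [X in _ + X]RintegralZl//; last exact/bdm_integrable/bdm_ev.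
  by rewrite (Rint_ev0 nF) mulr0 addr0.
Qed.

(** After enough steps the integral of |b| is small although b^2 has kept its mean:
    b lives on a small set, where it is large. *)
Lemma concentration k (xi : freq) (a : seq (mode R d)) eps : xi != 0 -> 0 < eps ->
  exists b E, [/\ forall x, ev b x ^+ 2 = ev a x ^+ 2 + ev E x,
    wnorm (hweight R k.+1) E <= eps,
    \int[mu]_t `|ev b (row_of t)| <= eps &
    \int[mu]_t (ev b (row_of t) ^+ 2) <= anorm a ^+ 2].
Proof.
move=> xi0 eps0.
have [J HJ] : exists J, s ^+ J * anorm a <= eps.
  have c : s ^+ J * anorm a @[J --> \oo] --> 0 * anorm a.
    apply: cvgM; last exact: cvg_cst.
    by apply: cvg_expr; rewrite ger0_norm ?s_ge0 ?s_lt1.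
  rewrite mul0r in c; have /cvgrPdist_le/(_ _ eps0)[J _ HJ] := c.
  exists J; have := HJ J (leqnn J) => /=; rewrite sub0r normrN.
  exact: le_trans (ler_norm _).
have [b [E [F [bE sE wE bF iF]]]] := concentration_step k a J xi0 eps0.
have sq f : bdm (fun t : d.-tuple (measurableTypeR R) => ev f (row_of t) ^+ 2).
  rewrite (_ : (fun t => _) = (fun t => ev (tmul f f) (row_of t))); first exact: bdm_ev.
  by apply/funext => t; rewrite ev_mul expr2.
exists b, E; split => //.
  apply: le_trans HJ; rewrite -iF.
  by apply: le_Rint_bdm => //; [exact/bdm_norm/bdm_ev|exact: bdm_ev].
under eq_Rintegral do rewrite bE.
rewrite RintegralD//; try exact: bdm_integrable; last exact/bdm_integrable/bdm_ev.
rewrite (Rint_ev0 sE) addr0; apply: le_trans (ler_norm _) _.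
apply: Rint_le_bound => // t; rewrite ger0_norm ?sqr_ge0// -real_normK ?num_real//.
by rewrite lerXn2r ?nnegrE ?anorm_ge0 ?ev_le_anorm.
Qed.

(** *** Divergence free waves *)

Definition dot (u m : freq) : R := \sum_i (u 0 i)%:~R * (m 0 i)%:~R.

Lemma dotD u m m' : dot u (m + m') = dot u m + dot u m'.
Proof.
rewrite /dot -big_split; apply: eq_bigr => i _ /=.
by rewrite mxE intrD mulrDr.
Qed.

Lemma dotB u m m' : dot u (m - m') = dot u m - dot u m'.
Proof.
rewrite /dot -sumrB; apply: eq_bigr => i _ /=.
by rewrite !mxE intrD mulrDr intrN mulrN.
Qed.

Lemma dotMn u m n : dot u (m *+ n) = n%:R * dot u m.
Proof.
elim: n => [|n IH].
  by rewrite mul0r /dot big1// => i _; rewrite mulr0n mxE mulr0.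
by rewrite mulrS dotD IH -addn1 natrD; ring.
Qed.

Lemma dot_le (u m : freq) : (forall i, `|u 0 i| <= 1) -> `|dot u m| <= d%:R * fnorm m.
Proof.
move=> u1; apply: le_trans (ler_norm_sum _ _ _) _.
apply: (@le_trans _ _ (\sum_(i < d) fnorm m)); last first.
  by rewrite sumr_const card_ord mulr_natl.
apply: ler_sum => i _; rewrite normrM; apply: le_trans (coord_le_fnorm R m i).
by rewrite ler_piMl// -intr_norm -[1]/(1%:~R) ler_int.
Qed.

Variables (xi eta : freq).
Hypothesis orth : dot xi eta = 0.
Hypothesis xi1 : forall i, `|xi 0 i| <= 1.
Hypothesis eta1 : forall i, `|eta 0 i| <= 1.
Hypothesis xi_neq0 : xi != 0.
Hypothesis xi2 : fnorm xi ^+ 2 <= 2.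

Let xi_ge1 : 1 <= fnorm xi. Proof. exact: fnorm_ge1. Qed.

Let xi_le2 : fnorm xi <= 2.
Proof.
rewrite -(@ler_pXn2r _ 2) ?nnegrE ?fnorm_ge0//; apply: le_trans xi2 _; lra.
Qed.

(** The symbol of eta (xi.grad) - xi (eta.grad): its image is divergence free,
    and at multiples of xi it is parallel to eta. *)
Definition sigma (i : 'I_d) m : R :=
  2 * pi * ((eta 0 i)%:~R * dot xi m - (xi 0 i)%:~R * dot eta m).

Lemma sigmaD i m m' : sigma i (m + m') = sigma i m + sigma i m'.
Proof. by rewrite /sigma !dotD; ring. Qed.

Lemma sigmaB i m m' : sigma i (m - m') = sigma i m - sigma i m'.
Proof. by rewrite /sigma !dotB; ring. Qed.

Lemma sigma_xi i n :
  sigma i (xi *+ n) = n%:R * (2 * pi * (eta 0 i)%:~R * fnorm xi ^+ 2).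
Proof.
have d2 : dot eta xi = 0 by rewrite -orth; apply: eq_bigr => j _; rewrite mulrC.
have d1 : dot xi xi = fnorm xi ^+ 2 by rewrite fnorm_sqr; apply: eq_bigr => j _; rewrite expr2.
by rewrite /sigma !dotMn d1 d2; ring.
Qed.

Definition Csigma : R := 2 * pi * (2 * d%:R).

Lemma Csigma_ge0 : 0 <= Csigma.
Proof. by rewrite /Csigma mulr_ge0 ?mulr_ge0// pi_ge0. Qed.

Lemma sigma_le i m : `|sigma i m| <= Csigma * fnorm m.
Proof.
rewrite /sigma normrM (ger0_norm (ltW (twopi_gt0 R))) /Csigma -mulrA.
rewrite ler_wpM2l ?(ltW (twopi_gt0 R))//.
have H (u v : freq) : (forall i, `|u 0 i| <= 1) -> (forall i, `|v 0 i| <= 1) ->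
    `|(u 0 i)%:~R * dot v m| <= d%:R * fnorm m.
  move=> u1 v1; rewrite normrM; apply: le_trans (dot_le m v1).
  by rewrite ler_piMl// -intr_norm -[1]/(1%:~R) ler_int.
have := H _ _ eta1 xi1; have := H _ _ xi1 eta1 => ? ?.
by apply: le_trans (ler_normB _ _) _; lra.
Qed.

Lemma div_sigma f x : \sum_i ev (pderiv i (imult (sigma i) f)) x = 0.
Proof.
rewrite /pderiv /imult /ev.
under eq_bigr do rewrite !big_map /=.
rewrite exchange_big big1// => l _; rewrite /amp /mfreq /shft /=.
rewrite -mulr_suml; set X := \sum_i _.
suff -> : X = 0 by rewrite mul0r.
rewrite /X (eq_bigr (fun i => (2 * pi) ^+ 2 * l.1.1 * (dot xi l.1.2 *
   ((eta 0 i)%:~R * (l.1.2 0 i)%:~R) - dot eta l.1.2 * ((xi 0 i)%:~R * (l.1.2 0 i)%:~R)))).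
  rewrite -mulr_sumr sumrB -!mulr_sumr -/(dot eta _) -/(dot xi _); ring.
by move=> i _; rewrite /sigma; ring.
Qed.

Lemma ev_tmul1 (c : freq -> R) b A m beta x :
  ev (imult c (tmul b [:: (A, m, beta)])) x = \sum_(l <- b) amp l * A / 2 *
   (c (mfreq l + m) * wave (mfreq l + m) (shft l + beta + pi / 2) x +
    c (mfreq l - m) * wave (mfreq l - m) (shft l - beta + pi / 2) x).
Proof.
elim: b => [|l b IH]; first by rewrite big_nil /ev big_nil.
rewrite big_cons -IH /tmul /= /imult /= !ev_cons /amp /mfreq /shft /=.
ring.
Qed.

Section wave_packet.
Variables (b : seq (mode R d)) (N : nat).
Hypothesis N_gt0 : (0 < N)%N.

Let cN : R := Num.sqrt 2 / (2 * pi * N%:R * fnorm xi ^+ 2).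

Let m0 : freq := xi *+ N.

(** The wave is divided by its frequency, since sigma multiplies by it; the factor
    sqrt 2 makes the square of the oscillation have mean 1. *)
Definition packet (i : 'I_d) : seq (mode R d) :=
  imult (sigma i) (tmul b [:: (cN, m0, - (pi / 2))]).

(** The terms in which sigma falls on b instead of the wave; they are of the order
    of the inverse of N. *)
Definition packet_rem (i : 'I_d) : seq (mode R d) :=
  tmul (imult (sigma i) b) [:: (cN, m0, - (pi / 2))].

Lemma sqrt2_le : Num.sqrt 2 <= (2 : R).
Proof.
rewrite -(@ler_pXn2r _ 2) ?nnegrE ?sqrtr_ge0// sqr_sqrtr//; lra.
Qed.

Lemma packetE i x : ev (packet i) x =
  Num.sqrt 2 * (eta 0 i)%:~R * (ev b x * wave m0 0 x) + ev (packet_rem i) x.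
Proof.
have N0 : N%:R != 0 :> R by rewrite pnatr_eq0 -lt0n.
have X0 : fnorm xi ^+ 2 != 0 by rewrite expf_neq0// gt_eqF// (lt_le_trans ltr01 xi_ge1).
have P0 : 2 * pi != 0 :> R by rewrite gt_eqF// twopi_gt0.
have cE : cN * (N%:R * (2 * pi * (eta 0 i)%:~R * fnorm xi ^+ 2)) =
    Num.sqrt 2 * (eta 0 i)%:~R.
  rewrite /cN; move: (2 * pi : R) P0 => P P0; move: (Num.sqrt 2 : R) => s2.
  move: (fnorm xi ^+ 2) X0 (N%:R : R) N0 => X X0 n n0.
  by field; rewrite P0 n0 X0.
rewrite /packet ev_tmul1 /packet_rem ev_mul ev_wave ev_imult.
rewrite /ev mulr_suml mulr_suml mulr_sumr -big_split /=; apply: eq_bigr => l _.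
move: l => [[A m] beta]; rewrite /amp /mfreq /shft /=.
have e1 : beta - pi / 2 + pi / 2 = beta by rewrite subrK.
have e2 : beta + pi / 2 - pi / 2 = beta by rewrite addrK.
have wpi : wave (m - m0) (beta + pi / 2 + pi / 2) x = - wave (m - m0) beta x.
  by rewrite /wave !addrA -(addrA _ (pi / 2)) -splitr cosDpi.
rewrite opprK e1 wpi.
have p1 := wave_mul m beta m0 0 x; rewrite addr0 subr0 in p1.
have p2 := wave_mul m (beta + pi / 2) m0 (- (pi / 2)) x.
rewrite opprK e2 wpi in p2.
transitivity (Num.sqrt 2 * (eta 0 i)%:~R * A * (wave m beta x * wave m0 0 x) +
  sigma i m * A * cN * (wave m (beta + pi / 2) x * wave m0 (- (pi / 2)) x)); last by ring.
by rewrite p1 p2 sigmaD sigmaB sigma_xi -cE; ring.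
Qed.

Hypothesis b_le : deg b <= N%:R.

Let N1 : (1 : R) <= N%:R. Proof. by rewrite ler1n. Qed.

Let cN_le : 0 <= cN <= N%:R^-1.
Proof.
have P1 := twopi_ge1 R; have pi1 := pi_ge1 R.
have N0 : (0 : R) < N%:R by rewrite ltr0n.
have X1 : 1 <= fnorm xi ^+ 2 by rewrite exprn_ege1.
rewrite /cN; apply/andP; split.
  by rewrite divr_ge0 ?sqrtr_ge0// !mulr_ge0 ?pi_ge0 ?ler0n ?fnorm_ge0.
rewrite ler_pdivrMr; last by rewrite !mulr_gt0 ?pi_gt0// (lt_le_trans ltr01).
have -> : N%:R^-1 * (2 * pi * N%:R * fnorm xi ^+ 2) = 2 * pi * fnorm xi ^+ 2.
  by field; rewrite gt_eqF.
apply: le_trans sqrt2_le _; apply: (@le_trans _ _ (2 * pi)); first lra.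
by rewrite ler_peMr// ltW// twopi_gt0.
Qed.

Let anorm_wave_le f : anorm (tmul f [:: (cN, m0, - (pi / 2))]) <= anorm f / N%:R.
Proof.
have /andP[c0 c1] := cN_le.
rewrite anorm_mul /anorm wnorm_cons wnorm_nil mul1r addr0 /amp /= ger0_norm//.
by rewrite ler_wpM2l// anorm_ge0.
Qed.

Lemma packet_rem_le i : anorm (packet_rem i) <= Csigma * deg b * anorm b / N%:R.
Proof.
apply: le_trans (anorm_wave_le _) _; rewrite ler_wpM2r ?invr_ge0//.
apply: wnorm_imult_le => l /(spec_deg (f := b)) lb; rewrite mul1r mulr1.
by apply: le_trans (sigma_le _ _) _; rewrite ler_wpM2l// Csigma_ge0.
Qed.

Let spec_Psi : spec (fun m => N%:R * fnorm xi - deg b <= fnorm m <= N%:R * fnorm xi + deg b)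
  (tmul b [:: (cN, m0, - (pi / 2))]).
Proof.
move=> l lP; apply/andP; split; move: l lP.
  apply: (spec_low_mul (D := deg b)); first exact: spec_deg.
  by apply: spec_cons; [rewrite subrK /m0 fnormMn|exact: spec_nil].
rewrite addrC; apply: spec_mul_low; first exact: spec_deg.
by apply: spec_cons; [rewrite /m0 fnormMn|exact: spec_nil].
Qed.

Lemma spec_packet i :
  spec (fun m => N%:R * fnorm xi - deg b <= fnorm m <= N%:R * fnorm xi + deg b)
    (packet i).
Proof. by apply: spec_imult; exact: spec_Psi. Qed.

Lemma packet_le i : anorm (packet i) <= Csigma * 3 * anorm b.
Proof.
have N0 : (0 : R) < N%:R by rewrite ltr0n.
apply: (@le_trans _ _ (Csigma * (3 * N%:R) * (anorm b / N%:R))); last first.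
  by rewrite le_eqVlt; apply/orP; left; apply/eqP; field; rewrite gt_eqF.
apply: le_trans (ler_wpM2l _ (anorm_wave_le b)); last first.
  by rewrite mulr_ge0 ?Csigma_ge0// mulr_ge0// ltW.
apply: wnorm_imult_le => l /spec_Psi/andP[_ lb]; rewrite mul1r mulr1.
apply: le_trans (sigma_le _ _) _; rewrite ler_wpM2l ?Csigma_ge0//.
apply: (le_trans lb); rewrite (_ : 3 * N%:R = N%:R * 2 + N%:R); last by ring.
by rewrite lerD// ler_wpM2l// ltW.
Qed.

(** What remains of w_i w_j next to eta_i eta_j b^2: the double frequency in 2
    cos^2 = 1 + cos, and the products with packet_rem. *)
Definition packet_err (i j : 'I_d) : seq (mode R d) :=
  tscale ((eta 0 i)%:~R * (eta 0 j)%:~R) (tmul (tmul b b) [:: (1, m0 + m0, 0)]) ++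
  tscale (Num.sqrt 2 * (eta 0 i)%:~R)
    (tmul (tmul b [:: (1, m0, 0)]) (packet_rem j)) ++
  tscale (Num.sqrt 2 * (eta 0 j)%:~R)
    (tmul (tmul b [:: (1, m0, 0)]) (packet_rem i)) ++
  tmul (packet_rem i) (packet_rem j).

Lemma packet_mul i j x : ev (packet i) x * ev (packet j) x =
  (eta 0 i)%:~R * (eta 0 j)%:~R * ev b x ^+ 2 + ev (packet_err i j) x.
Proof.
rewrite !packetE /packet_err; move: (packet_rem i) (packet_rem j) => r r'.
rewrite !ev_cat !ev_scale !ev_mul !ev_wave wave_double.
have s2 : Num.sqrt 2 ^+ 2 = 2 :> R by rewrite sqr_sqrtr.
move: (ev b x) (wave m0 0 x) (ev r x) (ev r' x).
move: (Num.sqrt 2 : R) s2 => s2 s22 B W ri rj.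
have -> : (s2 * (eta 0 i)%:~R * (B * W) + ri) * (s2 * (eta 0 j)%:~R * (B * W) + rj) =
  s2 ^+ 2 * ((eta 0 i)%:~R * (eta 0 j)%:~R * (B * W) ^+ 2) +
  s2 * (eta 0 i)%:~R * (B * W * rj) + s2 * (eta 0 j)%:~R * (B * W * ri) + ri * rj by ring.
by rewrite s22; ring.
Qed.

Lemma packet_err_le k i j (L r : R) : 0 < L -> L + deg (tmul b b) <= 2 * N%:R ->
  (forall i, anorm (packet_rem i) <= r) ->
  wnorm (hweight R k.+1) (packet_err i j) <=
  L^-1 * anorm b ^+ 2 + 4 * (anorm b * r) + r ^+ 2.
Proof.
move=> L0 LN Hr.
have eta_le i' : `|(eta 0 i')%:~R : R| <= 1.
  by rewrite -intr_norm -[1]/(1%:~R) ler_int.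
have r0 : 0 <= r by exact: le_trans (anorm_ge0 _) (Hr i).
have A0 := anorm_ge0 b.
have L2 : L + deg (tmul b b) <= fnorm (m0 + m0).
  rewrite -mulr2n fnormMn /m0 fnormMn; apply: (le_trans LN).
  by rewrite ler_wpM2l// ler_peMr.
have [w1 _] := wnorm_osc k 0 1 L0 L2.
have h0 : forall m, 0 <= hweight R k.+1 m by move=> m; exact: hweight_ge0.
have cross i' j' : wnorm (hweight R k.+1) (tscale (Num.sqrt 2 * (eta 0 i')%:~R)
    (tmul (tmul b [:: (1, m0, 0)]) (packet_rem j'))) <= 2 * (anorm b * r).
  rewrite wnorm_scale normrM; apply: ler_pM => //.
  - exact: wnorm_ge0.
  - rewrite -[leRHS]mulr1; apply: ler_pM => //.
    by rewrite ger0_norm ?sqrtr_ge0// sqrt2_le.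
  apply: le_trans (hweight_le_anorm _ _) _; rewrite anorm_mul (anorm_mul b).
  rewrite {2}/anorm wnorm_cons wnorm_nil mul1r addr0 /amp /= normr1 mulr1.
  by rewrite ler_wpM2l.
rewrite /packet_err !wnorm_cat !addrA.
have c1 := cross i j; have c2 := cross j i.
have last : wnorm (hweight R k.+1) (tmul (packet_rem i) (packet_rem j)) <= r ^+ 2.
  apply: le_trans (hweight_le_anorm _ _) _; rewrite anorm_mul expr2.
  by apply: ler_pM; rewrite ?anorm_ge0.
have first : wnorm (hweight R k.+1) (tscale ((eta 0 i)%:~R * (eta 0 j)%:~R)
    (tmul (tmul b b) [:: (1, m0 + m0, 0)])) <= L^-1 * anorm b ^+ 2.
  rewrite wnorm_scale normrM -[leRHS]mul1r; apply: ler_pM => //.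
  - exact: wnorm_ge0.
  - by rewrite -[leRHS]mulr1; apply: ler_pM.
  apply: (le_trans w1).
  by rewrite anorm_mul normr1 mulr1 expr2.
by lra.
Qed.

End wave_packet.

End high_frequencies.

(** * One step of the cancellation *)

Lemma pow2_near (R : realType) (X : R) : \forall n \near \oo, X <= 2 ^+ n.
Proof.
exists (Num.bound `|X|) => // n /= Xn; apply: le_trans (ler_norm _) _.
apply: (@le_trans _ _ n%:R).
  by apply: (le_trans (ltW (archi_boundP (normr_ge0 X)))); rewrite ler_nat.
by rewrite -natrX ler_nat ltnW// ltn_expl.
Qed.

(** The field w cancels rho in the direction eta (x) eta up to errors E0 and S,
    while w itself, its stress and its products with the fields of frequency at
    most D are small. *)
Record step_spec (R : realType) (d : nat) (eta : 'rV[int]_d) (alpha : R) (k : nat)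
    (rho : seq (mode R d)) (delta D eps : R) (n : nat) (w : 'I_d -> seq (mode R d)) (E0 : seq (mode R d))
    (S : 'I_d -> 'I_d -> seq (mode R d)) : Prop := StepSpec {
  step_spectrum : forall i, spec (fun m => (2 ^+ n <= fnorm R m) &&
    (fnorm R m < 9 / 10 * 2 ^+ n.+1)) (w i);
  step_div : forall x, \sum_i ev (pderiv i (w i)) x = 0;
  step_Lp : forall (p : R) i, 1 <= p <= 2 - delta ->
    (Lnorm (torus_measure R d) p%:E (fun t => (ev (w i) (row_of t))%:E) <= eps%:E)%E;
  step_anorm : forall i, (2 ^+ n) `^ (- delta) * anorm (w i) <= eps;
  step_stress : forall i j, wnorm (hweight R k.+1) (Lm alpha i j w) <= eps;
  step_cross : forall i f, spec (fun m => fnorm R m <= D) f ->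
    wnorm (hweight R k.+1) (tmul (w i) f) <= eps * anorm f;
  step_square : forall i j x, ev (w i) x * ev (w j) x =
    (eta 0 i)%:~R * (eta 0 j)%:~R * (ev E0 x - ev rho x) + ev (S i j) x;
  step_E0 : wnorm (hweight R k.+1) E0 <= eps;
  step_S : forall i j, wnorm (hweight R k.+1) (S i j) <= eps }.

(** For a large constant c the function a = c - rho / (2 c) has the square c^2 -
    rho up to a small error, and c^2 is invisible in spaces of functions modulo
    constants. Concentrating a gives the amplitude b of a packet. All of this is
    fixed before n, so that every term with a negative power of the frequency 2^n
    becomes small. *)
Lemma block_step (R : realType) (d : nat) (xi eta : 'rV[int]_d) (alpha : R) (k : nat)
    (rho : seq (mode R d)) (delta D eps : R) :
  dot R xi eta = 0 -> (forall i, `|xi 0 i| <= 1) -> (forall i, `|eta 0 i| <= 1) ->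
  xi != 0 -> fnorm R xi ^+ 2 <= 2 ->
  2 * alpha <= k%:R -> 0 < delta -> 0 < eps <= 1 -> 0 <= D ->
  \forall n \near \oo, exists w E0 S, step_spec eta alpha k rho delta D eps n w E0 S.
Proof.
move=> orth xi1 eta1 xi_neq0 xi2 hk d0 /andP[eps0 eps1] D0.
pose c := 1 + anorm rho / eps.
have Ar := anorm_ge0 rho.
have c1 : 1 <= c by rewrite lerDl divr_ge0// ltW.
have c0 : 0 < c by exact: lt_le_trans ltr01 c1.
pose a : seq (mode R d) := (c, 0, 0) :: tscale (- (2 * c)^-1) rho.
have evc (C : R) x : ev [:: (C, 0, 0)] x = C by rewrite ev_wave wave_cos phase0 cos0 mulr1.
have aE x : ev a x ^+ 2 = c ^+ 2 - ev rho x + (4 * c ^+ 2)^-1 * ev rho x ^+ 2.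
  rewrite /a -cat1s ev_cat evc ev_scale; field; rewrite gt_eqF//.
pose Y := anorm a ^+ 2.
have Y0 : 0 <= Y by rewrite sqr_ge0.
(* the bound Y for the integral of b^2 is known before b is: it fixes the height
     L for the interpolation, and L fixes how far to concentrate *)
have [L L1 HL] : exists2 L, 1 <= L & L `^ (- delta) * Y <= (eps / 4) ^+ 2 / 2.
  pose Z := 1 + Y / ((eps / 4) ^+ 2 / 2).
  have e0 : 0 < (eps / 4) ^+ 2 / 2 by rewrite divr_gt0 ?exprn_gt0 ?divr_gt0.
  have Z1 : 1 <= Z by rewrite lerDl divr_ge0// ltW.
  have Z0 : 0 < Z by exact: lt_le_trans ltr01 Z1.
  exists (Z `^ delta^-1).
    by rewrite -(powRr0 Z); apply: ler_powR => //; rewrite invr_ge0 ltW.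
  rewrite -powRrM mulrN mulVf ?gt_eqF// powR_inv1 ?(ltW Z0)//.
  rewrite mulrC ler_pdivrMr// /Z mulrDr mulr1.
  rewrite [X in _ <= _ + X](_ : _ = Y) ?lerDr ?ltW//.
  by rewrite mulrC divfK// gt_eqF.
have L0 : 0 < L by exact: lt_le_trans ltr01 L1.
pose e1 := Num.min (eps / 4) ((eps / 4) ^+ 2 / (2 * L)).
have e10 : 0 < e1 by rewrite lt_min divr_gt0//= divr_gt0 ?exprn_gt0 ?divr_gt0 ?mulr_gt0.
have [b [E [bE wE ib ib2]]] := concentration k a xi_neq0 e10.
have Lpb (p : R) : 1 <= p <= 2 - delta ->
    (Lnorm (torus_measure R d) p%:E (fun t => (ev b (row_of t))%:E) <= (eps / 4)%:E)%E.
  apply: (Lnorm_interp (bdm_ev b) L1 d0); first by apply/andP; split; lra.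
  apply: (@le_trans _ _ (L * ((eps / 4) ^+ 2 / (2 * L)) + (eps / 4) ^+ 2 / 2)).
    apply: lerD.
      rewrite ler_wpM2l ?(ltW L0)//; apply: (le_trans ib).
      by rewrite ge_min lexx orbT.
    by apply: le_trans HL; rewrite ler_wpM2l ?powR_ge0.
  rewrite le_eqVlt; apply/orP; left; apply/eqP; field; by rewrite gt_eqF.
have Ab := anorm_ge0 b.
pose Cw := Csigma R d * 3 * anorm b.
have Cw0 : 0 <= Cw by rewrite /Cw mulr_ge0// mulr_ge0// Csigma_ge0.
pose Cr := Csigma R d * deg b * anorm b.
have Cr0 : 0 <= Cr by rewrite /Cr mulr_ge0// mulr_ge0 ?Csigma_ge0 ?deg_ge0.
have CL0 : 0 <= CL R k by rewrite exprn_ge0// ltW// twopi_gt0.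
near=> n.
have n2 : (2 <= n)%N by near: n; exact: nbhs_infty_ge.
have b64 : 64 * deg b <= 2 ^+ n by near: n; exact: pow2_near.
have D64 : 64 * D <= 2 ^+ n by near: n; exact: pow2_near.
have bw : (Cw / eps) `^ delta^-1 <= 2 ^+ n by near: n; exact: pow2_near.
have bL : CL R k * (2 * Cw) / eps <= 2 ^+ n by near: n; exact: pow2_near.
have bC : Cw / eps <= 2 ^+ n by near: n; exact: pow2_near.
have bd : deg (tmul b b) <= 2 ^+ n by near: n; exact: pow2_near.
have ba : 4 * anorm b ^+ 2 / eps <= 2 ^+ n by near: n; exact: pow2_near.
have br : 4 * Cr / eps <= 2 ^+ n by near: n; exact: pow2_near.
have bar : 16 * (anorm b * Cr) / eps <= 2 ^+ n by near: n; exact: pow2_near.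
(* 1 <= |xi| <= 17/12, so that N |xi| stays well inside [2^n, 0.9 2^(n+1)] for
     N = (5/4) 2^n *)
set H : R := 2 ^+ n in b64 D64 bw bL bC bd ba br bar; pose N := (5 * 2 ^ (n - 2))%N.
have H0 : 0 < H by rewrite exprn_gt0.
have NE : N%:R = 5 / 4 * H :> R.
  rewrite /H /N natrM natrX -{2}(subnK n2) exprD expr2; by field.
have Ngt0 : (0 < N)%N by rewrite muln_gt0 expn_gt0.
have inv X : X / eps <= H -> X / H <= eps.
  by rewrite !ler_pdivrMr// mulrC.
have degb0 := deg_ge0 b.
have bN : deg b <= N%:R by rewrite NE; clear -b64 H0 degb0; lra.
have z1 := fnorm_ge1 R xi_neq0; have z2 : fnorm R xi <= 17 / 12.
  rewrite leNgt; apply/negP => z; clear -xi2 z z1; nra.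
have Hz1 : H * 1 <= H * fnorm R xi by rewrite ler_wpM2l// ltW.
have Hz2 : H * fnorm R xi <= H * (17 / 12) by rewrite ler_wpM2l// ltW.
have Rle i : anorm (packet_rem xi eta b N i) <= Cr / H.
  apply: le_trans (packet_rem_le xi1 eta1 xi_neq0 b Ngt0 i) _; rewrite ler_wpM2l//.
  by rewrite lef_pV2 ?posrE ?ltr0n// NE; clear -H0; lra.
have Wle i : anorm (packet xi eta b N i) <= Cw by exact: packet_le.
have RH : Cr / H <= eps / 4 by have := inv _ br; rewrite -mulrA; clear; lra.
have RH0 : 0 <= Cr / H by rewrite divr_ge0 ?(ltW H0).
have specW' i : spec (fun m => H + D <= fnorm R m) (packet xi eta b N i).
  by apply: specW (@spec_packet R d xi eta b N i) => m /andP[+ _]; rewrite NE => h1; clear -h1 Hz1 b64 D64 degb0 D0 H0; lra.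
pose E0 := [:: (c ^+ 2, 0, 0)] ++ tscale (4 * c ^+ 2)^-1 (tmul rho rho) ++ E.
exists (packet xi eta b N), E0, (packet_err xi eta b N); split.
- move=> i; apply: specW (@spec_packet R d xi eta b N i) => m /andP[+ +].
  rewrite NE exprS -/H => h1 h2; apply/andP; split; clear -h1 h2 Hz1 Hz2 b64 degb0 H0; lra.
- by move=> x; exact: div_sigma.
- move=> p i /[dup] pp /andP[p1 _].
  have q1 : (1 <= p%:E)%E by rewrite lee_fin.
  pose f x := Num.sqrt 2 * (eta 0 i)%:~R * (ev b x * wave (xi *+ N) 0 x).
  have mb := measurable_ev b.
  have mf : measurable_fun setT (fun t : d.-tuple (measurableTypeR R) => f (row_of t)).
    by case: (bdmZ (Num.sqrt 2 * (eta 0 i)%:~R)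
      (bdmM (bdm_ev b) (bdm_wave (R := R) (xi *+ N) 0))).
  have -> : (fun t : d.-tuple (measurableTypeR R) => (ev (packet xi eta b N i) (row_of t))%:E) =
      EFin \o (fun t => f (row_of t) + ev (packet_rem xi eta b N i) (row_of t)).
    by apply/funext => t /=; rewrite packetE.
  apply: le_trans (LnormD _ q1 mf (measurable_ev (packet_rem xi eta b N i))) _.
  apply: (@le_trans _ _ (`|2|%:E * (eps / 4)%:E + (eps / 4)%:E)%E); last first.
    by rewrite ger0_norm// -EFinM -EFinD lee_fin; clear -eps0; lra.
  apply: leeD; last first.
    apply: le_trans (Lnorm_ev_le _ q1) _; rewrite lee_fin.
    exact: le_trans (Rle i) RH.
  apply: le_trans (lee_wpmul2l _ (Lpb p pp)); last by rewrite lee_fin.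
  rewrite -(LnormZ_eq (torus_measure R d) 2 q1 mb); apply: le_Lnorm => //.
    by case: (bdmZ 2 (bdm_ev b)).
  move=> t; rewrite /f !normrM mulrA (ger0_norm (sqrtr_ge0 2)).
  rewrite -[leRHS]mulr1; apply: ler_pM => //; rewrite ?mulr_ge0 ?sqrtr_ge0//; last exact: wave_norm.
  rewrite ler_wpM2r// (ger0_norm (ler0n R 2)) -[leRHS]mulr1; apply: ler_pM; rewrite ?sqrtr_ge0 ?sqrt2_le//.
  by rewrite -intr_norm -[1]/(1%:~R) ler_int.
- move=> i; apply: le_trans (ler_wpM2l (powR_ge0 _ _) (Wle i)) _.
  rewrite powRN mulrC ler_pdivrMr ?powR_gt0// mulrC -ler_pdivrMr//.
  have C0 : 0 <= Cw / eps by rewrite divr_ge0// ltW.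
  have -> : Cw / eps = ((Cw / eps) `^ delta^-1) `^ delta.
    by rewrite -powRrM mulVf ?gt_eqF// powRr1.
  have h := @ge0_ler_powR R delta (ltW d0); apply: h => //; rewrite nnegrE ?powR_ge0// ltW.
- move=> i j; apply: le_trans (@wnorm_Lm_le R d alpha _ hk i j (packet xi eta b N) H H0 _) _.
    by move=> i'; apply: specW (specW' i') => m h; clear -h D0; lra.
  apply: (@le_trans _ _ (CL R k * (2 * Cw) / H)); last exact: inv.
  rewrite mulrAC ler_wpM2r ?invr_ge0 ?(ltW H0)// ler_wpM2l//.
  by have := Wle i; have := Wle j; clear; lra.
- move=> i f sf; apply: le_trans (wnorm_high _ H0 (spec_mul_high (specW' i) sf)) _.
  rewrite anorm_mul mulrA ler_wpM2r ?anorm_ge0//.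
  apply: le_trans (inv _ bC); rewrite mulrC ler_wpM2r ?invr_ge0 ?(ltW H0)//.
- move=> i j x; rewrite packet_mul// bE aE; congr (_ * _ + _).
  by rewrite /E0 !ev_cat evc ev_scale ev_mul; ring.
- rewrite /E0 !wnorm_cat wnorm_cons wnorm_nil /hweight eqxx mul0r !add0r -/(hweight R k.+1).
  have wr : wnorm (hweight R k.+1) (tscale (4 * c ^+ 2)^-1 (tmul rho rho)) <= eps / 4.
    rewrite wnorm_scale ger0_norm ?invr_ge0 ?mulr_ge0 ?(ltW c0)//.
    apply: le_trans (ler_wpM2l _ (hweight_le_anorm _ _)) _.
      by rewrite invr_ge0 !mulr_ge0 ?(ltW c0).
    have c20 : 0 < 4 * c ^+ 2 by rewrite mulr_gt0 ?exprn_gt0.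
    rewrite anorm_mul mulrC ler_pdivrMr//.
    have cr : anorm rho <= eps * c.
      by rewrite /c mulrDr mulr1 mulrC divfK ?gt_eqF// lerDr ltW.
    have c2 : anorm rho * anorm rho <= (eps * c) * (eps * c) by apply: ler_pM.
    apply: (le_trans c2); have -> : eps / 4 * (4 * c ^+ 2) = eps * c * c by clear; field.
    rewrite [leLHS]mulrA ler_wpM2r ?(ltW c0)//.
    by rewrite ler_piMr ?mulr_ge0 ?(ltW eps0) ?(ltW c0).
  have e4 : e1 <= eps / 4 by rewrite /e1 ge_min lexx.
  by clear -wr e4 wE eps0; lra.
- move=> i j; apply: le_trans (packet_err_le eta1 xi_neq0 k i j H0 _ Rle) _.
    by rewrite NE; clear -bd H0; lra.
  have h1 := inv _ ba; have h2 := inv _ bar.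
  have h3 : (Cr / H) ^+ 2 <= eps / 4 * 1.
    rewrite expr2; apply: ler_pM => //; clear -RH eps1; lra.
  have e2 : anorm b * (Cr / H) = (16 * (anorm b * Cr) / H) / 16 by clear -H0; field; rewrite gt_eqF.
  have e3 : H^-1 * anorm b ^+ 2 = (4 * anorm b ^+ 2 / H) / 4 by clear -H0; field; rewrite gt_eqF.
  by rewrite e2 e3; clear -h1 h2 h3 eps0; lra.
Unshelve. all: by end_near. Qed.


(** * Cancelling the stress *)

Section decomposition.
Variables (R : realType) (d : nat).
Local Notation freq := 'rV[int]_d.

(** The tensors eta (x) eta of these integer vectors span the symmetric matrices. *)
Definition direction (i j : 'I_d) : freq :=
  if i == j then delta_mx 0 i else delta_mx 0 i + delta_mx 0 j.

Lemma directionE i j k : (direction i j 0 k)%:~R =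
  (k == i)%:R + (i != j)%:R * (k == j)%:R :> R.
Proof.
rewrite /direction; case: eqVneq => [_|_] /=; rewrite !mxE eqxx /=.
  by rewrite mul0r addr0; case: (k == i).
by rewrite mul1r intrD; case: (k == i); case: (k == j).
Qed.

(** Take e_i - e_j, or any other vector of the standard basis if i = j; here two
    dimensions are necessary. *)
Lemma direction_orth i j : (1 < d)%N -> exists xi : freq,
  [/\ dot R xi (direction i j) = 0, (forall k, `|xi 0 k| <= 1),
    (forall k, `|direction i j 0 k| <= 1), xi != 0 & fnorm R xi ^+ 2 <= 2].
Proof.
move=> d1.
have sumd (F : 'I_d -> R) l : \sum_k (k == l)%:R * F k = F l.
  rewrite (bigD1 l)//= eqxx mul1r big1 ?addr0// => k /negbTE ->; exact: mul0r.
have [<-|ij] := eqVneq i j.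
  have [l li] : exists l : 'I_d, l != i.
    pose k0 : 'I_d := Ordinal (ltnW d1); pose k1 : 'I_d := Ordinal d1.
    by have [e|] := eqVneq k0 i; [exists k1; rewrite -e|exists k0].
  exists (delta_mx 0 l); split.
  - rewrite /dot; under eq_bigr do rewrite directionE eqxx mul0r addr0 mxE eqxx /= mulrz_nat.
    by rewrite sumd (negbTE li).
  - by move=> k; rewrite mxE eqxx /=; case: (k == l).
  - by move=> k; rewrite /direction eqxx mxE eqxx /=; case: (k == i).
  - by apply/eqP => /rowP/(_ l); rewrite !mxE !eqxx.
  - rewrite fnorm_sqr (bigD1 l)//= big1 => [|k /negbTE kl].
      by rewrite mxE !eqxx expr1n addr0 ler1n.
    by rewrite mxE eqxx kl expr0n.
exists (delta_mx 0 i - delta_mx 0 j); split.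
- rewrite /dot (eq_bigr (fun k => (k == i)%:R * 1 + (-1) * ((k == j)%:R * 1))).
    by rewrite big_split -mulr_sumr /= !sumd; ring.
  move=> k _; rewrite directionE ij mul1r !mxE eqxx /=.
  have [->|ki] := eqVneq k i; first by rewrite (negbTE ij) !(intrD, intrN)/=; ring.
  by case: (k == j); rewrite !(intrD, intrN)/=; ring.
- move=> k; rewrite !mxE eqxx /=.
  have [->|ki] := eqVneq k i; first by rewrite (negbTE ij).
  by case: (k == j).
- move=> k; rewrite /direction (negbTE ij) !mxE eqxx /=.
  have [->|ki] := eqVneq k i; first by rewrite (negbTE ij).
  by case: (k == j).
- by apply/eqP => /rowP/(_ i); rewrite !mxE !eqxx (negbTE ij).
- rewrite fnorm_sqr (eq_bigr (fun k => (k == i)%:R * 1 + (k == j)%:R * 1)).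
    by rewrite big_split /= !sumd.
  move=> k _; rewrite !mxE eqxx /=.
  have [->|ki] := eqVneq k i; first by rewrite (negbTE ij) !(intrD, intrN)/=; ring.
  by case: (k == j); rewrite !(intrD, intrN)/=; ring.
Qed.

Lemma direction_le i j k : `|(direction i j 0 k)%:~R : R| <= 1.
Proof.
rewrite directionE; have [<-|ij] := eqVneq i j.
  by rewrite mul0r addr0; case: (k == i); rewrite ?normr1 ?normr0.
rewrite mul1r; have [->|ki] := eqVneq k i; first by rewrite (negbTE ij) addr0 normr1.
by case: (k == j); rewrite ?add0r ?addr0 ?normr1 ?normr0.
Qed.

(** The vectors e_a + e_b produce the off-diagonal entries; what they contribute
    to the diagonal is taken off the terms of the vectors e_a. *)
Lemma decomposition (S dec : 'I_d -> 'I_d -> R) : (forall i j, S i j = S j i) ->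
  (forall a, dec a a = S a a - \sum_(c | c != a) S a c) ->
  (forall a b, a != b -> dec a b = 2^-1 * S a b) -> forall i j,
  \sum_a \sum_b (direction a b 0 i)%:~R * (direction a b 0 j)%:~R * dec a b = S i j.
Proof.
move=> Ssym daa dab i j.
have sumd (F : 'I_d -> R) l : \sum_k (l == k)%:R * F k = F l.
  rewrite (bigD1 l)//= eqxx mul1r big1 ?addr0// => k; rewrite eq_sym => /negbTE ->.
  exact: mul0r.
pose T a := \sum_c (c != a)%:R * S a c.
have TE a : T a = \sum_(c | c != a) S a c.
  by rewrite /T [RHS]big_mkcond /=; apply: eq_bigr => c _; case: (c != a); rewrite ?mul1r ?mul0r.
transitivity (\sum_a ((i == a)%:R * ((j == a)%:R * (S a a - T a)) + \sum_b
  ((i == a)%:R * ((j == a)%:R * (2^-1 * ((b != a)%:R * S a b))) +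
   (i == a)%:R * ((j == b)%:R * (2^-1 * ((b != a)%:R * S a b))) +
   (j == a)%:R * ((i == b)%:R * (2^-1 * ((b != a)%:R * S a b))) +
   (i == b)%:R * ((j == b)%:R * (2^-1 * ((a != b)%:R * S b a)))))).
  apply: eq_bigr => a _; rewrite (bigD1 a)//= [in RHS](bigD1 a)//= addrA; congr (_ + _).
    rewrite daa !directionE eqxx !mul0r !addr0 TE; case: (i == a); case: (j == a) => /=; ring.
  apply: eq_bigr => b ba; have ab : a != b by rewrite eq_sym.
  rewrite dab// !directionE ab ba.
  by rewrite !mul1r (Ssym b a); ring.
rewrite big_split /= sumd.
under [X in _ + X]eq_bigr do rewrite !big_split /=.
rewrite !big_split /=.
have A1 : \sum_a \sum_b (i == a)%:R * ((j == a)%:R * (2^-1 * ((b != a)%:R * S a b))) =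
    (j == i)%:R * (2^-1 * T i).
  under eq_bigr do rewrite -mulr_sumr -mulr_sumr -mulr_sumr.
  exact: sumd.
have A4 : \sum_a \sum_b (i == b)%:R * ((j == b)%:R * (2^-1 * ((a != b)%:R * S b a))) =
    (j == i)%:R * (2^-1 * T i) by rewrite exchange_big.
have A2 : \sum_a \sum_b (i == a)%:R * ((j == b)%:R * (2^-1 * ((b != a)%:R * S a b))) =
    2^-1 * ((j != i)%:R * S i j).
  under eq_bigr do rewrite -mulr_sumr sumd.
  exact: sumd.
have A3 : \sum_a \sum_b (j == a)%:R * ((i == b)%:R * (2^-1 * ((b != a)%:R * S a b))) =
    2^-1 * ((i != j)%:R * S j i).
  under eq_bigr do rewrite -mulr_sumr sumd.
  exact: sumd.
rewrite A1 A2 A3 A4 (Ssym j i) (eq_sym i j).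
by have [->|ji] := eqVneq j i; rewrite /=; field.
Qed.

End decomposition.

Section iteration.
Variables (R : realType) (d : nat) (alpha : R) (k : nat) (kappa c0 : R).
Hypothesis d_gt1 : (1 < d)%N.
Hypothesis hk : 2 * alpha <= k%:R.
Hypothesis kappa_gt0 : 0 < kappa.
Hypothesis c0_gt0 : 0 < c0.
Hypothesis c0_le1 : c0 <= 1.
Local Notation mu := (torus_measure R d).
Local Notation tp := (seq (mode R d)).
Local Notation W := (wnorm (hweight R k.+1)).
Implicit Types (x : 'rV[R]_d).

Let W_ge0 (f : tp) : 0 <= W f.
Proof. by apply: wnorm_ge0 => m; exact: hweight_ge0. Qed.

Let dR : R := d%:R.

Let dR1 : 1 <= dR. Proof. by rewrite /dR ler1n ltnW. Qed.

Let sum_cst (c : R) : \sum_(a < d) c = dR * c.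
Proof. by rewrite sumr_const card_ord mulr_natl. Qed.

Let sum2_change (F G : 'I_d -> 'I_d -> R) a b :
  (forall a' b', ~~ ((a' == a) && (b' == b)) -> F a' b' = G a' b') ->
  \sum_a' \sum_b' F a' b' = \sum_a' \sum_b' G a' b' + (F a b - G a b).
Proof.
move=> FG; apply/eqP; rewrite addrC -subr_eq -sumrB; apply/eqP.
under eq_bigr do rewrite -sumrB.
rewrite (bigD1 a)//= (bigD1 b)//= !big1 ?addr0//.
  by move=> a' a'a; rewrite big1// => b' _; rewrite FG ?subrr// (negbTE a'a).
by move=> b' b'b; rewrite FG ?subrr// (negbTE b'b) andbF.
Qed.

Definition dec_tp (S : 'I_d -> 'I_d -> tp) a b : tp :=
  if a == b then S a a ++ tscale (-1) (flatten [seq S a c | c <- enum 'I_d & c != a])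
  else tscale 2^-1 (S a b).

Lemma dec_tpE (S : 'I_d -> 'I_d -> tp) x i j :
  (forall i j, ev (S i j) x = ev (S j i) x) ->
  \sum_a \sum_b (direction a b 0 i)%:~R * (direction a b 0 j)%:~R *
    ev (dec_tp S a b) x = ev (S i j) x.
Proof.
move=> Ssym; apply: (decomposition (S := fun i j => ev (S i j) x)
  (dec := fun a b => ev (dec_tp S a b) x)) => //.
- move=> a; rewrite /dec_tp eqxx ev_cat ev_scale ev_flatten big_map mulN1r.
  by rewrite big_filter big_enum_cond.
- by move=> a b /negbTE ab; rewrite /dec_tp ab ev_scale.
Qed.

Lemma W_dec_tp (S : 'I_d -> 'I_d -> tp) (s : R) a b : (forall i j, W (S i j) <= s) ->
  W (dec_tp S a b) <= dR * s.
Proof.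
move=> HS; have s0 : 0 <= s by exact: le_trans (W_ge0 _) (HS a a).
rewrite /dec_tp; case: eqVneq => [_|ab].
  rewrite wnorm_cat wnorm_scale normrN1 mul1r wnorm_flatten big_map big_filter big_enum_cond /=.
  apply: (@le_trans _ _ (\sum_(c < d) s)); last by rewrite sumr_const card_ord mulr_natl.
  rewrite [leRHS](bigD1 a)//= lerD//; exact: ler_sum.
rewrite wnorm_scale ger0_norm//; apply: ler_pM => //.
by apply: le_trans dR1; rewrite invf_le1// ler1n.
Qed.

(** Stage of the construction: last block, partial sum, remaining stress, bound
    for the remaining stress, and bounds for the sizes and the frequencies of all
    blocks so far. *)
Record stage := Stage { st_w : 'I_d -> tp; st_U : 'I_d -> tp;
  st_rho : 'I_d -> 'I_d -> tp; st_e : R; st_A : R; st_D : R }.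

Definition total (s : stage) : R := \sum_a \sum_b W (st_rho s a b).

Record stage_ok (s : stage) : Prop := StageOk {
  ok_eq : forall i j x, ev (st_U s i) x * ev (st_U s j) x +
    ev (Lm alpha i j (st_U s)) x = \sum_a \sum_b (direction a b 0 i)%:~R *
      (direction a b 0 j)%:~R * ev (st_rho s a b) x;
  ok_total : total s <= st_e s;
  ok_e : 0 < st_e s;
  ok_A : forall i, anorm (st_U s i) <= st_A s;
  ok_D0 : 0 <= st_D s;
  ok_D : forall i, spec (fun m => fnorm R m <= st_D s) (st_U s i) }.

Definition Kself : R := 2 + 2 * dR ^+ 2.

(** All bounds for the new block are multiples of the decrease of st_e, so that
    they sum up by telescoping. The division by 1 + st_A in pa_cross makes the
    products with all previous blocks together summable. The ranges of p and theta
    grow to the full ones as st_e tends to 0. *)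
Record passage (n : nat) (s s' : stage) : Prop := Passage {
  pa_ok : stage_ok s';
  pa_le : st_e s' <= st_e s;
  pa_U : st_U s' = (fun i => st_U s i ++ st_w s' i);
  pa_A : st_A s' = st_A s + \sum_i anorm (st_w s' i);
  pa_D : st_D s' = st_D s + \sum_i deg (st_w s' i);
  pa_spec : forall i, spec (fun m => (2 ^+ n <= fnorm R m) &&
    (fnorm R m < 9 / 10 * 2 ^+ n.+1)) (st_w s' i);
  pa_div : forall x, \sum_i ev (pderiv i (st_w s' i)) x = 0;
  pa_Lp : forall (p : R) i, 1 <= p <= 2 - kappa * st_e s ->
    (Lnorm mu p%:E (fun t => (ev (st_w s' i) (row_of t))%:E) <=
      (c0 * (st_e s - st_e s'))%:E)%E;
  pa_anorm : forall theta i, kappa * st_e s <= theta ->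
    (2 ^+ n) `^ (- theta) * anorm (st_w s' i) <= c0 * (st_e s - st_e s');
  pa_cross : forall i f, spec (fun m => fnorm R m <= st_D s) f ->
    W (tmul (st_w s' i) f) <= (st_e s - st_e s') / (1 + st_A s) * anorm f;
  pa_self : forall i j, exists2 G, (forall x, ev (st_w s' i) x * ev (st_w s' j) x = ev G x) &
    W G <= Kself * (st_e s - st_e s') }.

Lemma A_ge0 s : stage_ok s -> 0 <= st_A s.
Proof. by move=> /ok_A H; apply: le_trans (anorm_ge0 _) (H (Ordinal (ltnW d_gt1))). Qed.

Lemma D_ge0 s : stage_ok s -> 0 <= st_D s.
Proof. exact: ok_D0. Qed.

(** A stage waits with an empty block as long as the frequency is too low to
    advance. *)
Definition idle (s : stage) : stage :=
  Stage (fun=> [::]) (st_U s) (st_rho s) (st_e s) (st_A s) (st_D s).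

Lemma idle_passage n s : stage_ok s -> passage n s (idle s).
Proof.
move=> ok.
have n0 : anorm ([::] : tp) = 0 by rewrite /anorm wnorm_nil.
have z : (0 : R) <= c0 * (st_e s - st_e s) by rewrite subrr mulr0.
split=> //=.
- by case: ok.
- by apply/funext => i; rewrite cats0.
- by rewrite n0 sumr_const mul0rn addr0.
- by rewrite /deg big_nil sumr_const mul0rn addr0.
- by move=> x; rewrite big1// => i _; rewrite /pderiv /imult ev_nil.
- move=> p i /andP[p1 _]; apply: (@le_trans _ _ (anorm ([::] : tp))%:E).
    by apply: Lnorm_ev_le; rewrite lee_fin.
  by rewrite lee_fin n0.
- by move=> theta i _; rewrite n0 mulr0.
- by move=> i f _; rewrite wnorm_nil subrr !mul0r.
- move=> i j; exists [::]; first by move=> x; rewrite ev_nil mul0r.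
  by rewrite wnorm_nil subrr mulr0.
Qed.

Definition rate : R := 1 - (2 * dR ^+ 2)^-1.

Let d2 : 0 < 2 * dR ^+ 2.
Proof. by rewrite mulr_gt0// exprn_gt0// (lt_le_trans ltr01 dR1). Qed.

Lemma rate_lt1 : 0 < rate < 1.
Proof.
rewrite /rate subr_gt0 ltrBlDr ltrDl invr_gt0 d2 andbT invf_lt1//.
by have := exprn_ege1 2 dR1; lra.
Qed.

Lemma largest_rho s : exists a b, total s <= dR ^+ 2 * W (st_rho s a b).
Proof.
pose i0 : 'I_d := Ordinal (ltnW d_gt1).
have [p _ Hp] := @arg_maxP _ _ _ (i0, i0) xpredT
  (fun p : 'I_d * 'I_d => W (st_rho s p.1 p.2)) isT.
exists p.1, p.2; rewrite /total.
apply: (@le_trans _ _ (\sum_(a < d) \sum_(b < d) W (st_rho s p.1 p.2))).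
  by apply: ler_sum => a _; apply: ler_sum => b _; exact: (Hp (a, b)).
by rewrite !sum_cst expr2 mulrA.
Qed.

(** The largest of the d^2 coefficients of the stress carries a fraction 1 / d^2
    of it. It is cancelled, and the errors, decomposed along the same directions,
    are kept below half of what is gained. *)
Lemma advance s : stage_ok s -> \forall n \near \oo,
  exists2 s', passage n s s' & st_e s' <= rate * st_e s.
Proof.
move=> ok; have [a [b Hab]] := largest_rho s.
have e0 := ok_e ok; have A0 := A_ge0 ok; have D0 := D_ge0 ok.
pose g := st_e s / (2 * dR ^+ 2).
have g0 : 0 < g by rewrite divr_gt0.
have gE : st_e s - rate * st_e s = g by rewrite /rate /g; ring.
pose M := 4 * dR ^+ 3 * (1 + st_A s).
have d3 : 1 <= dR ^+ 3 by exact: exprn_ege1.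
have A1 : 1 <= 1 + st_A s by rewrite lerDl.
have dA : 1 <= dR ^+ 3 * (1 + st_A s).
  exact: mulr_ege1.
have M0 : 0 < M by rewrite /M -mulrA mulr_gt0// (lt_le_trans ltr01 dA).
pose eps := Num.min 1 (c0 * g / M).
have cg0 : 0 < c0 * g / M by rewrite divr_gt0// mulr_gt0.
have eps0 : 0 < eps by rewrite lt_min ltr01.
have eps1 : eps <= 1 by rewrite ge_min lexx.
have epsM : M * eps <= c0 * g.
  apply: (@le_trans _ _ (M * (c0 * g / M))); last by rewrite mulrC divfK// gt_eqF.
  by rewrite ler_wpM2l ?(ltW M0)// ge_min lexx orbT.
have cg : c0 * g <= g by rewrite ler_piMl// ltW.
have epscg : eps <= c0 * g.
  apply: le_trans epsM; rewrite ler_peMl ?(ltW eps0)// /M -mulrA.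
  by lra.
have epsA : eps <= g / (1 + st_A s).
  rewrite ler_pdivlMr ?(lt_le_trans ltr01 A1)//; apply: le_trans cg; apply: le_trans epsM.
  rewrite mulrC ler_wpM2r ?(ltW eps0)// /M ler_peMl ?(le_trans ler01 A1)//.
  by lra.
have [xi [orth xi1 eta1 xi0 xi2]] := direction_orth R a b d_gt1.
have de0 : 0 < kappa * st_e s by rewrite mulr_gt0.
have eps01 : 0 < eps <= 1 by rewrite eps0.
have stepn := block_step (st_rho s a b) orth xi1 eta1 xi0 xi2 hk de0 eps01 D0.
near=> n.
have [w [E0 [S [ssp sdiv sLp san sst scr ssq sE0 sS]]]] :
  exists w E0 S, step_spec (direction a b) alpha k (st_rho s a b) (kappa * st_e s)
    (st_D s) eps n w E0 S by near: n; exact: stepn.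
pose U' i := st_U s i ++ w i.
pose S' i j := S i j ++ tmul (w i) (st_U s j) ++ tmul (w j) (st_U s i) ++ Lm alpha i j w.
pose rho' a' b' := (if (a' == a) && (b' == b) then E0 else st_rho s a' b') ++ dec_tp S' a' b'.
pose s' := Stage w U' rho' (rate * st_e s) (st_A s + \sum_i anorm (w i))
  (st_D s + \sum_i deg (w i)).
have WS' i j : W (S' i j) <= 2 * eps * (1 + st_A s).
  rewrite /S' 3!wnorm_cat.
  have h1 := sS i j; have h2 := sst i j.
  have h3 : W (tmul (w i) (st_U s j)) <= eps * st_A s.
    by apply: (le_trans (scr _ _ (@ok_D _ ok j))); rewrite ler_wpM2l ?(ltW eps0)// (ok_A ok).
  have h4 : W (tmul (w j) (st_U s i)) <= eps * st_A s.
    by apply: (le_trans (scr _ _ (@ok_D _ ok i))); rewrite ler_wpM2l ?(ltW eps0)// (ok_A ok).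
  have -> : 2 * eps * (1 + st_A s) = eps + (eps * st_A s + (eps * st_A s + eps)) by ring.
  by rewrite !lerD.
have evS' i j x : ev (S' i j) x = ev (S i j) x + (ev (w i) x * ev (st_U s j) x +
    (ev (w j) x * ev (st_U s i) x + ev (Lm alpha i j w) x)).
  by rewrite /S' 3!ev_cat !ev_mul.
exists s'; last by [].
split => //=.
- split => /=.
  + move=> i j x; rewrite /rho'.
    have S'sym i' j' : ev (S' i' j') x = ev (S' j' i') x.
      have q1 := ssq i' j' x; have q2 := ssq j' i' x.
      have e1 : ev (S i' j') x = ev (S j' i') x.
        rewrite mulrC q2 in q1; move: q1.
        by rewrite (mulrC (direction a b 0 j')%:~R) => /addrI.
      rewrite !evS' (Lm_sym alpha i' j') e1; ring.
    under eq_bigr do under eq_bigr do rewrite ev_cat mulrDr.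
    under eq_bigr do rewrite big_split /=.
    rewrite big_split /= dec_tpE//.
    have -> : \sum_a' \sum_b' (direction a' b' 0 i)%:~R * (direction a' b' 0 j)%:~R *
        ev (if (a' == a) && (b' == b) then E0 else st_rho s a' b') x =
      \sum_a' \sum_b' (direction a' b' 0 i)%:~R * (direction a' b' 0 j)%:~R *
        ev (st_rho s a' b') x +
      (direction a b 0 i)%:~R * (direction a b 0 j)%:~R * (ev E0 x - ev (st_rho s a b) x).
      rewrite (sum2_change (a := a) (b := b) (G := fun a' b' => (direction a' b' 0 i)%:~R *
        (direction a' b' 0 j)%:~R * ev (st_rho s a' b') x)).
        by rewrite !eqxx /= -mulrBr.
      by move=> a' b' /negbTE ->.
    rewrite -(ok_eq ok) /U' (Lm_cat alpha i j (st_U s) w) 3!ev_cat evS'.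
    have q1 := ssq i j x.
    have -> : (ev (st_U s i) x + ev (w i) x) * (ev (st_U s j) x + ev (w j) x) =
      ev (st_U s i) x * ev (st_U s j) x + ev (st_U s i) x * ev (w j) x +
      ev (w i) x * ev (st_U s j) x + ev (w i) x * ev (w j) x by ring.
    rewrite q1; ring.
  + rewrite /total /= /rho'.
    under eq_bigr do under eq_bigr do rewrite wnorm_cat.
    under eq_bigr do rewrite big_split /=.
    rewrite big_split /=.
    have dec_le : \sum_a' \sum_b' W (dec_tp S' a' b') <= dR ^+ 3 * (2 * eps * (1 + st_A s)).
      apply: (@le_trans _ _ (\sum_(a' < d) \sum_(b' < d) dR * (2 * eps * (1 + st_A s)))).
        by apply: ler_sum => a' _; apply: ler_sum => b' _; exact: W_dec_tp.
      by rewrite !sum_cst !exprS expr0 mulr1 !mulrA.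
    have rho_le : \sum_a' \sum_b' W (if (a' == a) && (b' == b) then E0 else st_rho s a' b') =
        total s - W (st_rho s a b) + W E0.
      rewrite (sum2_change (a := a) (b := b) (G := fun a' b' => W (st_rho s a' b'))).
        by rewrite !eqxx /= /total; ring.
      by move=> a' b' /negbTE ->.
    rewrite rho_le.
    have t1 : total s - W (st_rho s a b) <= st_e s - 2 * g.
      have dd : 1 <= dR ^+ 2 by exact: exprn_ege1.
      have dd0 : 0 < dR ^+ 2 by exact: lt_le_trans ltr01 dd.
      have h1 : total s / dR ^+ 2 <= W (st_rho s a b) by rewrite ler_pdivrMr// mulrC.
      have h2 : 2 * g = st_e s / dR ^+ 2.
        by rewrite /g; move: (dR ^+ 2) dd0 => D' D'0; field; rewrite gt_eqF.
      rewrite h2; have := ok_total ok; set t := total s in h1 *; set e := st_e s => te.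
      have h3 : t * (1 - (dR ^+ 2)^-1) <= e * (1 - (dR ^+ 2)^-1).
        by rewrite ler_wpM2r// subr_ge0 invf_le1.
      by lra.
    have e3 : eps <= dR ^+ 3 * (1 + st_A s) * eps by rewrite ler_peMl// ltW.
    have rE : rate * st_e s = st_e s - g by rewrite -gE; ring.
    rewrite rE; rewrite /M in epsM; lra.
  + by rewrite mulr_gt0//; case/andP: rate_lt1.
  + move=> i; rewrite /U' /anorm wnorm_cat lerD//; first exact: (ok_A ok).
    by rewrite (bigD1 i)//= lerDl sumr_ge0// => j _; exact: anorm_ge0.
  + by rewrite addr_ge0// sumr_ge0// => j _; exact: deg_ge0.
  + move=> i; apply: spec_cat.
      apply: specW (@ok_D _ ok i) => m /le_trans; apply.
      by rewrite lerDl sumr_ge0// => j _; exact: deg_ge0.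
    apply: specW (@spec_deg R d (w i)) => m /le_trans; apply.
    by rewrite (bigD1 i)//= addrCA lerDl addr_ge0// sumr_ge0// => j _; exact: deg_ge0.
- by rewrite ler_piMl ?(ltW e0)//; case/andP: rate_lt1 => _ /ltW.
- move=> p i pp; rewrite gE; apply: (le_trans (sLp p i pp)); rewrite lee_fin//.
- move=> theta i th; rewrite gE; apply: le_trans epscg; apply: le_trans (san i).
  rewrite ler_wpM2r ?anorm_ge0// ler_powR ?lerN2//.
  by rewrite exprn_ege1// ler1n.
- move=> i f sf; rewrite gE; apply: (le_trans (scr i f sf)).
  by rewrite ler_wpM2r ?anorm_ge0.
- move=> i j; pose h : R := (direction a b 0 i)%:~R * (direction a b 0 j)%:~R.
  exists (tscale h E0 ++ tscale (- h) (st_rho s a b) ++ S i j).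
    by move=> x; rewrite ssq !ev_cat !ev_scale -/h; ring.
  have h1 : `|h| <= 1 by rewrite normrM mulr_ile1 ?direction_le.
  rewrite gE !wnorm_cat !wnorm_scale normrN.
  have t1 : `|h| * W E0 <= 1 * eps by apply: ler_pM.
  have t2 : `|h| * W (st_rho s a b) <= 1 * st_e s.
    apply: ler_pM => //; apply: le_trans (ok_total ok).
    rewrite /total (bigD1 a)//= (bigD1 b)//= -addrA lerDl addr_ge0// sumr_ge0// => a' _.
    by rewrite sumr_ge0.
  have t3 := sS i j.
  have eg : st_e s = 2 * dR ^+ 2 * g by rewrite /g [RHS]mulrC divfK// gt_eqF.
  by rewrite /Kself; lra.
Unshelve. all: by end_near. Qed.

End iteration.

(** * The sequence of blocks *)

Section stages.
Variables (R : realType) (d : nat) (alpha : R) (k : nat) (kappa c0 : R).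
Hypothesis d_gt1 : (1 < d)%N.
Hypothesis hk : 2 * alpha <= k%:R.
Hypothesis kappa_gt0 : 0 < kappa.
Hypothesis c0_gt0 : 0 < c0.
Hypothesis c0_le1 : c0 <= 1.
Local Notation stage := (stage R d).
Local Notation passage := (passage alpha k kappa c0).
Local Notation stage_ok := (stage_ok alpha k).
Local Notation rate := (rate R d).

Implicit Types (s : stage).

(** Advance whenever the frequency 2^n allows it; the comparison with idle s makes
    the choice depend on the state only, not on its last block. *)
Definition next n (s : stage) : stage :=
  match pselect (exists s', passage n (idle s) s' /\ st_e s' <= rate * st_e s) with
  | left H => projT1 (cid H)
  | right _ => idle s
  end.

Lemma idle_ok s : stage_ok s -> stage_ok (idle s).
Proof. by case. Qed.

Lemma passage_idle n s s' : passage n (idle s) s' -> passage n s s'.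
Proof. by case. Qed.

Lemma next_passage n s : stage_ok s -> passage n s (next n s).
Proof.
move=> ok; rewrite /next; case: pselect => [H|_]; last exact: idle_passage.
by apply: passage_idle; case: (cid H) => s' [].
Qed.

Variables (s0 : stage) (nv : nat).
Hypothesis ok0 : stage_ok s0.

Fixpoint st n : stage := if n is n'.+1 then next (nv + n') (st n') else s0.

Lemma st_ok n : stage_ok (st n).
Proof. by elim: n => //= n IH; have [] := next_passage (nv + n) IH. Qed.

Lemma st_passage n : passage (nv + n) (st n) (st n.+1).
Proof. exact: next_passage (st_ok n). Qed.

Lemma st_e_le n m : st_e (st (n + m)) <= st_e (st n).
Proof.
elim: m => [|m IH]; first by rewrite addn0.
by rewrite addnS; apply: le_trans IH; have [] := st_passage (n + m).
Qed.

(** While nothing happens the state stays the same up to its last block, and a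
    fixed state can be advanced at every large frequency. *)
Lemma st_advance n : exists m, st_e (st m) <= rate * st_e (st n).
Proof.
have [n1 _ Hn1] := advance d_gt1 hk kappa_gt0 c0_gt0 c0_le1 (idle_ok (st_ok n)).
have step j : st_e (st (n + j)) <= rate * st_e (st n) \/
    idle (st (n + j)) = idle (st n).
  elim: j => [|j IH]; first by right; rewrite addn0.
  case: IH => [IH|IH].
    by left; apply: le_trans IH; rewrite -addn1 addnA; exact: st_e_le.
  have eE : st_e (st (n + j)) = st_e (st n) := congr1 (@st_e R d) IH.
  rewrite addnS /= /next; case: pselect => [H|_]; last by right.
  by left; case: (cid H) => s' /= p; case: p => _; rewrite eE.
case: (step n1) => [H|H]; first by exists (n + n1)%N.
exists (n + n1).+1.
have eE : st_e (st (n + n1)) = st_e (st n) := congr1 (@st_e R d) H.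
rewrite /= /next; case: pselect => [H'|[]].
  by case: (cid H') => s' /= p; case: p => _; rewrite eE.
rewrite H eE; have [|s' p' e'] := Hn1 (nv + (n + n1))%N; first by rewrite /=; lia.
by exists s'.
Qed.

Lemma st_e_gt0 n : 0 < st_e (st n).
Proof. by case: (st_ok n). Qed.

Lemma st_e_cvg : st_e (st n) @[n --> \oo] --> 0.
Proof.
have [r0 r1] := andP (rate_lt1 R d_gt1).
have pow j : exists m, st_e (st m) <= rate ^+ j * st_e s0.
  elim: j => [|j [m IH]]; first by exists 0%N; rewrite expr0 mul1r.
  have [m' H] := st_advance m; exists m'; apply: (le_trans H).
  by rewrite exprS -mulrA ler_wpM2l// ltW.
apply/cvgrPdist_le => eps eps0.
have c : rate ^+ j * st_e s0 @[j --> \oo] --> 0 * st_e s0.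
  apply: cvgM; last exact: cvg_cst.
  by apply: cvg_expr; rewrite ger0_norm ?ltW.
rewrite mul0r in c; have /cvgrPdist_le/(_ _ eps0)[j _ Hj] := c.
have := Hj j (leqnn j) => /=; rewrite sub0r normrN => Hj'.
have [m Hm] := pow j; exists m => // n /= mn.
rewrite sub0r normrN (ger0_norm (ltW (st_e_gt0 _))) -(subnKC mn).
apply: (le_trans (st_e_le _ _)); apply: (le_trans Hm).
exact: le_trans (ler_norm _) Hj'.
Qed.

End stages.

Section blocks.
Variables (R : realType) (d : nat) (chi : 'rV[R]_d -> R) (alpha : R) (k : nat).
Variables (kappa c0 : R).
Hypothesis d_gt1 : (1 < d)%N.
Hypothesis hk : 2 * alpha <= k%:R.
Hypothesis kappa_gt0 : 0 < kappa.
Hypothesis c0_gt0 : 0 < c0.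
Hypothesis c0_le1 : c0 <= 1.
Local Notation mu := (torus_measure R d).
Local Notation W := (wnorm (hweight R k.+1)).
Variables (a0 : 'I_d -> seq (mode R d)) (nv : nat).
Hypothesis spec_a0 : forall i, spec (fun m => m != 0) (a0 i).
Hypothesis div_a0 : forall x, \sum_i ev (pderiv i (a0 i)) x = 0.
Hypothesis deg_a0 : forall i, deg (a0 i) < 9 / 10 * 2 ^+ nv.

Definition rho0 := dec_tp (fun i j => tmul (a0 i) (a0 j) ++ Lm alpha i j a0).

Definition e0 : R := 1 + \sum_a \sum_b W (rho0 a b).

Definition stage0 : stage R d := Stage (fun=> [::]) a0 rho0 e0
  (\sum_i anorm (a0 i) + \sum_(l < nv.+1) \sum_i anorm (mult (dsym chi l) (a0 i)))
  (\sum_i deg (a0 i)).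

Lemma stage0_ok : stage_ok alpha k stage0.
Proof.
split => /=.
- move=> i j x; rewrite dec_tpE; first by rewrite ev_cat ev_mul.
  by move=> i' j'; rewrite !(ev_cat (tmul _ _)) !ev_mul Lm_sym mulrC.
- by rewrite /total /e0 /= lerDr.
- rewrite /e0 ltr_pwDl// sumr_ge0// => a _; rewrite sumr_ge0// => b _.
  by apply: wnorm_ge0 => m; exact: hweight_ge0.
- move=> i; rewrite (bigD1 i)//= -addrA lerDl addr_ge0//.
    by rewrite sumr_ge0// => j _; exact: anorm_ge0.
  by rewrite sumr_ge0// => l _; rewrite sumr_ge0// => j _; exact: anorm_ge0.
- by rewrite sumr_ge0// => i _; exact: deg_ge0.
- move=> i; apply: specW (@spec_deg R d (a0 i)) => m /le_trans; apply.
  by rewrite (bigD1 i)//= lerDl sumr_ge0// => j _; exact: deg_ge0.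
Qed.

Local Notation st := (st alpha k kappa c0 stage0 nv).

Definition blocks n : 'I_d -> seq (mode R d) := if n is 0 then a0 else st_w (st n).

Let e n := st_e (st n).

Let pass n : passage alpha k kappa c0 (nv + n) (st n) (st n.+1).
Proof. exact: st_passage stage0_ok n. Qed.

Let ok n : stage_ok alpha k (st n). Proof. exact: st_ok stage0_ok n. Qed.

Let e_le n : e n.+1 <= e n. Proof. by case: (pass n). Qed.

Let e_gt0 n : 0 < e n. Proof. exact: ok_e (ok n). Qed.

Let e_cvg : e n @[n --> \oo] --> 0.
Proof. exact: st_e_cvg stage0_ok. Qed.

Lemma e_sum N : \sum_(n < N) (e n - e n.+1) <= e 0.
Proof.
have -> : \sum_(n < N) (e n - e n.+1) = e 0 - e N.
  by elim: N => [|N IH]; rewrite ?big_ord0 ?subrr// big_ord_recr /= IH; ring.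
by rewrite lerBlDr lerDl ltW.
Qed.

Lemma U_blocks n i : U blocks n i = st_U (st n) i.
Proof.
elim: n => [//|n IH] /=; rewrite IH.
by have := congr1 (fun f => f i) (pa_U (pass n)).
Qed.

Local Notation blk := (block chi nv blocks).

Lemma block_low l i : (l <= nv)%N -> blk l i = mult (dsym chi l) (a0 i).
Proof. by rewrite /block => ->. Qed.

Lemma block_high n i : blk (nv + n.+1) i = st_w (st n.+1) i.
Proof. by rewrite /block addnS ltnNge leq_addr /= -addnS addKn. Qed.

Lemma blocks_A n : \sum_(l < (nv + n).+1) \sum_j anorm (blk l j) <= st_A (st n).
Proof.
elim: n => [|n IH].
  rewrite addn0 /=; apply: (@le_trans _ _ (\sum_(l < nv.+1) \sum_i anorm (mult (dsym chi l) (a0 i)))).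
    apply: ler_sum => l _; apply: ler_sum => i _; rewrite block_low//.
    by rewrite -ltnS.
  by rewrite lerDr sumr_ge0// => j _; exact: anorm_ge0.
rewrite addnS big_ord_recr /= (pa_A (pass n)); apply: lerD => //.
by rewrite -addnS; apply: ler_sum => j _; rewrite block_high.
Qed.

Lemma blocks_D n l j : (l <= nv + n)%N ->
  spec (fun m => fnorm R m <= st_D (st n)) (blk l j).
Proof.
elim: n l => [|n IH] l ln.
  rewrite addn0 in ln; rewrite block_low//; apply: spec_mult.
  exact: (@ok_D _ _ _ _ _ (ok 0)).
have DD : st_D (st n) <= st_D (st n.+1).
  by rewrite (pa_D (pass n)) lerDl sumr_ge0// => i _; exact: deg_ge0.
have [ln'|ln'] := leqP l (nv + n).
  by apply: specW (@IH l ln') => m /le_trans; apply.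
have -> : l = (nv + n.+1)%N by lia.
rewrite block_high (pa_D (pass n)).
apply: specW (@spec_deg R d (st_w (st n.+1) j)) => m /le_trans; apply.
rewrite (bigD1 j)//= addrCA lerDl addr_ge0//; first exact: (ok_D0 (ok n)).
by rewrite sumr_ge0// => i _; exact: deg_ge0.
Qed.

Let coef_ge0 n : 0 <= st_A (st n) -> 0 <= (e n - e n.+1) / (1 + st_A (st n)).
Proof. by move=> A0; rewrite divr_ge0 ?subr_ge0// addr_ge0. Qed.

(** Bounds for the product of two blocks, summable over all pairs: the first
    blocks form a finite family, products with a smaller index are controlled by
    pa_cross and squares by pa_self. *)
Definition spread n l : R := if (n <= nv)%N then
    \sum_i \sum_j anorm (blk n i) * anorm (blk l j)
  else if (l < n)%N then (e (n - nv).-1 - e (n - nv)) / (1 + st_A (st (n - nv).-1)) *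
    \sum_j anorm (blk l j)
  else Kself R d * (e (n - nv).-1 - e (n - nv)).

Let K0 : 0 <= Kself R d.
Proof. by rewrite /Kself addr_ge0// mulr_ge0// sqr_ge0. Qed.

Let A_ge0' n : 0 <= st_A (st n). Proof. by eapply A_ge0; [exact: d_gt1|exact: ok]. Qed.

Lemma spread_ge0 n l : 0 <= spread n l.
Proof.
rewrite /spread; case: (leqP n nv) => nn.
  by rewrite sumr_ge0// => i _; rewrite sumr_ge0// => j _; rewrite mulr_ge0 ?anorm_ge0.
have d0 : 0 <= e (n - nv).-1 - e (n - nv).
  by rewrite subr_ge0; have := e_le (n - nv).-1; rewrite prednK// subn_gt0.
case: ifP => _; last by rewrite mulr_ge0.
apply: mulr_ge0; first by apply: divr_ge0 => //; rewrite addr_ge0.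
by rewrite sumr_ge0// => j _; exact: anorm_ge0.
Qed.

Lemma spread_sum N : \sum_(n < N) \sum_(l < n.+1) spread n l <=
  \sum_(n < nv.+1) \sum_(l < n.+1) spread n l + (1 + Kself R d) * e 0.
Proof.
apply: (@le_trans _ _ (\sum_(n < nv.+1 + N) \sum_(l < n.+1) spread n l)).
  rewrite (big_ord_widen (nv.+1 + N)%N (fun n => \sum_(l < n.+1) spread n l)) ?leq_addl//.
  rewrite [leRHS](bigID (fun n : 'I__ => (n < N)%N))/= lerDl sumr_ge0// => n _.
  by rewrite sumr_ge0// => l _; exact: spread_ge0.
rewrite big_split_ord /= lerD2l.
apply: (@le_trans _ _ (\sum_(n < N) (1 + Kself R d) * (e n - e n.+1))); last first.
  by rewrite -mulr_sumr ler_wpM2l ?addr_ge0// e_sum.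
apply: ler_sum => n _.
have d0 : 0 <= e n - e n.+1 by rewrite subr_ge0.
have nE : (nv.+1 + n - nv = n.+1)%N by lia.
have nn : (nv.+1 + n <= nv)%N = false by lia.
rewrite big_ord_recr /= mulrDl mul1r; apply: lerD; last first.
  by rewrite /spread nn ltnn nE.
under eq_bigr do rewrite /spread nn nE /= ltn_ord.
rewrite -mulr_sumr; apply: (@le_trans _ _
  ((e n - e n.+1) / (1 + st_A (st n)) * (1 + st_A (st n)))); last first.
  by rewrite divfK// gt_eqF// ltr_pwDl.
rewrite ler_wpM2l ?coef_ge0//.
by apply: (le_trans (blocks_A n)); rewrite lerDr.
Qed.

Lemma spreadP n l i j : (l <= n)%N -> exists2 G,
  (forall x, ev (blk n i) x * ev (blk l j) x = ev G x) & W G <= spread n l.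
Proof.
move=> ln; rewrite /spread; case: (leqP n nv) => nn.
  exists (tmul (blk n i) (blk l j)); first by move=> x; rewrite ev_mul.
  apply: le_trans (hweight_le_anorm _ _) _; rewrite anorm_mul.
  rewrite (bigD1 i)//= (bigD1 j)//= -addrA lerDl addr_ge0//.
    by rewrite sumr_ge0// => j' _; rewrite mulr_ge0 ?anorm_ge0.
  by rewrite sumr_ge0// => i' _; rewrite sumr_ge0// => j' _; rewrite mulr_ge0 ?anorm_ge0.
have nE : n = (nv + (n - nv).-1.+1)%N by rewrite prednK ?subn_gt0// subnKC// ltnW.
set m := (n - nv).-1 in nE *; have mE : (n - nv = m.+1)%N by rewrite /m prednK// subn_gt0.
rewrite mE; case: ltnP => ln'.
  exists (tmul (blk n i) (blk l j)); first by move=> x; rewrite ev_mul.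
  rewrite nE block_high.
  have lm : (l <= nv + m)%N by lia.
  apply: le_trans (pa_cross (pass m) i (@blocks_D m l j lm)) _.
  apply: ler_wpM2l; first exact: coef_ge0.
  by rewrite (bigD1 j)//= lerDl sumr_ge0// => j' _; exact: anorm_ge0.
have -> : l = n by apply/eqP; rewrite eqn_leq ln ln'.
rewrite nE !block_high; exact: pa_self (pass m) i j.
Qed.

Definition drop n : R := if n is m.+1 then c0 * (e m - e m.+1) else 0.

Lemma drop_ge0 n : 0 <= drop n.
Proof. by case: n => //= n; rewrite mulr_ge0 ?(ltW c0_gt0)// subr_ge0. Qed.

Lemma drop_sumS N : \sum_(n < N) drop n.+1 <= c0 * e 0.
Proof. by rewrite /drop -mulr_sumr ler_wpM2l ?(ltW c0_gt0)// e_sum. Qed.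

Lemma drop_sum N : \sum_(n < N) drop n <= c0 * e 0.
Proof.
case: N => [|N]; first by rewrite big_ord0 mulr_ge0 ?(ltW c0_gt0)// ltW.
by rewrite big_ord_recl /= add0r; exact: drop_sumS.
Qed.

Lemma blocks_Lp n (p : R) i : 1 <= p <= 2 - kappa * e n ->
  (Lnorm mu p%:E (fun t => (ev (blocks n.+1 i) (row_of t))%:E) <= (drop n.+1)%:E)%E.
Proof. by move=> H; apply: (pa_Lp (pass n)). Qed.

Lemma blocks_anorm n theta i : kappa * e n <= theta ->
  (2 ^+ (nv + n)) `^ (- theta) * anorm (blocks n.+1 i) <= drop n.+1.
Proof. by move=> H; apply: (pa_anorm (pass n)). Qed.

Lemma e_near (x : R) : 0 < x -> \forall n \near \oo, kappa * e n <= x.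
Proof.
move=> x0; have /cvgrPdist_le/(_ _ (divr_gt0 x0 kappa_gt0))[N _ HN] := e_cvg.
exists N => // n /HN /=; rewrite sub0r normrN (ger0_norm (ltW (e_gt0 n))).
by rewrite ler_pdivlMr// mulrC.
Qed.

Lemma good : good_blocks chi alpha nv k blocks.
Proof.
split.
- move=> i l la; apply/andP; split; first exact: spec_a0 la.
  exact: le_lt_trans (spec_deg la) (deg_a0 i).
- by move=> n i; apply: (@pa_spec _ _ _ _ _ _ _ _ _ (pass n)).
- by case=> [|n] x; [exact: div_a0|apply: (pa_div (pass n))].
- exists drop, (c0 * e 0); split; [exact: drop_ge0|exact: drop_sum| |].
    move=> p /andP[p1 p2].
    have [N _ HN] : \forall n \near \oo, kappa * e n <= 2 - p.
      by apply: e_near; rewrite subr_gt0.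
    exists N.+1 => // -[//|n] /= Nn i; apply: blocks_Lp.
    by have := HN n Nn => /= h; rewrite p1 /=; lra.
  move=> theta theta0; have [N _ HN] := e_near theta0.
  exists N.+1 => // -[//|n] /= Nn i; apply: le_trans (blocks_anorm i (HN n Nn)).
  rewrite ler_wpM2r ?anorm_ge0// !powRN lef_pV2 ?posrE ?powR_gt0 ?exprn_gt0//.
  apply: ge0_ler_powR; rewrite ?nnegrE ?exprn_ge0//; first exact: ltW.
  by rewrite ler_weXn2l// ?ler1n// leq_add2l.
- exists spread; eexists; split; [exact: spread_ge0|exact: spread_sum|exact: spreadP].
- pose E N i j : seq (mode R d) := flatten [seq tscale ((direction ab.1 ab.2 0 i)%:~R *
    (direction ab.1 ab.2 0 j)%:~R) (st_rho (st N) ab.1 ab.2) |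
    ab <- [seq (a, b) | a <- enum 'I_d, b <- enum 'I_d]].
  exists E; split.
    move=> N i j x; rewrite !U_blocks (_ : U blocks N = st_U (st N)); last first.
      by apply/funext => i'; exact: U_blocks.
    rewrite (ok_eq (ok N)) /E ev_flatten big_map big_allpairs_dep /= big_enum /=.
    apply: eq_bigr => a _; rewrite big_enum /=; apply: eq_bigr => b _.
    by rewrite ev_scale.
  move=> i j; have z : (fun=> 0 : R) @ \oo --> (0 : R) by exact: cvg_cst.
  refine (squeeze_cvgr _ z e_cvg); apply: nearW => N; apply/andP; split.
    by apply: wnorm_ge0 => m; exact: hweight_ge0.
  apply: le_trans (ok_total (ok N)); rewrite /E wnorm_flatten big_map big_allpairs_dep /=.
  rewrite big_enum /= /total; apply: ler_sum => a _; rewrite big_enum /=.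
  apply: ler_sum => b _; rewrite wnorm_scale ler_piMl//.
    by apply: wnorm_ge0 => m; exact: hweight_ge0.
  by rewrite normrM mulr_ile1 ?direction_le.
Qed.

End blocks.

Theorem blocks_exist (R : realType) (d : nat) (chi : 'rV[R]_d -> R) (alpha : R)
    (a0 : 'I_d -> seq (mode R d)) (p theta eps : R) : (1 < d)%N ->
  (forall i, spec (fun m => m != 0) (a0 i)) ->
  (forall x, \sum_i ev (pderiv i (a0 i)) x = 0) ->
  1 <= p < 2 -> 0 < theta -> 0 < eps -> exists nv k' a,
  [/\ 2 * alpha <= k'%:R, a 0 = a0, good_blocks chi alpha nv k' a,
    (forall i N, \sum_(n < N) fine (Lnorm (torus_measure R d) p%:E
      (fun t => (ev (a n.+1 i) (row_of t))%:E)) <= eps) &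
    (forall i N, \sum_(n < N) (2 ^+ (nv + n)) `^ (- theta) * anorm (a n.+1 i) <= eps)].
Proof.
move=> d1 sa da /andP[p1 p2] theta0 eps0.
pose k := Num.bound (2 * alpha).
have hk : 2 * alpha <= k%:R.
  have [a0'|a0'] := leP 0 (2 * alpha); first exact: ltW (archi_boundP a0').
  by apply: (le_trans (ltW a0')).
have [nv0 _ Hnv] : \forall n \near \oo, (2 * (\sum_i deg (a0 i)) + 1 : R) <= 2 ^+ n.
  exact: pow2_near.
pose nv := nv0; have {Hnv} Hnv := Hnv nv (leqnn nv).
have deg_a i : deg (a0 i) < 9 / 10 * 2 ^+ nv.
  have h : deg (a0 i) <= \sum_i deg (a0 i).
    by rewrite (bigD1 i)//= lerDl sumr_ge0// => j _; exact: deg_ge0.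
  have h0 := deg_ge0 (a0 i); rewrite /= in Hnv; lra.
have E0 : 0 < e0 alpha k a0 := ok_e (stage0_ok chi alpha k a0 nv).
pose e0' := e0 alpha k a0.
pose kappa := Num.min ((2 - p) / e0') (theta / e0').
have kap0 : 0 < kappa by rewrite lt_min !divr_gt0 ?subr_gt0.
pose c0 := Num.min 1 (eps / e0').
have c00 : 0 < c0 by rewrite lt_min ltr01 divr_gt0.
have c01 : c0 <= 1 by rewrite ge_min lexx.
have ce : c0 * e0' <= eps.
  by rewrite -ler_pdivlMr// ge_min lexx orbT.
pose st n := st alpha k kappa c0 (stage0 chi alpha k a0 nv) nv n.
have e_le n : st_e (st n) <= e0'.
  by have := st_e_le kappa c0 nv (stage0_ok chi alpha k a0 nv) 0 n.
have k1 n : kappa * st_e (st n) <= 2 - p.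
  apply: (@le_trans _ _ (kappa * e0')); first by rewrite ler_wpM2l// ltW.
  by rewrite -ler_pdivlMr// ge_min lexx.
have k2 n : kappa * st_e (st n) <= theta.
  apply: (@le_trans _ _ (kappa * e0')); first by rewrite ler_wpM2l// ltW.
  by rewrite -ler_pdivlMr// ge_min lexx orbT.
exists nv, k, (blocks chi alpha k kappa c0 a0 nv); split=> //.
- exact: good.
- move=> i N; apply: le_trans ce; apply: (le_trans (y := \sum_(n < N) drop chi alpha k kappa c0 a0 nv n.+1));
    last exact: drop_sumS.
  apply: ler_sum => n _; rewrite -lee_fin fineK; last first.
    rewrite ge0_fin_numE ?Lnorm_ge0//.
    by apply: le_lt_trans (Lnorm_ev_le _ _) _; rewrite ?lee_fin// ltry.
  apply: blocks_Lp => //; rewrite p1 /=; have := k1 n; rewrite /st; lra.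
- move=> i N; apply: le_trans ce; apply: (le_trans (y := \sum_(n < N) drop chi alpha k kappa c0 a0 nv n.+1));
    last exact: drop_sumS.
  by apply: ler_sum => n _; apply: blocks_anorm => //; exact: k2.
Qed.

(** * Averages with positive kernels *)

Section schur.
Context {disp : measure_display} {T : measurableType disp} {R : realType}.
Variable P : probability T R.
Local Notation N q f := (Lnorm P q (EFin \o f)).

(** Young's inequality for t and s^(p-1). *)
Lemma powR_tangent (p s t : R) : 1 <= p -> 0 <= s -> 0 <= t ->
  s `^ p + p * s `^ (p - 1) * (t - s) <= t `^ p.
Proof.
move=> p1 s0 t0; have p0 : 0 < p by exact: lt_le_trans ltr01 p1.
have [pe|pn] := eqVneq p 1.
  by rewrite pe subrr powRr0 !powRr1//; lra.
have pgt1 : 1 < p by rewrite lt_neqAle eq_sym pn.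
have q0 : 0 < p / (p - 1) by rewrite divr_gt0// subr_gt0.
have pq : p^-1 + (p / (p - 1))^-1 = 1.
  rewrite invf_div -{1}[p^-1]mul1r -mulrDl addrC subrK divff// gt_eqF//.
have := conjugate_powR t0 (powR_ge0 s (p - 1)) p0 q0 pq.
rewrite -powRrM (mulrC (p - 1)) divfK ?gt_eqF ?subr_gt0//.
have -> : s `^ p / (p / (p - 1)) = s `^ p * (1 - p^-1).
  by rewrite -[X in _ * (X - _)]pq [_ + _ - _]addrAC subrr add0r.
have -> : p * s `^ (p - 1) * (t - s) = p * (t * s `^ (p - 1)) - p * s `^ p.
  have -> : s `^ p = s * s `^ (p - 1).
    by rewrite mulr_powRB1.
  by ring.
move=> /(ler_wpM2l (ltW p0)).
have -> : p * (t `^ p / p + s `^ p * (1 - p^-1)) = t `^ p + p * s `^ p - s `^ p.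
  by field; rewrite gt_eqF.
by lra.
Qed.

Variable w : T -> T -> R.
Hypothesis w_ge0 : forall x y, 0 <= w x y.
Hypothesis mw : measurable_fun setT (fun z : T * T => w z.1 z.2).
Variable Cw : R.
Hypothesis w_le : forall x y, w x y <= Cw.
Hypothesis w_mean1 : forall x, \int[P]_y w x y = 1.
Hypothesis w_mean2 : forall y, \int[P]_x w x y = 1.

Let bw1 x : bdm (w x).
Proof.
split; first exact: measurableT_comp mw (pair1_measurable x).
by exists Cw => y; rewrite ger0_norm.
Qed.

Let bw2 y : bdm (fun x => w x y).
Proof.
split; first exact: measurableT_comp mw (pair2_measurable y).
by exists Cw => x; rewrite ger0_norm.
Qed.

Let Ew1 x : (\int[P]_y (w x y)%:E = 1)%E.
Proof.
rewrite -[LHS]fineK; first by rewrite -[fine _]/(\int[P]_y w x y) w_mean1.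
by apply: integrable_fin_num => //; exact: bdm_integrable.
Qed.

Let Ew2 y : (\int[P]_x (w x y)%:E = 1)%E.
Proof.
rewrite -[LHS]fineK; first by rewrite -[fine _]/(\int[P]_x w x y) w_mean2.
by apply: integrable_fin_num => //; exact: bdm_integrable.
Qed.

(** The tangent inequality at the absolute value s of the average, averaged. *)
Lemma jensen_average (g : T -> R) p x : 1 <= p -> P.-integrable setT (EFin \o g) ->
  ((`|\int[P]_y (g y * w x y)| `^ p)%:E <= \int[P]_y (`|g y| `^ p * w x y)%:E)%E.
Proof.
move=> p1 ig; have p0 : 0 < p by exact: lt_le_trans ltr01 p1.
have mg : measurable_fun setT g by move/integrableP: ig => [/measurable_EFinP].
have mgp : measurable_fun setT (fun y => (`|g y| `^ p * w x y)%:E).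
  apply/measurable_EFinP; apply: measurable_funM; last by case: (bw1 x).
  by apply/measurable_EFinP; exact: measurable_norm_powR.
have [->|fin] := eqVneq (\int[P]_y (`|g y| `^ p * w x y)%:E)%E +oo%E; first by rewrite leey.
have ip : P.-integrable setT (EFin \o (fun y => `|g y| `^ p * w x y)).
  apply/integrableP; split => //.
  under eq_integral do rewrite gee0_abs ?lee_fin ?mulr_ge0 ?powR_ge0//.
  by rewrite ltey.
set s := `|_|; have s0 : 0 <= s by exact: normr_ge0.
have ign : P.-integrable setT (EFin \o (fun y => `|g y|)) by exact: integrable_norm.
have igw := integrable_mul_bdm ign (bw1 x).
have iw : P.-integrable setT (EFin \o w x) by exact: bdm_integrable.
have sle : s <= \int[P]_y (`|g y| * w x y).
  have igw' := integrable_mul_bdm ig (bw1 x).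
  apply: le_trans (le_normr_Rintegral measurableT igw') _.
  rewrite le_eqVlt; apply/orP; left; apply/eqP; apply: eq_Rintegral => y _.
  by rewrite normrM (ger0_norm (w_ge0 x y)).
rewrite -[X in (_ <= X)%E]fineK; last by apply: integrable_fin_num.
rewrite lee_fin -[fine _]/(\int[P]_y (`|g y| `^ p * w x y)).
pose c := p * s `^ (p - 1).
have c0 : 0 <= c by rewrite mulr_ge0 ?powR_ge0 ?(ltW p0).
have i1 : P.-integrable setT (EFin \o (fun y => c * (`|g y| * w x y))).
  by apply: eq_integrable (integrableZl measurableT c igw) => // t _ /=.
have i2 : P.-integrable setT (EFin \o (fun y => (s `^ p - c * s) * w x y)).
  by apply: eq_integrable (integrableZl measurableT (s `^ p - c * s) iw) => // t _ /=.
apply: (@le_trans _ _ (\int[P]_y (c * (`|g y| * w x y) + (s `^ p - c * s) * w x y))).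
  rewrite RintegralD// !RintegralZl// w_mean1 mulr1.
  by have := ler_wpM2l c0 sle; lra.
apply: le_Rintegral => //.
  by apply: eq_integrable (integrableD measurableT i1 i2) => // t _ /=.
move=> y _; have h := powR_tangent p1 s0 (normr_ge0 (g y)).
have := ler_wpM2r (w_ge0 x y) h; rewrite -/c; lra.
Qed.

Let P_gt0 : (0 < P [set: T])%E.
Proof. by rewrite probability_setT lte01. Qed.

(** Schur's test for a kernel with mean 1 in both variables: Jensen's inequality,
    then Tonelli's theorem. *)
Lemma schur_average (g : T -> R) q : (1 <= q)%E -> P.-integrable setT (EFin \o g) ->
  measurable_fun setT (fun x => \int[P]_y (g y * w x y))%R ->
  (N q (fun x => \int[P]_y (g y * w x y))%R <= N q g)%E.
Proof.
move=> q1 ig mT.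
have mg : measurable_fun setT g by move/integrableP: ig => [/measurable_EFinP].
case: q q1 => [q||]// q1.
  rewrite lee_fin in q1; have q0 : 0 < q by exact: lt_le_trans ltr01 q1.
  pose f (z : T * T) := (`|g z.2| `^ q * w z.1 z.2)%:E.
  have f0 z : (0 <= f z)%E by rewrite lee_fin mulr_ge0 ?powR_ge0.
  have mf : measurable_fun setT f.
    apply/measurable_EFinP; apply: measurable_funM => //.
    have mp : measurable_fun setT (fun y => `|g y| `^ q).
      by apply/measurable_EFinP; exact: measurable_norm_powR.
    by apply: (measurableT_comp mp); exact: measurable_snd.
  rewrite unlock; apply: poweR_mono; first by rewrite invr_ge0 ltW.
    by apply: integral_ge0 => t _; rewrite lee_fin powR_ge0.
  apply: (@le_trans _ _ (\int[P]_x \int[P]_y f (x, y))%E).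
    apply: ge0_le_integral => //.
    - by move=> t _; rewrite lee_fin powR_ge0.
    - exact: measurable_norm_powR.
    - exact: measurable_fun_fubini_tonelli_F.
    - by move=> x _; exact: jensen_average.
  rewrite (@fubini_tonelli _ _ _ _ _ P P f mf f0).
  apply: ge0_le_integral => //.
  - by move=> y _; apply: integral_ge0 => x _; exact: f0.
  - exact: measurable_fun_fubini_tonelli_G.
  - exact: measurable_norm_powR.
  - move=> y _; rewrite /f /=; under eq_integral do rewrite EFinM.
    rewrite ge0_integralZl// ?lee_fin ?powR_ge0//.
    + by rewrite Ew2 mule1.
    + by apply/measurable_EFinP; case: (bw2 y).
    + by move=> x _; rewrite lee_fin.
rewrite unlock P_gt0; set M := ess_sup P (abse \o (EFin \o g)).
have M0 : (0 <= M)%E by apply: ess_sup_gee => //; apply: nearW => t; exact: abse_ge0.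
apply/ess_supP; apply: nearW => x /=.
have [->|Moo] := eqVneq M +oo%E; first by rewrite leey.
have Mfin : M \is a fin_num by rewrite ge0_fin_numE// ltey.
have igw' := integrable_mul_bdm ig (bw1 x).
have ign : P.-integrable setT (EFin \o (fun y => `|g y|)) by exact: integrable_norm.
have igw := integrable_mul_bdm ign (bw1 x).
apply: (@le_trans _ _ (\int[P]_y (`|g y| * w x y)%:E)%E).
  rewrite -[X in (_ <= X)%E]fineK; last exact: integrable_fin_num.
  rewrite lee_fin; apply: le_trans (le_normr_Rintegral measurableT igw') _.
  rewrite le_eqVlt; apply/orP; left; apply/eqP; apply: eq_Rintegral => y _.
  by rewrite normrM (ger0_norm (w_ge0 x y)).
apply: (@le_trans _ _ (\int[P]_y (fine M * w x y)%:E)%E); last first.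
  under eq_integral do rewrite EFinM.
  rewrite ge0_integralZl// ?lee_fin ?fine_ge0//.
  + by rewrite Ew1 mule1 fineK.
  + by apply/measurable_EFinP; case: (bw1 x).
  + by move=> y _; rewrite lee_fin.
apply: ae_ge0_le_integral => //.
- by move=> y _; rewrite lee_fin mulr_ge0.
- by apply/measurable_EFinP; apply: measurable_funM; [exact: measurableT_comp|case: (bw1 x)].
- by move=> y _; rewrite lee_fin mulr_ge0// fine_ge0.
- by apply/measurable_EFinP; apply: measurable_funM => //; case: (bw1 x).
have := ess_sup_ge P (fun y => `|(g y)%:E|%E); apply: filterS => y gM _.
by rewrite lee_fin ler_wpM2r// -lee_fin fineK.
Qed.

End schur.

(** * Fejer means *)

Section fejer.
Variables (R : realType) (d : nat).
Local Notation mu := (torus_measure R d).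
Local Notation freq := 'rV[int]_d.
Implicit Types (f g : seq (mode R d)) (m : freq) (x y : 'rV[R]_d).
Local Notation row_of := (@row_of R d).
Local Notation mtuple := (d.-tuple (measurableTypeR R)).

Variable K : nat.
Hypothesis K_gt0 : (0 < K)%N.
Local Notation box := {ffun 'I_d -> 'I_K}.

Definition box_freq (h : box) : freq := \row_i ((h i : nat)%:Z).

Lemma box_freq_inj : injective box_freq.
Proof.
move=> h h' /rowP H; apply/ffunP => i; have := H i; rewrite !mxE => -[hi].
exact: val_inj.
Qed.

(** Weights of the Fejer kernel: the proportion of pairs of box frequencies with
    difference m. *)
Definition fejer m : R := (K%:R ^+ d)^-1 *
  \sum_(h : box) \sum_(h' : box) (box_freq h - box_freq h' == m)%:R.

Let Kd0 : (0 : R) < K%:R ^+ d. Proof. by rewrite exprn_gt0// ltr0n. Qed.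

Let card_box : #|{: box}|%:R = K%:R ^+ d :> R.
Proof. by rewrite card_ffun !card_ord natrX. Qed.

Lemma fejerN m : fejer (- m) = fejer m.
Proof.
rewrite /fejer exchange_big /=; congr (_ * _); apply: eq_bigr => h _.
by apply: eq_bigr => h' _; rewrite -eqr_oppLR opprB.
Qed.

Lemma fejer_ge0 m : 0 <= fejer m.
Proof. by rewrite mulr_ge0 ?invr_ge0 ?(ltW Kd0)// sumr_ge0// => h _; rewrite sumr_ge0. Qed.

Lemma fejer_le1 m : fejer m <= 1.
Proof.
rewrite /fejer mulrC ler_pdivrMr// mul1r -card_box -sum1_card natr_sum.
apply: ler_sum => h _.
have [[h' H]|H] := pselect (exists h' : box, box_freq h - box_freq h' = m).
  rewrite (bigD1 h')//= big1 ?addr0 ?ler1n ?leq_b1//.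
    by case: (_ == _).
  move=> h'' /eqP hh; case: eqP => // H'; exfalso; apply: hh.
  apply: box_freq_inj; apply: oppr_inj; apply: (@addrI _ (box_freq h)).
  by rewrite H.
rewrite big1// => h' _; case: eqP => // H'; exfalso; apply: H; by exists h'.
Qed.

Lemma fejer0 : fejer 0 = 1.
Proof.
rewrite /fejer (eq_bigr (fun=> 1)); last first.
  move=> h _; rewrite (bigD1 h)//= subrr eqxx big1 ?addr0// => h' hh.
  by case: eqP => // /subr0_eq/box_freq_inj e; rewrite e eqxx in hh.
by rewrite sumr_const card_box mulVf// gt_eqF.
Qed.

Lemma box_diff_cube (h h' : box) : box_freq h - box_freq h' \in cube d K.
Proof.
rewrite mem_cube; apply/forallP => i; rewrite !mxE.
have := ltn_ord (h i); have := ltn_ord (h' i); lia.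
Qed.

Lemma fejer_cube m : m \notin cube d K -> fejer m = 0.
Proof.
move=> mK; rewrite /fejer big1 ?mulr0// => h _; rewrite big1// => h' _.
by case: eqP => // e; rewrite -e box_diff_cube in mK.
Qed.

Definition fejer_kernel x y : R :=
  \sum_(m <- cube d K) fejer m * (cosm m y * cosm m x + sinm m y * sinm m x).

Let sum_fejer (G : freq -> R) : \sum_(m <- cube d K) fejer m * G m =
  (K%:R ^+ d)^-1 * \sum_(h : box) \sum_(h' : box) G (box_freq h - box_freq h').
Proof.
rewrite /fejer; under eq_bigr do rewrite -mulrA mulr_suml.
rewrite -mulr_sumr exchange_big /=; congr (_ * _); apply: eq_bigr => h _.
under eq_bigr do rewrite mulr_suml.
rewrite exchange_big /=; apply: eq_bigr => h' _.
rewrite (bigD1_seq (box_freq h - box_freq h')) ?cube_uniq ?box_diff_cube//=.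
rewrite eqxx mul1r big1 ?addr0// => m; rewrite eq_sym => /negbTE ->; exact: mul0r.
Qed.

(** The kernel is a sum of two squares. *)
Lemma fejer_kernel_ge0 x y : 0 <= fejer_kernel x y.
Proof.
rewrite /fejer_kernel sum_fejer mulr_ge0 ?invr_ge0 ?(ltW Kd0)//.
pose a h := phase (box_freq h) x - phase (box_freq h) y.
rewrite (_ : \sum_h _ = (\sum_(h : box) cos (a h)) ^+ 2 + (\sum_(h : box) sin (a h)) ^+ 2).
  by rewrite addr_ge0 ?sqr_ge0.
rewrite !expr2 !mulr_suml -big_split /=; apply: eq_bigr => h _.
rewrite !mulr_sumr -big_split /=; apply: eq_bigr => h' _.
rewrite /cosm /sinm !phaseB.
have -> : forall p q p' q' : R, cos (p' - q') * cos (p - q) + sin (p' - q') * sin (p - q) =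
   cos (p - q - (p' - q')).
  by move=> p q p' q'; rewrite [RHS]cosB; ring.
rewrite -cosB; congr cos; rewrite /a; ring.
Qed.

Lemma fejer_kernel_sym x y : fejer_kernel x y = fejer_kernel y x.
Proof. by apply: eq_bigr => m _; congr (_ * _); ring. Qed.

Lemma fejer_kernel_le x y : fejer_kernel x y <= 2 * (size (cube d K))%:R.
Proof.
rewrite /fejer_kernel; apply: (@le_trans _ _ (\sum_(m <- cube d K) (2 : R))); last first.
  by rewrite big_const_seq count_predT iter_addr addr0 mulr_natr.
apply: ler_sum => m _.
have b1 (c s c' s' : R) : `|c| <= 1 -> `|s| <= 1 -> `|c'| <= 1 -> `|s'| <= 1 ->
    `|c * c' + s * s'| <= 2.
  move=> ? ? ? ?; apply: le_trans (ler_normD _ _) _; rewrite !normrM.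
  have h1 : `|c| * `|c'| <= 1 by rewrite mulr_ile1.
  have h2 : `|s| * `|s'| <= 1 by rewrite mulr_ile1.
  by lra.
have n1 z b : `|wave m b z| <= 1 by exact: wave_norm.
apply: le_trans (ler_norm _) _; rewrite normrM (ger0_norm (fejer_ge0 m)).
rewrite -[leRHS]mul1r; apply: ler_pM => //; first exact: fejer_ge0.
  exact: fejer_le1.
by rewrite !cosmE !sinmE; apply: b1; exact: n1.
Qed.

Lemma fejer_kernel_mean x : \int[mu]_t fejer_kernel x (row_of t) = 1.
Proof.
have bm m b c : mu.-integrable setT (EFin \o (fun t : mtuple => wave m b (row_of t) * c)).
  apply: bdm_integrable; rewrite (_ : (fun t => _) = (fun t => c * wave m b (row_of t))).
    by apply: bdmZ; exact: bdm_wave.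
  by apply/funext => t; rewrite mulrC.
rewrite /fejer_kernel Rint_sum; last first.
  move=> m; apply: bdm_integrable; apply: bdmZ; apply: bdmD.
    by apply: bdmM; [rewrite cosmE; exact: bdm_wave|exact: bdm_cst].
  by apply: bdmM; [rewrite sinmE; exact: bdm_wave|exact: bdm_cst].
have I m : \int[mu]_t (fejer m * (cosm m (row_of t) * cosm m x + sinm m (row_of t) * sinm m x)) =
    fejer m * (m == 0)%:R.
  rewrite RintegralZl//; last first.
    apply: bdm_integrable; apply: bdmD.
      by apply: bdmM; [rewrite cosmE; exact: bdm_wave|exact: bdm_cst].
    by apply: bdmM; [rewrite sinmE; exact: bdm_wave|exact: bdm_cst].
  rewrite cosmE sinmE RintegralD//; try exact: bm.
  rewrite !RintegralZr//; try exact/bdm_integrable/bdm_wave.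
  rewrite !Rint_wave; case: eqVneq => [->|_]; last by rewrite !mul0r addr0.
  by rewrite cos0 cosN cos_pihalf mul0r addr0 wave_cos phase0 cos0 mulr1.
under eq_bigr do rewrite I.
rewrite (bigD1_seq 0) ?cube_uniq//=; last first.
  by rewrite mem_cube; apply/forallP => i; rewrite mxE.
rewrite eqxx mulr1 fejer0 big1 ?addr0// => m /negbTE ->; exact: mulr0.
Qed.

Lemma fejer_average (g : mtuple -> R) (F : functional R d) :
  mu.-integrable setT (EFin \o g) ->
  (forall phi, test_fun phi -> F phi = \int[mu]_t (g t * phi (row_of t))) ->
  forall x, ev (trunc fejer F K) x = \int[mu]_t (g t * fejer_kernel x (row_of t)).
Proof.
move=> ig FE x; rewrite ev_trunc.
under [RHS]eq_Rintegral do rewrite /fejer_kernel mulr_sumr.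
have ic m : mu.-integrable setT (EFin \o (fun t => g t * cosm m (row_of t))).
  by apply: integrable_mul_bdm => //; rewrite cosmE; exact: bdm_wave.
have is' m : mu.-integrable setT (EFin \o (fun t => g t * sinm m (row_of t))).
  by apply: integrable_mul_bdm => //; rewrite sinmE; exact: bdm_wave.
have iZ (h : mtuple -> R) c : mu.-integrable setT (EFin \o h) ->
    mu.-integrable setT (EFin \o (fun t => c * h t)).
  by move=> ih; apply: eq_integrable (integrableZl measurableT c ih) => // t _.
have E m t : g t * (fejer m * (cosm m (row_of t) * cosm m x + sinm m (row_of t) * sinm m x)) =
  fejer m * cosm m x * (g t * cosm m (row_of t)) + fejer m * sinm m x * (g t * sinm m (row_of t)).
  by ring.
rewrite Rint_sum; last first.
  move=> m; apply: eq_integrable (integrableD measurableT (iZ _ (fejer m * cosm m x) (ic m))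
    (iZ _ (fejer m * sinm m x) (is' m))) => // t _ /=.
  by rewrite E EFinD.
apply: eq_bigr => m _; under [RHS]eq_Rintegral do rewrite E.
rewrite RintegralD//; try exact: iZ.
by rewrite !RintegralZl// -FE ?(FE (sinm m))//; [ring|exact: sinm_test|exact: cosm_test].
Qed.

(** The kernel is nonnegative with mean 1 in both variables. *)
Lemma fejer_contraction (g : mtuple -> R) (F : functional R d) q :
  mu.-integrable setT (EFin \o g) ->
  (forall phi, test_fun phi -> F phi = \int[mu]_t (g t * phi (row_of t))) ->
  (1 <= q)%E ->
  (Lnorm mu q (fun t => (ev (trunc fejer F K) (row_of t))%:E) <= Lnorm mu q (EFin \o g))%E.
Proof.
move=> ig FE q1; pose w (s t : mtuple) := fejer_kernel (row_of s) (row_of t).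
have e : (fun t : mtuple => ev (trunc fejer F K) (row_of t)) =
    (fun s => \int[mu]_t (g t * w s t)).
  by apply/funext => s; rewrite (fejer_average ig FE).
have mT : measurable_fun setT (fun s => \int[mu]_t (g t * w s t)).
  by rewrite -e; exact: measurable_ev.
have mwave m b : measurable_fun setT (fun t : mtuple => wave m b (row_of t)).
  by case: (bdm_wave (R := R) m b).
have mw : measurable_fun setT (fun z : mtuple * mtuple => w z.1 z.2).
  apply: measurable_sum => m; apply: measurable_funM => //.
  apply: measurable_funD; apply: measurable_funM; rewrite ?cosmE ?sinmE.
  - by apply: (measurableT_comp (mwave m 0)); exact: measurable_snd.
  - by apply: (measurableT_comp (mwave m 0)); exact: measurable_fst.
  - by apply: (measurableT_comp (mwave m (- (pi / 2)))); exact: measurable_snd.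
  - by apply: (measurableT_comp (mwave m (- (pi / 2)))); exact: measurable_fst.
have -> : (fun t : mtuple => (ev (trunc fejer F K) (row_of t))%:E) =
    EFin \o (fun s => \int[mu]_t (g t * w s t)).
  by apply/funext => s /=; rewrite (fejer_average ig FE).
apply: (schur_average (w := w) (fun s t => fejer_kernel_ge0 _ _) mw
  (fun s t => fejer_kernel_le _ _)) => //.
- by move=> s; exact: fejer_kernel_mean.
- move=> t; rewrite /w; under eq_Rintegral do rewrite fejer_kernel_sym.
  exact: fejer_kernel_mean.
Qed.

Lemma fejer_mult f : ev (trunc fejer (distribution_of (ev f)) K) =1 ev (mult fejer f).
Proof.
move=> x; rewrite ev_trunc; apply: mult_series; first exact: fejerN.
exact: fejer_cube.
Qed.

Definition fejer1 (z : int) : R := K%:R^-1 *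
  \sum_(a < K) \sum_(b < K) ((a : nat)%:Z - (b : nat)%:Z == z)%:R.

(** The box and its differences are products over the coordinates. *)
Lemma fejer_prod m : fejer m = \prod_i fejer1 (m 0 i).
Proof.
rewrite /fejer1 big_split /= prodr_const card_ord exprVn; congr (_ * _).
rewrite bigA_distr_bigA /=; apply: eq_bigr => h _.
rewrite bigA_distr_bigA /=; apply: eq_bigr => h' _.
have -> : (box_freq h - box_freq h' == m) =
    [forall i, (h i : nat)%:Z - (h' i : nat)%:Z == m 0 i].
  apply/eqP/forallP => [e i|H]; first by rewrite -e !mxE.
  by apply/rowP => i; rewrite !mxE; apply/eqP.
have [H|H] := boolP [forall i, (h i : nat)%:Z - (h' i : nat)%:Z == m 0 i].
  by rewrite big1// => i _; rewrite (forallP H i).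
by have /forallPn[i Hi] := H; rewrite (bigD1 i)//= (negbTE Hi) mul0r.
Qed.

Lemma fejer1_bounds z : 1 - `|z|%:~R / K%:R <= fejer1 z <= 1.
Proof.
have K0 : (0 : R) < K%:R by rewrite ltr0n.
apply/andP; split; last first.
  rewrite /fejer1 mulrC ler_pdivrMr// mul1r -[X in _ <= X%:R]card_ord -sum1_card natr_sum.
  apply: ler_sum => a _.
  have [[b H]|H] := pselect (exists b : 'I_K, (a : nat)%:Z - (b : nat)%:Z = z).
    rewrite (bigD1 b)//= big1 ?addr0 ?ler1n ?leq_b1//; first by case: (_ == _).
    move=> b' /eqP bb; case: eqP => // H'; exfalso; apply: bb; apply: val_inj.
    by move: H'; rewrite -H => /addrI/oppr_inj[].
  by rewrite big1// => b _; case: eqP => // H'; exfalso; apply: H; exists b.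
have count n : K%:R - n%:R <= \sum_(b < K) \sum_(a < K) ((a : nat)%:Z - (b : nat)%:Z == n%:Z)%:R :> R.
  apply: (@le_trans _ _ (\sum_(b < K) (b + n < K)%:R)).
    have [nK|Kn] := leqP K n; last first.
      rewrite (bigID (fun b : 'I_K => (b < K - n)%N)) /= ler_wpDr ?sumr_ge0//.
      rewrite (eq_bigr (fun=> 1)); last by move=> b bK; rewrite (_ : (b + n < K)%N)//; lia.
      rewrite -(big_ord_widen K (fun=> 1 : R) (leq_subr n K)) sumr_const card_ord.
      by rewrite natrB// ltnW.
    by apply: le_trans (sumr_ge0 _ _) => //; rewrite subr_le0 ler_nat.
  apply: ler_sum => b _; case: ltnP => bK; last by rewrite sumr_ge0.
  rewrite (bigD1 (Ordinal bK))//= (_ : _ == _); last by apply/eqP; lia.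
  by rewrite lerDl sumr_ge0.
rewrite /fejer1 [leRHS]mulrC ler_pdivlMr// mulrBl mul1r divfK ?gt_eqF//.
case: z => n.
  by rewrite exchange_big /=; exact: count.
have -> : `|Negz n| = (n.+1)%:Z by [].
apply: le_trans (count n.+1) _; apply: ler_sum => b _; apply: ler_sum => a _.
rewrite (_ : ((a : nat)%:Z - (b : nat)%:Z == n.+1%:Z) = ((b : nat)%:Z - (a : nat)%:Z == Negz n))//.
by apply/eqP/eqP; lia.
Qed.

End fejer.

Lemma fejer_cvg (R : realType) (d : nat) (m : 'rV[int]_d) :
  fejer R K.+1 m @[K --> \oo] --> (1 : R).
Proof.
rewrite (_ : (fun K => _) = (fun K => \prod_i fejer1 R K.+1 (m 0 i))); last first.
  by apply/funext => K; rewrite fejer_prod.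
have F i : fejer1 R K.+1 (m 0 i) @[K --> \oo] --> (1 : R).
  have c1 : (1 - `|m 0 i|%:~R / K.+1%:R : R) @[K --> \oo] --> (1 : R).
    rewrite -[X in _ --> X]subr0 -[X in _ - X](mulr0 (`|m 0 i|%:~R)).
    apply: cvgB; first exact: cvg_cst.
    by apply: cvgM; [exact: cvg_cst|exact: cvg_harmonic].
  have c2 : (fun=> 1 : R) @ \oo --> (1 : R) by exact: cvg_cst.
  by refine (squeeze_cvgr _ c1 c2); apply: nearW => K; exact: fejer1_bounds.
have P (r : seq 'I_d) : \prod_(i <- r) fejer1 R K.+1 (m 0 i) @[K --> \oo] --> (1 : R).
  elim: r => [|i r IH].
    by under eq_fun do rewrite big_nil; exact: cvg_cst.
  have h := cvgM (F i) IH; rewrite mulr1 in h.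
  have E : (fun K => \prod_(j <- i :: r) fejer1 R K.+1 (m 0 j)) =
      (fun K => fejer1 R K.+1 (m 0 i) * \prod_(j <- r) fejer1 R K.+1 (m 0 j)).
    by apply/funext => K; rewrite big_cons.
  by rewrite E; exact: h.
exact: P.
Qed.

(** The weights tend to 1 and f has finitely many waves. *)
Lemma fejer_ev_cvg (R : realType) (d : nat) (f : seq (mode R d)) eps : 0 < eps ->
  \forall K \near \oo, forall q, (1 <= q)%E ->
   (Lnorm (torus_measure R d) q (fun t => (ev (mult (fejer R K.+1) f) (row_of t) -
      ev f (row_of t))%:E) <= eps%:E)%E.
Proof.
move=> eps0.
have c : \sum_(l <- f) `|amp l| * (1 - fejer R K.+1 (mfreq l)) @[K --> \oo] --> (0 : R).
  rewrite -[X in _ --> X](_ : \sum_(l <- f) `|amp l| * (1 - 1) = 0); last first.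
    by rewrite big1// => l _; rewrite subrr mulr0.
  apply: (@cvg_bigsum R _ f (fun l K => `|amp l| * (1 - fejer R K.+1 (mfreq l)))) => l.
  apply: cvgM; first exact: cvg_cst.
  by apply: cvgB; [exact: cvg_cst|exact: fejer_cvg].
have /cvgrPdist_le/(_ _ eps0) := c; apply: filterS => K /= HK q q1.
have E : (fun t : d.-tuple (measurableTypeR R) =>
    (ev (mult (fejer R K.+1) f) (row_of t) - ev f (row_of t))%:E) =
    (fun t => (ev (mult (fun m => fejer R K.+1 m - 1) f) (row_of t))%:E).
  apply/funext => t; congr (_%:E).
  rewrite (ev_multS (fejer R K.+1) (fun=> - 1)); congr (_ + _).
  by rewrite /ev /mult big_map -sumrN; apply: eq_bigr => l _; rewrite /amp /= mulN1r mulNr.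
rewrite E; apply: (le_trans (Lnorm_ev_le _ q1)); rewrite lee_fin.
apply: le_trans HK; rewrite sub0r normrN; apply: le_trans (ler_norm _).
rewrite /anorm /wnorm /mult big_map le_eqVlt; apply/orP; left; apply/eqP.
apply: eq_bigr => l _; rewrite mul1r {1}/amp /= normrM mulrC distrC (ger0_norm (_ : 0 <= 1 - _))//.
by rewrite subr_ge0 fejer_le1.
Qed.

(** * Density of trigonometric polynomials *)

Section density.
Variables (R : realType) (d : nat).
Local Notation M := (measurableTypeR R).
Local Notation mu := (torus_measure R d).
Local Notation row_of := (@row_of R d).
Local Notation mtuple := (d.-tuple M).
Implicit Types (f g : seq (mode R d)) (h k : mtuple -> R).

(** Bounded functions that are limits of trigonometric polynomials in mean square.
    They form an algebra closed under bounded limits, hence contain the indicator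
    of every measurable set as soon as they contain those of the half-spaces. *)
Definition approximable h : Prop := bdm h /\ forall eps : R, 0 < eps ->
  exists f, \int[mu]_t ((h t - ev f (row_of t)) ^+ 2) <= eps.

Lemma bdm_sqr h : bdm h -> bdm (fun t => h t ^+ 2).
Proof. by move=> bh; under eq_fun do rewrite expr2; exact: bdmM. Qed.

Lemma approximable_ev f : approximable (fun t => ev f (row_of t)).
Proof.
split=> [|eps eps0]; first exact: bdm_ev.
exists f; under eq_Rintegral do rewrite subrr expr0n.
by rewrite Rint_cst ltW.
Qed.

Lemma Rint_sqr_le (a b c : mtuple -> R) (A B : R) : bdm a -> bdm b -> bdm c ->
  (forall t, `|c t| <= `|a t| + `|b t|) ->
  \int[mu]_t (a t ^+ 2) <= A -> \int[mu]_t (b t ^+ 2) <= B ->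
  \int[mu]_t (c t ^+ 2) <= 2 * A + 2 * B.
Proof.
move=> ba bb bc abc aA bB.
have ia := bdm_sqr ba; have ib := bdm_sqr bb; have ic := bdm_sqr bc.
apply: (@le_trans _ _ (\int[mu]_t (2 * a t ^+ 2 + 2 * b t ^+ 2))).
  apply: le_Rint_bdm => //; first by apply: bdmD; exact: bdmZ.
  move=> t; rewrite -[c t ^+ 2]real_normK ?num_real//.
  rewrite -[a t ^+ 2]real_normK ?num_real// -[b t ^+ 2]real_normK ?num_real//.
  have h := abc t; have h0 := normr_ge0 (c t); have h1 := sqr_ge0 (`|a t| - `|b t|).
  have h2 : `|c t| ^+ 2 <= (`|a t| + `|b t|) ^+ 2 by rewrite lerXn2r ?nnegrE ?addr_ge0.
  apply: le_trans h2 _; rewrite -subr_ge0.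
  rewrite (_ : _ - _ = (`|a t| - `|b t|) ^+ 2)//; ring.
rewrite RintegralD//; try by apply: bdm_integrable; exact: bdmZ.
rewrite !RintegralZl//; try exact: bdm_integrable.
by lra.
Qed.

Lemma approximableB h k : approximable h -> approximable k ->
  approximable (fun t => h t - k t).
Proof.
move=> [bh ah] [bk ak]; split=> [|eps eps0]; first exact: bdmB.
have e4 : 0 < eps / 4 by rewrite divr_gt0.
have [f Hf] := ah _ e4; have [g Hg] := ak _ e4.
exists (f ++ tscale (-1) g).
have -> : eps = 2 * (eps / 4) + 2 * (eps / 4) by field.
apply: (Rint_sqr_le (bdmB bh (bdm_ev f)) (bdmB bk (bdm_ev g)) _ _ Hf Hg).
  by apply: bdmB; [exact: bdmB|exact: bdm_ev].
move=> t; rewrite ev_cat ev_scale mulN1r.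
rewrite (_ : _ - _ - _ = (h t - ev f (row_of t)) - (k t - ev g (row_of t))); last by ring.
exact: ler_normB.
Qed.

(** First approximate k by g, then h with a precision that depends on the size of
    g. *)
Lemma approximableM h k : approximable h -> approximable k ->
  approximable (fun t => h t * k t).
Proof.
move=> [bh ah] [bk ak]; split=> [|eps eps0]; first exact: bdmM.
have [_ [C hC]] := bh; have C0 : 0 <= C by exact: le_trans (normr_ge0 _) (hC [tuple 0 | _ < d]).
have e1 : 0 < eps / (4 * (C ^+ 2 + 1)) by rewrite divr_gt0// mulr_gt0// ltr_wpDl ?sqr_ge0.
have [g Hg] := ak _ e1.
have g0 := anorm_ge0 g.
have e2 : 0 < eps / (4 * (anorm g ^+ 2 + 1)) by rewrite divr_gt0// mulr_gt0// ltr_wpDl ?sqr_ge0.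
have [f Hf] := ah _ e2.
have X2 (c e : R) (a b : mtuple -> R) : 0 <= c -> 0 < e -> bdm a -> bdm b ->
    (forall t, `|b t| <= c * `|a t|) -> \int[mu]_t (a t ^+ 2) <= e / (4 * (c ^+ 2 + 1)) ->
    \int[mu]_t (b t ^+ 2) <= e / 4.
  move=> c0 e0 ba bb ab aE.
  apply: (@le_trans _ _ (\int[mu]_t (c ^+ 2 * a t ^+ 2))).
    apply: le_Rint_bdm; [exact: bdm_sqr|by apply: bdmZ; exact: bdm_sqr|move=> t].
    rewrite -exprMn -real_normK ?num_real// -[leRHS]real_normK ?num_real//.
    by rewrite lerXn2r ?nnegrE// normrM (ger0_norm c0).
  rewrite RintegralZl//; last by apply: bdm_integrable; exact: bdm_sqr.
  apply: le_trans (ler_wpM2l (sqr_ge0 c) aE) _.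
  have c1 : 0 < c ^+ 2 + 1 by rewrite ltr_wpDl ?sqr_ge0.
  rewrite (_ : c ^+ 2 * _ = (e / 4) * (c ^+ 2 / (c ^+ 2 + 1))); last first.
    by field; rewrite gt_eqF.
  apply: ler_piMr; first by rewrite divr_ge0// ltW.
  by rewrite ler_pdivrMr// mul1r lerDl.
exists (tmul f g).
have -> : eps = 2 * (eps / 4) + 2 * (eps / 4) by field.
have b1 : bdm (fun t => h t * (k t - ev g (row_of t))).
  by apply: bdmM => //; apply: bdmB => //; exact: bdm_ev.
have b2 : bdm (fun t => ev g (row_of t) * (h t - ev f (row_of t))).
  by apply: bdmM; [exact: bdm_ev|apply: bdmB => //; exact: bdm_ev].
apply: (Rint_sqr_le b1 b2).
- by apply: bdmB; [exact: bdmM|exact: bdm_ev].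
- move=> t; rewrite ev_mul.
  rewrite (_ : _ - _ = h t * (k t - ev g (row_of t)) + ev g (row_of t) * (h t - ev f (row_of t))).
    exact: ler_normD.
  by ring.
- apply: (X2 C) Hg => //; first by apply: bdmB => //; exact: bdm_ev.
  by move=> t; rewrite normrM ler_wpM2r.
- apply: (X2 (anorm g)) Hf => //; first by apply: bdmB => //; exact: bdm_ev.
  by move=> t; rewrite normrM ler_wpM2r// ev_le_anorm.
Qed.

Lemma approximable_cst c : approximable (fun=> c).
Proof.
split=> [|eps eps0]; first exact: bdm_cst.
exists [:: (c, 0, 0)]; under eq_Rintegral do
  rewrite ev_cons ev_nil wave_cos phase0 cos0 mulr1 addr0 subrr expr0n.
by rewrite Rint_cst ltW.
Qed.

Lemma approximableX h n : approximable h -> approximable (fun t => h t ^+ n).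
Proof.
move=> ah; elim: n => [|n IH].
  by under eq_fun do rewrite expr0; exact: approximable_cst.
by under eq_fun do rewrite exprS; exact: approximableM.
Qed.

Lemma approximable_lim (hn : nat -> mtuple -> R) h (B : R) :
  (forall n, approximable (hn n)) -> (forall n t, `|hn n t| <= B) -> bdm h ->
  {ae mu, forall t, hn n t @[n --> \oo] --> h t} -> approximable h.
Proof.
move=> ah hB bh cv; split=> // eps eps0.
have [mh [C hC]] := bh.
have bd n : bdm (fun t => h t - hn n t) by apply: bdmB => //; case: (ah n).
have [] := @dominated_Rint _ _ _ mu (fun n t => (h t - hn n t) ^+ 2) (fun=> 0)
    (fun=> (C + B) ^+ 2).
- by move=> n; case: (bdm_sqr (bd n)).
- exact: measurable_cst.
- exact/bdm_integrable/bdm_cst.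
- move=> n t; rewrite ger0_norm ?sqr_ge0// -real_normK ?num_real//.
  have hle : `|h t - hn n t| <= C + B.
    by apply: le_trans (ler_normB _ _) _; rewrite lerD.
  by rewrite lerXn2r ?nnegrE// (le_trans _ hle).
- apply: filterS cv => t ct.
  have c0 : h t - hn n t @[n --> \oo] --> (0 : R).
    by rewrite -(subrr (h t)); apply: cvgB => //; exact: cvg_cst.
  by have h2 := cvgM c0 c0; rewrite mulr0 in h2; exact: h2.
move=> _; rewrite Rint_cst => c0.
have e4 : 0 < eps / 4 by rewrite divr_gt0.
have /cvgrPdist_le/(_ _ e4)[n _ Hn] := c0.
have {}Hn := Hn n (leqnn n).
have {}Hn : \int[mu]_t (h t - hn n t) ^+ 2 <= eps / 4.
  by apply: le_trans Hn; rewrite /= sub0r normrN ler_norm.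
have [bn /(_ _ e4)[f Hf]] := ah n; exists f.
have -> : eps = 2 * (eps / 4) + 2 * (eps / 4) by field.
apply: (Rint_sqr_le (bd n) (bdmB bn (bdm_ev f)) _ _ Hn Hf).
  by apply: bdmB => //; exact: bdm_ev.
by move=> t; apply: le_trans (ler_normD _ _); rewrite addrA subrK.
Qed.

Let aset (A : set mtuple) : Prop := measurable A /\ approximable (\1_A).

Let bdm_indic (A : set mtuple) : measurable A -> bdm (\1_A : mtuple -> R).
Proof.
move=> mA; split; first exact: measurable_indic.
by exists 1 => t; rewrite indicE ger0_norm// lern1 leq_b1.
Qed.

Lemma aset_sigma : sigma_algebra setT aset.
Proof.
have asetC A : aset A -> aset (~` A).
  move=> [mA aA]; split; first exact: measurableC.
  have := approximableB (approximable_cst 1) aA; congr approximable.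
  by apply/funext => t; rewrite !indicE in_setC; case: (t \in A); rewrite /= ?subrr ?subr0.
have asetI A B : aset A -> aset B -> aset (A `&` B).
  move=> [mA aA] [mB aB]; split; first exact: measurableI.
  by have := approximableM aA aB; congr approximable; apply/funext => t; rewrite indicI.
have aset0 : aset set0.
  split; first exact: measurable0.
  by rewrite indic0; exact: approximable_cst.
split=> [//|A aA|F aF]; first by rewrite setTD; exact: asetC.
have mF : measurable (\bigcup_k F k) by apply: bigcupT_measurable => k; case: (aF k).
split=> //.
pose G n := \big[setI/setT]_(k < n) ~` F k.
have aG n : aset (G n).
  rewrite /G; elim/big_ind: _ => [|A B|k _]; [by rewrite -setC0; exact: asetC|exact: asetI|].
  exact: asetC.
have -> : \1_(\bigcup_k F k) = (fun t => 1 - \1_(~` \bigcup_k F k) t) :> (mtuple -> R).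
  apply/funext => t; rewrite !indicE in_setC.
  by case: (t \in _); rewrite /= ?subrr ?subr0.
apply: approximableB; first exact: approximable_cst.
apply: (@approximable_lim (fun n => \1_(G n)) _ 1).
- by move=> n; case: (aG n).
- by move=> n t; rewrite indicE ger0_norm// lern1 leq_b1.
- by apply: bdm_indic; exact: measurableC.
apply: nearW => t.
have GE n : G n t <-> forall k : nat, (k < n)%N -> ~ F k t.
  rewrite /G -(bigcap_mkord n (fun k : nat => ~` F k)); split=> H k kn; exact: H.
have [[k _ Fk]|nF] := pselect ((\bigcup_k F k) t).
  have -> : \1_(~` \bigcup_k F k) t = 0 :> R.
    by rewrite indicE in_setC mem_set//; exists k.
  apply: cvg_near_cst; exists k.+1 => // n /= kn.
  by rewrite indicE memNset// => /GE /(_ k kn).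
have -> : \1_(~` \bigcup_k F k) t = 1 :> R by rewrite indicE mem_set.
apply: cvg_near_cst; apply: nearW => n; rewrite indicE mem_set//.
by apply/GE => k _ Fk; apply: nF; exists k.
Qed.

Lemma coord_ae (j : 'I_d) (a : R) : {ae mu, forall t : mtuple, 0 < tnth t j < 1 /\ tnth t j != a}.
Proof.
pose E : set M := ~` (`]0, 1[%classic `\ a).
have mE : measurable E by apply/measurableC/measurableD.
have mEj : measurable ((fun t : mtuple => tnth t j) @^-1` E).
  by rewrite -[X in measurable X]setTI; exact: measurable_tnth.
have bE : bdm (\1_E : M -> R).
  split; first exact: measurable_indic.
  by exists 1 => t; rewrite indicE ger0_norm// lern1 leq_b1.
have I0 : \int[mu]_t \1_((fun t : mtuple => tnth t j) @^-1` E) t = 0 :> R.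
  apply: (@Rint_torus_coord0 _ _ j); first exact: bdm_indic.
  move=> t; rewrite /Rintegral (eq_integral (fun y => (\1_E y)%:E)); last first.
    by move=> y _; rewrite !indicE /upd; congr (_%:E); congr (nat_of_bool _)%:R;
       apply: asbool_equiv_eq; rewrite /= tnth_mktuple eqxx.
  rewrite integral_unif// integral_indic//.
  suff e0 : lebesgue_measure (E `&` `[0, 1]%classic) = 0%E by exact: congr1 e0.
  apply: (@subset_measure0 _ _ _ lebesgue_measure _ ([set 0] `|` [set 1] `|` [set a])).
  - exact: measurableI.
  - by apply: measurableU; first apply: measurableU.
  - move=> x [/= nx]; rewrite in_itv /= => /andP[x0 x1].
    have [->|n0] := eqVneq x 0; first by left; left.
    have [->|n1] := eqVneq x 1; first by left; right.
    have [->|na] := eqVneq x a; first by right.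
    exfalso; apply: nx; split; last by move=> /= e; rewrite e eqxx in na.
    by rewrite /= in_itv /= !lt_neqAle x0 x1 eq_sym n0 n1.
  - by apply: countable_lebesgue_measure0; apply: finite_set_countable; rewrite !finite_setU.
exists ((fun t : mtuple => tnth t j) @^-1` E); split => //.
  have := I0; rewrite /Rintegral integral_indic// setIT => h.
  rewrite -[LHS]fineK ?fin_num_measure//; exact: congr1 h.
move=> t /= nt Et; apply: nt; move: Et; rewrite /E.
by move=> /= [+ na]; rewrite in_itv /= => ->; split => //; apply/eqP.
Qed.

Lemma measurable_half_space (j : 'I_d) (a : R) :
  measurable [set t : mtuple | tnth t j < a].
Proof.
rewrite (_ : mkset _ = (fun t : mtuple => tnth t j) @^-1` `]-oo, a[%classic).
  by rewrite -[X in measurable X]setTI; exact: measurable_tnth.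
by apply/seteqP; split => t /=; rewrite in_itv.
Qed.

Let half_spaceE (j : 'I_d) (a : R) t :
  \1_[set t : mtuple | tnth t j < a] t = (tnth t j < a)%R%:R :> R.
Proof. by rewrite indicE; congr (nat_of_bool _)%:R; exact: asboolb. Qed.

Section half_space.
Variables (j : 'I_d) (a : R).
Hypothesis a01 : 0 < a < 1.

(** A trigonometric polynomial that is smaller than 1/2 for 0 < t_j < a and larger
    than 1/2 for a < t_j < 1: up to constants, 2 sin(pi t_j) sin(pi (a - t_j)). *)
Let sep : seq (mode R d) :=
  [:: (- (1 / 6), (\row_i (i == j)%:Z), - (pi * a)); (1 / 2 + cos (pi * a) / 6, 0, 0)].

Let sepE t : ev sep (row_of t) = 1 / 2 - sin (pi * tnth t j) * sin (pi * (a - tnth t j)) / 3.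
Proof.
rewrite /sep !ev_cons ev_nil /amp /mfreq /shft /= wave_cos phase0 cos0 /wave.
have -> : phase (\row_i (i == j)%:Z) (row_of t) = 2 * pi * tnth t j.
  rewrite /phase (bigD1 j)//= !mxE eqxx mul1r big1 ?addr0// => i /negbTE ij.
  by rewrite mxE ij mul0r.
have sc (x y : R) : 2 * (sin x * sin y) = cos (x - y) - cos (x + y).
  by rewrite cosB cosD; ring.
have -> : 2 * pi * tnth t j + - (pi * a) = pi * tnth t j - pi * (a - tnth t j) by ring.
have := sc (pi * tnth t j) (pi * (a - tnth t j)).
have -> : pi * tnth t j + pi * (a - tnth t j) = pi * a by ring.
by set u := sin _ * _; set v := cos (_ - _); set w := cos (pi * a); lra.
Qed.

Let sep_bounds t : 1 / 6 <= ev sep (row_of t) <= 5 / 6.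
Proof.
rewrite sepE; set u := sin _ * _.
have : `|u| <= 1.
  by rewrite normrM mulr_ile1// ler_norml sin_geN1 sin_le1.
by rewrite ler_norml => /andP[h1 h2]; apply/andP; split; lra.
Qed.

Let sin_pos (x : R) : 0 < x < 1 -> 0 < sin (pi * x).
Proof.
move=> /andP[x0 x1]; apply: sin_gt0_pi; rewrite mulr_gt0 ?pi_gt0//=.
by rewrite -[ltRHS]mulr1 ltr_pM2l// pi_gt0.
Qed.

(** (1 - s^n)^(2^n) tends to 1 for s < 1/2 and to 0 for s > 1/2, according to the
    limit of 2^n s^n. *)
Let step n t : R := (1 - ev sep (row_of t) ^+ n) ^+ (2 ^ n).

Let step_bounds n t : `|step n t| <= 1.
Proof.
have /andP[s0 s1] := sep_bounds t.
have p0 : 0 <= ev sep (row_of t) ^+ n <= 1.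
  by rewrite exprn_ge0 ?exprn_ile1//; lra.
rewrite /step normrX exprn_ile1//; rewrite ler_norml.
by move: p0 => /andP[? ?]; apply/andP; split; lra.
Qed.

Let step_cvg t : 0 < tnth t j < 1 -> tnth t j != a ->
  step n t @[n --> \oo] --> ((tnth t j < a)%R%:R : R).
Proof.
set x := tnth t j => /andP[x0 x1] xa.
have /andP[s0 s1] := sep_bounds t; set s := ev sep (row_of t) in s0 s1 *.
have two n : (2 ^ n)%:R = 2 ^+ n :> R by rewrite natrX.
have sX n : 0 <= s ^+ n <= 1 by rewrite exprn_ge0 ?exprn_ile1//; lra.
have [xlta|] := ltP x a.
  have sl : 2 * s < 1.
    rewrite /s sepE -/x; have := sin_pos (introT andP (conj x0 x1)).
    have : 0 < sin (pi * (a - x)) by apply: sin_pos; move: a01; lra.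
    move=> h1 h2; have := mulr_gt0 h2 h1; lra.
  have c1 : 1 - (2 * s) ^+ n @[n --> \oo] --> (1 : R).
    rewrite -[X in _ --> X]subr0; apply: cvgB; first exact: cvg_cst.
    by apply: cvg_expr; rewrite ger0_norm//; lra.
  have c2 : (fun=> 1 : R) @ \oo --> (1 : R) by exact: cvg_cst.
  rewrite mulr1n; refine (squeeze_cvgr _ c1 c2); apply: nearW => n.
  apply/andP; split; last by apply: le_trans (ler_norm _) (step_bounds n t).
  (* 1 - 2^n s^n is a lower bound by the Bernoulli inequality *)
  rewrite /step -/s exprMn -two mulr_natl -[X in X - _]addr0.
  have := sX n => /andP[y0 y1].
  elim: (2 ^ n)%N => [|N IH]; first by rewrite mulr0n expr0; lra.
  rewrite exprS mulrS; move: IH; rewrite addr0 => IH.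
  have := ler_wpM2l (_ : 0 <= 1 - s ^+ n) IH.
  have h : 0 <= s ^+ n * (s ^+ n *+ N) by rewrite mulr_ge0// mulrn_wge0.
  by move/(_ ltac:(lra)); move: h; lra.
rewrite le_eqVlt eq_sym (negbTE xa) /= => alx.
have sg : 1 < 2 * s.
  rewrite /s sepE -/x; have := sin_pos (introT andP (conj x0 x1)).
  have : 0 < sin (pi * (x - a)) by apply: sin_pos; move: a01; lra.
  rewrite (_ : pi * (a - x) = - (pi * (x - a))) ?sinN; last by ring.
  by move=> h1 h2; have := mulr_gt0 h2 h1; lra.
have c1 : (fun=> 0 : R) @ \oo --> (0 : R) by exact: cvg_cst.
have c2 : (2 * s)^-1 ^+ n @[n --> \oo] --> (0 : R).
  by apply: cvg_expr; rewrite ger0_norm ?invr_ge0 ?invf_lt1//; lra.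
rewrite mulr0n; refine (squeeze_cvgr _ c1 c2); apply: nearW => n.
have /andP[y0 y1] := sX n; apply/andP; split.
  by rewrite /step -/s exprn_ge0//; lra.
rewrite exprVn -[leRHS]mul1r ler_pdivlMr ?exprn_gt0//; last by lra.
(* (1 - y)^M M y <= (1 - y)^M (1 + y)^M <= 1 for y = s^n and M = 2^n *)
apply: (@le_trans _ _ ((1 - s ^+ n) ^+ (2 ^ n) * (1 + s ^+ n) ^+ (2 ^ n))).
  rewrite ler_wpM2l ?exprn_ge0//; first by lra.
  rewrite exprMn -two mulr_natl.
  elim: (2 ^ n)%N => [|N IH]; first by rewrite mulr0n expr0; lra.
  rewrite exprS mulrS.
  have h2 : 0 <= (1 + s ^+ n) ^+ N - s ^+ n *+ N.
    by rewrite subr_ge0.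
  have e1 : 1 <= (1 + s ^+ n) ^+ N by rewrite exprn_ege1//; lra.
  have := ler_wpM2l y0 e1; move: IH; lra.
rewrite -exprMn exprn_ile1//.
  by rewrite mulr_ge0//; lra.
rewrite (_ : _ * _ = 1 - s ^+ n ^+ 2); last by ring.
by rewrite lerBlDr lerDl sqr_ge0.
Qed.

Lemma inner_half_space : approximable (\1_[set t : mtuple | tnth t j < a]).
Proof.
apply: (approximable_lim _ step_bounds (bdm_indic (measurable_half_space j a))).
  move=> n; apply: approximableX; apply: approximableB; first exact: approximable_cst.
  by apply: approximableX; exact: approximable_ev.
by apply: filterS (coord_ae j a) => t [t01 ta]; rewrite half_spaceE; exact: step_cvg.
Qed.

End half_space.

Lemma half_space_approximable (j : 'I_d) (a : R) :
  approximable (\1_[set t : mtuple | tnth t j < a]).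
Proof.
have bH := bdm_indic (measurable_half_space j a).
have [a0|a0] := leP a 0.
  apply: (@approximable_lim (fun _ _ => 0) _ 0) => //.
  - by move=> n; exact: approximable_cst.
  - by move=> n t; rewrite normr0.
  apply: filterS (coord_ae j 0) => t [/andP[t0 _] _]; rewrite half_spaceE ltNge.
  by rewrite (le_trans a0 (ltW t0)) /=; exact: cvg_cst.
have [a1|a1] := leP 1 a.
  apply: (@approximable_lim (fun _ _ => 1) _ 1) => //.
  - by move=> n; exact: approximable_cst.
  - by move=> n t; rewrite normr1.
  apply: filterS (coord_ae j 0) => t [/andP[_ t1] _]; rewrite half_spaceE.
  by rewrite (lt_le_trans t1 a1) /=; exact: cvg_cst.
by apply: inner_half_space; rewrite a0.
Qed.

Lemma aset_coord (j : 'I_d) (Y : set M) : measurable Y ->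
  aset ((fun t : mtuple => tnth t j) @^-1` Y).
Proof.
have [as0 asC asU] := aset_sigma.
rewrite RGenInftyO.measurableE; move: Y.
apply: smallest_sub.
  split=> [|A aA|F aF].
  - by rewrite preimage_set0.
  - by rewrite setTD preimage_setC -setTD; exact: asC.
  - by rewrite preimage_bigcup; exact: asU.
move=> A [x ->]; rewrite (_ : _ @^-1` _ = [set t : mtuple | tnth t j < x]).
  by split; [exact: measurable_half_space|exact: half_space_approximable].
by apply/seteqP; split => t /=; rewrite in_itv.
Qed.

Lemma measurable_approximable (A : set mtuple) : measurable A -> approximable (\1_A).
Proof.
move=> mA; suff [] : aset A by [].
move: A mA; apply: smallest_sub; first exact: aset_sigma.
move=> A; rewrite -bigcup_seq => -[j _ [Y mY <-]].
by rewrite setTI; exact: aset_coord.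
Qed.

Lemma approximableD h k : approximable h -> approximable k ->
  approximable (fun t => h t + k t).
Proof.
move=> ah ak; have := approximableB ah (approximableB (approximable_cst 0) ak).
by congr approximable; apply/funext => t; rewrite sub0r opprK.
Qed.

Lemma approximable_sum (I : Type) (r : seq I) (F : I -> mtuple -> R) :
  (forall i, approximable (F i)) -> approximable (fun t => \sum_(i <- r) F i t).
Proof.
move=> aF; elim: r => [|i r IH].
  by under eq_fun do rewrite big_nil; exact: approximable_cst.
by under eq_fun do rewrite big_cons; exact: approximableD.
Qed.

(** For y <= n the sum is the floor of y. *)
Lemma layer_sum (y : R) n : 0 <= y <= n%:R ->
  `|y - \sum_(i < n) (i.+1%:R <= y)%R%:R| <= 1.
Proof.
move=> /andP[y0 yn].
pose S (N : nat) : R := \sum_(i < N) (i.+1%:R <= y)%R%:R; rewrite -/(S n).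
suff [h1 h2] : (n%:R <= y -> S n = n%:R) /\ (y < n%:R -> S n <= y <= S n + 1).
  have [ny|/h2] := leP n%:R y.
    by rewrite h1// (le_anti (introT andP (conj yn ny))) subrr normr0.
  by rewrite ler_norml => /andP[? ?]; apply/andP; split; lra.
elim: n {yn} => [|n [IH1 IH2]].
  by rewrite /S big_ord0; split=> // y0'; exfalso; move: y0 y0'; lra.
rewrite {1 2 3}/S big_ord_recr /= -/(S n) -natr1; case: leP => ny.
  by split=> //; rewrite IH1//; lra.
split=> // _; rewrite addr0.
by have [ny'|/IH2//] := leP n%:R y; rewrite IH1//; apply/andP; split; lra.
Qed.

(** A layer cake decomposition: up to a multiple of 1 / n, a bounded function is a
    combination of indicators of its superlevel sets. *)
Lemma bdm_approximable h : bdm h -> approximable h.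
Proof.
move=> bh; have [mh [C hC]] := bh.
have C0 : 0 <= C by exact: le_trans (normr_ge0 _) (hC [tuple 0 | _ < d]).
pose D := C + 1; have D0 : 0 < D by rewrite ltr_wpDl.
pose y t : R := (h t + D) / (2 * D).
have y01 t : 0 <= y t <= 1.
  have := hC t; rewrite ler_norml => /andP[h1 h2].
  by rewrite /y divr_ge0 ?ler_pdivrMr ?mulr_gt0// /D; try lra; rewrite mul1r; lra.
pose hn n t : R := 2 * D / n.+1%:R * (\sum_(i < n.+1) (i.+1%:R <= n.+1%:R * y t)%R%:R) - D.
have hnE n t : `|h t - hn n t| <= 2 * D / n.+1%:R.
  have n0 : (0 : R) < n.+1%:R by rewrite ltr0n.
  have := @layer_sum (n.+1%:R * y t) n.+1; set S := \sum_(i < _) _ => hl.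
  have {}hl : `|n.+1%:R * y t - S| <= 1.
    apply: hl; have /andP[? ?] := y01 t.
    by rewrite mulr_ge0// -[leRHS]mulr1 ler_pM2l.
  rewrite (_ : h t - hn n t = 2 * D / n.+1%:R * (n.+1%:R * y t - S)).
    rewrite normrM ger0_norm ?divr_ge0 ?mulr_ge0 ?(ltW D0)//.
    by rewrite ler_piMr// divr_ge0 ?mulr_ge0 ?(ltW D0).
  rewrite /hn -/S /y; move: n0 D0; move: (n.+1%:R : R) S {hl} => q S q0 D0.
  by field; rewrite !gt_eqF.
apply: (@approximable_lim hn _ (C + 2 * D)) => //.
- move=> n; apply: approximableB; last exact: approximable_cst.
  apply: approximableM; first exact: approximable_cst.
  apply: approximable_sum => i.
  have mA : measurable [set t : mtuple | (i.+1%:R <= n.+1%:R * y t)%R].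
    rewrite -[X in measurable X]setTI; apply: measurable_fun_le => //.
    apply: measurable_funM => //; apply: measurable_funM => //.
    exact: measurable_funD.
  have := measurable_approximable mA; congr approximable; apply/funext => t.
  by rewrite indicE; congr (nat_of_bool _)%:R; exact: asboolb.
- move=> n t; rewrite (_ : hn n t = h t - (h t - hn n t)); last by rewrite opprB addrC subrK.
  apply: le_trans (ler_normB _ _) _; apply: lerD => //; apply: le_trans (hnE n t) _.
  rewrite ler_pdivrMr ?ltr0n// ler_peMr ?mulr_ge0 ?(ltW D0)//.
  by rewrite ler1n.
apply: nearW => t.
have c : 2 * D / n.+1%:R @[n --> \oo] --> (0 : R).
  by rewrite -[X in _ --> X](mulr0 (2 * D)); apply: cvgM; [exact: cvg_cst|exact: cvg_harmonic].
apply/cvgrPdist_le => e e0; have /cvgrPdist_le/(_ _ e0)[N _ HN] := c.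
exists N => // n Nn; apply: le_trans (hnE n t) _.
by apply: le_trans (HN n Nn); rewrite sub0r normrN ler_norm.
Qed.

Lemma Lnorm_le_Rint (p e : R) h : 1 <= p -> 0 <= e ->
  mu.-integrable setT (EFin \o (fun t => `|h t| `^ p)) ->
  \int[mu]_t (`|h t| `^ p) <= e `^ p -> (Lnorm mu p%:E (EFin \o h) <= e%:E)%E.
Proof.
move=> p1 e0 ih hle; have p0 : 0 < p by exact: lt_le_trans ltr01 p1.
rewrite unlock.
rewrite (eq_integral (fun t => (`|h t| `^ p)%:E)); last first.
  by move=> t _; rewrite -poweR_EFin.
rewrite -[X in (X `^ _)%E]fineK; last exact: integrable_fin_num.
rewrite poweR_EFin lee_fin.
have -> : e = (e `^ p) `^ p^-1 by rewrite -powRrM divff ?gt_eqF// powRr1.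
apply: ge0_ler_powR => //.
- by rewrite invr_ge0 ltW.
- by rewrite nnegrE; apply: Rintegral_ge0 => t _; exact: powR_ge0.
- by rewrite nnegrE powR_ge0.
Qed.

(** Jensen's inequality for the power 2 / p, from the tangent at e^p. *)
Lemma Lnorm_le_sqr (p e : R) h : 1 <= p < 2 -> 0 < e -> bdm h ->
  \int[mu]_t (h t ^+ 2) <= e ^+ 2 -> (Lnorm mu p%:E (EFin \o h) <= e%:E)%E.
Proof.
move=> /andP[p1 p2] e0 bh he; have p0 : 0 < p by exact: lt_le_trans ltr01 p1.
have bp : bdm (fun t => `|h t| `^ p).
  have [mh [C hC]] := bh; split.
    by apply/measurable_EFinP; exact: measurable_norm_powR.
  exists (C `^ p) => t; rewrite ger0_norm ?powR_ge0//.
  apply: ge0_ler_powR; rewrite ?nnegrE ?(ltW p0)//.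
  exact: le_trans (normr_ge0 _) (hC t).
apply: Lnorm_le_Rint => //; [exact: ltW|exact: bdm_integrable|].
have q1 : 1 <= 2 / p by rewrite ler_pdivlMr// mul1r ltW.
have sq (x : R) : 0 <= x -> (x `^ p) `^ (2 / p) = x ^+ 2.
  by move=> x0; rewrite -powRrM mulrC divfK ?gt_eqF// powR_mulrn.
pose c := 2 / p * (e `^ p) `^ (2 / p - 1).
have c0 : 0 < c by rewrite mulr_gt0 ?divr_gt0// !powR_gt0.
have : \int[mu]_t (e ^+ 2 + c * (`|h t| `^ p - e `^ p)) <= \int[mu]_t (h t ^+ 2).
  apply: le_Rint_bdm; last 2 first.
  - exact: bdm_sqr.
  - move=> t; rewrite -[leRHS]real_normK ?num_real// -!sq ?(ltW e0)//.
    exact: powR_tangent (powR_ge0 _ _) (powR_ge0 _ _).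
  by apply: bdmD; [exact: bdm_cst|apply: bdmZ; apply: bdmB => //; exact: bdm_cst].
have ic := bdm_integrable mu (bdm_cst (e `^ p) : bdm (fun _ : mtuple => _)).
have ih := bdm_integrable mu bp.
have bB : bdm (fun t => `|h t| `^ p - e `^ p) by apply: bdmB bp _; exact: bdm_cst.
rewrite RintegralD//; first last.
- by apply: bdm_integrable; exact: bdmZ.
- exact/bdm_integrable/bdm_cst.
rewrite [X in _ + X]RintegralZl//; last exact: bdm_integrable.
rewrite RintegralB// !Rint_cst => h1.
have h2 := le_trans h1 he; rewrite -subr_le0.
by rewrite -(pmulr_rle0 _ c0); move: h2; lra.
Qed.

(** Truncate the large values, and approximate the bounded rest in mean square. *)
Theorem trig_polynomials_dense (p eps : R) (g : mtuple -> R) :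
  1 <= p < 2 -> 0 < eps -> measurable_fun setT g ->
  (Lnorm mu p%:E (EFin \o g) < +oo)%E ->
  exists f, (Lnorm mu p%:E (fun t => (g t - ev f (row_of t))%:E) <= eps%:E)%E.
Proof.
move=> /[dup] p12 /andP[p1 p2] eps0 mg gfin; have p0 : 0 < p by exact: lt_le_trans ltr01 p1.
have ig : mu.-integrable setT (EFin \o (fun t => `|g t| `^ p)).
  apply/integrableP; split; first exact: measurable_norm_powR.
  under eq_integral do rewrite gee0_abs ?lee_fin ?powR_ge0//.
  apply: contraTT gfin; rewrite -!leNgt !leye_eq => /eqP e; rewrite unlock.
  rewrite (eq_integral (fun t => (`|g t| `^ p)%:E)) ?e; last first.
    by move=> t _; rewrite -poweR_EFin.
  by rewrite poweRyr// invr_eq0 gt_eqF.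
pose gn n t := if `|g t| <= n%:R then g t else 0.
have bn n : bdm (gn n).
  split.
    apply: measurable_fun_if => //.
    - by apply: measurable_fun_ler => //; exact: measurableT_comp.
    - exact: measurable_funS mg.
  by exists n%:R => t; rewrite /gn; case: ifP => // _; rewrite normr0.
have mgn n : measurable_fun setT (fun t => g t - gn n t).
  by apply: measurable_funB => //; case: (bn n).
have le1 n t : `|g t - gn n t| `^ p <= `|g t| `^ p.
  apply: ge0_ler_powR; rewrite ?nnegrE ?(ltW p0)//.
  by rewrite /gn; case: ifP => _; rewrite ?subr0// subrr normr0.
have [] := @dominated_Rint _ _ _ mu (fun n t => `|g t - gn n t| `^ p) (fun=> 0)
    (fun t => `|g t| `^ p).
- by move=> n; apply/measurable_EFinP; exact: measurable_norm_powR.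
- exact: measurable_cst.
- exact: ig.
- by move=> n t; rewrite ger0_norm ?powR_ge0.
- apply: nearW => t; apply: cvg_near_cst.
  exists (Num.bound `|g t|) => // n /= Hn; rewrite /gn ifT.
    by rewrite subrr normr0 powR0// gt_eqF.
  apply: ltW; apply: lt_le_trans (archi_boundP (normr_ge0 _)) _; by rewrite ler_nat.
move=> _; rewrite Rint_cst => c0.
have e2 : 0 < eps / 2 by rewrite divr_gt0.
have ep : 0 < (eps / 2) `^ p by rewrite powR_gt0.
have /cvgrPdist_le/(_ _ ep)[n _ Hn] := c0; have {}Hn := Hn n (leqnn n).
have es : 0 < (eps / 2) ^+ 2 by rewrite exprn_gt0.
have [_ /(_ _ es)[f Hf]] := bdm_approximable (bn n).
exists f.
have -> : (fun t => (g t - ev f (row_of t))%:E) =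
   EFin \o (fun t => (g t - gn n t) + (gn n t - ev f (row_of t))).
  by apply/funext => t /=; rewrite addrA subrK.
have bf : bdm (fun t => gn n t - ev f (row_of t)) by apply: bdmB => //; exact: bdm_ev.
have pE : (1 <= p%:E)%E by rewrite lee_fin.
apply: (le_trans (@LnormD _ _ _ mu p%:E _ _ pE (mgn n) bf.1)).
rewrite [eps]splitr EFinD; apply: leeD; last exact: Lnorm_le_sqr.
apply: Lnorm_le_Rint => //; first exact: ltW.
  apply: le_integrable ig => //; first exact: measurable_norm_powR.
  by move=> t _; rewrite lee_fin (ger0_norm (powR_ge0 _ _)) (ger0_norm (powR_ge0 _ _)); exact: le1.
by apply: le_trans Hn; rewrite sub0r normrN ler_norm.
Qed.

End density.

(** * Mollification of solenoidal fields *)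

Section mollification.
Variables (R : realType) (d : nat).
Local Notation mu := (torus_measure R d).
Local Notation freq := 'rV[int]_d.
Local Notation row_of := (@row_of R d).
Local Notation mtuple := (d.-tuple (measurableTypeR R)).
Implicit Types (f h : seq (mode R d)) (m : freq) (x : 'rV[R]_d) (c : freq -> R).

Definition trigs (a b : freq -> R) (r : seq freq) : seq (mode R d) :=
  flatten [seq [:: (a m, m, 0); (b m, m, - (pi / 2))] | m <- r].

Definition linear_on_tests (F : functional R d) : Prop :=
  forall (a : R) phi psi, test_fun phi -> test_fun psi ->
    F (fun x => a * phi x + psi x) = a * F phi + F psi.

Section linear_functionals.
Variable F : functional R d.
Hypothesis linF : linear_on_tests F.

Lemma linear_ev f : F (ev f) = \sum_(l <- f) amp l * F (wave (mfreq l) (shft l)).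
Proof.
have F0 : F (ev [::]) = 0.
  have := linF 1 (ev_test [::]) (ev_test [::]).
  rewrite (_ : (fun x => _) = ev [::]); last by apply/funext => x; rewrite ev_nil mulr0 addr0.
  by move=> /eqP; rewrite mul1r -subr_eq subrr eq_sym => /eqP.
elim: f => [|l f IH]; first by rewrite big_nil F0.
rewrite big_cons -IH -linF; [|exact: wave_test|exact: ev_test].
by congr F; apply/funext => x; rewrite ev_cons.
Qed.

Lemma linear_testZ a phi : test_fun phi -> F (fun x => a * phi x) = a * F phi.
Proof.
move=> tf; have := linF a tf (ev_test [::]); rewrite [F (ev _)]linear_ev big_nil addr0 => <-.
by congr F; apply/funext => x; rewrite ev_nil addr0.
Qed.

Lemma linear_trigs a b r :
  F (ev (trigs a b r)) = \sum_(m <- r) (a m * F (cosm m) + b m * F (sinm m)).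
Proof.
rewrite linear_ev /trigs big_flatten big_map; apply: eq_bigr => m _.
by rewrite unlock /= addr0 cosmE sinmE.
Qed.

(** Both sides are the same bilinear expression in the Fourier coefficients of F
    and h. *)
Lemma pairing_trunc c h K : (forall m, c (- m) = c m) ->
  (forall m, m \notin cube d K -> c m = 0) ->
  \int[mu]_t (ev (trunc c F K) (row_of t) * ev h (row_of t)) = F (ev (mult c h)).
Proof.
move=> ce c0; pose H := distribution_of (ev h).
have -> : ev (mult c h) = ev (trunc c H K).
  by apply/funext => x; rewrite -(mult_series _ _ ce c0) ev_trunc.
rewrite [RHS]linear_trigs.
under eq_Rintegral do rewrite ev_trunc mulr_suml.
have bc m : bdm (fun t : mtuple => ev h (row_of t) * cosm m (row_of t)).
  by apply: bdmM; [exact: bdm_ev|rewrite cosmE; exact: bdm_wave].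
have bs m : bdm (fun t : mtuple => ev h (row_of t) * sinm m (row_of t)).
  by apply: bdmM; [exact: bdm_ev|rewrite sinmE; exact: bdm_wave].
pose A m t := (c m * F (cosm m)) * (ev h (row_of t) * cosm m (row_of t)) +
  (c m * F (sinm m)) * (ev h (row_of t) * sinm m (row_of t)).
have bA m : bdm (A m) by apply: bdmD; exact: bdmZ.
transitivity (\int[mu]_t (\sum_(m <- cube d K) A m t)).
  by apply: eq_Rintegral => t _; apply: eq_bigr => m _; rewrite /A; ring.
rewrite Rint_sum; last by move=> m; exact: bdm_integrable.
apply: eq_bigr => m _; rewrite /A RintegralD//; try by apply/bdm_integrable/bdmZ.
rewrite !RintegralZl//; try exact: bdm_integrable.
by rewrite /H /distribution_of; ring.
Qed.

End linear_functionals.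

Lemma ev_mult_trunc c c' F K x :
  ev (mult c (trunc c' F K)) x = ev (trunc (fun m => c m * c' m) F K) x.
Proof.
rewrite ev_trunc /mult /trunc map_flatten -map_comp ev_flatten big_map.
apply: eq_bigr => m _ /=.
by rewrite !ev_cons ev_nil /amp /mfreq /shft /= -cosmE -sinmE; ring.
Qed.

Lemma ev_trunc_cube c F K L x : (forall m, m \notin cube d K -> c m = 0) ->
  (forall m, m \notin cube d L -> c m = 0) -> ev (trunc c F K) x = ev (trunc c F L) x.
Proof.
move=> cK cL; rewrite !ev_trunc -(fsum_cube (K := K)) ?(fsum_cube (K := L))//.
  by move=> m /cL ->; rewrite mul0r.
by move=> m /cK ->; rewrite mul0r.
Qed.

Lemma ev_truncB c F G K x :
  ev (trunc c F K) x - ev (trunc c G K) x = ev (trunc c (F - G) K) x.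
Proof.
rewrite !ev_trunc -sumrB; apply: eq_bigr => m _.
rewrite (_ : (F - G) (cosm m) = F (cosm m) - G (cosm m))//.
by rewrite (_ : (F - G) (sinm m) = F (sinm m) - G (sinm m))//; ring.
Qed.

(** Fejer means contract L^q, and they converge on trigonometric polynomials. *)
Lemma fejer_Lnorm_cvg (q : \bar R) (g : mtuple -> R) (F : functional R d) (eps : R) :
  (1 <= q)%E -> represents g F -> 0 < eps ->
  (forall e : R, 0 < e -> exists f,
    (Lnorm mu q (fun t => (g t - ev f (row_of t))%:E) <= e%:E)%E) ->
  \forall K \near \oo,
    (Lnorm mu q (fun t => (ev (trunc (fejer R K.+1) F K.+1) (row_of t) - g t)%:E)
      <= eps%:E)%E.
Proof.
move=> q1 [ig gF] eps0 dense.
have mg : measurable_fun setT g by move/integrableP: ig => [/measurable_EFinP].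
have e3 : 0 < eps / 3 by rewrite divr_gt0.
have [f Hf] := dense _ e3.
apply: filterS (fejer_ev_cvg f e3) => K /(_ _ q1) HK.
pose D := F - distribution_of (ev f).
have iD : mu.-integrable setT (EFin \o (fun t => g t - ev f (row_of t))).
  have := integrableB measurableT ig (bdm_integrable mu (bdm_ev f)).
  by apply: eq_integrable => // t _ /=.
have DE phi : test_fun phi -> D phi = \int[mu]_t ((g t - ev f (row_of t)) * phi (row_of t)).
  move=> tf; rewrite (_ : D phi = F phi - distribution_of (ev f) phi)// gF// -RintegralB//.
  - by apply: eq_Rintegral => t _; rewrite mulrBl.
  - by apply: integrable_mul_bdm => //; exact: bdm_test.
  - by apply/bdm_integrable/bdmM; [exact: bdm_ev|exact: bdm_test].
have HD := fejer_contraction (ltn0Sn K) iD DE q1.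
have E : (fun t : mtuple => (ev (trunc (fejer R K.+1) F K.+1) (row_of t) - g t)%:E) =
  EFin \o (fun t => ev (trunc (fejer R K.+1) D K.+1) (row_of t) +
    ((ev (mult (fejer R K.+1) f) (row_of t) - ev f (row_of t)) + - (g t - ev f (row_of t)))).
  apply/funext => t /=; congr (_%:E); rewrite -ev_truncB.
  by rewrite (fejer_mult (ltn0Sn K)); ring.
have mf k := measurable_ev k : measurable_fun setT (fun t : mtuple => ev k (row_of t)).
have m2 : measurable_fun setT (fun t : mtuple =>
    ev (mult (fejer R K.+1) f) (row_of t) - ev f (row_of t)) by exact: measurable_funB.
have m3 : measurable_fun setT (fun t => - (g t - ev f (row_of t))).
  by apply: measurableT_comp => //; exact: measurable_funB.
rewrite E; apply: (le_trans (@LnormD _ _ _ mu q _ _ q1 (mf _) (measurable_funD m2 m3))).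
rewrite (_ : eps = eps / 3 + (eps / 3 + eps / 3)); last by field.
rewrite !EFinD; apply: leeD; first exact: le_trans HD Hf.
apply: (le_trans (@LnormD _ _ _ mu q _ _ q1 m2 m3)); apply: leeD => //.
by rewrite LnormN_eq.
Qed.

Lemma fejer_block_cvg (q : \bar R) (f : seq (mode R d)) (eps : R) : (1 <= q)%E -> 0 < eps ->
  \forall K \near \oo, (Lnorm mu q (fun t => (ev (mult (fejer R K.+1) f) (row_of t) -
     ev f (row_of t))%:E) <= eps%:E)%E.
Proof. by move=> q1 eps0; apply: filterS (fejer_ev_cvg f eps0) => K; exact. Qed.

Section field.
Variable v : vfunctional R d.
Hypothesis dist_v : is_vdistribution v.
Hypothesis div_v : weakly_div_free v.
Hypothesis mean_v : mean_zero v.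

Let lin_v i : linear_on_tests (v i).
Proof. by have [] := dist_v i. Qed.

(** Fejer means of v without the zero mode, whose amplitude vanishes if v has mean
    zero. *)
Definition mollify K (i : 'I_d) : seq (mode R d) :=
  [seq l <- trunc (fejer R K.+1) (v i) K.+1 | mfreq l != 0].

Lemma mollify_neq0 K i : spec (fun m => m != 0) (mollify K i).
Proof. by move=> l; rewrite mem_filter => /andP[]. Qed.

Let v0 i : v i (cosm 0) = 0.
Proof. by have := mean_v i => -[]. Qed.

Lemma ev_mult_mollify c K i x :
  ev (mult c (mollify K i)) x = ev (mult c (trunc (fejer R K.+1) (v i) K.+1)) x.
Proof.
rewrite /ev /mult !big_map /mollify big_filter [RHS](bigID (fun l => mfreq l != 0)) /=.
rewrite [X in _ = _ + X]big1_seq ?addr0//= => l; rewrite negbK => /andP[/eqP l0].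
rewrite /trunc => /flatten_mapP[m _]; rewrite !inE => /orP[]/eqP e; move: l0.
  by rewrite e /mfreq /amp /= => ->; rewrite v0 !(mulr0, mul0r).
rewrite e /mfreq /shft /= => ->.
by rewrite wave_sin phase0 sin0 mulr0.
Qed.

Lemma ev_mollify K i x : ev (mollify K i) x = ev (trunc (fejer R K.+1) (v i) K.+1) x.
Proof. by have := ev_mult_mollify (fun=> 1) K i x; rewrite !ev_mult1. Qed.

(** Testing the weak divergence with the cosine and the sine of frequency m shows
    that the coefficients of v at m are orthogonal to m. *)
Lemma mollify_div K x : \sum_i ev (pderiv i (mollify K i)) x = 0.
Proof.
have E i : ev (pderiv i (mollify K i)) x = \sum_(m <- cube d K.+1)
    fejer R K.+1 m * (v i (sinm m) * (2 * pi * (m 0 i)%:~R) * cosm m x -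
      v i (cosm m) * (2 * pi * (m 0 i)%:~R) * sinm m x).
  rewrite /pderiv ev_imult /mollify big_filter.
  transitivity (ev (pderiv i (trunc (fejer R K.+1) (v i) K.+1)) x).
    rewrite /pderiv ev_imult [RHS](bigID (fun l => mfreq l != 0)) /=.
    rewrite [X in _ = _ + X]big1 ?addr0//= => l; rewrite negbK => /eqP ->.
    by rewrite mxE mulr0 !mul0r.
  rewrite /pderiv ev_imult /trunc big_flatten big_map; apply: eq_bigr => m _.
  rewrite unlock /= addr0 /amp /mfreq /shft /= /cosm /sinm /wave.
  by rewrite add0r cosDpihalf addNr addr0; ring.
under eq_bigr do rewrite E; rewrite exchange_big /= big1// => m _.
rewrite -mulr_sumr.
have P (phi psi : 'rV[R]_d -> R) (s : R) : test_fun phi -> test_fun psi ->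
    (forall i, partial i phi = (fun x => (s * (2 * pi * (m 0 i)%:~R)) * psi x)) ->
    s != 0 -> \sum_i v i psi * (2 * pi * (m 0 i)%:~R) = 0.
  move=> tphi tpsi dphi s0; have := div_v tphi.
  under eq_bigr do rewrite dphi linear_testZ//.
  move=> H; apply: (mulfI s0); rewrite mulr0 -[RHS]H mulr_sumr.
  by apply: eq_bigr => i _; ring.
have dwave i b : partial i (wave m b) = fun x => 2 * pi * (m 0 i)%:~R * wave m (b + pi / 2) x.
  have -> : wave m b = ev [:: (1, m, b)] :> ('rV[R]_d -> R).
    by apply/funext => y; rewrite ev_cons ev_nil /amp /mfreq /shft /= mul1r addr0.
  rewrite partial_ev; apply/funext => y.
  by rewrite /pderiv /imult /= ev_cons ev_nil /amp /mfreq /shft /= mulr1 addr0.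
have Pc : \sum_i v i (cosm m) * (2 * pi * (m 0 i)%:~R) = 0.
  apply: (P (sinm m) (cosm m) 1 (sinm_test R m) (cosm_test R m) _ (oner_neq0 _)) => i.
  by rewrite sinmE cosmE dwave addNr; apply/funext => y; rewrite mul1r.
have Ps : \sum_i v i (sinm m) * (2 * pi * (m 0 i)%:~R) = 0.
  have n1 : -1 != 0 :> R by rewrite oppr_eq0 oner_neq0.
  apply: (P (cosm m) (sinm m) (-1) (cosm_test R m) (sinm_test R m) _ n1) => i.
  rewrite cosmE dwave add0r; apply/funext => y.
  by rewrite /wave cosDpihalf /sinm; ring.
rewrite (_ : \sum_i _ = (\sum_i v i (sinm m) * (2 * pi * (m 0 i)%:~R)) * cosm m x -
   (\sum_i v i (cosm m) * (2 * pi * (m 0 i)%:~R)) * sinm m x).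
  by rewrite Pc Ps !mul0r subr0 mulr0.
by rewrite !mulr_suml -sumrB.
Qed.

End field.

End mollification.

(** * Approximation block by block *)

Section block_approximation.
Variables (R : realType) (d : nat) (chi : 'rV[R]_d -> R) (alpha theta : R).
Hypothesis d_gt1 : (1 < d)%N.
Hypothesis hchi : bump_function chi.
Hypothesis alpha_gt0 : 0 < alpha.
Hypothesis theta_gt0 : 0 < theta.
Local Notation mu := (torus_measure R d).
Local Notation freq := 'rV[int]_d.
Local Notation row_of := (@row_of R d).
Local Notation mtuple := (d.-tuple (measurableTypeR R)).
Implicit Types (f h : seq (mode R d)) (F G : functional R d) (v : vfunctional R d).
Local Notation dsym := (dsym chi).

Lemma P_dyadicB n F G x : P_dyadic chi n (F - G) x = P_dyadic chi n F x - P_dyadic chi n G x.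
Proof. by rewrite !(P_dyadic_trunc hchi) -ev_truncB. Qed.

Lemma Lnorm_ev_fin (q : \bar R) f : (1 <= q)%E ->
  Lnorm mu q (fun t => (ev f (row_of t))%:E) \is a fin_num.
Proof.
move=> q1; rewrite ge0_fin_numE ?Lnorm_ge0//.
exact: le_lt_trans (Lnorm_ev_le f q1) (ltry _).
Qed.

Lemma LP_norm_fin (q : \bar R) n v : (1 <= q)%E -> LP_norm chi q n v \is a fin_num.
Proof.
move=> q1; rewrite ge0_fin_numE ?Lnorm_ge0//.
apply: le_lt_trans (LP_norm_ev_le q1 _) (ltry _) => i x.
exact: (P_dyadic_trunc hchi).
Qed.

Lemma Lnorm_block_le (q : \bar R) n v i : (1 <= q)%E ->
  (Lnorm mu q (fun t => (P_dyadic chi n (v i) (row_of t))%:E) <= LP_norm chi q n v)%E.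
Proof.
move=> q1.
have mF j : measurable_fun setT (fun t : mtuple => P_dyadic chi n (v j) (row_of t)).
  have := measurable_ev (trunc (dsym n) (v j) (2 ^ n)).
  by congr measurable_fun; apply/funext => t; rewrite (P_dyadic_trunc hchi).
exact: (@Lnorm_le_enorm _ _ q (fun j t => P_dyadic chi n (v j) (row_of t)) i q1 mF).
Qed.

Lemma ev_mult_mollify_block v K n i x : mean_zero v ->
  ev (mult (dsym n) (mollify v K i)) x =
  ev (mult (fejer R K.+1) (trunc (dsym n) (v i) (2 ^ n))) x.
Proof.
move=> mv; rewrite ev_mult_mollify// !ev_mult_trunc.
rewrite (@ev_trunc_cube _ _ _ _ K.+1 (2 ^ n)).
- by rewrite !ev_trunc; apply: eq_bigr => m _; rewrite (mulrC (dsym n m)).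
- by move=> m mK; rewrite fejer_cube// mulr0.
- by move=> m mK; rewrite (dsym_cube hchi _ mK) ?mul0r// pow2_nat.
Qed.

Lemma sum_shift (z : nat -> R) (Z : nat -> R) k N : (forall n, (n < k)%N -> z n = 0) ->
  (forall n, 0 <= z n) -> (forall n, z (k + n)%N <= Z n) ->
  \sum_(n < N) z n <= \sum_(n < N) Z n.
Proof.
move=> z0 zp zZ; apply: (@le_trans _ _ (\sum_(n < k + N) z n)).
  rewrite addnC big_split_ord /= lerDl; apply: sumr_ge0 => i _; exact: zp.
rewrite big_split_ord /= big1 ?add0r; first by apply: ler_sum => n _; exact: zZ.
by move=> i _; apply: z0.
Qed.

(** Perturb a Fejer mean of v into a singular solution. Since Fejer means act on
    each block separately, the first blocks of v are approximated well and on all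
    others the error is at most a multiple of them; x measures this error and y
    the perturbation. *)
Lemma block_approximation (q : \bar R) v (N1 : nat) (eta : R) : (1 <= q)%E -> 0 < eta ->
  is_vdistribution v -> weakly_div_free v -> mean_zero v ->
  exists u (x y : nat -> R), [/\ singular_solutions chi alpha u,
    (forall n, (LP_norm chi q n (u - v)%R <= (x n + y n)%:E)%E),
    (forall n, 0 <= x n <= 2 * d%:R * fine (LP_norm chi q n v) /\ 0 <= y n),
    (forall n, (n <= N1)%N -> x n <= eta) &
    (forall N, \sum_(n < N) (2 ^+ n) `^ (- theta) * y n <= eta)].
Proof.
move=> q1 eta0 dist_v div_v mean_v.
have d0 : (0 : R) < d%:R by rewrite ltr0n ltnW.
have ed : 0 < eta / d%:R by rewrite divr_gt0.
pose f n i := trunc (dsym n) (v i) (2 ^ n).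
have [K0 _ HK0] : \forall K \near \oo, forall ni : 'I_N1.+1 * 'I_d,
    (Lnorm mu q (fun t => (ev (mult (fejer R K.+1) (f ni.1 ni.2)) (row_of t) -
      ev (f ni.1 ni.2) (row_of t))%:E) <= (eta / d%:R)%:E)%E.
  by apply: filter_forall => ni; exact: fejer_block_cvg.
pose K := K0; have {}HK0 := HK0 K (leqnn _).
pose A n i : seq (mode R d) := mult (fejer R K.+1) (f n i) ++ tscale (-1) (f n i).
have AE n i x : ev (A n i) x = ev (mult (fejer R K.+1) (f n i)) x - ev (f n i) x.
  by rewrite ev_cat ev_scale mulN1r.
have sp i : spec (fun m => m != 0) (mollify v K i) by exact: mollify_neq0.
have [nv [k' [a [hk aE gb _ Hth]]]] := blocks_exist chi alpha d_gt1 sp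
  (mollify_div dist_v div_v K) (introT andP (conj (lexx 1) (ltr1n R 2))) theta_gt0 ed.
have [g [Su _ _ Pu]] := singular_solution_of_blocks hchi alpha_gt0 hk gb.
set u := (fun i phi => _) in Su Pu.
pose B n i : seq (mode R d) := if (n <= nv)%N then [::] else a (n - nv)%N i.
pose x n : R := \sum_i fine (Lnorm mu q (fun t => (ev (A n i) (row_of t))%:E)).
pose y n : R := \sum_i anorm (B n i).
have y0 n : 0 <= y n by apply: sumr_ge0 => i _; exact: anorm_ge0.
have x0 n : 0 <= x n by apply: sumr_ge0 => i _; rewrite fine_ge0// Lnorm_ge0.
have diff n i z : P_dyadic chi n ((u - v) i) z = ev (A n i ++ B n i) z.
  rewrite (_ : (u - v) i = u i - v i)// P_dyadicB Pu (P_dyadic_trunc hchi) -/(f n i).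
  rewrite ev_cat AE /B /block; case: leqP => nnv.
    by rewrite ev_nil addr0 aE ev_mult_mollify_block.
  rewrite -ev_mult_mollify_block// ev_mult0 ?sub0r 1?addrC//.
  have := @gb_spec0 _ _ _ _ _ _ _ gb i; rewrite aE; apply: specW => m /andP[_ hm].
  case: n nnv => // n nnv; apply: (dsym_low hchi); apply: lt_le_trans hm _.
  by rewrite ler_wpM2l// ler_weXn2l// ler1n.
exists u, x, y; split=> //.
- move=> n; rewrite /LP_norm.
  have -> : (fun t => (enorm (fun i => P_dyadic chi n ((u - v) i) (row_of t)))%:E) =
     (fun t : mtuple => (enorm (fun i => ev (A n i ++ B n i) (row_of t)))%:E).
    by apply/funext => t; congr (enorm _)%:E; apply/funext => i; rewrite diff.
  apply: (le_trans (Lnorm_enorm_le q1 (fun i => measurable_ev (A n i ++ B n i)))).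
  rewrite /x /y -big_split /= -sumEFin; apply: lee_sum => i _.
  rewrite EFinD fineK ?Lnorm_ev_fin//.
  have -> : EFin \o (fun t => ev (A n i ++ B n i) (row_of t)) =
    EFin \o (fun t : mtuple => ev (A n i) (row_of t) + ev (B n i) (row_of t)).
    by apply/funext => t /=; rewrite ev_cat.
  apply: (le_trans (@LnormD _ _ _ mu q _ _ q1 (measurable_ev _) (measurable_ev _))).
  by apply: leeD => //; exact: Lnorm_ev_le.
- move=> n; split=> //; rewrite x0 /=.
  rewrite (_ : 2 * d%:R * _ = \sum_(i < d) 2 * fine (LP_norm chi q n v)); last first.
    by rewrite sumr_const card_ord -[RHS]mulr_natr; ring.
  apply: ler_sum => i _.
  rewrite -lee_fin fineK ?Lnorm_ev_fin// EFinM fineK ?LP_norm_fin//.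
  have fle : (Lnorm mu q (fun t => (ev (f n i) (row_of t))%:E) <= LP_norm chi q n v)%E.
    apply: le_trans (Lnorm_block_le n v i q1); rewrite le_eqVlt; apply/orP; left; apply/eqP.
    by apply: eq_Lnorm => t; rewrite (P_dyadic_trunc hchi).
  have -> : (fun t => (ev (A n i) (row_of t))%:E) = EFin \o (fun t : mtuple =>
      ev (mult (fejer R K.+1) (f n i)) (row_of t) + - ev (f n i) (row_of t)).
    by apply/funext => t /=; rewrite AE.
  have mN : measurable_fun setT (fun t : mtuple => - ev (f n i) (row_of t)).
    by apply: measurableT_comp => //; exact: measurable_ev.
  apply: (le_trans (@LnormD _ _ _ mu q _ _ q1 (measurable_ev _) mN)).
  rewrite LnormN_eq mule_natl mule2n.
  apply: leeD => //; apply: le_trans fle.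
  have := fejer_contraction (ltn0Sn K) (bdm_integrable mu (bdm_ev (f n i))) (fun _ _ => erefl) q1.
  by under eq_Lnorm do rewrite (fejer_mult (ltn0Sn K)).
- move=> n nN1; have -> : eta = \sum_(i < d) eta / d%:R.
    by rewrite sumr_const card_ord -[RHS]mulr_natr divfK ?gt_eqF.
  apply: ler_sum => i _; rewrite -lee_fin fineK ?Lnorm_ev_fin//.
  have := HK0 (Ordinal (nN1 : (n < N1.+1)%N), i) => /=; congr (_ <= _)%E.
  by apply: eq_Lnorm => t; rewrite AE.
- move=> N.
  pose Z n := (2 ^+ (nv + n)) `^ (- theta) * \sum_i anorm (a n.+1 i).
  apply: (@le_trans _ _ (\sum_(n < N) Z n)).
    apply: (@sum_shift (fun n => (2 ^+ n) `^ (- theta) * y n) Z nv.+1).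
    + by move=> n nnv; rewrite /y big1 ?mulr0// => i _; rewrite /B -ltnS nnv /anorm wnorm_nil.
    + by move=> n; rewrite mulr_ge0 ?powR_ge0.
    + move=> n; rewrite /Z /y; apply: ler_pM => //.
      - exact: y0.
      - rewrite !powRN lef_pV2 ?posrE ?powR_gt0 ?exprn_gt0//.
        apply: ge0_ler_powR; rewrite ?nnegrE ?exprn_ge0 ?(ltW theta_gt0)//.
        by rewrite ler_weXn2l ?ler1n// addSn leqW.
      - by rewrite /B leqNgt addSn ltnS leq_addr /= subSn ?leq_addr// addKn.
  rewrite /Z; under eq_bigr do rewrite mulr_sumr.
  rewrite exchange_big /=.
  have -> : eta = \sum_(i < d) eta / d%:R.
    by rewrite sumr_const card_ord -[RHS]mulr_natr divfK ?gt_eqF.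
  by apply: ler_sum => i _; exact: Hth.
Qed.

End block_approximation.

(** * Density in the Besov norms *)

Section tails.
Variable R : realType.

Lemma tail_small (z : nat -> R) (C e : R) : (forall n, 0 <= z n) ->
  (forall N, \sum_(n < N) z n <= C) -> 0 < e ->
  exists N1 : nat, forall N, \sum_(n < N | (N1 <= n)%N) z n <= e.
Proof.
move=> z0 zC e0; have cS := summable_cvg z0 zC.
have nd : nondecreasing_seq (fun N => \sum_(n < N) z n).
  by apply/nondecreasing_seqP => N; rewrite big_ord_recr /= lerDl.
have /cvgrPdist_le/(_ _ e0)[N1 _ HN1] := cS.
exists N1 => N; have {}HN1 := HN1 N1 (leqnn _).
have le_lim M : \sum_(n < M) z n - \sum_(n < N1) z n <= e.
  apply: le_trans (le_trans (ler_norm _) HN1); rewrite lerB//.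
  exact: nondecreasing_cvgn_le.
have [NN|NN] := leqP N N1.
  rewrite big1 ?(ltW e0)// => n; rewrite leqNgt (leq_trans (ltn_ord n) NN) //.
apply: le_trans (le_lim N); rewrite [X in _ <= X - _](bigID (fun n : 'I_N => (N1 <= n)%N)) /=.
rewrite (_ : \sum_(n < N | ~~ (N1 <= n)%N) z n = \sum_(n < N1) z n) ?addrK//.
rewrite (big_ord_widen _ _ (ltnW NN)); apply: eq_bigl => n; by rewrite -ltnNge.
Qed.

Lemma dyadic_weight_ge1 (s : R) n : 0 <= s -> 1 <= (2 ^+ n) `^ s.
Proof. by move=> s0; rewrite -[leLHS](powRr0 (2 ^+ n)) ler_powR// exprn_ege1// ler1n. Qed.

Lemma sum_head_le (c : nat -> R) N1 N : (forall n, 0 <= c n) ->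
  \sum_(n < N | ~~ (N1 <= n)%N) c n <= \sum_(n < N1) c n.
Proof.
move=> c0; have [NN|NN] := leqP N N1.
  apply: (@le_trans _ _ (\sum_(n < N) c n)).
    by rewrite [leRHS](bigID (fun n : 'I_N => ~~ (N1 <= n)%N)) /= lerDl sumr_ge0.
  have nd : nondecreasing_seq (fun N => \sum_(n < N) c n).
    by apply/nondecreasing_seqP => n; rewrite big_ord_recr /= lerDl.
  exact: nd.
rewrite (big_ord_widen _ _ (ltnW NN)) le_eqVlt; apply/orP; left; apply/eqP.
by apply: eq_bigl => n; rewrite -ltnNge.
Qed.

Lemma powR_add_le (r x y : R) : 1 <= r -> 0 <= x -> 0 <= y ->
  (x + y) `^ r <= 2 `^ r * (x `^ r + y `^ r).
Proof.
move=> r1 x0 y0; have r0 : 0 <= r by exact: le_trans ler01 r1.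
wlog xy : x y x0 y0 / x <= y.
  move=> W; have [/W|/ltW/W] := leP x y; first exact.
  by rewrite (addrC y) (addrC (y `^ r)); apply.
apply: (@le_trans _ _ ((2 * y) `^ r)).
  by apply: ge0_ler_powR; rewrite ?nnegrE ?addr_ge0 ?mulr_ge0//; lra.
by rewrite powRM// ler_wpM2l ?powR_ge0// lerDr powR_ge0.
Qed.

End tails.

Section besov_density.
Variables (R : realType) (d : nat) (chi : 'rV[R]_d -> R) (alpha theta : R).
Hypothesis d_gt1 : (1 < d)%N.
Hypothesis hchi : bump_function chi.
Hypothesis alpha_gt0 : 0 < alpha.
Hypothesis theta_gt0 : 0 < theta.
Implicit Types (v u : vfunctional R d).

Lemma besov_partial_sums (s r : R) (q : \bar R) v : 1 <= r -> (1 <= q)%E ->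
  (besov_norm chi s q r%:E v < +oo)%E ->
  exists C, forall N, \sum_(n < N) (2 ^+ n) `^ (s * r) * fine (LP_norm chi q n v) `^ r <= C.
Proof.
move=> r1 q1; have r0 : 0 < r by exact: lt_le_trans ltr01 r1.
rewrite /besov_norm; set S := (\sum_(0 <= n <oo) _)%E => Sfin.
have t0 n : (0 <= ((2 ^+ n) `^ (s * r))%:E * LP_norm chi q n v `^ r)%E.
  by rewrite mule_ge0// ?lee_fin ?powR_ge0// poweR_ge0.
have S0 : (0 <= S)%E by exact: nneseries_ge0.
have Sf : S \is a fin_num.
  rewrite ge0_fin_numE// ltey; apply: contraTneq Sfin => ->.
  by rewrite poweRyr ?invr_eq0 ?gt_eqF// ltxx.
exists (fine S) => N; rewrite -lee_fin fineK// -sumEFin.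
apply: le_trans (nneseries_lim_ge N (fun n _ _ => t0 n)); rewrite big_mkord.
apply: lee_sum => n _; rewrite EFinM -(poweR_EFin (fine _)) fineK//.
exact: LP_norm_fin.
Qed.

(** Errors summable in l^r and in l^1 are treated separately, up to the constant
    in (x + y)^r <= 2^r (x^r + y^r). *)
Lemma besov_split_le (r : R) (q : \bar R) v (x y : nat -> R) (s : R) : 1 <= r -> 0 <= s ->
  (forall n, 0 <= x n) -> (forall n, 0 <= y n) ->
  (forall n, (LP_norm chi q n v <= (x n + y n)%:E)%E) ->
  (forall N, \sum_(n < N) (2 ^+ n) `^ (- theta * r) * x n `^ r <= s `^ r) ->
  (forall N, \sum_(n < N) (2 ^+ n) `^ (- theta) * y n <= s) ->
  (besov_norm chi (- theta) q r%:E v <= (4 * s)%:E)%E.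
Proof.
move=> r1 s0 x0 y0 Hv Hx Hy; have r0 : 0 < r by exact: lt_le_trans ltr01 r1.
have two : 2 <= 2 `^ r :> R.
  by rewrite -[leLHS]powRr1// ler_powR// ler1n.
rewrite /besov_norm.
have -> : (4 * s)%:E = (((4 * s) `^ r)%:E `^ r^-1)%E.
  by rewrite poweR_EFin -powRrM mulfV ?gt_eqF// powRr1// mulr_ge0.
have t0 n : (0 <= ((2 ^+ n) `^ (- theta * r))%:E * LP_norm chi q n v `^ r)%E.
  by rewrite mule_ge0// ?lee_fin ?powR_ge0// poweR_ge0.
apply: poweR_mono; first by rewrite invr_ge0 ltW.
  exact: nneseries_ge0.
apply: lime_le; first exact: is_cvg_nneseries.
apply: nearW => N; rewrite big_mkord.
pose X n := (2 ^+ n) `^ (- theta * r) * x n `^ r.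
pose Y n := ((2 ^+ n) `^ (- theta) * y n) `^ r.
apply: (@le_trans _ _ (\sum_(n < N) (2 `^ r * (X n + Y n))%:E)%E).
  apply: lee_sum => n _; rewrite (_ : 2 `^ r * _ =
     (2 ^+ n) `^ (- theta * r) * (2 `^ r * (x n `^ r + y n `^ r))).
    rewrite EFinM lee_wpmul2l ?lee_fin ?powR_ge0//.
    apply: (@le_trans _ _ ((x n + y n) `^ r)%:E); last by rewrite lee_fin powR_add_le.
    by rewrite -poweR_EFin; apply: poweR_mono => //; [exact: ltW|exact: Lnorm_ge0].
  by rewrite /X /Y powRM ?powR_ge0// -powRrM; ring.
rewrite sumEFin lee_fin -mulr_sumr big_split /=.
rewrite (_ : 4 * s = 2 * (2 * s)); last by ring.
rewrite [leRHS]powRM ?mulr_ge0// ler_wpM2l ?powR_ge0//.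
apply: (@le_trans _ _ (s `^ r + s `^ r)).
  apply: lerD; first exact: Hx.
  apply: (le_trans (powR_superadd (z := fun i : 'I_N => (2 ^+ i) `^ (- theta) * y i) _ r1 _)).
    by move=> i; rewrite mulr_ge0 ?powR_ge0.
  apply: ge0_ler_powR; rewrite ?nnegrE ?(ltW r0)//.
  - by apply: sumr_ge0 => i _; rewrite mulr_ge0 ?powR_ge0.
  - exact: Hy.
rewrite powRM//; have := ler_wpM2r (powR_ge0 s r) two; lra.
Qed.

(** For r finite the blocks of v beyond some N1 contribute little to the norm; the
    blocks before N1 are approximated. *)
Lemma besov_dense (q r : \bar R) v (eps : R) : (1 <= q)%E -> (1 <= r)%E -> r != +oo%E ->
  is_vdistribution v -> weakly_div_free v -> mean_zero v ->
  (besov_norm chi (- theta) q r v < +oo)%E -> 0 < eps ->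
  exists2 u, singular_solutions chi alpha u &
    (besov_norm chi (- theta) q r (u - v)%R < eps%:E)%E.
Proof.
move=> q1 r1 rfin dv divv mv vfin eps0; case: r r1 rfin vfin => [r||]// r1 _ vfin.
rewrite lee_fin in r1; have r0 : 0 < r by exact: lt_le_trans ltr01 r1.
pose s := eps / 8; have s0 : 0 < s by rewrite divr_gt0.
have sr : 0 < s `^ r / 2 by rewrite divr_gt0 ?powR_gt0.
have [C HC] := besov_partial_sums r1 q1 vfin.
pose B n := fine (LP_norm chi q n v).
have B0 n : 0 <= B n by rewrite fine_ge0 ?Lnorm_ge0.
pose D : R := (2 * d%:R) `^ r.
have D0 : 0 <= D by exact: powR_ge0.
pose z n := D * ((2 ^+ n) `^ (- theta * r) * B n `^ r).
have z0 n : 0 <= z n by rewrite !mulr_ge0 ?powR_ge0.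
have zC N : \sum_(n < N) z n <= D * C by rewrite -mulr_sumr ler_wpM2l.
have [N1 HN1] := tail_small z0 zC sr.
pose k : R := (2 * N1.+1%:R)^-1.
have k1 : 0 < k <= 1.
  by rewrite invr_gt0 mulr_gt0// invf_le1 ?mulr_gt0// -natrM ler1n muln_gt0.
have /andP[k0 kle] := k1.
pose eta := s * k; have eta0 : 0 < eta by rewrite mulr_gt0.
have etas : eta <= s by rewrite /eta ler_piMr// ltW.
have [u [x [y [Su Hu xy xN yN]]]] := block_approximation d_gt1 hchi alpha_gt0 theta_gt0
  N1 q1 eta0 dv divv mv.
exists u => //; apply: (@le_lt_trans _ _ (4 * s)%:E); last first.
  by rewrite lte_fin /s; move: eps0; lra.
have x0 n : 0 <= x n by have [/andP[]] := xy n.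
apply: (besov_split_le r1 (ltW s0) x0) Hu _ _.
- by move=> n; have [] := xy n.
- move=> N.
  have w1 n : (2 ^+ n) `^ (- theta * r) <= 1 :> R.
    rewrite mulNr powRN invf_le1 ?powR_gt0 ?exprn_gt0//.
    by rewrite dyadic_weight_ge1// mulr_ge0// ltW.
  rewrite (bigID (fun n : 'I_N => (N1 <= n)%N)) /= (_ : s `^ r = s `^ r / 2 + s `^ r / 2); last by field.
  apply: lerD.
    apply: le_trans (HN1 N); apply: ler_sum => n _.
    rewrite /z mulrCA ler_wpM2l ?powR_ge0// /D -powRM ?mulr_ge0//.
    by have [/andP[xn0 xn1] _] := xy n; apply: ge0_ler_powR; rewrite ?nnegrE ?(ltW r0)// !mulr_ge0.
  apply: (@le_trans _ _ (\sum_(n < N1) (2 ^+ n) `^ (- theta * r) * x n `^ r)).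
    apply: (@sum_head_le _ (fun n => (2 ^+ n) `^ (- theta * r) * x n `^ r)) => n.
    by rewrite mulr_ge0 ?powR_ge0.
  apply: (@le_trans _ _ (\sum_(n < N1) s `^ r * k)).
    apply: ler_sum => n _; apply: (@le_trans _ _ (eta `^ r)).
      rewrite -[leRHS]mul1r; apply: ler_pM; rewrite ?powR_ge0//.
      by apply: ge0_ler_powR; rewrite ?nnegrE ?(ltW r0) ?(ltW eta0) ?xN// ltnW.
    by rewrite /eta powRM ?(ltW s0) ?(ltW k0)// ler_wpM2l ?powR_ge0// ge1r_powR.
  rewrite sumr_const card_ord -[leLHS]mulr_natr -mulrA ler_wpM2l ?powR_ge0//.
  rewrite /k invfM -mulrA ler_piMr// mulrC ler_pdivrMr// mul1r ler_nat.
  exact: leqnSn.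
- by move=> N; exact: le_trans (yN _) etas.
Qed.

End besov_density.

(** * Weak-star density *)

Section hoelder_inequality.
Context {disp : measure_display} {T : measurableType disp} {R : realType}.
Variable P : probability T R.
Local Notation N q f := (Lnorm P q (EFin \o f)).

Let P_gt0 : (0 < P [set: T])%E.
Proof. by rewrite [X in (_ < X)%E]probability_setT lte01. Qed.

Lemma Lnorm1_mul_sup (f g : T -> R) : measurable_fun setT f -> measurable_fun setT g ->
  (N 1%E (f \* g)%R <= N 1%E f * N +oo%E g)%E.
Proof.
move=> mf mg; set M := N +oo%E g.
have M0 : (0 <= M)%E by exact: Lnorm_ge0.
rewrite !Lnorm1 -ge0_integralZr//; last by apply: measurableT_comp => //; exact/measurable_EFinP.
apply: ae_ge0_le_integral => //.
- by apply: measurableT_comp => //; apply/measurable_EFinP; exact: measurable_funM.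
- by move=> t _; rewrite mule_ge0.
- apply: emeasurable_funM => //; apply: measurableT_comp => //; exact/measurable_EFinP.
have := ess_sup_ge P (abse \o (EFin \o g)); apply: filterS => t gM _.
rewrite /= normrM EFinM lee_wpmul2l// ?lee_fin//.
by apply: le_trans gM _; rewrite /M unlock P_gt0.
Qed.

(** The exponents 1 and infinity are added to the case of two finite exponents. *)
Lemma Rint_mul_le (q : \bar R) (f g : T -> R) : (1 <= q)%E -> bdm f -> bdm g ->
  (`|\int[P]_t (f t * g t)|%:E <= N q f * N (hoelder_conjugate q) g)%E.
Proof.
move=> q1 bf bg; have bfg := bdmM bf bg; have [mf _] := bf; have [mg _] := bg.
apply: (@le_trans _ _ (N 1%E (f \* g)%R)).
  rewrite (Lnorm1_Rint P bfg) lee_fin.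
  by apply: le_normr_Rintegral => //; exact: bdm_integrable.
case: q q1 => [q||]// q1.
  rewrite lee_fin in q1; have q0 : 0 < q by exact: lt_le_trans ltr01 q1.
  have [->|qn] := eqVneq q 1; first by rewrite hoelder_conjugate1; exact: Lnorm1_mul_sup.
  have qgt1 : 1 < q by rewrite lt_neqAle eq_sym qn.
  have -> : hoelder_conjugate q%:E = (q / (q - 1))%:E.
    rewrite /hoelder_conjugate /= eqe gt_eqF// -EFinB inver subr_eq0 (negbTE qn).
    by rewrite -EFinM.
  apply: hoelder => //; first by rewrite divr_gt0// subr_gt0.
  by rewrite invf_div; field; rewrite gt_eqF.
rewrite hoelder_conjugatey muleC.
have -> : (f \* g)%R = (g \* f)%R by apply/funext => t /=; rewrite mulrC.
exact: Lnorm1_mul_sup.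
Qed.

End hoelder_inequality.

Section weak_star.
Variables (R : realType) (d : nat) (chi : 'rV[R]_d -> R) (alpha theta : R).
Hypothesis d_gt1 : (1 < d)%N.
Hypothesis hchi : bump_function chi.
Hypothesis alpha_gt0 : 0 < alpha.
Hypothesis theta_gt0 : 0 < theta.
Local Notation mu := (torus_measure R d).
Local Notation freq := 'rV[int]_d.
Local Notation row_of := (@row_of R d).
Local Notation mtuple := (d.-tuple (measurableTypeR R)).
Implicit Types (v w g : vfunctional R d) (F G : functional R d) (m : freq).
Local Notation dsym := (dsym chi).

(** Symbol of the sum of the block l and its two neighbours, equal to 1 on the
    frequencies of the block l. *)
Let wide l m := \sum_(k < l.+2 | (l <= k.+1)%N) dsym k m.

Lemma wide_dsym l m : wide l m * dsym l m = dsym l m.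
Proof.
have [->|nz] := eqVneq (dsym l m) 0; first by rewrite mulr0.
have := dsym_adjacent hchi nz; rewrite -[sym chi l.+1 m]sum_dsym.
rewrite (bigID (fun k : 'I_l.+2 => (l <= k.+1)%N)) /= -/(wide l m).
suff -> : \sum_(k < l.+2 | ~~ (l <= k.+1)%N) dsym k m =
    (if l is l'.+2 then sym chi l' m else 0).
  by rewrite addrK => ->; rewrite mul1r.
case: l {nz} => [|[|l]]; [by rewrite big1|by rewrite big1|].
rewrite -sum_dsym (big_ord_widen l.+4 (fun k => dsym k m)); last by lia.
by apply: eq_bigl => k; rewrite -ltnNge ltnS.
Qed.

Lemma sum_wide_le (b : nat -> R) (B : R) l : 0 <= B -> (forall k, (k <= l.+1)%N -> b k <= B) ->
  \sum_(k < l.+2 | (l <= k.+1)%N) b k <= 3 * B.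
Proof.
move=> B0 bB; rewrite big_mkcond /= !big_ord_recr /= leqnSn leqW//.
have h : \sum_(k < l) (if (l <= k.+1)%N then b k else 0) <= B.
  case: l bB => [|l] bB; first by rewrite big_ord0.
  rewrite big_ord_recr /= leqnn big1 ?add0r; first by apply: bB; lia.
  by move=> k _; rewrite ifF//; have := ltn_ord k; lia.
have h1 : b l <= B by apply: bB; lia.
have h2 : b l.+1 <= B by apply: bB; lia.
by move: h h1 h2; lra.
Qed.

(** The block l of G only meets the blocks of F of neighbouring index. *)
Lemma linear_block_pairing F G (q : \bar R) l : linear_on_tests F -> (1 <= q)%E ->
  (`|F (P_dyadic chi l G)|%:E <=
   (\sum_(k < l.+2 | (l <= k.+1)%N)
     Lnorm mu q (fun t => (P_dyadic chi k F (row_of t))%:E)) *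
   Lnorm mu (hoelder_conjugate q) (fun t => (P_dyadic chi l G (row_of t))%:E))%E.
Proof.
move=> lF q1; set h := trunc (dsym l) G (2 ^ l).
have PE : P_dyadic chi l G = ev h by apply/funext => x; exact: (P_dyadic_trunc hchi).
have cubeE k m : (k < l.+2)%N -> m \notin cube d (2 ^ l.+1) -> dsym k m = 0.
  by move=> kl; apply: (dsym_cube hchi); rewrite pow2_nat ler_weXn2l// ?ler1n// -ltnS.
have wN m : wide l (- m) = wide l m by apply: eq_bigr => k _; exact: (dsymN hchi).
have w0 m : m \notin cube d (2 ^ l.+1) -> wide l m = 0.
  by move=> mK; rewrite /wide big1// => k _; exact: cubeE.
have -> : F (P_dyadic chi l G) =
    \int[mu]_t (ev (trunc (wide l) F (2 ^ l.+1)) (row_of t) * ev h (row_of t)).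
  rewrite (pairing_trunc lF)//; congr F; apply/funext => x.
  rewrite PE ev_mult_trunc !ev_trunc; apply: eq_bigr => m _.
  by rewrite wide_dsym.
apply: (le_trans (@Rint_mul_le _ _ _ mu q _ _ q1 (bdm_ev _) (bdm_ev _))).
rewrite PE; apply: lee_wpmul2r; first exact: Lnorm_ge0.
have WE x : ev (trunc (wide l) F (2 ^ l.+1)) x =
    \sum_(k < l.+2 | (l <= k.+1)%N) P_dyadic chi k F x.
  rewrite ev_trunc /wide; under eq_bigr do rewrite mulr_suml.
  rewrite exchange_big /=; apply: eq_bigr => k _.
  by rewrite (@P_dyadicE _ _ _ hchi k (2 ^ l.+1)%N)// pow2_nat ler_weXn2l// ?ler1n// -ltnS.
have mP k : measurable_fun setT (fun t : mtuple => P_dyadic chi k F (row_of t)).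
  have := measurable_ev (trunc (dsym k) F (2 ^ k)).
  by congr measurable_fun; apply/funext => t; rewrite (P_dyadic_trunc hchi).
rewrite [in leRHS]big_mkcond /=.
pose Q (k : 'I_l.+2) (t : mtuple) : R := if (l <= k.+1)%N then P_dyadic chi k F (row_of t) else 0.
have mQ k : measurable_fun setT (Q k) by rewrite /Q; case: (l <= k.+1)%N; [exact: mP|exact: measurable_cst].
have -> : EFin \o (fun t => ev (trunc (wide l) F (2 ^ l.+1)) (row_of t)) =
    EFin \o (fun t => \sum_(k < l.+2) Q k t).
  by apply/funext => t /=; rewrite WE big_mkcond.
apply: (le_trans (Lnorm_sum mu (index_enum _) q1 mQ)); apply: lee_sum => k _.
rewrite /Q; case: (l <= k.+1)%N => //.
by rewrite (_ : EFin \o _ = EFin \o (fun=> 0))// Lnorm_cst// normr0.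
Qed.

Lemma pairing_bound w g (q : \bar R) (b gam : nat -> R) : (forall i, linear_on_tests (w i)) ->
  (1 <= q)%E ->
  (forall k, (LP_norm chi q k w <= (b k)%:E)%E) ->
  (forall k, (LP_norm chi (hoelder_conjugate q) k g <= (gam k)%:E)%E) ->
  forall l, `|\sum_i w i (P_dyadic chi l (g i))| <=
    d%:R * ((\sum_(k < l.+2 | (l <= k.+1)%N) b k) * gam l).
Proof.
move=> lw q1 Hb Hg l; apply: le_trans (ler_norm_sum _ _ _) _.
rewrite (_ : d%:R * _ = \sum_(i < d) (\sum_(k < l.+2 | (l <= k.+1)%N) b k) * gam l); last first.
  by rewrite sumr_const card_ord -[RHS]mulr_natr mulrC.
apply: ler_sum => i _; rewrite -lee_fin.
apply: le_trans (linear_block_pairing _ l (lw i) q1) _.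
rewrite EFinM; apply: lee_pmul => //; try exact: Lnorm_ge0.
- by apply: sume_ge0 => k _; exact: Lnorm_ge0.
- rewrite -sumEFin; apply: lee_sum => k _; apply: le_trans (Hb k); exact: Lnorm_block_le.
- apply: le_trans (Hg l); apply: Lnorm_block_le => //; exact: hoelder_conj_ge1.
Qed.

Lemma linear_P_le F G n : linear_on_tests F ->
  F (P_le chi n G) = \sum_(l < n.+1) F (P_dyadic chi l G).
Proof.
move=> lF.
have PE k : P_dyadic chi k G = ev (trunc (dsym k) G (2 ^ k)).
  by apply/funext => x; exact: (P_dyadic_trunc hchi).
elim: n => [|n IH]; first by rewrite big_ord_recl big_ord0 addr0.
rewrite big_ord_recr /= -IH -[F (P_dyadic _ _ _)]mul1r [LHS]/=.
have Pn : P_le chi n G = ev (trunc (sym chi n) G (2 ^ n)).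
  by apply/funext => x; exact: (P_le_trunc hchi).
rewrite addrC -lF; first last.
- by rewrite Pn; exact: ev_test.
- by rewrite -/(P_dyadic chi n.+1 G) PE; exact: ev_test.
by congr F; apply/funext => x; rewrite mul1r /= subrK.
Qed.

(** Absolute convergence makes the limit in besov_pairing exist. *)
Lemma besov_pairing_le w g (B : R) : (forall i, linear_on_tests (w i)) ->
  (forall N, \sum_(l < N) `|\sum_i w i (P_dyadic chi l (g i))| <= B) ->
  `|besov_pairing chi w g| <= B.
Proof.
move=> lw HB; pose T l := \sum_i w i (P_dyadic chi l (g i)).
have E : (fun n => \sum_i w i (P_le chi n (g i))) = (fun n => series T n.+1).
  apply/funext => n; rewrite /series /= big_mkord exchange_big /=.
  by apply: eq_bigr => i _; exact: linear_P_le.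
have cT : cvgn (series T).
  have h : (fun N => \sum_(l < N) `|T l|) = series (fun l => `|T l|).
    by apply/funext => N; rewrite seriesEord.
  apply: normed_cvg; have := @summable_cvg _ (fun l => `|T l|) B (fun=> normr_ge0 _) HB.
  by rewrite h.
have cT' : series T n.+1 @[n --> \oo] --> limn (series T).
  by have := cT; rewrite -(cvg_shiftS (series T)).
rewrite /besov_pairing E (cvg_lim _ cT')//.
have cn : `|series T n.+1| @[n --> \oo] --> `|limn (series T)| by exact: cvg_norm.
rewrite -(cvg_lim _ cn)//; apply: limr_le.
  by apply/cvg_ex; eexists; exact: cn.
apply: nearW => n; rewrite /series /= big_mkord.
exact: le_trans (ler_norm_sum _ _ _) (HB n.+1).
Qed.

(** The blocks of the functions g j of large index have a small norm in the
    predual space, whereas u - v stays bounded. On the blocks of small index u - v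
    itself is small. *)
Lemma besov_weak_star_dense (q : \bar R) v (k : nat) (g : 'I_k -> vfunctional R d) (eps : R) :
  (1 <= q)%E -> is_vdistribution v -> weakly_div_free v -> mean_zero v ->
  (besov_norm chi (- theta) q +oo%E v < +oo)%E ->
  (forall j, (besov_norm chi theta (hoelder_conjugate q) 1%E (g j) < +oo)%E) -> 0 < eps ->
  exists2 u, singular_solutions chi alpha u &
    forall j, `|besov_pairing chi (u - v)%R (g j)| < eps.
Proof.
move=> q1 dv divv mv vfin gfin eps0.
have q'1 : (1 <= hoelder_conjugate q)%E by exact: hoelder_conj_ge1.
pose B n := fine (LP_norm chi q n v).
have B0 n : 0 <= B n by rewrite fine_ge0 ?Lnorm_ge0.
have w0 n s : 0 < (2 ^+ n) `^ s :> R by rewrite powR_gt0 ?exprn_gt0.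
have [V V0 HV] : exists2 V : R, 0 <= V & forall n, B n <= (2 ^+ n) `^ theta * V.
  move: vfin; rewrite /besov_norm; set s := ereal_sup _ => sfin.
  have ub n : (((2 ^+ n) `^ (- theta))%:E * LP_norm chi q n v <= s)%E.
    by apply: ereal_sup_ubound; exists n.
  have s0 : (0 <= s)%E by apply: le_trans (ub 0%N); rewrite mule_ge0 ?lee_fin ?powR_ge0 ?Lnorm_ge0.
  have sf : s \is a fin_num by rewrite ge0_fin_numE.
  exists (fine s) => [|n]; first exact: fine_ge0.
  have := ub n; rewrite -(fineK sf) -(fineK (LP_norm_fin hchi n v q1)) -EFinM lee_fin -/(B n).
  by rewrite powRN mulrC ler_pdivrMr// mulrC.
pose gam j n := fine (LP_norm chi (hoelder_conjugate q) n (g j)).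
have gam0 j n : 0 <= gam j n by rewrite fine_ge0 ?Lnorm_ge0.
pose z j n := (2 ^+ n) `^ theta * gam j n.
have z0 j n : 0 <= z j n by rewrite mulr_ge0 ?powR_ge0.
have /choice[C HC] : forall j, exists C, forall N, \sum_(n < N) z j n <= C.
  move=> j; have [C HC] := besov_partial_sums hchi (lexx 1) q'1 (gfin j).
  exists C => N; apply: le_trans (HC N); apply: ler_sum => n _.
  by rewrite mulr1 powRr1//; exact: (gam0 j n).
have C0 j : 0 <= C j by have := HC j 0%N; rewrite big_ord0.
pose D : R := d%:R * (3 * 2 `^ theta).
have D0 : 0 <= D by rewrite !mulr_ge0 ?powR_ge0.
pose A : R := 2 * d%:R * V + 2.
have A0 : 0 < A by rewrite ltr_wpDl// !mulr_ge0.
pose tau := eps / (4 * (D * A + 1)).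
have DA : 0 < D * A + 1 by rewrite ltr_wpDl// mulr_ge0// ltW.
have tau0 : 0 < tau by rewrite divr_gt0// mulr_gt0.
have /choice[N1 HN1] : forall j, exists N1 : nat, forall N, \sum_(n < N | (N1 <= n)%N) z j n <= tau.
  by move=> j; exact: tail_small (z0 j) (HC j) tau0.
pose M := (\max_j N1 j)%N.
pose Ct := \sum_j C j.
have Ct0 : 0 <= Ct by apply: sumr_ge0 => j _.
pose eta := Num.min 1 (eps / (8 * (D * Ct + 1))).
have DC : 0 < D * Ct + 1 by rewrite ltr_wpDl// mulr_ge0.
have eta0 : 0 < eta by rewrite lt_min ltr01 divr_gt0// mulr_gt0.
have eta1 : eta <= 1 by rewrite ge_min lexx.
have etae : eta <= eps / (8 * (D * Ct + 1)) by rewrite ge_min lexx orbT.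
have [u [x [y [Su Hu xy xN yN]]]] := block_approximation d_gt1 hchi alpha_gt0 theta_gt0
  M.+1 q1 eta0 dv divv mv.
exists u => // j.
pose b n := x n + y n.
have y0 n : 0 <= y n by have [] := xy n.
have x0 n : 0 <= x n by have [/andP[]] := xy n.
have yle n : y n <= (2 ^+ n) `^ theta * eta.
  have := yN n.+1; rewrite big_ord_recr /= => h.
  have {}h : (2 ^+ n) `^ (- theta) * y n <= eta.
    apply: le_trans h; rewrite lerDr; apply: sumr_ge0 => i _.
    by rewrite mulr_ge0 ?powR_ge0.
  by move: h; rewrite powRN mulrC ler_pdivrMr// mulrC.
have bA n : b n <= (2 ^+ n) `^ theta * A.
  have [/andP[_ xn] _] := xy n; rewrite -/(B n) in xn.
  have h1 : 2 * d%:R * B n <= 2 * d%:R * ((2 ^+ n) `^ theta * V).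
    by rewrite ler_wpM2l ?mulr_ge0.
  have h2 : (2 ^+ n) `^ theta * eta <= (2 ^+ n) `^ theta * 2.
    by rewrite ler_wpM2l ?powR_ge0//; apply: le_trans eta1 _; rewrite ler1n.
  rewrite /b /A; apply: le_trans (lerD (le_trans xn h1) (le_trans (yle n) h2)) _.
  by rewrite le_eqVlt; apply/orP; left; apply/eqP; ring.
have bs n : (n <= M.+1)%N -> b n <= (2 ^+ n) `^ theta * (2 * eta).
  move=> nM; have := xN n nM; have := yle n; rewrite /b.
  have := ler_wpM2r (ltW eta0) (dyadic_weight_ge1 n (ltW theta_gt0)); lra.
have wmono n l : (n <= l.+1)%N -> (2 ^+ n) `^ theta <= 2 `^ theta * (2 ^+ l) `^ theta :> R.
  move=> nl; rewrite -powRM ?exprn_ge0// -exprS.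
  by apply: ge0_ler_powR; rewrite ?nnegrE ?exprn_ge0 ?(ltW theta_gt0)// ler_weXn2l ?ler1n.
pose c l := if (M <= l)%N then A else 2 * eta.
have c0 l : 0 <= c l by rewrite /c; case: ifP => _; [exact: ltW|rewrite mulr_ge0 ?ltW].
have wide_le l : \sum_(n < l.+2 | (l <= n.+1)%N) b n <=
    3 * (2 `^ theta * (2 ^+ l) `^ theta * c l).
  apply: sum_wide_le => [|n nl]; first by rewrite !mulr_ge0 ?powR_ge0.
  apply: (@le_trans _ _ ((2 ^+ n) `^ theta * c l)); last by rewrite ler_wpM2r ?wmono.
  rewrite /c; case: leqP => Ml; first exact: bA.
  by apply: bs; exact: leq_trans nl (leqW Ml).
have lw i : linear_on_tests ((u - v) i).
  have [dS _ _ _] : singular_solution chi alpha u by case: Su.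
  have [[lu _] [lv _]] := (dS i, dv i).
  move=> s phi psi tp ts; rewrite (_ : (u - v) i = u i - v i)//.
  rewrite (_ : forall h, (u i - v i) h = u i h - v i h)//.
  rewrite (_ : (u i - v i) phi = u i phi - v i phi)// (_ : (u i - v i) psi = u i psi - v i psi)//.
  by rewrite lu// lv//; ring.
have bound := pairing_bound lw q1 (b := b) (gam := gam j) Hu
  (fun n => ltac:(by rewrite /gam fineK// (LP_norm_fin hchi))).
apply: (@le_lt_trans _ _ (eps / 2)); last by move: eps0; lra.
apply: besov_pairing_le => // N.
apply: (@le_trans _ _ (\sum_(l < N) D * c l * z j l)).
  apply: ler_sum => l _; apply: le_trans (bound l) _.
  rewrite (_ : D * c l * z j l = d%:R * ((3 * (2 `^ theta * (2 ^+ l) `^ theta * c l)) * gam j l)).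
    by rewrite ler_wpM2l// ler_wpM2r.
  by rewrite /D /z; ring.
rewrite (bigID (fun l : 'I_N => (M <= l)%N)) /=.
apply: (@le_trans _ _ (D * A * tau + D * (2 * eta) * C j)).
  apply: lerD.
    apply: (@le_trans _ _ (D * A * \sum_(l < N | (N1 j <= l)%N) z j l)); last first.
      by rewrite ler_wpM2l// mulr_ge0// ltW.
    rewrite mulr_sumr [leRHS]big_mkcond [leLHS]big_mkcond /=; apply: ler_sum => l _.
    have N1M : (N1 j <= M)%N by exact: (leq_bigmax j).
    rewrite /c; case: leqP => Ml; last first.
      by case: ifP => _ //; rewrite !mulr_ge0 ?(ltW A0).
    by rewrite (leq_trans N1M Ml).
  apply: (@le_trans _ _ (\sum_(l < N | ~~ (M <= l)%N) D * (2 * eta) * z j l)).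
    by apply: ler_sum => l; rewrite /c => /negbTE ->.
  rewrite -mulr_sumr ler_wpM2l ?mulr_ge0 ?(ltW eta0)//.
  apply: le_trans (HC j N); rewrite [leRHS](bigID (fun l : 'I_N => (M <= l)%N)) /=.
  by rewrite lerDr sumr_ge0.
have h1 : D * A * tau <= eps / 4.
  rewrite /tau (_ : D * A * _ = (eps / 4) * (D * A / (D * A + 1))); last first.
    by field; rewrite gt_eqF.
  by rewrite ler_piMr ?divr_ge0 ?(ltW eps0)// ler_pdivrMr// mul1r lerDl.
have h2 : D * (2 * eta) * C j <= eps / 4.
  have CjC : C j <= Ct by rewrite /Ct (bigD1 j)//= lerDl sumr_ge0.
  apply: (@le_trans _ _ (2 * (eps / (8 * (D * Ct + 1))) * (D * Ct))).
    rewrite (_ : D * _ * _ = 2 * eta * (D * C j)); last by ring.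
    by apply: ler_pM; rewrite ?mulr_ge0 ?(ltW eta0)// ler_wpM2l.
  rewrite (_ : 2 * _ * _ = (eps / 4) * (D * Ct / (D * Ct + 1))); last first.
    by field; rewrite gt_eqF.
  by rewrite ler_piMr ?divr_ge0 ?(ltW eps0)// ler_pdivrMr// mul1r lerDl.
by move: h1 h2; lra.
Qed.

End weak_star.

(** * Density in the Lebesgue norms *)

(** Perturb a Fejer mean of v; Fejer means converge in L^p. *)
Lemma Lp_dense (R : realType) (d : nat) (chi : 'rV[R]_d -> R) (alpha p : R)
    (v : vfunctional R d) (eps : R) :
  (1 < d)%N -> bump_function chi -> 0 < alpha -> 1 <= p < 2 ->
  is_vdistribution v -> weakly_div_free v -> mean_zero v ->
  (Lp_norm p%:E v < +oo)%E -> 0 < eps ->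
  exists2 u, singular_solutions chi alpha u & (Lp_norm p%:E (u - v)%R < eps%:E)%E.
Proof.
move=> d1 hchi alpha0 /[dup] p12 /andP[p1 p2] dv divv mv vfin eps0.
pose mu := torus_measure R d.
have p1E : (1 <= p%:E)%E by rewrite lee_fin.
have [_ [g gv <-] gfin] := ereal_inf_lt vfin.
have mg i : measurable_fun setT (g i).
  by have [/integrableP[/measurable_EFinP]] := gv i.
have gifin i : (Lnorm mu p%:E (EFin \o g i) < +oo)%E.
  by apply: le_lt_trans gfin; exact: Lnorm_le_enorm.
pose D : R := (2 * d%:R + 1).
have D0 : 0 < D by rewrite ltr_wpDl ?mulr_ge0.
pose del := eps / D; have del0 : 0 < del by rewrite divr_gt0.
have [K0 _ HK0] : \forall K \near \oo, forall i : 'I_d,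
    (Lnorm mu p%:E (fun t => (ev (trunc (fejer R K.+1) (v i) K.+1) (row_of t) - g i t)%:E)
      <= del%:E)%E.
  apply: filter_forall => i; apply: fejer_Lnorm_cvg => // e e0.
  exact: trig_polynomials_dense.
pose K := K0; have {}HK0 := HK0 K (leqnn _).
have sp i : spec (fun m => m != 0) (mollify v K i) by exact: mollify_neq0.
have [nv [k' [a [hk aE gb HLp _]]]] := blocks_exist chi alpha d1 sp
  (mollify_div dv divv K) p12 ltr01 del0.
have [h [Su ih Lh _]] := singular_solution_of_blocks hchi alpha0 hk gb.
set u := (fun i phi => _) in Su.
exists u => //.
have mh i : measurable_fun setT (h i) by have /integrableP[/measurable_EFinP] := ih i.
pose A i (t : d.-tuple (measurableTypeR R)) : R := ev (mollify v K i) (row_of t) - g i t.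
have mA i : measurable_fun setT (A i) by apply: measurable_funB => //; exact: measurable_ev.
pose G i t : R := A i t + h i t.
have mG i : measurable_fun setT (G i) by exact: measurable_funD.
have repG i : represents (G i) ((u - v) i).
  have [ig gE] := gv i.
  have ie : mu.-integrable setT (EFin \o (fun t => ev (a 0 i) (row_of t) + h i t)).
    by apply: eq_integrable (integrableD measurableT
      (bdm_integrable mu (bdm_ev (a 0 i))) (ih i)) => // t _ /=.
  have GE t : G i t = ev (a 0 i) (row_of t) + h i t - g i t by rewrite /G /A aE; ring.
  split.
    by apply: eq_integrable (integrableB measurableT ie ig) => // t _; rewrite /= GE.
  move=> phi tphi; rewrite (_ : (u - v) i phi = u i phi - v i phi)// gE// /u.
  rewrite -RintegralB//; [|exact: integrable_mul_bdm ie (bdm_test tphi)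
    |exact: integrable_mul_bdm ig (bdm_test tphi)].
  by apply: eq_Rintegral => t _; rewrite GE mulrBl.
apply: (@le_lt_trans _ _ (Lnorm mu p%:E (fun t => (enorm (fun i => G i t))%:E))).
  by apply: ereal_inf_lbound; exists G.
apply: le_lt_trans (Lnorm_enorm_le p1E mG) _.
apply: (@le_lt_trans _ _ (\sum_(i < d) (2 * del)%:E)%E).
  apply: lee_sum => i _.
  apply: (le_trans (@LnormD _ _ _ mu p%:E _ _ p1E (mA i) (mh i))).
  rewrite (_ : 2 * del = del + del); last by ring.
  rewrite EFinD; apply: leeD.
    apply: le_trans (HK0 i); rewrite le_eqVlt; apply/orP; left; apply/eqP.
    by apply: eq_Lnorm => t; rewrite /= /A ev_mollify.
  by apply: Lh => //; exact: ltW.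
rewrite sumEFin lte_fin sumr_const card_ord -[ltLHS]mulr_natr /del.
rewrite (_ : 2 * (eps / D) * d%:R = eps * (2 * d%:R / D)); last first.
  have e (x y z w : R) : x * (y * z) * w = y * (x * w * z) by ring.
  exact: e.
by rewrite gtr_pMr// ltr_pdivrMr// mul1r /D ltrDl.
Qed.

Theorem theorem1p8 (R : realType) (d : nat) (chi : 'rV[R]_d -> R)
    (alpha p theta : R) (q r : \bar R) :
  (2 <= d)%N -> bump_function chi -> 0 < alpha -> 1 <= p < 2 -> 0 < theta ->
  (1 <= q)%E -> (1 <= r)%E ->
  let S := singular_solutions chi alpha in
  let PB := solenoidal (besov_space chi (- theta) q r) in
  [/\ norm_dense (Lp_norm p%:E) (solenoidal (Lp_space p%:E)) S,
      (r != +oo%E -> norm_dense (besov_norm chi (- theta) q r) PB S) &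
      (r = +oo%E ->
       weak_star_dense chi
         (besov_space chi theta (hoelder_conjugate q) 1%E) PB S)].
Proof.
move=> d1 hchi alpha0 p12 theta0 q1 r1 S PB.
have S_sol u : S u -> weakly_div_free u /\ mean_zero u by move=> [[]].
have S_PB : S `<=` PB.
  by move=> u Su; split; [case: Su => _ _; exact|exact: S_sol].
split.
- split=> [u Su|v eps [[dv vfin] [divv mv]] eps0]; last exact: Lp_dense.
  by split; [case: Su => _ + _; exact|exact: S_sol].
- move=> rfin; split=> // v eps [[dv vfin] [divv mv]] eps0.
  exact: besov_dense.
- move=> rE; split=> // v k g eps [[dv vfin] [divv mv]] gY eps0.
  rewrite rE in vfin; apply: besov_weak_star_dense vfin _ _ => // j.
  by case: (gY j).
Qed.
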